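(* The tritronquée solution $y_t$ of the Painlevé equation $y''=6y^2+z$ is analytic in the region $$\mathcal{D}:=\Big\{z\ne 0:\ \arg z\in\big[-\tfrac{3\pi}{5},\pi\big]\Big\}\ \cup\ \Big\{z:\ |z|<\tfrac{37}{20}\Big\}.$$
   Context: The Painlevé equation $P_I$ is written as $y''=6y^2+z$. Under the change of variables $$x=\frac{e^{i\pi/4}}{30}(24z)^{5/4},\qquad y(z)=i\sqrt{\frac z6}\left(1-\frac{4}{25x^2}+h(x)\right)$$ (so that $\arg x=\frac{\pi}{4}+\frac54\arg z$, and in particular $x\in i\mathbb{R}^+$ corresponds to $\arg z=\pi/5$), $P_I$ becomes $$h''+\frac1x h'-h=\frac{h^2}{2}+\frac{392}{625x^4}.$$ The tritronquée $y_t$ is the solution of $P_I$ which corresponds, through this change of variables, to the unique solution $h$ with the behavior $h(x)=O(x^{-4})$ as $x\to+i\infty$ (i.e. $|z|\to\infty$ along $\arg z=\pi/5$). *)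

(* Defs.v *)
From Stdlib Require Import Reals.
From Coquelicot Require Import Coquelicot.
Open Scope C_scope.

Definition Cexp (z : C) : C :=
  RtoC (exp (Re z)) * (cos (Im z), sin (Im z)).

(* Principal argument, in (-PI, PI]; only meaningful for z <> 0. *)
Definition Carg (z : C) : R :=
  if Rle_dec 0 (Im z) then acos (Re z / Cmod z) else (- acos (Re z / Cmod z))%R.

(* Principal branch of z^a for real a, that is |z|^a e^(i a arg z), cut along
   the negative real axis; only meaningful for z <> 0. *)
Definition Cpowr (z : C) (a : R) : C :=
  RtoC (Rpower (Cmod z) a) * Cexp (Ci * RtoC (a * Carg z)).

Definition is_C_solution (U : C -> Prop) (F : C -> C -> C -> C) (f : C -> C) : Prop :=
  exists f' : C -> C, forall z : C, U z ->
    is_derive f z (f' z) /\ is_derive f' z (F z (f z) (f' z)).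

Definition PI_solution (U : C -> Prop) (y : C -> C) : Prop :=
  is_C_solution U (fun z w _ => 6 * w ^ 2 + z) y.

(* h'' + h'/x - h = h^2/2 + 392/(625 x^4), solved for h''. *)
Definition h_solution (V : C -> Prop) (h : C -> C) : Prop :=
  is_C_solution V
    (fun x w w' => - (w' / x) + w + w ^ 2 / 2 + 392 / (625 * x ^ 4)) h.

Definition xvar (z : C) : C :=
  Cexp (Ci * RtoC (PI / 4)) / 30 * Cpowr (24 * z) (5 / 4).

Definition y_of_h (h : C -> C) (z : C) : C :=
  Ci * Cpowr (z / 6) (1 / 2) * (1 - 4 / (25 * xvar z ^ 2) + h (xvar z)).

(* N contains a neighbourhood of the end of the ray arg z = PI/5, which is the
   ray that xvar maps onto the positive imaginary axis. *)
Definition near_ray_end (N : C -> Prop) : Prop :=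
  exists r0 : R, (0 < r0)%R /\
    forall r : R, (r0 < r)%R ->
      locally (RtoC r * Cexp (Ci * RtoC (PI / 5))) N.

(* The tritronquee solution is specified through its germ along the end of the
   ray arg z = PI/5: y is constrained only on the open set W, and is arbitrary
   elsewhere. *)
Definition is_tritronquee (y : C -> C) : Prop :=
  exists (W V : C -> Prop) (h : C -> C),
    open W /\ open V /\ near_ray_end W /\
    (forall z : C, W z -> z <> 0) /\
    (forall x : C, V x -> x <> 0) /\
    PI_solution W y /\
    h_solution V h /\
    (forall z : C, W z -> V (xvar z) /\ y z = y_of_h h z) /\
    (exists K t0 : R, (0 < t0)%R /\
       forall t : R, (t0 < t)%R -> Rle (Cmod (h (Ci * RtoC t))) (K / t ^ 4)).

Definition region_D (z : C) : Prop :=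
  (z <> 0 /\ (- (3 * PI / 5) <= Carg z <= PI)%R) \/ (Cmod z < 37 / 20)%R.

(* The function with germ y along the end of the ray arg z = PI/5 continues
   analytically to D: some Y, holomorphic on an open set containing D, coincides
   with y near the end of that ray.  The ray lies in the connected set D, so Y is
   determined on D by the germ. *)
Definition tritronquee_analytic_on (D : C -> Prop) (y : C -> C) : Prop :=
  exists (U : C -> Prop) (Y : C -> C),
    open U /\ (forall z : C, D z -> U z) /\
    (forall z : C, U z -> ex_derive Y z) /\
    PI_solution U Y /\
    near_ray_end (fun z => Y z = y z).

(* Main.v *)
(* The germ h is continued by itself: a solution exists on a thin tube around a segment as long as the
   energy N^2 = |h|^2 + |h'|^2 (or a substitute) stays below an explicit barrier, and solutions on
   overlapping convex sets are glued.  From the axis x = it, t large, the continuation goes horizontally to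
   Re x > -1/20, then down vertical lines (N < 33/50 / ((|x| + Im x) |x|^2)).  For Re x > 5/2 it goes on down to
   Im x -> -oo: there h' = -h sqrt(1 + h/3) up to small terms, and |x|^(1/2) |h| stays small by a bootstrap
   on horizontal strips.  Finally the region Re x > -1/20, Im x < -287/100 is reached by horizontal lines to the left.
   The reflection x -> - conj x gives the left half plane, so the inverse change of variables gives y on
   arg z in [-3 pi/5, pi], |z| > 1.847.

   Along arg z = pi/5 one has y = e^(-2 i pi/5) w with w'' = 6 w^2 - s, s = |z|.  The energy of w - P, where P is
   an explicit polynomial with small residual, controls w down to s = 0; so y(0) and y'(0) are known
   well enough for the Taylor series at 0 to be majorized by that of (37/20 - z)^-2, which solves y'' = 6 y^2. *)

From Stdlib Require Import Reals Lra Lia Psatz ClassicalEpsilon.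
From Coquelicot Require Import Coquelicot.
Require Import Defs.
Local Open Scope R_scope.

(** * Complex derivatives *)

(** The linear part h'' = h conserves N^2 on vertical lines and lets it grow exponentially on
    horizontal ones, so vertical lines do the long-range work and horizontal ones are kept far up or
    short. Below the real axis the barrier only increases and its quadratic term would make it blow
    up, so the energy does not reach Im x -> -oo; there, boundedness on a whole half-line to the
    right forces h close to the decaying manifold. A rectangle around x = 0, of half-height 287/100
    and reaching Re x = 5/2, is never entered. It lies inside |x| < 381/100, which |z| > 1847/1000
    avoids; the disc |z| < 37/20 fills the hole with little room to spare, and this thin overlap
    dictates how sharp the constants are. In the disc the binding condition is the one on y'(0):
    0.3156 against 2 (20/37)^3 = 0.3159. On the left it is the reflection of h that is continued to
    the right and then reflected back, so the same estimates serve twice. Branches are identified by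
    uniqueness of Cauchy data along segments, or along arcs |z| = r issuing from the ray. *)

Lemma Cmod_sqr (z : C) : Cmod z ^ 2 = Re z ^ 2 + Im z ^ 2.
Proof. unfold Cmod, Re, Im. rewrite pow2_sqrt; [ring | nra]. Qed.

Lemma Re_abs_le (z : C) : Rabs (Re z) <= Cmod z.
Proof.
  generalize (Cmod_ge_0 z) (Cmod_sqr z); intros.
  apply Rabs_le. split; nra.
Qed.

Lemma Im_abs_le (z : C) : Rabs (Im z) <= Cmod z.
Proof.
  generalize (Cmod_ge_0 z) (Cmod_sqr z); intros. apply Rabs_le. split; nra.
Qed.

Lemma Cmod_le_ReIm (z : C) : Cmod z <= Rabs (Re z) + Rabs (Im z).
Proof.
  generalize (Cmod_ge_0 z) (Cmod_sqr z) (Rabs_pos (Re z)) (Rabs_pos (Im z)); intros.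
  rewrite <- (pow2_abs (Re z)), <- (pow2_abs (Im z)) in H0. nra.
Qed.

Definition cderiv (f : C -> C) (z l : C) : Prop := @is_derive C_AbsRing C_NormedModule f z l.

Lemma cderiv_eps (f : C -> C) (z l : C) :
  cderiv f z l <-> forall eps : R, 0 < eps -> exists del : R, 0 < del /\
    forall w : C, Cmod (w - z)%C < del ->
      Cmod (f w - f z - l * (w - z))%C <= eps * Cmod (w - z)%C.
Proof.
  split.
  - intros [_ H] eps He.
    assert (Hz : is_filter_lim (@locally (AbsRing_UniformSpace C_AbsRing) z) z).
    { intros P HP. exact HP. }
    destruct (H z Hz (mkposreal eps He)) as [d Hd].
    exists d. split; [apply cond_pos|]. intros w Hw.
    specialize (Hd w Hw). simpl in Hd.
    replace (f w - f z - l * (w - z))%C with (f w - f z - (w - z) * l)%C by ring.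
    exact Hd.
  - intros H. split.
    + apply @is_linear_scal_l.
    + intros x Hx eps. apply (@is_filter_lim_locally_unique C_AbsRing (AbsRing_NormedModule C_AbsRing) z x) in Hx. rewrite <- Hx. clear x Hx.
      destruct (H eps (cond_pos eps)) as [d [Hd0 Hd]].
      exists (mkposreal d Hd0). intros w Hw. specialize (Hd w Hw).
      replace (f w - f z - l * (w - z))%C with (f w - f z - (w - z) * l)%C in Hd by ring.
      exact Hd.
Qed.

(** The composition and product rules speak of C as a module over itself, whereas [cderiv] targets
    [C_NormedModule]; the remainder estimates of the two notions coincide. *)
Lemma cderiv_abs (f : C -> C) (z l : C) :
  cderiv f z l <-> @is_derive C_AbsRing (AbsRing_NormedModule C_AbsRing) f z l.
Proof.
  split; intros [_ H]; (split; [apply @is_linear_scal_l|]); intros x Hx eps;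
  exact (H x Hx eps).
Qed.

(** The uniform structure of C is that of the product R x R, whose balls are squares; here discs
    replace them. *)
Lemma loc_eps (z : C) (P : C -> Prop) :
  @locally C_UniformSpace z P <->
  exists d : R, 0 < d /\ forall w : C, Cmod (w - z)%C < d -> P w.
Proof.
  rewrite locally_C. split.
  - intros [d Hd]. exists d. split; [apply cond_pos|]. intros w Hw. apply Hd, Hw.
  - intros [d [H0 Hd]]. exists (mkposreal d H0). intros w Hw. apply Hd, Hw.
Qed.

Lemma cderiv_const (c z : C) : cderiv (fun _ => c) z 0%C.
Proof. apply (@is_derive_const C_AbsRing C_NormedModule). Qed.

Lemma cderiv_id (z : C) : cderiv (fun w => w) z 1%C.
Proof. apply cderiv_abs, (@is_derive_id C_AbsRing). Qed.

Lemma cderiv_plus (f g : C -> C) (z lf lg : C) :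
  cderiv f z lf -> cderiv g z lg -> cderiv (fun w => f w + g w)%C z (lf + lg)%C.
Proof. apply (@is_derive_plus C_AbsRing C_NormedModule). Qed.

Lemma cderiv_minus (f g : C -> C) (z lf lg : C) :
  cderiv f z lf -> cderiv g z lg -> cderiv (fun w => f w - g w)%C z (lf - lg)%C.
Proof. apply (@is_derive_minus C_AbsRing C_NormedModule). Qed.

Lemma cderiv_mult (f g : C -> C) (z lf lg : C) :
  cderiv f z lf -> cderiv g z lg ->
  cderiv (fun w => f w * g w)%C z (lf * g z + f z * lg)%C.
Proof.
  rewrite !cderiv_abs. intros H1 H2.
  apply (@is_derive_mult C_AbsRing f g z lf lg H1 H2 Cmult_comm).
Qed.

Lemma cderiv_comp (f g : C -> C) (z lf lg : C) :
  cderiv f (g z) lf -> cderiv g z lg -> cderiv (fun w => f (g w)) z (lg * lf)%C.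
Proof.
  rewrite (cderiv_abs g). apply (@is_derive_comp C_AbsRing C_NormedModule f g z lf lg).
Qed.

Lemma cderiv_ext_loc (f g : C -> C) (z l : C) (d : R) : 0 < d ->
  (forall w, Cmod (w - z)%C < d -> f w = g w) -> cderiv f z l -> cderiv g z l.
Proof.
  intros Hd H. rewrite !cderiv_eps. intros Hf eps He.
  destruct (Hf eps He) as [d' [Hd' H']]. exists (Rmin d d').
  split; [apply Rmin_case; lra|]. intros w Hw.
  rewrite <- (H w), <- (H z).
  - apply H'. eapply Rlt_le_trans; [exact Hw|apply Rmin_r].
  - replace (z - z)%C with (RtoC 0) by ring. rewrite Cmod_0. exact Hd.
  - eapply Rlt_le_trans; [exact Hw|apply Rmin_l].
Qed.

Lemma cderiv_ext (f g : C -> C) (z l : C) : (forall w, f w = g w) -> cderiv f z l -> cderiv g z l.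
Proof. intros H. apply (cderiv_ext_loc f g z l 1); [lra|auto]. Qed.

Lemma cderiv_val (f : C -> C) (z l : C) l' : cderiv f z l -> l = l' -> cderiv f z l'.
Proof. intros H E. rewrite <- E. exact H. Qed.

Lemma Cmod_pos (z : C) : z <> 0%C -> 0 < Cmod z.
Proof. intros H. destruct (Cmod_ge_0 z) as [h|h]; [exact h|]. symmetry in h. apply Cmod_eq_0 in h. contradiction. Qed.

Lemma Cmod_nz (z : C) : 0 < Cmod z -> z <> 0%C.
Proof. intros H E. rewrite E, Cmod_0 in H. lra. Qed.

Lemma Cmod_minus_comm (a b : C) : Cmod (a - b)%C = Cmod (b - a)%C.
Proof. rewrite <- Cmod_opp. f_equal. ring. Qed.

Lemma Cmod_tri_minus (a b : C) : Cmod (a - b)%C <= Cmod a + Cmod b.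
Proof. unfold Cminus. eapply Rle_trans; [apply Cmod_triangle|]. rewrite Cmod_opp. lra. Qed.

Lemma Cmod_tri_rev (a b : C) : Cmod a - Cmod b <= Cmod (a - b)%C.
Proof. generalize (Cmod_triangle (a - b) b). replace (a - b + b)%C with a by ring. lra. Qed.

Lemma cderiv_cont (f : C -> C) (z l : C) : cderiv f z l -> forall eps, 0 < eps ->
  exists d, 0 < d /\ forall w, Cmod (w - z)%C < d -> Cmod (f w - f z)%C < eps.
Proof.
  rewrite cderiv_eps. intros H eps He. destruct (H 1 Rlt_0_1) as [d [Hd Hw]].
  assert (Hl := Cmod_ge_0 l).
  assert (Hp : 0 < eps / (Cmod l + 2)) by (apply Rdiv_lt_0_compat; lra).
  exists (Rmin d (eps / (Cmod l + 2))). split; [apply Rmin_case; lra|].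
  intros w h. assert (h1 : Cmod (w - z)%C < d) by (eapply Rlt_le_trans; [exact h|apply Rmin_l]).
  assert (h2 : Cmod (w - z)%C < eps / (Cmod l + 2)) by (eapply Rlt_le_trans; [exact h|apply Rmin_r]).
  specialize (Hw w h1).
  replace (f w - f z)%C with ((f w - f z - l * (w - z)) + l * (w - z))%C by ring.
  eapply Rle_lt_trans; [apply Cmod_triangle|]. rewrite Cmod_mult.
  assert (h3 : (Cmod l + 2) * Cmod (w - z)%C < eps).
  { apply (Rmult_lt_compat_l (Cmod l + 2)) in h2; [|lra].
    replace ((Cmod l + 2) * (eps / (Cmod l + 2))) with eps in h2 by (field; lra). exact h2. }
  generalize (Cmod_ge_0 (w - z)%C). nra.
Qed.

Lemma cderiv_inv (z : C) : z <> 0%C -> cderiv (fun w => / w)%C z (- / (z * z))%C.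
Proof.
  intros Hz. assert (Hm := Cmod_pos z Hz). apply cderiv_eps. intros eps He.
  set (m := Cmod z) in *.
  assert (Hp : 0 < eps * (m * m * m) / 2) by (apply Rdiv_lt_0_compat; [|lra]; repeat apply Rmult_lt_0_compat; lra).
  exists (Rmin (m / 2) (eps * (m * m * m) / 2)). split; [apply Rmin_case; lra|].
  intros w h.
  assert (h1 : Cmod (w - z)%C < m / 2) by (eapply Rlt_le_trans; [exact h|apply Rmin_l]).
  assert (h2 : Cmod (w - z)%C < eps * (m * m * m) / 2) by (eapply Rlt_le_trans; [exact h|apply Rmin_r]).
  assert (hw : m / 2 < Cmod w).
  { generalize (Cmod_tri_rev z w). rewrite Cmod_minus_comm. fold m. lra. }
  assert (Hw : w <> 0%C) by (apply Cmod_nz; lra).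
  replace (/ w - / z - - / (z * z) * (w - z))%C with ((w - z) * (w - z) / (z * z * w))%C by (field; auto).
  assert (Hzzw : (z * z * w)%C <> 0%C) by (repeat apply Cmult_neq_0; auto).
  rewrite Cmod_div by exact Hzzw. rewrite !Cmod_mult. fold m.
  assert (hd := Cmod_ge_0 (w - z)%C). set (d := Cmod (w - z)%C) in *. set (u := Cmod w) in *.
  apply Rle_div_l; [repeat apply Rmult_lt_0_compat; lra|].
  assert (d <= eps * (m * m * u)); [|nra].
  apply Rle_trans with (eps * (m * m * m) / 2); [lra|].
  assert (0 < eps * (m * m)) by (repeat apply Rmult_lt_0_compat; lra). nra.
Qed.

Lemma cderiv_inv_fun (f : C -> C) (z l : C) : f z <> 0%C -> cderiv f z l ->
  cderiv (fun w => / f w)%C z (- l / (f z * f z))%C.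
Proof.
  intros H Hf. eapply cderiv_val.
  - exact (cderiv_comp (fun w => / w)%C f z _ l (cderiv_inv (f z) H) Hf).
  - field. exact H.
Qed.

Lemma cderiv_div (f g : C -> C) (z lf lg : C) : g z <> 0%C -> cderiv f z lf -> cderiv g z lg ->
  cderiv (fun w => f w / g w)%C z ((lf * g z - f z * lg) / (g z * g z))%C.
Proof.
  intros H Hf Hg. eapply cderiv_val.
  - exact (cderiv_mult f _ z _ _ Hf (cderiv_inv_fun g z lg H Hg)).
  - cbv beta. field. exact H.
Qed.

Lemma cderiv_scal (c : C) (f : C -> C) (z l : C) : cderiv f z l -> cderiv (fun w => c * f w)%C z (c * l)%C.
Proof.
  intros H. eapply cderiv_val; [exact (cderiv_mult _ _ z _ _ (cderiv_const c z) H)|cbv beta; ring].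
Qed.

(** * Paths and barriers *)

Lemma rderiv_eps (f : R -> R) (t l : R) :
  is_derive f t l <-> forall eps : R, 0 < eps -> exists del : R, 0 < del /\
    forall s : R, Rabs (s - t) < del -> Rabs (f s - f t - l * (s - t)) <= eps * Rabs (s - t).
Proof.
  split.
  - intros [_ H] eps He.
    assert (Hz : is_filter_lim (@locally (AbsRing_UniformSpace R_AbsRing) t) t) by (intros P HP; exact HP).
    destruct (H t Hz (mkposreal eps He)) as [d Hd].
    exists d. split; [apply cond_pos|]. intros w Hw.
    specialize (Hd w Hw). simpl in Hd.
    replace (f w - f t - l * (w - t)) with (f w - f t - (w - t) * l) by ring.
    exact Hd.
  - intros H. split.
    + apply @is_linear_scal_l.
    + intros x Hx eps. apply (@is_filter_lim_locally_unique R_AbsRing (AbsRing_NormedModule R_AbsRing) t x) in Hx. rewrite <- Hx. clear x Hx.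
      destruct (H eps (cond_pos eps)) as [d [Hd0 Hd]].
      exists (mkposreal d Hd0). intros w Hw. specialize (Hd w Hw).
      replace (f w - f t - l * (w - t)) with (f w - f t - (w - t) * l) in Hd by ring.
      exact Hd.
Qed.

(** Derivative of a path with values in C. Through it the complex equations are restricted to lines
    and arcs, where real-variable arguments apply. *)
Definition pder (phi : R -> C) (t : R) (l : C) : Prop :=
  forall eps : R, 0 < eps -> exists del : R, 0 < del /\
    forall s : R, Rabs (s - t) < del ->
      Cmod (phi s - phi t - l * RtoC (s - t))%C <= eps * Rabs (s - t).

Lemma pder_Re phi t l : pder phi t l -> is_derive (fun s => Re (phi s)) t (Re l).
Proof.
  intros H. apply rderiv_eps. intros eps He. destruct (H eps He) as [d [Hd Hs]].
  exists d. split; [exact Hd|]. intros s h. eapply Rle_trans; [|exact (Hs s h)].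
  eapply Rle_trans; [|apply Re_abs_le]. right. f_equal. unfold Re; simpl. ring.
Qed.

Lemma pder_Im phi t l : pder phi t l -> is_derive (fun s => Im (phi s)) t (Im l).
Proof.
  intros H. apply rderiv_eps. intros eps He. destruct (H eps He) as [d [Hd Hs]].
  exists d. split; [exact Hd|]. intros s h. eapply Rle_trans; [|exact (Hs s h)].
  eapply Rle_trans; [|apply Im_abs_le]. right. f_equal. unfold Im; simpl. ring.
Qed.

Lemma pder_ReIm (phi : R -> C) t (l : C) :
  is_derive (fun s => Re (phi s)) t (Re l) -> is_derive (fun s => Im (phi s)) t (Im l) -> pder phi t l.
Proof.
  rewrite !rderiv_eps. intros H1 H2 eps He.
  destruct (H1 (eps / 2)) as [d1 [Hd1 h1]]; [lra|]. destruct (H2 (eps / 2)) as [d2 [Hd2 h2]]; [lra|].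
  exists (Rmin d1 d2). split; [apply Rmin_case; lra|]. intros s h.
  eapply Rle_trans; [apply Cmod_le_ReIm|].
  assert (a1 : Rabs (s - t) < d1) by (eapply Rlt_le_trans; [exact h|apply Rmin_l]).
  assert (a2 : Rabs (s - t) < d2) by (eapply Rlt_le_trans; [exact h|apply Rmin_r]).
  specialize (h1 s a1). specialize (h2 s a2).
  replace (Re (phi s - phi t - l * RtoC (s - t))%C) with (Re (phi s) - Re (phi t) - Re l * (s - t)) by (unfold Re; simpl; ring).
  replace (Im (phi s - phi t - l * RtoC (s - t))%C) with (Im (phi s) - Im (phi t) - Im l * (s - t)) by (unfold Im; simpl; ring).
  lra.
Qed.

Lemma pder_line (p e : C) t : pder (fun s => p + RtoC s * e)%C t e.
Proof.
  intros eps He. exists 1. split; [lra|]. intros s _.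
  replace (p + RtoC s * e - (p + RtoC t * e) - e * RtoC (s - t))%C with (RtoC 0).
  - rewrite Cmod_0. apply Rmult_le_pos; [lra|apply Rabs_pos].
  - rewrite RtoC_minus. ring.
Qed.

Lemma pder_comp (f : C -> C) (g : R -> C) t (l m : C) :
  cderiv f (g t) l -> pder g t m -> pder (fun s => f (g s)) t (l * m)%C.
Proof.
  rewrite cderiv_eps. intros Hf Hg eps He.
  assert (Hl := Cmod_ge_0 l). assert (Hm := Cmod_ge_0 m).
  set (e1 := Rmin 1 (eps / (2 * (Cmod l + 1)))).
  assert (He1 : 0 < e1) by (apply Rmin_case; [lra|apply Rdiv_lt_0_compat; lra]).
  assert (He1' : e1 * (Cmod l + 1) <= eps / 2).
  { apply Rle_trans with (eps / (2 * (Cmod l + 1)) * (Cmod l + 1)); [apply Rmult_le_compat_r; [lra|apply Rmin_r]|].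
    right. field. lra. }
  set (e2 := eps / (2 * (Cmod m + 1))).
  assert (He2 : 0 < e2) by (apply Rdiv_lt_0_compat; lra).
  destruct (Hf e2 He2) as [d2 [Hd2 h2]].
  destruct (Hg e1 He1) as [d1 [Hd1 h1]].
  exists (Rmin d1 (d2 / (Cmod m + 2))). split; [apply Rmin_case; [lra|apply Rdiv_lt_0_compat; lra]|].
  intros s h.
  assert (a1 : Rabs (s - t) < d1) by (eapply Rlt_le_trans; [exact h|apply Rmin_l]).
  assert (a2 : Rabs (s - t) < d2 / (Cmod m + 2)) by (eapply Rlt_le_trans; [exact h|apply Rmin_r]).
  specialize (h1 s a1).
  assert (a3 : Cmod (g s - g t)%C <= (Cmod m + 1) * Rabs (s - t)).
  { replace (g s - g t)%C with ((g s - g t - m * RtoC (s - t)) + m * RtoC (s - t))%C by ring.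
    eapply Rle_trans; [apply Cmod_triangle|]. rewrite Cmod_mult, Cmod_R.
    assert (e1 <= 1) by apply Rmin_l. generalize (Rabs_pos (s - t)). nra. }
  assert (a4 : (Cmod m + 2) * Rabs (s - t) < d2).
  { apply (Rmult_lt_compat_l (Cmod m + 2)) in a2; [|lra].
    replace ((Cmod m + 2) * (d2 / (Cmod m + 2))) with d2 in a2 by (field; lra). exact a2. }
  assert (a5 : Cmod (g s - g t)%C < d2) by (generalize (Rabs_pos (s - t)); nra).
  specialize (h2 (g s) a5).
  replace (f (g s) - f (g t) - l * m * RtoC (s - t))%C
    with ((f (g s) - f (g t) - l * (g s - g t)) + l * (g s - g t - m * RtoC (s - t)))%C by ring.
  eapply Rle_trans; [apply Cmod_triangle|]. rewrite Cmod_mult.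
  assert (e2 * (Cmod m + 1) = eps / 2) by (unfold e2; field; lra).
  generalize (Rabs_pos (s - t)) (Cmod_ge_0 (g s - g t - m * RtoC (s - t))%C). intros.
  apply Rle_trans with (e2 * ((Cmod m + 1) * Rabs (s - t)) + Cmod l * (e1 * Rabs (s - t))).
  - apply Rplus_le_compat; [|apply Rmult_le_compat_l; assumption].
    eapply Rle_trans; [exact h2|]. apply Rmult_le_compat_l; lra.
  - nra.
Qed.

Lemma pder_minus phi psi t (l m : C) : pder phi t l -> pder psi t m ->
  pder (fun s => phi s - psi s)%C t (l - m)%C.
Proof.
  intros H1 H2. apply pder_ReIm.
  - apply is_derive_ext with (fun s => minus (Re (phi s)) (Re (psi s))); [reflexivity|].
    exact (is_derive_minus _ _ _ _ _ (pder_Re _ _ _ H1) (pder_Re _ _ _ H2)).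
  - apply is_derive_ext with (fun s => minus (Im (phi s)) (Im (psi s))); [reflexivity|].
    exact (is_derive_minus _ _ _ _ _ (pder_Im _ _ _ H1) (pder_Im _ _ _ H2)).
Qed.

Lemma pder_val phi t (l m : C) : pder phi t l -> l = m -> pder phi t m.
Proof. intros H E. rewrite <- E. exact H. Qed.

Definition Cdot (a b : C) : R := Re a * Re b + Im a * Im b.

Lemma Cdot_le (a b : C) : Cdot a b <= Cmod a * Cmod b.
Proof.
  apply Rle_trans with (Rabs (Cdot a b)); [apply Rle_abs|].
  rewrite <- (Rabs_pos_eq (Cmod a * Cmod b)); [|apply Rmult_le_pos; apply Cmod_ge_0].
  apply Rsqr_le_abs_0. unfold Rsqr.
  assert (H1 := Cmod_sqr a). assert (H2 := Cmod_sqr b).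
  replace (Cmod a * Cmod b * (Cmod a * Cmod b)) with (Cmod a ^ 2 * Cmod b ^ 2) by ring.
  rewrite H1, H2. unfold Cdot. assert (0 <= (Re a * Im b - Im a * Re b) ^ 2) by apply pow2_ge_0. nra.
Qed.

Lemma pder_sq phi t (l : C) : pder phi t l ->
  is_derive (fun s => Cmod (phi s) ^ 2) t (2 * Cdot (phi t) l).
Proof.
  intros H.
  apply is_derive_ext with (fun s => Re (phi s) ^ 2 + Im (phi s) ^ 2).
  { intros s. symmetry. apply Cmod_sqr. }
  assert (H1 := pder_Re _ _ _ H). assert (H2 := pder_Im _ _ _ H).
  evar_last.
  - apply (is_derive_plus (fun s => Re (phi s) ^ 2) (fun s => Im (phi s) ^ 2)).
    + apply (is_derive_pow _ 2 _ _ H1).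
    + apply (is_derive_pow _ 2 _ _ H2).
  - unfold Cdot, plus; simpl. ring.
Qed.

Lemma is_derive_continuity_pt f t l : is_derive f t l -> continuity_pt f t.
Proof. intros H. apply derivable_continuous_pt. exists l. apply is_derive_Reals. exact H. Qed.

Lemma derive_nonpos_decr (f df : R -> R) a b : a <= b ->
  (forall t, a <= t <= b -> is_derive f t (df t)) ->
  (forall t, a <= t <= b -> df t <= 0) -> f b <= f a.
Proof.
  intros Hab Hd Hn.
  destruct (MVT_gen f a b df) as [c [Hc E]].
  - intros x Hx. rewrite Rmin_left, Rmax_right in Hx by lra. apply Hd. lra.
  - intros x Hx. rewrite Rmin_left, Rmax_right in Hx by lra.
    apply (is_derive_continuity_pt f x (df x)), Hd. lra.
  - rewrite Rmin_left, Rmax_right in Hc by lra. specialize (Hn c Hc). nra.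
Qed.

(** D(t) e^(-Kt) is nonincreasing. With D the squared distance of two solutions this is uniqueness
    of the Cauchy problem. *)
Lemma gronwall_zero (D D' : R -> R) K a b : a <= b ->
  (forall t, a <= t <= b -> is_derive D t (D' t)) ->
  (forall t, a <= t <= b -> D' t <= K * D t) -> D a <= 0 -> D b <= 0.
Proof.
  intros Hab Hd Hk H0.
  assert (H := derive_nonpos_decr (fun t => D t * exp (- K * t))
    (fun t => (D' t - K * D t) * exp (- K * t)) a b Hab).
  assert (D b * exp (- K * b) <= D a * exp (- K * a)).
  { apply H.
    - intros t Ht. evar_last.
      + apply (is_derive_mult D (fun t => exp (- K * t)) t (D' t) (- K * exp (- K * t))).
        * apply Hd, Ht.
        * auto_derive; [auto|ring].
        * intros; apply Rmult_comm.
      + unfold plus, mult; simpl. ring.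
    - intros t Ht. specialize (Hk t Ht). assert (0 < exp (- K * t)) by apply exp_pos. nra. }
  assert (0 < exp (- K * b)) by apply exp_pos. assert (0 < exp (- K * a)) by apply exp_pos. nra.
Qed.

(** At a first zero D would come down from positive values, so its slope could not be positive
    there. In the applications D is a bound minus an energy, and the differential inequality has to
    be checked only where the two are equal. *)
Lemma barrier (D D' : R -> R) a b :
  (forall t, a <= t <= b -> is_derive D t (D' t)) -> 0 < D a ->
  (forall t, a <= t <= b -> D t = 0 -> (forall s, a <= s <= t -> 0 <= D s) -> 0 < D' t) ->
  forall t, a <= t <= b -> 0 < D t.
Proof.
  intros Hd Ha Hb t Ht. apply Rnot_le_lt. intros Hneg.
  (* The supremum m of [E] ends the initial interval of positivity. D m < 0 contradicts positivity
     just before m, D m = 0 contradicts the positive slope, and D m > 0 with m < t would prolong the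
     interval. *)
  set (E := fun s => a <= s <= t /\ forall r, a <= r <= s -> 0 < D r).
  destruct (completeness E) as [m [Hm1 Hm2]].
  { exists t. intros s [Hs _]. lra. }
  { exists a. split; [lra|]. intros r Hr. replace r with a by lra. exact Ha. }
  assert (Ham : a <= m). { apply Hm1. split; [lra|]. intros r Hr. replace r with a by lra. exact Ha. }
  assert (Hmt : m <= t). { apply Hm2. intros s [Hs _]. lra. }
  assert (Hbelow : forall r, a <= r < m -> 0 < D r).
  { intros r Hr. apply Rnot_le_lt. intros Hr0.
    assert (m <= r); [|lra]. apply Hm2. intros s [Hs1 Hs2].
    apply Rnot_lt_le. intros Hrs. assert (0 < D r) by (apply Hs2; lra). lra. }
  assert (HDm := Hd m ltac:(lra)). assert (HD := proj1 (rderiv_eps _ _ _) HDm).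
  destruct (Rtotal_order (D m) 0) as [H|[H|H]].
  - assert (a < m). { destruct Ham as [|E']; [assumption|]. rewrite <- E' in H. lra. }
    destruct (HD 1 Rlt_0_1) as [d [Hd0 h]].
    (* A step q this small stays where the first-order estimate holds and changes D by at most half
       of |D m|. *)
    set (q := Rmin (Rmin (d / 2) ((m - a) / 2)) (- D m / (2 * (Rabs (D' m) + 1)))).
    assert (Hp := Rabs_pos (D' m)).
    assert (Hq : 0 < q). { unfold q. repeat apply Rmin_case; try lra. apply Rdiv_lt_0_compat; lra. }
    assert (q <= d / 2) by (unfold q; eapply Rle_trans; [apply Rmin_l|apply Rmin_l]).
    assert (q <= (m - a) / 2) by (unfold q; eapply Rle_trans; [apply Rmin_l|apply Rmin_r]).
    assert (q * (Rabs (D' m) + 1) <= - D m / 2).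
    { apply Rle_trans with (- D m / (2 * (Rabs (D' m) + 1)) * (Rabs (D' m) + 1)); [apply Rmult_le_compat_r; [lra|apply Rmin_r]|].
      right; field; lra. }
    assert (0 < D (m - q)) by (apply Hbelow; lra).
    specialize (h (m - q)). replace (m - q - m) with (- q) in h by ring.
    rewrite Rabs_Ropp, (Rabs_pos_eq q) in h by lra. specialize (h ltac:(lra)).
    apply Rabs_le_between in h. assert (- Rabs (D' m) <= D' m <= Rabs (D' m)).
    { split; [|apply Rle_abs]. generalize (Rle_abs (- D' m)). rewrite Rabs_Ropp. lra. }
    nra.
  - assert (Hpos : 0 < D' m).
    { apply Hb; [lra|exact H|]. intros s Hs. destruct (Req_dec s m) as [->|]; [lra|].
      left. apply Hbelow. lra. }
    assert (a < m). { destruct Ham as [|E']; [assumption|]. rewrite <- E' in H. lra. }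
    destruct (HD (D' m / 2)) as [d [Hd0 h]]; [lra|].
    set (q := Rmin (d / 2) ((m - a) / 2)).
    assert (Hq : 0 < q). { unfold q. apply Rmin_case; lra. }
    assert (q <= d / 2) by apply Rmin_l. assert (q <= (m - a) / 2) by apply Rmin_r.
    assert (0 < D (m - q)) by (apply Hbelow; lra).
    specialize (h (m - q)). replace (m - q - m) with (- q) in h by ring.
    rewrite Rabs_Ropp, (Rabs_pos_eq q) in h by lra. specialize (h ltac:(lra)).
    apply Rabs_le_between in h. nra.
  - destruct (Req_dec m t) as [->|Hne]; [lra|].
    destruct (HD 1 Rlt_0_1) as [d [Hd0 h]].
    assert (Hp := Rabs_pos (D' m)).
    set (q := Rmin (Rmin (d / 2) (t - m)) (D m / (2 * (Rabs (D' m) + 1)))).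
    assert (Hq : 0 < q). { unfold q. repeat apply Rmin_case; try lra. apply Rdiv_lt_0_compat; lra. }
    assert (q <= d / 2) by (unfold q; eapply Rle_trans; [apply Rmin_l|apply Rmin_l]).
    assert (q <= t - m) by (unfold q; eapply Rle_trans; [apply Rmin_l|apply Rmin_r]).
    assert (Hqd : q * (Rabs (D' m) + 1) <= D m / 2).
    { apply Rle_trans with (D m / (2 * (Rabs (D' m) + 1)) * (Rabs (D' m) + 1)); [apply Rmult_le_compat_r; [lra|apply Rmin_r]|].
      right; field; lra. }
    assert (m + q <= m); [|lra]. apply Hm1. split; [lra|]. intros r Hr.
    destruct (Rlt_le_dec r m) as [h1|h1]; [apply Hbelow; lra|].
    specialize (h r). assert (Hrm : Rabs (r - m) = r - m) by (apply Rabs_pos_eq; lra).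
    rewrite Hrm in h. specialize (h ltac:(lra)). apply Rabs_le_between in h.
    assert (- Rabs (D' m) <= D' m <= Rabs (D' m)).
    { split; [|apply Rle_abs]. generalize (Rle_abs (- D' m)). rewrite Rabs_Ropp. lra. }
    nra.
Qed.

(** * Continuation and gluing *)

Definition openC (U : C -> Prop) : Prop :=
  forall z, U z -> exists d, 0 < d /\ forall w, Cmod (w - z)%C < d -> U w.

Definition convexC (K : C -> Prop) : Prop :=
  forall x y t, K x -> K y -> 0 <= t <= 1 -> K (x + RtoC t * (y - x))%C.

Lemma Cmod_path_bounded (f f1 : C -> C) (g g' : R -> C) a b : a <= b ->
  (forall t, a <= t <= b -> pder g t (g' t) /\ cderiv f (g t) (f1 (g t))) ->
  exists M, 0 <= M /\ forall t, a <= t <= b -> Cmod (f (g t)) <= M.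
Proof.
  intros Hab H.
  destruct (continuity_ab_maj (fun t => Cmod (f (g t)) ^ 2) a b Hab) as [m [Hm _]].
  { intros c Hc. destruct (H c Hc) as [H1 H2].
    eapply is_derive_continuity_pt, pder_sq, pder_comp; eassumption. }
  exists (Cmod (f (g m))). split; [apply Cmod_ge_0|]. intros t Ht. specialize (Hm t Ht). simpl in Hm.
  generalize (Cmod_ge_0 (f (g m))) (Cmod_ge_0 (f (g t))). nra.
Qed.

Lemma conv_lt a u v t : a < u -> a < v -> 0 <= t <= 1 -> a < u + t * (v - u).
Proof. intros. destruct (Req_dec t 0) as [->|]; nra. Qed.

Lemma conv_gt a u v t : u < a -> v < a -> 0 <= t <= 1 -> u + t * (v - u) < a.
Proof. intros. destruct (Req_dec t 0) as [->|]; nra. Qed.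

Section ODE.

Variables (A G : C -> C) (B lam : C) (Dom : C -> Prop).
Hypothesis HA : forall x, Dom x -> Cmod (A x) <= 1.

(** The equation is f'' = A f' + B f + lam f^2 + G, general enough for both the h equation and P_I.
    The derivative f1 is carried along so that values of f and f1 at a point are Cauchy data; [Dom]
    records where the bound on A holds. *)
Definition Sol (U : C -> Prop) (f f1 : C -> C) : Prop :=
  forall z, U z -> Dom z /\ cderiv f z (f1 z) /\
    cderiv f1 z (A z * f1 z + B * f z + lam * (f z * f z) + G z)%C.

Lemma Sol_sub (U V : C -> Prop) f f1 : (forall z, V z -> U z) -> Sol U f f1 -> Sol V f f1.
Proof. intros H S z Hz. apply S, H, Hz. Qed.

(** Both solutions are bounded on the compact path, and f^2 - g^2 = (f + g)(f - g), so the
    difference satisfies a linear equation with bounded coefficients and [gronwall_zero] applies to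
    |f - g|^2 + |f1 - g1|^2. *)
Lemma Sol_unique_path (U : C -> Prop) (f f1 g g1 : C -> C) (p p' : R -> C) (Gam a b : R) : a <= b ->
  Sol U f f1 -> Sol U g g1 ->
  (forall t, a <= t <= b -> U (p t) /\ pder p t (p' t) /\ Cmod (p' t) <= Gam) ->
  f (p a) = g (p a) -> f1 (p a) = g1 (p a) -> f (p b) = g (p b) /\ f1 (p b) = g1 (p b).
Proof.
  intros Hab Sf Sg Hp E0 E1.
  destruct (Cmod_path_bounded f f1 p p' a b Hab) as [Mf [HMf0 HMf]].
  { intros t Ht. destruct (Hp t Ht) as [h1 [h2 h3]]. split; [exact h2|apply (Sf _ h1)]. }
  destruct (Cmod_path_bounded g g1 p p' a b Hab) as [Mg [HMg0 HMg]].
  { intros t Ht. destruct (Hp t Ht) as [h1 [h2 h3]]. split; [exact h2|apply (Sg _ h1)]. }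
  set (L := Cmod B + Cmod lam * (Mf + Mg)).
  assert (HL : 0 <= L). { unfold L. generalize (Cmod_ge_0 B) (Cmod_ge_0 lam). nra. }
  assert (HG : 0 <= Gam). { destruct (Hp a ltac:(lra)) as [_ [_ h]]. generalize (Cmod_ge_0 (p' a)). lra. }
  set (d := fun t => (f (p t) - g (p t))%C). set (d1 := fun t => (f1 (p t) - g1 (p t))%C).
  set (dd1 := fun t => (A (p t) * d1 t + (B + lam * (f (p t) + g (p t))) * d t)%C).
  set (D := fun t => Cmod (d t) ^ 2 + Cmod (d1 t) ^ 2).
  assert (HD : D b <= 0).
  { apply (gronwall_zero D (fun t => 2 * Cdot (d t) (d1 t * p' t) + 2 * Cdot (d1 t) (dd1 t * p' t)) (2 * Gam * (2 + L)) a b Hab).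
    - intros t Ht. destruct (Hp t Ht) as [h1 [h2 h3]].
      destruct (Sf _ h1) as [_ [f2 f3]]. destruct (Sg _ h1) as [_ [g2 g3]].
      apply (is_derive_plus (fun t => Cmod (d t) ^ 2) (fun t => Cmod (d1 t) ^ 2)).
      + apply pder_sq. eapply pder_val.
        * apply pder_minus; [exact (pder_comp _ _ _ _ _ f2 h2)|exact (pder_comp _ _ _ _ _ g2 h2)].
        * unfold d1. ring.
      + apply pder_sq. eapply pder_val.
        * apply pder_minus; [exact (pder_comp _ _ _ _ _ f3 h2)|exact (pder_comp _ _ _ _ _ g3 h2)].
        * unfold dd1, d1, d. ring.
    - intros t Ht. destruct (Hp t Ht) as [h1 [h2 h3]].
      assert (hD := proj1 (Sf _ h1)). assert (hA := HA _ hD).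
      assert (c1 := Cdot_le (d t) (d1 t * p' t)). assert (c2 := Cdot_le (d1 t) (dd1 t * p' t)).
      rewrite Cmod_mult in c1, c2.
      assert (n0 := Cmod_ge_0 (d t)). assert (n1 := Cmod_ge_0 (d1 t)). assert (n2 := Cmod_ge_0 (p' t)).
      assert (n3 := Cmod_ge_0 (dd1 t)).
      assert (c3 : Cmod (dd1 t) <= Cmod (d1 t) + L * Cmod (d t)).
      { unfold dd1. eapply Rle_trans; [apply Cmod_triangle|]. rewrite !Cmod_mult.
        apply Rplus_le_compat; [nra|]. apply Rmult_le_compat_r; [exact n0|].
        unfold L. eapply Rle_trans; [apply Cmod_triangle|]. rewrite Cmod_mult.
        apply Rplus_le_compat_l. apply Rmult_le_compat_l; [apply Cmod_ge_0|].
        eapply Rle_trans; [apply Cmod_triangle|]. specialize (HMf t Ht). specialize (HMg t Ht). lra. }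
      unfold D.
      set (x := Cmod (d t)) in *. set (y := Cmod (d1 t)) in *. set (w := Cmod (dd1 t)) in *. set (q := Cmod (p' t)) in *.
      assert (Cdot (d t) (d1 t * p' t) <= Gam * (x * y)) by (eapply Rle_trans; [exact c1|]; assert (0 <= x * y) by nra; nra).
      assert (Cdot (d1 t) (dd1 t * p' t) <= Gam * (y * (y + L * x))).
      { eapply Rle_trans; [exact c2|]. assert (0 <= y * w) by nra. assert (y * w <= y * (y + L * x)) by nra. 
        apply Rle_trans with (Gam * (y * w)); nra. }
      assert (x * y <= x ^ 2 + y ^ 2) by nra.
      assert (0 <= x ^ 2) by nra. assert (0 <= y ^ 2) by nra.
      assert (x * y + y * (y + L * x) <= (2 + L) * (x ^ 2 + y ^ 2)) by nra.
      nra.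
    - unfold D, d, d1. rewrite E0, E1. right.
      replace (g (p a) - g (p a))%C with (RtoC 0) by ring. replace (g1 (p a) - g1 (p a))%C with (RtoC 0) by ring.
      rewrite Cmod_0. ring. }
  unfold D in HD. assert (n0 := Cmod_ge_0 (d b)). assert (n1 := Cmod_ge_0 (d1 b)).
  assert (Z0 : Cmod (d b) = 0) by nra. assert (Z1 : Cmod (d1 b) = 0) by nra.
  apply Cmod_eq_0 in Z0. apply Cmod_eq_0 in Z1. unfold d in Z0. unfold d1 in Z1.
  split.
  - replace (f (p b)) with ((f (p b) - g (p b)) + g (p b))%C by ring. rewrite Z0. ring.
  - replace (f1 (p b)) with ((f1 (p b) - g1 (p b)) + g1 (p b))%C by ring. rewrite Z1. ring.
Qed.

Lemma Sol_unique_seg (U : C -> Prop) (f f1 g g1 : C -> C) (x y : C) :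
  Sol U f f1 -> Sol U g g1 ->
  (forall t, 0 <= t <= 1 -> U (x + RtoC t * (y - x))%C) ->
  f x = g x -> f1 x = g1 x -> f y = g y /\ f1 y = g1 y.
Proof.
  intros Sf Sg HU E0 E1.
  assert (H := Sol_unique_path U f f1 g g1 (fun t => x + RtoC t * (y - x))%C (fun _ => y - x)%C (Cmod (y - x)%C) 0 1 Rle_0_1 Sf Sg).
  cbv beta in H. replace (x + 0 * (y - x))%C with x in H by ring. replace (x + 1 * (y - x))%C with y in H by ring.
  apply H; auto. intros t Ht. split; [apply HU, Ht|]. split; [apply pder_line|lra].
Qed.

(** Takes the place of the identity theorem: the segment from x to y stays in both convex sets, and
    uniqueness propagates along it. *)
Lemma agree_convex (K K' : C -> Prop) (f f1 g g1 : C -> C) (x y : C) :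
  convexC K -> convexC K' -> Sol K f f1 -> Sol K' g g1 ->
  K x -> K' x -> K y -> K' y -> f x = g x -> f1 x = g1 x -> f y = g y /\ f1 y = g1 y.
Proof.
  intros c c' S S' Kx K'x Ky K'y. apply (Sol_unique_seg (fun z => K z /\ K' z)).
  - intros z [h _]. apply S, h.
  - intros z [_ h]. apply S', h.
  - intros t Ht. split; [apply c|apply c']; assumption.
Qed.

Lemma Glue (I : Type) (K : I -> C -> Prop) (g g1 : I -> C -> C) :
  (forall i, openC (K i)) -> (forall i, Sol (K i) (g i) (g1 i)) ->
  (forall i j x, K i x -> K j x -> g i x = g j x /\ g1 i x = g1 j x) ->
  exists f f1, Sol (fun x => exists i, K i x) f f1 /\
    forall i x, K i x -> f x = g i x /\ f1 x = g1 i x.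
Proof.
  intros HO HS HE.
  (* At each point of the union a branch is chosen classically. All branches through a point agree,
     so near any point of K i the glued function coincides with g i, which transfers the
     derivatives. *)
  set (pick := fun x => excluded_middle_informative (exists i, K i x)).
  set (f := fun x => match pick x with
    | left h => g (proj1_sig (constructive_indefinite_description _ h)) x | right _ => RtoC 0 end).
  set (f1 := fun x => match pick x with
    | left h => g1 (proj1_sig (constructive_indefinite_description _ h)) x | right _ => RtoC 0 end).
  assert (Hf : forall i x, K i x -> f x = g i x /\ f1 x = g1 i x).
  { intros i x Hx. unfold f, f1. destruct (pick x) as [h|h].
    - destruct (constructive_indefinite_description _ h) as [j Hj]. simpl. apply HE; assumption.
    - exfalso. apply h. exists i. exact Hx. }
  exists f, f1. split; [|exact Hf].
  intros z [i Hz]. destruct (HS i z Hz) as [h0 [h1 h2]]. destruct (HO i z Hz) as [d [Hd Hw]].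
  destruct (Hf i z Hz) as [e0 e1]. rewrite e0, e1. split; [exact h0|]. split.
  - apply (cderiv_ext_loc (g i) f z _ d Hd); [|exact h1]. intros w h. symmetry. apply Hf, Hw, h.
  - apply (cderiv_ext_loc (g1 i) f1 z _ d Hd); [|exact h2]. intros w h. symmetry. apply Hf, Hw, h.
Qed.

(** For a unit vector e, multiplication by its conjugate turns e into 1: the tube is the open
    rectangle exceeding by eta, on all sides, the segment from p to p + l e. *)
Definition tube (e p : C) (eta l : R) (x : C) : Prop :=
  let w := ((x - p) * Cconj e)%C in - eta < Re w < l + eta /\ Rabs (Im w) < eta.

Lemma Re_conj_mult_le (e x : C) : Cmod e = 1 -> Rabs (Re (x * Cconj e)%C) <= Cmod x.
Proof. intros He. eapply Rle_trans; [apply Re_abs_le|]. rewrite Cmod_mult, Cmod_conj, He. lra. Qed.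

Lemma Im_conj_mult_le (e x : C) : Cmod e = 1 -> Rabs (Im (x * Cconj e)%C) <= Cmod x.
Proof. intros He. eapply Rle_trans; [apply Im_abs_le|]. rewrite Cmod_mult, Cmod_conj, He. lra. Qed.

Lemma tube_open e p eta l : Cmod e = 1 -> openC (tube e p eta l).
Proof.
  intros He z [[h1 h2] h3]. cbv zeta in *. set (wz := ((z - p) * Cconj e)%C) in *.
  exists (Rmin (Rmin (Re wz + eta) (l + eta - Re wz)) (eta - Rabs (Im wz))).
  split; [repeat apply Rmin_case; lra|]. intros x Hx.
  assert (a1 : Cmod (x - z)%C < Re wz + eta) by (eapply Rlt_le_trans; [exact Hx|]; eapply Rle_trans; [apply Rmin_l|apply Rmin_l]).
  assert (a2 : Cmod (x - z)%C < l + eta - Re wz) by (eapply Rlt_le_trans; [exact Hx|]; eapply Rle_trans; [apply Rmin_l|apply Rmin_r]).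
  assert (a3 : Cmod (x - z)%C < eta - Rabs (Im wz)) by (eapply Rlt_le_trans; [exact Hx|apply Rmin_r]).
  assert (b1 := Re_conj_mult_le e (x - z)%C He). assert (b2 := Im_conj_mult_le e (x - z)%C He).
  unfold tube. replace ((x - p) * Cconj e)%C with (wz + (x - z) * Cconj e)%C by (unfold wz; ring).
  cbv zeta. set (v := ((x - z) * Cconj e)%C) in *.
  replace (Re (wz + v)%C) with (Re wz + Re v) by reflexivity.
  replace (Im (wz + v)%C) with (Im wz + Im v) by reflexivity.
  apply Rabs_le_between in b1. split; [lra|]. eapply Rle_lt_trans; [apply Rabs_triang|]. lra.
Qed.

Lemma tube_convex e p eta l : convexC (tube e p eta l).
Proof.
  intros x y t [[a1 a2] a3] [[b1 b2] b3] Ht. unfold tube in *. cbv zeta in *.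
  replace ((x + RtoC t * (y - x) - p) * Cconj e)%C
    with ((x - p) * Cconj e + RtoC t * ((y - p) * Cconj e - (x - p) * Cconj e))%C by ring.
  set (u := ((x - p) * Cconj e)%C) in *. set (v := ((y - p) * Cconj e)%C) in *.
  replace (Re (u + RtoC t * (v - u))%C) with (Re u + t * (Re v - Re u)) by (unfold Re; simpl; ring).
  replace (Im (u + RtoC t * (v - u))%C) with (Im u + t * (Im v - Im u)) by (unfold Im; simpl; ring).
  apply Rabs_lt_between in a3. apply Rabs_lt_between in b3.
  repeat split; try (apply conv_lt; lra); try (apply conv_gt; lra). apply Rabs_lt_between. split; [apply conv_lt|apply conv_gt]; lra.
Qed.

Lemma tube_line e p eta l u : Cmod e = 1 -> 0 < eta -> - eta < u < l + eta -> tube e p eta l (p + RtoC u * e)%C.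
Proof.
  intros He Heta Hu. unfold tube. cbv zeta.
  replace ((p + RtoC u * e - p) * Cconj e)%C with (RtoC u * (e * Cconj e))%C by ring.
  rewrite <- Cmod2_conj, He.
  replace (RtoC u * RtoC (1 ^ 2))%C with (RtoC u).
  - simpl. rewrite Rabs_R0. lra.
  - replace (1 ^ 2) with 1 by ring. ring.
Qed.

Definition disc (c : C) (r : R) (x : C) : Prop := Cmod (x - c)%C < r.

Lemma disc_open c r : openC (disc c r).
Proof.
  intros z Hz. exists (r - Cmod (z - c)%C). unfold disc in *. split; [lra|]. intros w Hw.
  replace (w - c)%C with ((w - z) + (z - c))%C by ring. eapply Rle_lt_trans; [apply Cmod_triangle|]. lra.
Qed.

Lemma disc_convex c r : convexC (disc c r).
Proof.
  intros x y t Hx Hy Ht. unfold disc in *.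
  replace (x + RtoC t * (y - x) - c)%C with (RtoC (1 - t) * (x - c) + RtoC t * (y - c))%C by (rewrite RtoC_minus; ring).
  eapply Rle_lt_trans; [apply Cmod_triangle|]. rewrite !Cmod_mult, !Cmod_R, !Rabs_pos_eq by lra.
  destruct (Req_dec t 0) as [->|]; [lra|]. nra.
Qed.

Lemma Glue2 (K K' : C -> Prop) (f f1 g g1 : C -> C) (x : C) :
  openC K -> openC K' -> convexC K -> convexC K' -> Sol K f f1 -> Sol K' g g1 ->
  K x -> K' x -> f x = g x -> f1 x = g1 x ->
  exists h h1, Sol (fun z => K z \/ K' z) h h1 /\
    (forall z, K z -> h z = f z /\ h1 z = f1 z) /\ (forall z, K' z -> h z = g z /\ h1 z = g1 z).
Proof.
  intros O O' c c' S S' Kx K'x E0 E1.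
  destruct (Glue bool (fun b => if b then K else K') (fun b => if b then f else g) (fun b => if b then f1 else g1))
    as [h [h1 [HS Hh]]].
  - intros []; assumption.
  - intros []; assumption.
  - assert (HE : forall z, K z -> K' z -> f z = g z /\ f1 z = g1 z).
    { intros z Hz Hz'. apply (agree_convex K K' f f1 g g1 x z); assumption. }
    intros [] [] z Hi Hj; auto. destruct (HE z Hj Hi). auto.
  - exists h, h1. split; [|split; [exact (Hh true)|exact (Hh false)]].
    intros z [Hz|Hz]; apply HS; [exists true|exists false]; exact Hz.
Qed.

Variable Om : R -> C -> Prop.
Hypothesis Hloc : forall M, exists del, 0 < del /\ forall x0 a0 a1, Om M x0 -> Cmod a0 <= M -> Cmod a1 <= M ->
  exists g g1, Sol (disc x0 del) g g1 /\ g x0 = a0 /\ g1 x0 = a1.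

(** [Hloc] gives a radius of existence that depends on the bound M alone, and the a priori estimate
    says that the data at the current end are again bounded by M. Hence the continuation advances by
    a fixed length at each step; only the width shrinks, and finitely many steps leave it
    positive. *)
Lemma Tube (e p : C) (l M : R) (a0 a1 : C) : Cmod e = 1 -> 0 <= l ->
  (forall u, 0 <= u <= l -> Om M (p + RtoC u * e)%C) ->
  (forall s eta g g1, 0 <= s <= l -> 0 < eta -> Sol (tube e p eta s) g g1 -> g p = a0 -> g1 p = a1 ->
     Cmod (g (p + RtoC s * e)%C) <= M /\ Cmod (g1 (p + RtoC s * e)%C) <= M) ->
  Cmod a0 <= M -> Cmod a1 <= M ->
  exists eta g g1, 0 < eta /\ Sol (tube e p eta l) g g1 /\ g p = a0 /\ g1 p = a1.
Proof.
  intros He Hl HOm Hap Ha0 Ha1. destruct (Hloc M) as [del [Hdel HL]].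
  (* Induction on the number of steps of length del/2, truncated at l. *)
  assert (step : forall n, exists eta g g1, 0 < eta /\ Sol (tube e p eta (Rmin l (INR n * (del / 2)))) g g1 /\ g p = a0 /\ g1 p = a1).
  { induction n as [|n IH].
    - destruct (HL p a0 a1) as [g [g1 [Ss [E0 E1]]]]; [|exact Ha0|exact Ha1|].
      { replace p with (p + RtoC 0 * e)%C by ring. apply HOm. lra. }
      exists (del / 4), g, g1. split; [lra|]. split; [|split; assumption].
      apply (Sol_sub (disc p del)); [|exact Ss].
      intros z [[h1 h2] h3]. cbv zeta in *. change (INR 0) with 0 in h2. rewrite Rmult_0_l, Rmin_right in h2 by exact Hl.
      unfold disc. cbv zeta in *.
      assert (Cmod (z - p)%C = Cmod ((z - p) * Cconj e)%C) by (rewrite Cmod_mult, Cmod_conj, He; ring).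
      rewrite H. eapply Rle_lt_trans; [apply Cmod_le_ReIm|].
      assert (Rabs (Re ((z - p) * Cconj e)%C) < del / 4) by (apply Rabs_lt_between; lra). lra.
    - destruct IH as [eta [g [g1 [Heta [Ss [E0 E1]]]]]].
      set (s := Rmin l (INR n * (del / 2))) in *.
      assert (Hs : 0 <= s <= l).
      { split; [|apply Rmin_l]. unfold s. apply Rmin_case; [lra|]. apply Rmult_le_pos; [apply pos_INR|lra]. }
      destruct (Hap s eta g g1 Hs Heta Ss E0 E1) as [b0 b1].
      destruct (HL (p + RtoC s * e)%C (g (p + RtoC s * e)%C) (g1 (p + RtoC s * e)%C) (HOm s Hs) b0 b1) as [f [f1 [Sf [F0 F1]]]].
      destruct (Glue2 (tube e p eta s) (disc (p + RtoC s * e)%C del) g g1 f f1 (p + RtoC s * e)%C) as [h [h1 [Sh [Hh _]]]].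
      + apply tube_open, He.
      + apply disc_open.
      + apply tube_convex.
      + apply disc_convex.
      + exact Ss.
      + exact Sf.
      + apply tube_line; [exact He|exact Heta|lra].
      + unfold disc. replace (p + RtoC s * e - (p + RtoC s * e))%C with (RtoC 0) by ring. rewrite Cmod_0. exact Hdel.
      + symmetry; exact F0.
      + symmetry; exact F1.
      (* A point of the new tube beyond the old one is within (del/2 + del/8) + del/8 < del of the
         end p + s e, hence in the disc around it. *)
      + exists (Rmin eta (del / 8)), h, h1. split; [apply Rmin_case; lra|]. split.
        * apply (Sol_sub (fun z => tube e p eta s z \/ disc (p + RtoC s * e)%C del z)); [|exact Sh].
          intros z [[h2 h3] h4]. cbv zeta in *.
          assert (q1 : Rmin eta (del / 8) <= eta) by apply Rmin_l.
          assert (q2 : Rmin eta (del / 8) <= del / 8) by apply Rmin_r.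
          assert (q3 : Rmin l (INR (S n) * (del / 2)) <= s + del / 2).
          { rewrite S_INR. unfold s. destruct (Rle_dec l (INR n * (del / 2))).
            - rewrite (Rmin_left l (INR n * (del / 2))) by lra. eapply Rle_trans; [apply Rmin_l|]. lra.
            - rewrite (Rmin_right l (INR n * (del / 2))) by lra. eapply Rle_trans; [apply Rmin_r|]. lra. }
          set (w := ((z - p) * Cconj e)%C) in *.
          destruct (Rlt_le_dec (Re w) (s + eta)) as [h5|h5].
          -- left. unfold tube. fold w. cbv zeta. split; lra.
          -- right. unfold disc.
             assert (Ew : Cmod (z - (p + RtoC s * e))%C = Cmod (w - RtoC s)%C).
             { replace (w - RtoC s)%C with ((z - (p + RtoC s * e)) * Cconj e)%C.
               - rewrite Cmod_mult, Cmod_conj, He. ring.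
               - unfold w. replace (RtoC s) with (RtoC s * (e * Cconj e))%C at 2; [ring|].
                 rewrite <- Cmod2_conj, He. replace (1 ^ 2) with 1 by ring. ring. }
             rewrite Ew. eapply Rle_lt_trans; [apply Cmod_le_ReIm|].
             replace (Re (w - RtoC s)%C) with (Re w - s) by reflexivity.
             replace (Im (w - RtoC s)%C) with (Im w) by (unfold Im; simpl; ring).
             rewrite (Rabs_pos_eq (Re w - s)) by lra. lra.
        * assert (Hp : tube e p eta s p). { replace p with (p + RtoC 0 * e)%C at 2 by ring. apply tube_line; [exact He|exact Heta|lra]. }
          destruct (Hh p Hp) as [k0 k1]. rewrite k0, k1. auto. }
  destruct (archimed_cor1 (del / 2 / (l + 1))) as [n [Hn1 Hn2]]; [repeat apply Rdiv_lt_0_compat; lra|].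
  destruct (step n) as [eta [g [g1 [Heta [Ss [E0 E1]]]]]].
  assert (Hln : l <= INR n * (del / 2)).
  { apply lt_INR in Hn2. simpl in Hn2.
    apply (Rmult_lt_compat_l (INR n)) in Hn1; [|exact Hn2]. rewrite Rinv_r in Hn1 by lra.
    apply (Rmult_lt_compat_r (l + 1)) in Hn1; [|lra].
    replace (INR n * (del / 2 / (l + 1)) * (l + 1)) with (INR n * (del / 2)) in Hn1 by (field; lra). lra. }
  rewrite Rmin_left in Ss by exact Hln. exists eta, g, g1. auto.
Qed.

End ODE.

(** * Local existence by power series *)

(** Complex series are summed componentwise, so that the results on real series, Cauchy products
    included, apply directly. *)
Definition csums (a : nat -> C) (l : C) : Prop :=
  is_series (fun n => Re (a n)) (Re l) /\ is_series (fun n => Im (a n)) (Im l).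

Lemma csums_unique a l m : csums a l -> csums a m -> l = m.
Proof.
  intros [h1 h2] [k1 k2]. apply is_series_unique in h1. apply is_series_unique in h2.
  apply is_series_unique in k1. apply is_series_unique in k2.
  apply injective_projections; [change (Re l = Re m)|change (Im l = Im m)]; congruence.
Qed.

Lemma csums_ext a b l : (forall n, a n = b n) -> csums a l -> csums b l.
Proof.
  intros H [h1 h2]. split.
  - apply is_series_ext with (fun n => Re (a n)); [|exact h1]. intros n. rewrite H. reflexivity.
  - apply is_series_ext with (fun n => Im (a n)); [|exact h2]. intros n. rewrite H. reflexivity.
Qed.

Lemma csums_plus a b l m : csums a l -> csums b m -> csums (fun n => a n + b n)%C (l + m)%C.
Proof.
  intros [h1 h2] [k1 k2]. split.
  - apply (is_series_plus _ _ _ _ h1 k1).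
  - apply (is_series_plus _ _ _ _ h2 k2).
Qed.

Lemma csums_scal c a l : csums a l -> csums (fun n => c * a n)%C (c * l)%C.
Proof.
  intros [h1 h2]. split.
  - apply (is_series_minus (fun n => Re c * Re (a n)) (fun n => Im c * Im (a n)) (Re c * Re l) (Im c * Im l));
    [apply (is_series_scal (Re c) _ _ h1)|apply (is_series_scal (Im c) _ _ h2)].
  - apply (is_series_plus (fun n => Re c * Im (a n)) (fun n => Im c * Re (a n)) (Re c * Im l) (Im c * Re l));
    [apply (is_series_scal (Re c) _ _ h2)|apply (is_series_scal (Im c) _ _ h1)].
Qed.

Lemma csums_minus a b l m : csums a l -> csums b m -> csums (fun n => a n - b n)%C (l - m)%C.
Proof.
  intros h k. replace (l - m)%C with (l + (-1) * m)%C by ring.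
  apply csums_ext with (fun n => a n + (-1) * b n)%C; [intros; ring|].
  apply csums_plus; [exact h|apply csums_scal, k].
Qed.

Lemma is_series_val (a : nat -> R) (l m : R) : is_series a l -> l = m -> is_series a m.
Proof. intros H E. rewrite <- E. exact H. Qed.

Lemma csums_tail a l : csums a l -> csums (fun n => a (S n)) (l - a O)%C.
Proof.
  intros [h1 h2]. split.
  - apply (is_series_incr_1 (fun n => Re (a n))). apply (is_series_val _ _ _ h1).
    unfold plus, Re; simpl. ring.
  - apply (is_series_incr_1 (fun n => Im (a n))). apply (is_series_val _ _ _ h2).
    unfold plus, Im; simpl. ring.
Qed.

Lemma csums_untail a l : csums (fun n => a (S n)) l -> csums a (a O + l)%C.
Proof.
  intros [h1 h2]. split.
  - apply (is_series_decr_1 (fun n => Re (a n)) (Re (a O + l)%C)). apply (is_series_val _ _ _ h1).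
    unfold plus, opp, Re; simpl. ring.
  - apply (is_series_decr_1 (fun n => Im (a n)) (Im (a O + l)%C)). apply (is_series_val _ _ _ h2).
    unfold plus, opp, Im; simpl. ring.
Qed.

Lemma csums_zero : csums (fun _ => RtoC 0) (RtoC 0).
Proof.
  assert (H : is_series (fun _ : nat => 0) 0).
  { unfold is_series.
    apply filterlim_ext with (fun _ : nat => 0).
    - intros n. rewrite sum_n_const. ring.
    - apply filterlim_const. }
  split; exact H.
Qed.

Definition AS (a : nat -> C) : Prop := ex_series (fun n => Cmod (a n)).

Lemma AS_le (a : nat -> C) (b : nat -> R) : (forall n, Cmod (a n) <= b n) -> ex_series b -> AS a.
Proof.
  intros H. apply (@ex_series_le R_AbsRing R_CompleteNormedModule). intros n.
  change (Rabs (Cmod (a n)) <= b n). rewrite Rabs_pos_eq; [apply H|apply Cmod_ge_0].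
Qed.

Lemma AS_Re a : AS a -> ex_series (fun n => Rabs (Re (a n))).
Proof.
  intros H. apply (@ex_series_le R_AbsRing R_CompleteNormedModule _ (fun n => Cmod (a n))); [|exact H].
  intros n. change (Rabs (Rabs (Re (a n))) <= Cmod (a n)). rewrite Rabs_Rabsolu. apply Re_abs_le.
Qed.

Lemma AS_Im a : AS a -> ex_series (fun n => Rabs (Im (a n))).
Proof.
  intros H. apply (@ex_series_le R_AbsRing R_CompleteNormedModule _ (fun n => Cmod (a n))); [|exact H].
  intros n. change (Rabs (Rabs (Im (a n))) <= Cmod (a n)). rewrite Rabs_Rabsolu. apply Im_abs_le.
Qed.

Definition cser (a : nat -> C) : C := (Series (fun n => Re (a n)), Series (fun n => Im (a n))).

Lemma cser_correct a : AS a -> csums a (cser a).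
Proof.
  intros H. split; apply Series_correct, ex_series_Rabs; [apply AS_Re|apply AS_Im]; exact H.
Qed.

Lemma csums_bound a l : AS a -> csums a l -> Cmod l <= 2 * Series (fun n => Cmod (a n)).
Proof.
  intros H [h1 h2]. eapply Rle_trans; [apply Cmod_le_ReIm|].
  rewrite <- (is_series_unique _ _ h1), <- (is_series_unique _ _ h2).
  assert (Series (fun n => Rabs (Re (a n))) <= Series (fun n => Cmod (a n))).
  { apply Series_le; [|exact H]. intros n. split; [apply Rabs_pos|apply Re_abs_le]. }
  assert (Series (fun n => Rabs (Im (a n))) <= Series (fun n => Cmod (a n))).
  { apply Series_le; [|exact H]. intros n. split; [apply Rabs_pos|apply Im_abs_le]. }
  generalize (Series_Rabs _ (AS_Re a H)) (Series_Rabs _ (AS_Im a H)). lra.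
Qed.

Definition csum (f : nat -> C) (n : nat) : C :=
  (sum_f_R0 (fun k => Re (f k)) n, sum_f_R0 (fun k => Im (f k)) n).

Lemma csum_S f n : csum f (S n) = (csum f n + f (S n))%C.
Proof. reflexivity. Qed.

Lemma csum_ext f g n : (forall k, (k <= n)%nat -> f k = g k) -> csum f n = csum g n.
Proof.
  intros H. unfold csum. f_equal; apply sum_eq; intros k Hk; rewrite H; auto.
Qed.

Lemma csum_scal c f n : csum (fun k => c * f k)%C n = (c * csum f n)%C.
Proof.
  induction n as [|n IH]; [apply injective_projections; reflexivity|].
  rewrite !csum_S, IH. ring.
Qed.

Lemma csum_bound f (b : nat -> R) n : (forall k, (k <= n)%nat -> Cmod (f k) <= b k) -> Cmod (csum f n) <= sum_f_R0 b n.
Proof.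
  induction n as [|n IH]; intros H.
  - replace (csum f 0) with (f O) by (apply injective_projections; reflexivity). apply H. lia.
  - rewrite csum_S. eapply Rle_trans; [apply Cmod_triangle|]. simpl.
    apply Rplus_le_compat; [apply IH; intros; apply H; lia|apply H; lia].
Qed.

Definition conv (a b : nat -> C) (n : nat) : C := csum (fun k => a k * b (n - k)%nat)%C n.

Lemma csums_mult a b l m : AS a -> AS b -> csums a l -> csums b m -> csums (conv a b) (l * m)%C.
Proof.
  intros Ha Hb [h1 h2] [k1 k2].
  assert (A1 := AS_Re a Ha). assert (A2 := AS_Im a Ha). assert (B1 := AS_Re b Hb). assert (B2 := AS_Im b Hb).
  assert (P11 := is_series_mult _ _ _ _ h1 k1 A1 B1). assert (P22 := is_series_mult _ _ _ _ h2 k2 A2 B2).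
  assert (P12 := is_series_mult _ _ _ _ h1 k2 A1 B2). assert (P21 := is_series_mult _ _ _ _ h2 k1 A2 B1).
  split.
  - eapply is_series_ext; [|exact (is_series_minus _ _ _ _ P11 P22)].
    intros n. unfold conv, csum. simpl.
    change (sum_f_R0 (fun k => Re (a k) * Re (b (n - k)%nat)) n - sum_f_R0 (fun k => Im (a k) * Im (b (n - k)%nat)) n
      = sum_f_R0 (fun k => Re (a k) * Re (b (n - k)%nat) - Im (a k) * Im (b (n - k)%nat)) n).
    symmetry. apply (minus_sum (fun k => Re (a k) * Re (b (n - k)%nat))).
  - eapply is_series_ext; [|exact (is_series_plus _ _ _ _ P12 P21)].
    intros n. unfold conv, csum. simpl.
    change (sum_f_R0 (fun k => Re (a k) * Im (b (n - k)%nat)) n + sum_f_R0 (fun k => Im (a k) * Re (b (n - k)%nat)) n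
      = sum_f_R0 (fun k => Re (a k) * Im (b (n - k)%nat) + Im (a k) * Re (b (n - k)%nat)) n).
    symmetry. apply (plus_sum (fun k => Re (a k) * Im (b (n - k)%nat))).
Qed.

(** 1 - x^(n+1) is (1 - x) times the sum of x^k for k <= n, and each of these n + 1 terms is at
    least x^n. *)
Lemma lin_geom_bound x n : 0 <= x < 1 -> INR (n + 1) * x ^ n * (1 - x) <= 1 - x ^ (n + 1).
Proof.
  intros Hx. induction n as [|n IH]; [simpl; lra|].
  assert (0 <= x ^ (n + 1) <= 1).
  { split; [apply pow_le; lra|]. rewrite <- (pow1 (n + 1)). apply pow_incr. lra. }
  replace (S n + 1)%nat with (S (n + 1)) by lia. rewrite S_INR.
  rewrite <- !tech_pow_Rmult. assert (E : x * x ^ n = x ^ (n + 1)) by (rewrite Nat.add_1_r; reflexivity).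
  rewrite E. assert (INR (n + 1) * x ^ (n + 1) * (1 - x) <= x * (1 - x ^ (n + 1))).
  { rewrite <- E. replace (INR (n + 1) * (x * x ^ n) * (1 - x)) with (x * (INR (n + 1) * x ^ n * (1 - x))) by ring.
    rewrite E. apply Rmult_le_compat_l; lra. }
  nra.
Qed.

(** * Power series in a disc and their termwise derivatives *)

Definition ASr (a : nat -> C) (r : R) : Prop :=
  forall q, 0 <= q < r -> ex_series (fun n => Cmod (a n) * q ^ n).

Definition PSd (a : nat -> C) (n : nat) : C := (RtoC (INR (n + 1)) * a (S n))%C.

Lemma ASr_d a r : ASr a r -> ASr (PSd a) r.
Proof.
  intros H q Hq. set (q' := (q + r) / 2).
  assert (Hq' : 0 <= q' < r) by (unfold q'; lra). assert (Hqq : q < q') by (unfold q'; lra).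
  specialize (H q' Hq'). apply (ex_series_incr_1 (fun n => Cmod (a n) * q' ^ n)) in H.
  set (x := q / q'). assert (Hx : 0 <= x < 1).
  { unfold x. split; [apply Rdiv_le_0_compat; lra|]. apply Rlt_div_l; lra. }
  apply (ex_series_scal (/ (q' * (1 - x)))) in H.
  refine (@ex_series_le R_AbsRing R_CompleteNormedModule _ _ _ H). intros n.
  change (Rabs (Cmod (PSd a n) * q ^ n) <= / (q' * (1 - x)) * (Cmod (a (S n)) * q' ^ S n)).
  unfold PSd. rewrite Cmod_mult, Cmod_R, (Rabs_pos_eq (INR (n + 1))) by apply pos_INR.
  rewrite Rabs_pos_eq.
  2:{ apply Rmult_le_pos; [apply Rmult_le_pos; [apply pos_INR|apply Cmod_ge_0]|apply pow_le; lra]. }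
  replace (q ^ n) with (x ^ n * q' ^ n) by (rewrite <- Rpow_mult_distr; f_equal; unfold x; field; lra).
  replace (/ (q' * (1 - x)) * (Cmod (a (S n)) * q' ^ S n)) with (Cmod (a (S n)) * q' ^ n * / (1 - x)) by (simpl; field; lra).
  replace (INR (n + 1) * Cmod (a (S n)) * (x ^ n * q' ^ n)) with (Cmod (a (S n)) * q' ^ n * (INR (n + 1) * x ^ n)) by ring.
  apply Rmult_le_compat_l; [apply Rmult_le_pos; [apply Cmod_ge_0|apply pow_le; lra]|].
  apply Rmult_le_reg_r with (1 - x); [lra|]. rewrite Rinv_l by lra.
  eapply Rle_trans; [apply lin_geom_bound; exact Hx|]. assert (0 <= x ^ (n + 1)) by (apply pow_le; lra). lra.
Qed.

Lemma ASr_bound a A r : 0 < r -> (forall n, Cmod (a n) <= A * INR (n + 1) * (/ r) ^ n) -> ASr a r.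
Proof.
  intros Hr H q Hq. set (x := q / r).
  assert (Hx : 0 <= x < 1).
  { unfold x. split; [apply Rdiv_le_0_compat; lra|]. apply Rlt_div_l; lra. }
  set (y := (1 + x) / 2). assert (Hy : x < y < 1 /\ 0 < y) by (unfold y; lra).
  set (z := x / y). assert (Hz : 0 <= z < 1).
  { unfold z. split; [apply Rdiv_le_0_compat; lra|]. apply Rlt_div_l; lra. }
  assert (HA : 0 <= A).
  { specialize (H O). simpl in H. generalize (Cmod_ge_0 (a O)). lra. }
  assert (G : ex_series (fun n => y ^ n)) by (apply ex_series_geom; rewrite Rabs_pos_eq; lra).
  apply (ex_series_scal (A / (1 - z))) in G.
  refine (@ex_series_le R_AbsRing R_CompleteNormedModule _ _ _ G). intros n.
  change (Rabs (Cmod (a n) * q ^ n) <= A / (1 - z) * y ^ n).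
  rewrite Rabs_pos_eq by (apply Rmult_le_pos; [apply Cmod_ge_0|apply pow_le; lra]).
  apply Rle_trans with (A * INR (n + 1) * (/ r) ^ n * q ^ n); [apply Rmult_le_compat_r; [apply pow_le; lra|apply H]|].
  replace (A * INR (n + 1) * (/ r) ^ n * q ^ n) with (A * INR (n + 1) * x ^ n).
  2:{ unfold x, Rdiv. rewrite Rpow_mult_distr. ring. }
  replace (x ^ n) with (z ^ n * y ^ n) by (rewrite <- Rpow_mult_distr; f_equal; unfold z; field; lra).
  replace (A * INR (n + 1) * (z ^ n * y ^ n)) with (A * y ^ n * (INR (n + 1) * z ^ n)) by ring.
  replace (A / (1 - z) * y ^ n) with (A * y ^ n * / (1 - z)) by (field; lra).
  apply Rmult_le_compat_l; [apply Rmult_le_pos; [exact HA|apply pow_le; lra]|].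
  apply Rmult_le_reg_r with (1 - z); [lra|]. rewrite Rinv_l by lra.
  eapply Rle_trans; [apply lin_geom_bound; exact Hz|]. assert (0 <= z ^ (n + 1)) by (apply pow_le; lra). lra.
Qed.

Definition ps (a : nat -> C) (t : C) : C := cser (fun n => a n * t ^ n)%C.

Lemma Cmod_pow z n : Cmod (z ^ n)%C = Cmod z ^ n.
Proof. induction n as [|n IH]; simpl; [apply Cmod_1|]. rewrite Cmod_mult, IH. reflexivity. Qed.

Lemma AS_ps a r t : ASr a r -> Cmod t < r -> AS (fun n => a n * t ^ n)%C.
Proof.
  intros H Ht. refine (AS_le _ _ _ (H (Cmod t) _)); [|split; [apply Cmod_ge_0|exact Ht]].
  intros n. rewrite Cmod_mult, Cmod_pow. lra.
Qed.

Lemma ps_correct a r t : ASr a r -> Cmod t < r -> csums (fun n => a n * t ^ n)%C (ps a t).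
Proof. intros H Ht. apply cser_correct, (AS_ps a r t H Ht). Qed.

(** Induction on the exponent: the next remainder is w times the current one plus (n + 2) t^(n+1) (w
    - t)^2. *)
Lemma pow_taylor2 (w t : C) q n : Cmod t <= q -> Cmod w <= q ->
  Cmod (w ^ S (S n) - t ^ S (S n) - RtoC (INR (S n + 1)) * t ^ S n * (w - t))%C
    <= INR (S n + 1) * INR (n + 1) * q ^ n * Cmod (w - t)%C ^ 2.
Proof.
  intros Ht Hw. assert (Hq : 0 <= q) by (generalize (Cmod_ge_0 t); lra).
  assert (Hd := Cmod_ge_0 (w - t)%C).
  induction n as [|n IH].
  - replace (w ^ 2 - t ^ 2 - RtoC (INR (1 + 1)) * t ^ 1 * (w - t))%C with ((w - t) * (w - t))%C.
    + rewrite Cmod_mult. simpl. nra.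
    + replace (RtoC (INR (1 + 1))) with (1 + 1)%C by (rewrite <- RtoC_plus; f_equal; simpl; ring). ring.
  - replace (w ^ S (S (S n)) - t ^ S (S (S n)) - RtoC (INR (S (S n) + 1)) * t ^ S (S n) * (w - t))%C
      with (w * (w ^ S (S n) - t ^ S (S n) - RtoC (INR (S n + 1)) * t ^ S n * (w - t)) + RtoC (INR (S n + 1)) * t ^ S n * ((w - t) * (w - t)))%C.
    2:{ replace (S (S n) + 1)%nat with (S (S n + 1)) by lia. rewrite (S_INR (S n + 1)), RtoC_plus. 
        change (w ^ S (S (S n)))%C with (w * w ^ S (S n))%C. change (t ^ S (S (S n)))%C with (t * t ^ S (S n))%C.
        change (t ^ S (S n))%C with (t * t ^ S n)%C. ring. }
    eapply Rle_trans; [apply Cmod_triangle|]. rewrite !Cmod_mult, Cmod_R, Cmod_pow.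
    rewrite (Rabs_pos_eq (INR (S n + 1))) by apply pos_INR.
    set (E := Cmod (w ^ S (S n) - t ^ S (S n) - RtoC (INR (S n + 1)) * t ^ S n * (w - t))%C) in *.
    assert (HE : 0 <= E) by apply Cmod_ge_0.
    assert (Ht2 : Cmod t ^ S n <= q ^ S n) by (apply pow_incr; split; [apply Cmod_ge_0|exact Ht]).
    assert (Hqn : 0 <= q ^ n) by (apply pow_le; exact Hq).
    assert (E1 : q ^ S n = q * q ^ n) by reflexivity.
    assert (N0 := pos_INR n).
    replace (INR (S (S n) + 1)) with (INR n + 3) by (rewrite !plus_INR, !S_INR; simpl; ring).
    replace (INR (S n + 1)) with (INR n + 2) in * by (rewrite !plus_INR, !S_INR; simpl; ring).
    replace (INR (n + 1)) with (INR n + 1) in * by (rewrite !plus_INR; simpl; ring).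
    set (d := Cmod (w - t)%C) in *.
    apply Rle_trans with (q * ((INR n + 2) * (INR n + 1) * q ^ n * d ^ 2) + (INR n + 2) * q ^ S n * (d * d)).
    + apply Rplus_le_compat.
      * apply Rmult_le_compat; [apply Cmod_ge_0|exact HE|exact Hw|exact IH].
      * apply Rmult_le_compat_r; [nra|]. apply Rmult_le_compat_l; [lra|exact Ht2].
    + rewrite E1. replace (q * ((INR n + 2) * (INR n + 1) * q ^ n * d ^ 2) + (INR n + 2) * (q * q ^ n) * (d * d))
        with ((INR n + 2) * (INR n + 2) * (q * q ^ n) * d ^ 2) by ring.
      assert (0 <= (q * q ^ n) * d ^ 2) by (apply Rmult_le_pos; [nra|apply pow2_ge_0]). nra.
Qed.

(** The sum of the second-order remainders of the monomials is at most |w - t|^2 times a multiple of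
    the majorant of the second derivative at an intermediate radius q. *)
Lemma ps_deriv a r t : ASr a r -> Cmod t < r -> cderiv (ps a) t (ps (PSd a) t).
Proof.
  intros H Ht. assert (Ht0 := Cmod_ge_0 t).
  set (q := (Cmod t + r) / 2). assert (Hq : Cmod t < q < r) by (unfold q; lra).
  assert (H2 := ASr_d _ _ (ASr_d _ _ H)). specialize (H2 q ltac:(lra)).
  set (K := Series (fun n => Cmod (PSd (PSd a) n) * q ^ n)) in *.
  assert (HK : 0 <= K).
  { unfold K. rewrite <- (Rmult_0_l (Series (fun n => Cmod (PSd (PSd a) n) * q ^ n))), <- Series_scal_l.
    apply Series_le; [|exact H2]. intros n.
    assert (0 <= Cmod (PSd (PSd a) n) * q ^ n) by (apply Rmult_le_pos; [apply Cmod_ge_0|apply pow_le; lra]). lra. }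
  apply cderiv_eps. intros eps He.
  exists (Rmin (q - Cmod t) (eps / (2 * K + 1))). split; [apply Rmin_case; [lra|apply Rdiv_lt_0_compat; lra]|].
  intros w hw.
  assert (h1 : Cmod (w - t)%C < q - Cmod t) by (eapply Rlt_le_trans; [exact hw|apply Rmin_l]).
  assert (h2 : Cmod (w - t)%C < eps / (2 * K + 1)) by (eapply Rlt_le_trans; [exact hw|apply Rmin_r]).
  assert (Hw : Cmod w < q).
  { replace w with ((w - t) + t)%C by ring. eapply Rle_lt_trans; [apply Cmod_triangle|]. lra. }
  assert (Sw := ps_correct a r w H ltac:(lra)). assert (St := ps_correct a r t H Ht).
  assert (Sd := ps_correct _ r t (ASr_d _ _ H) Ht).
  apply csums_tail, csums_tail in Sw. apply csums_tail, csums_tail in St.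
  apply csums_tail in Sd. apply (csums_scal (w - t)%C) in Sd.
  assert (SR := csums_minus _ _ _ _ (csums_minus _ _ _ _ Sw St) Sd).
  set (R_ := fun n => (a (S (S n)) * w ^ S (S n) - a (S (S n)) * t ^ S (S n) - (w - t) * (PSd a (S n) * t ^ S n))%C) in *.
  assert (HR : forall n, Cmod (R_ n) <= Cmod (w - t)%C ^ 2 * (Cmod (PSd (PSd a) n) * q ^ n)).
  { intros n. unfold R_.
    replace (a (S (S n)) * w ^ S (S n) - a (S (S n)) * t ^ S (S n) - (w - t) * (PSd a (S n) * t ^ S n))%C
      with (a (S (S n)) * (w ^ S (S n) - t ^ S (S n) - RtoC (INR (S n + 1)) * t ^ S n * (w - t)))%C by (unfold PSd; ring).
    rewrite Cmod_mult. unfold PSd. rewrite !Cmod_mult, !Cmod_R, !(Rabs_pos_eq (INR _)) by apply pos_INR.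
    apply Rle_trans with (Cmod (a (S (S n))) * (INR (S n + 1) * INR (n + 1) * q ^ n * Cmod (w - t)%C ^ 2)).
    - apply Rmult_le_compat_l; [apply Cmod_ge_0|]. apply pow_taylor2; lra.
    - right. ring. }
  assert (exR : ex_series (fun n => Cmod (w - t)%C ^ 2 * (Cmod (PSd (PSd a) n) * q ^ n))).
  { apply (ex_series_scal (Cmod (w - t)%C ^ 2) _ H2). }
  assert (ASR : AS R_) by (apply (AS_le _ _ HR exR)).
  assert (Hb := csums_bound _ _ ASR SR).
  assert (Hb2 : Series (fun n => Cmod (R_ n)) <= Cmod (w - t)%C ^ 2 * K).
  { unfold K. rewrite <- Series_scal_l. apply Series_le; [|exact exR]. intros n. split; [apply Cmod_ge_0|apply HR]. }
  match type of Hb with Cmod ?l <= _ => replace (ps a w - ps a t - ps (PSd a) t * (w - t))%C with l end.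
  2:{ unfold PSd at 1. simpl. unfold PSd. simpl. ring. }
  eapply Rle_trans; [exact Hb|].
  set (d := Cmod (w - t)%C) in *. assert (Hd : 0 <= d) by apply Cmod_ge_0.
  apply (Rmult_lt_compat_l (2 * K + 1)) in h2; [|lra].
  replace ((2 * K + 1) * (eps / (2 * K + 1))) with eps in h2 by (field; lra). nra.
Qed.

Lemma conv_pow a b t n : conv (fun k => a k * t ^ k)%C (fun k => b k * t ^ k)%C n = (conv a b n * t ^ n)%C.
Proof.
  unfold conv. rewrite Cmult_comm, <- csum_scal. apply csum_ext. intros k Hk.
  replace n with (k + (n - k))%nat at 3 by lia.
  assert (E : forall i j, (t ^ (i + j))%C = (t ^ i * t ^ j)%C).
  { intros i j. induction i as [|i IH]; simpl; [ring|]. rewrite IH. ring. }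
  rewrite E. ring.
Qed.

(** Coefficient of t^n in the equation expanded at x0, solved for a_(n+2); p and g are the Taylor
    coefficients of A and G there. *)
Definition ode_rec (p g : nat -> C) (B lam : C) (a : nat -> C) (n : nat) : C :=
  ((conv (PSd a) p n + B * a n + lam * conv a a n + g n) / RtoC (INR (n + 2) * INR (n + 1)))%C.

Lemma ps_ode (A G : C -> C) (B lam x0 : C) (a p g : nat -> C) r :
  ASr a r -> ASr p r ->
  (forall t, Cmod t < r -> csums (fun n => p n * t ^ n)%C (A (x0 + t)%C)) ->
  (forall t, Cmod t < r -> csums (fun n => g n * t ^ n)%C (G (x0 + t)%C)) ->
  (forall n, a (S (S n)) = ode_rec p g B lam a n) ->
  Sol A G B lam (fun _ => True) (disc x0 r) (fun z => ps a (z - x0)%C) (fun z => ps (PSd a) (z - x0)%C).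
Proof.
  intros Ha Hp HA HG Hrec z Hz. split; [exact I|].
  assert (D0 : cderiv (fun w => w - x0)%C z 1%C).
  { eapply cderiv_val; [exact (cderiv_minus _ _ z _ _ (cderiv_id z) (cderiv_const x0 z))|ring]. }
  assert (Hd := ASr_d _ _ Ha). unfold disc in Hz.
  split.
  - eapply cderiv_val; [exact (cderiv_comp (ps a) (fun w => w - x0)%C z _ _ (ps_deriv a r _ Ha Hz) D0)|ring].
  - eapply cderiv_val; [exact (cderiv_comp (ps (PSd a)) (fun w => w - x0)%C z _ _ (ps_deriv _ r _ Hd Hz) D0)|].
    set (t := (z - x0)%C) in *. rewrite Cmult_1_l.
    assert (E : (x0 + t)%C = z) by (unfold t; ring).
    specialize (HA t Hz). specialize (HG t Hz). rewrite E in HA, HG.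
    apply (csums_unique (fun n => PSd (PSd a) n * t ^ n)%C).
    + exact (ps_correct _ r t (ASr_d _ _ Hd) Hz).
    + assert (Sa := ps_correct a r t Ha Hz). assert (Sd := ps_correct _ r t Hd Hz).
      assert (C1 := csums_mult _ _ _ _ (AS_ps _ r t Hd Hz) (AS_ps p r t Hp Hz) Sd HA).
      assert (C2 := csums_mult _ _ _ _ (AS_ps a r t Ha Hz) (AS_ps a r t Ha Hz) Sa Sa).
      replace (A z * ps (PSd a) t)%C with (ps (PSd a) t * A z)%C by ring.
      refine (csums_ext _ _ _ _ (csums_plus _ _ _ _ (csums_plus _ _ _ _ (csums_plus _ _ _ _ C1 (csums_scal B _ _ Sa)) (csums_scal lam _ _ C2)) HG)).
      intros n. cbv beta. rewrite !conv_pow. 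
      replace (PSd (PSd a) n) with (conv (PSd a) p n + B * a n + lam * conv a a n + g n)%C; [ring|].
      unfold PSd at 2. unfold PSd at 2. rewrite Hrec. unfold ode_rec.
      assert (INR (n + 2) <> 0) by (apply not_0_INR; lia). assert (INR (n + 1) <> 0) by (apply not_0_INR; lia).
      replace (S n + 1)%nat with (n + 2)%nat by lia. rewrite RtoC_mult. field.
      split; intros h; apply RtoC_inj in h; contradiction.
Qed.

(** Course-of-values recursion made structural: stage n is correct up to index n + 1, and stage m +
    1 adds the entry m + 2, computed from stage m. *)
Fixpoint rec_pre (F : (nat -> C) -> nat -> C) (a0 a1 : C) (n : nat) : nat -> C :=
  match n with
  | O => fun k => if Nat.eqb k 0 then a0 else a1
  | S m => fun k => if Nat.eqb k (S (S m)) then F (rec_pre F a0 a1 m) m else rec_pre F a0 a1 m k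
  end.

Lemma rec_seq (F : (nat -> C) -> nat -> C) (a0 a1 : C) :
  (forall a b n, (forall k, (k <= S n)%nat -> a k = b k) -> F a n = F b n) ->
  exists a, a 0%nat = a0 /\ a 1%nat = a1 /\ forall n, a (S (S n)) = F a n.
Proof.
  intros HF. exists (fun k => rec_pre F a0 a1 k k).
  assert (St : forall m n k, (k <= S n)%nat -> (n <= m)%nat -> rec_pre F a0 a1 m k = rec_pre F a0 a1 n k).
  { induction m as [|m IH]; intros n k Hk Hn; [replace n with O by lia; reflexivity|].
    destruct (Nat.eq_dec n (S m)) as [->|]; [reflexivity|]. simpl.
    destruct (Nat.eqb_spec k (S (S m))); [lia|]. apply IH; lia. }
  split; [reflexivity|]. split; [reflexivity|]. intros n.
  rewrite (St (S (S n)) (S n) (S (S n))) by lia. simpl. rewrite Nat.eqb_refl.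
  apply HF. intros k Hk. destruct (Nat.le_gt_cases k n).
  - apply St; lia.
  - replace k with (S n) by lia. symmetry. apply St; lia.
Qed.

Lemma ode_rec_local p g B lam a b n : (forall k, (k <= S n)%nat -> a k = b k) ->
  ode_rec p g B lam a n = ode_rec p g B lam b n.
Proof.
  intros H. unfold ode_rec.
  assert (E1 : conv (PSd a) p n = conv (PSd b) p n).
  { apply csum_ext. intros k Hk. unfold PSd. rewrite H by lia. reflexivity. }
  assert (E2 : conv a a n = conv b b n).
  { apply csum_ext. intros k Hk. rewrite !H by lia. reflexivity. }
  rewrite E1, E2, (H n) by lia. reflexivity.
Qed.

Lemma sum_tetra X n :
  sum_f_R0 (fun k => INR (k + 1) * (X - INR k)) n
  = INR (n + 1) * INR (n + 2) / 2 * X - INR n * INR (n + 1) * INR (n + 2) / 3.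
Proof.
  induction n as [|n IH]; [simpl; field|].
  rewrite tech5, IH, !plus_INR, !S_INR. simpl. field.
Qed.

Lemma sum_tetra2 n :
  sum_f_R0 (fun k => INR (k + 1) * INR (k + 2)) n = INR (n + 1) * INR (n + 2) * INR (n + 3) / 3.
Proof.
  induction n as [|n IH]; [simpl; field|].
  rewrite tech5, IH, !plus_INR, !S_INR. simpl. field.
Qed.

(** The numbers (k+1) Q^k are the coefficients of (1 - Qz)^-2, and its square (1 - Qz)^-4 has the
    tetrahedral numbers times Q^n. Since (1 - Qz)^-2 has a second derivative proportional to its
    square, it is the natural majorant for an equation with a quadratic term. *)
Lemma conv_tetra_bound (a b : nat -> C) (Ka Kb Q : R) n : 0 <= Q ->
  (forall k, (k <= n)%nat -> Cmod (a k) <= Ka * INR (k + 1) * Q ^ k) ->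
  (forall k, (k <= n)%nat -> Cmod (b k) <= Kb * INR (k + 1) * Q ^ k) ->
  Cmod (conv a b n) <= Ka * Kb * (INR (n + 1) * INR (n + 2) * INR (n + 3) / 6) * Q ^ n.
Proof.
  intros HQ Ha Hb. unfold conv.
  apply Rle_trans with (sum_f_R0 (fun k => INR (k + 1) * (INR (n + 1) - INR k) * (Ka * Kb * Q ^ n)) n).
  - apply csum_bound. intros k Hk. rewrite Cmod_mult.
    specialize (Ha k Hk). specialize (Hb (n - k)%nat ltac:(lia)).
    apply Rle_trans with (Ka * INR (k + 1) * Q ^ k * (Kb * INR (n - k + 1) * Q ^ (n - k))).
    + apply Rmult_le_compat; auto using Cmod_ge_0.
    + right. replace (Q ^ n) with (Q ^ k * Q ^ (n - k)) by (rewrite <- pow_add; f_equal; lia).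
      rewrite (plus_INR (n - k)), (plus_INR n), minus_INR by exact Hk. ring.
  - rewrite <- scal_sum, sum_tetra. right. rewrite !plus_INR. simpl. field.
Qed.

(** The coefficients are majorized by those of (M+1) (1 - Qz)^-2 with Q = 2 (M+2), so the radius of
    existence 1/Q depends on the bound M alone, which is what continuation by equal steps needs. *)
Lemma local_exist (A G : C -> C) (B lam x0 a0 a1 : C) (p g : nat -> C) (M : R) :
  0 <= M -> Cmod B <= 1 -> Cmod lam <= 6 -> Cmod a0 <= M -> Cmod a1 <= M ->
  (forall n, Cmod (p n) <= 1) ->
  (forall n, Cmod (g n) <= (M + 1) * (INR (n + 1) * INR (n + 2) * INR (n + 3) / 6)) ->
  (forall t, Cmod t < 1 / 2 -> csums (fun n => p n * t ^ n)%C (A (x0 + t)%C)) ->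
  (forall t, Cmod t < 1 / 2 -> csums (fun n => g n * t ^ n)%C (G (x0 + t)%C)) ->
  exists f f1, Sol A G B lam (fun _ => True) (disc x0 (/ (2 * (M + 2)))) f f1 /\ f x0 = a0 /\ f1 x0 = a1.
Proof.
  intros HM HB Hl H0 H1 Hp Hg HA HG.
  destruct (rec_seq (ode_rec p g B lam) a0 a1 (ode_rec_local p g B lam)) as [a [E0 [E1 Hrec]]].
  set (Q := 2 * (M + 2)). assert (HQ : 4 <= Q) by (unfold Q; lra).
  assert (Hb : forall n k, (k <= S n)%nat -> Cmod (a k) <= (M + 1) * INR (k + 1) * Q ^ k).
  { induction n as [|n IH]; intros k Hk.
    - destruct k as [|[|k]]; [| |lia].
      + rewrite E0. simpl. lra.
      + rewrite E1. simpl. nra.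
    - destruct (Nat.eq_dec k (S (S n))) as [->|]; [|apply IH; lia].
      rewrite Hrec. unfold ode_rec.
      assert (P1 : 0 < INR (n + 2)) by (apply lt_0_INR; lia). assert (P2 : 0 < INR (n + 1)) by (apply lt_0_INR; lia).
      assert (P3 : 0 < INR (n + 3)) by (apply lt_0_INR; lia).
      assert (Pq : 1 <= Q ^ n) by (apply pow_R1_Rle; lra).
      set (S3 := INR (n + 1) * INR (n + 2) * INR (n + 3) / 6) in *.
      rewrite Cmod_div by (intros h; apply RtoC_inj in h; nra).
      rewrite Cmod_R, Rabs_pos_eq by nra. apply Rle_div_l; [nra|].
      assert (C1 : Cmod (conv (PSd a) p n) <= (M + 1) * (2 * S3) * (Q * Q ^ n)).
      { unfold conv. apply Rle_trans with (sum_f_R0 (fun k => INR (k + 1) * INR (k + 2) * ((M + 1) * (Q * Q ^ n))) n).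
        - apply csum_bound. intros k Hk'. rewrite Cmod_mult. unfold PSd. rewrite Cmod_mult, Cmod_R, Rabs_pos_eq by apply pos_INR.
          specialize (IH (S k) ltac:(lia)). specialize (Hp (n - k)%nat).
          replace (S k + 1)%nat with (k + 2)%nat in IH by lia.
          assert (Q ^ k <= Q ^ n) by (apply Rle_pow; [lra|exact Hk']).
          apply Rle_trans with (INR (k + 1) * ((M + 1) * INR (k + 2) * Q ^ S k) * 1).
          + apply Rmult_le_compat; [apply Rmult_le_pos; [apply pos_INR|apply Cmod_ge_0]|apply Cmod_ge_0| |exact Hp].
            apply Rmult_le_compat_l; [apply pos_INR|exact IH].
          + change (Q ^ S k) with (Q * Q ^ k).
            replace (INR (k + 1) * ((M + 1) * INR (k + 2) * (Q * Q ^ k)) * 1) with (INR (k + 1) * INR (k + 2) * ((M + 1) * (Q * Q ^ k))) by ring.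
            apply Rmult_le_compat_l; [apply Rmult_le_pos; apply pos_INR|]. apply Rmult_le_compat_l; [lra|]. apply Rmult_le_compat_l; lra.
        - rewrite <- scal_sum, sum_tetra2. right. unfold S3. field. }
      assert (C2 : Cmod (conv a a n) <= (M + 1) * (M + 1) * S3 * Q ^ n).
      { apply conv_tetra_bound; [lra| |]; intros k Hk'; apply IH; lia. }
      assert (C3 : Cmod (a n) <= (M + 1) * S3 * Q ^ n).
      { eapply Rle_trans; [apply IH; lia|]. apply Rmult_le_compat_r; [lra|]. apply Rmult_le_compat_l; [lra|].
        unfold S3. rewrite !plus_INR. simpl. assert (0 <= INR n) by apply pos_INR. nra. }
      specialize (Hg n). fold S3 in Hg.
      assert (PS : 0 < S3) by (unfold S3; apply Rdiv_lt_0_compat; [repeat apply Rmult_lt_0_compat; assumption|lra]).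
      (* All four contributions carry the factor (M+1) S3, and so does the target because
         (n+1)(n+2)(n+3) = 6 S3. What remains is 2Q + 2 + 6(M+1) <= 6 Q^2. *)
      apply Rle_trans with ((M + 1) * (2 * S3) * (Q * Q ^ n) + 1 * ((M + 1) * S3 * Q ^ n) + 6 * ((M + 1) * (M + 1) * S3 * Q ^ n) + (M + 1) * S3).
      { eapply Rle_trans; [apply Cmod_triangle|]. apply Rplus_le_compat; [|exact Hg].
        eapply Rle_trans; [apply Cmod_triangle|]. apply Rplus_le_compat.
        - eapply Rle_trans; [apply Cmod_triangle|]. apply Rplus_le_compat; [exact C1|].
          rewrite Cmod_mult. apply Rmult_le_compat; auto using Cmod_ge_0.
        - rewrite Cmod_mult. apply Rmult_le_compat; auto using Cmod_ge_0. }
      replace (S (S n) + 1)%nat with (n + 3)%nat by lia.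
      replace ((M + 1) * INR (n + 3) * Q ^ S (S n) * (INR (n + 2) * INR (n + 1))) with ((M + 1) * S3 * (6 * Q * Q * Q ^ n)).
      2:{ unfold S3. simpl. field. }
      replace ((M + 1) * (2 * S3) * (Q * Q ^ n) + 1 * ((M + 1) * S3 * Q ^ n) + 6 * ((M + 1) * (M + 1) * S3 * Q ^ n) + (M + 1) * S3)
        with ((M + 1) * S3 * ((2 * Q + 1 + 6 * (M + 1)) * Q ^ n + 1)) by ring.
      apply Rmult_le_compat_l; [nra|].
      apply Rle_trans with ((2 * Q + 2 + 6 * (M + 1)) * Q ^ n); [lra|].
      apply Rmult_le_compat_r; [lra|]. unfold Q in *. nra. }
  assert (Hr : 0 < / Q) by (apply Rinv_0_lt_compat; lra).
  assert (Hr2 : / Q < 1 / 2). { replace (1 / 2) with (/ 2) by field. apply Rinv_lt_contravar; lra. }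
  assert (HAS : ASr a (/ Q)).
  { apply (ASr_bound a (M + 1)); [exact Hr|]. intros n. rewrite Rinv_inv. apply (Hb n). lia. }
  assert (HASp : ASr p (/ Q)).
  { apply (ASr_bound p 1); [exact Hr|]. intros n. rewrite Rinv_inv. eapply Rle_trans; [apply Hp|].
    assert (1 <= Q ^ n) by (apply pow_R1_Rle; lra). rewrite plus_INR. simpl. generalize (pos_INR n). nra. }
  exists (fun z => ps a (z - x0)%C), (fun z => ps (PSd a) (z - x0)%C).
  split; [|split].
  - apply (ps_ode A G B lam x0 a p g (/ Q)); auto.
    + intros t Ht. apply HA. lra.
    + intros t Ht. apply HG. lra.
  - replace (x0 - x0)%C with (RtoC 0) by ring. rewrite <- E0.
    apply (csums_unique (fun n => a n * 0 ^ n)%C).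
    + apply (ps_correct a (/ Q) 0%C HAS). rewrite Cmod_0. exact Hr.
    + replace (a 0%nat) with (a 0%nat * 0 ^ 0 + 0)%C by (simpl; ring).
      apply (csums_untail (fun n => a n * 0 ^ n)%C). apply csums_ext with (fun _ => RtoC 0); [intros; simpl; ring|apply csums_zero].
  - replace (x0 - x0)%C with (RtoC 0) by ring. rewrite <- E1.
    apply (csums_unique (fun n => PSd a n * 0 ^ n)%C).
    + apply (ps_correct _ (/ Q) 0%C (ASr_d _ _ HAS)). rewrite Cmod_0. exact Hr.
    + replace (a 1%nat) with (PSd a 0 * 0 ^ 0 + 0)%C by (unfold PSd; simpl; ring).
      apply (csums_untail (fun n => PSd a n * 0 ^ n)%C). apply csums_ext with (fun _ => RtoC 0); [intros; simpl; ring|apply csums_zero].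
Qed.

(** * The two equations and their local solutions *)

Definition SolPI := Sol (fun _ => 0%C) (fun z => z) 0%C 6%C (fun _ => True).

Definition kH : R := 392 / 625.

(** The domain |x| >= 1 is where the coefficient -1/x has modulus at most 1. *)
Definition SolH := Sol (fun x => - / x)%C (fun x => RtoC kH / (x * x * (x * x)))%C 1%C (/ 2)%C (fun x => 1 <= Cmod x).

Lemma csums_affine (x0 t : C) :
  csums (fun n => match n with O => x0 | 1%nat => RtoC 1 | _ => RtoC 0 end * t ^ n)%C (x0 + t)%C.
Proof.
  replace (x0 + t)%C with (x0 * t ^ 0 + (1 * t ^ 1 + 0))%C by (simpl; ring).
  apply (csums_untail (fun n => match n with O => x0 | 1%nat => RtoC 1 | _ => RtoC 0 end * t ^ n)%C).
  apply (csums_untail (fun n => match n with O => RtoC 1 | _ => RtoC 0 end * t ^ S n)%C).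
  apply csums_ext with (fun _ => RtoC 0); [intros; simpl; ring|apply csums_zero].
Qed.

Lemma PI_local (M : R) : exists del, 0 < del /\ forall x0 a0 a1 : C, Cmod x0 <= M -> Cmod a0 <= M -> Cmod a1 <= M ->
  exists g g1, SolPI (disc x0 del) g g1 /\ g x0 = a0 /\ g1 x0 = a1.
Proof.
  assert (HM : 0 <= Rmax M 0) by apply Rmax_r.
  exists (/ (2 * (Rmax M 0 + 2))). split; [apply Rinv_0_lt_compat; lra|].
  intros x0 a0 a1 Hx H0 H1. assert (Hm : M <= Rmax M 0) by apply Rmax_l.
  apply (local_exist _ _ _ _ x0 a0 a1 (fun _ => 0%C) (fun n => match n with O => x0 | 1%nat => RtoC 1 | _ => RtoC 0 end)).
  - exact HM.
  - rewrite Cmod_0. lra.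
  - rewrite Cmod_R, Rabs_pos_eq; lra.
  - lra.
  - lra.
  - intros _. rewrite Cmod_0. lra.
  - intros n. destruct n as [|[|n]].
    + simpl. lra.
    + rewrite Cmod_1. simpl. lra.
    + rewrite Cmod_0. apply Rmult_le_pos; [lra|]. apply Rdiv_le_0_compat; [|lra]. repeat apply Rmult_le_pos; apply pos_INR.
  - intros t _. apply csums_ext with (fun _ => RtoC 0); [intros; ring|apply csums_zero].
  - intros t _. apply csums_affine.
Qed.

Lemma csums_geom (q : C) : Cmod q < 1 -> AS (fun n => q ^ n)%C /\ csums (fun n => q ^ n)%C (/ (1 - q))%C.
Proof.
  intros Hq. assert (HA : AS (fun n => q ^ n)%C).
  { refine (AS_le _ (fun n => Cmod q ^ n) _ _); [intros n; rewrite Cmod_pow; lra|].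
    apply ex_series_geom. rewrite Rabs_pos_eq; [exact Hq|apply Cmod_ge_0]. }
  split; [exact HA|]. assert (Sl := cser_correct _ HA). set (l := cser (fun n => q ^ n)%C) in *.
  assert (E : (l - q ^ 0)%C = (q * l)%C).
  { apply (csums_unique (fun n => q ^ S n)%C); [exact (csums_tail _ _ Sl)|exact (csums_scal q _ _ Sl)]. }
  assert (Hn : (1 - q)%C <> 0%C).
  { apply Cmod_nz. generalize (Cmod_tri_rev 1 q). rewrite Cmod_1. lra. }
  replace (/ (1 - q))%C with l; [exact Sl|].
  assert (E2 : (l * (1 - q))%C = 1%C).
  { replace (l * (1 - q))%C with (l - q ^ 0 - q * l + 1)%C by (simpl; ring). rewrite E. ring. }
  replace l with (l * (1 - q) * / (1 - q))%C by (field; exact Hn). rewrite E2. ring.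
Qed.

(** With v the coefficients of the geometric series of 1/(x0 + t), two successive convolution
    squares give those of (x0 + t)^-4. For |x0| >= 2 the v_n are bounded by 1, so the last are at
    most tetrahedral. The radius is at most 1/4, hence |x| >= 1 on the disc. *)
Lemma H_local (M : R) : exists del, 0 < del /\ forall x0 a0 a1 : C, 2 <= Cmod x0 -> Cmod a0 <= M -> Cmod a1 <= M ->
  exists g g1, SolH (disc x0 del) g g1 /\ g x0 = a0 /\ g1 x0 = a1.
Proof.
  assert (HM : 0 <= Rmax M 0) by apply Rmax_r.
  exists (/ (2 * (Rmax M 0 + 2))). split; [apply Rinv_0_lt_compat; lra|].
  intros x0 a0 a1 Hx H0 H1. assert (Hm : M <= Rmax M 0) by apply Rmax_l.
  assert (Hnz : x0 <> 0%C) by (apply Cmod_nz; lra).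
  set (q := (- / x0)%C).
  assert (Hqm : Cmod q <= / 2).
  { unfold q. rewrite Cmod_opp, Cmod_inv by exact Hnz. apply Rinv_le_contravar; lra. }
  set (v := fun n => (/ x0 * q ^ n)%C).
  assert (Hv : forall n, Cmod (v n) <= 1).
  { intros n. unfold v. rewrite Cmod_mult, Cmod_pow. replace (Cmod (/ x0)%C) with (Cmod q) by (unfold q; apply Cmod_opp).
    assert (0 <= Cmod q) by apply Cmod_ge_0.
    assert (Cmod q ^ n <= 1) by (rewrite <- (pow1 n); apply pow_incr; lra).
    assert (0 <= Cmod q ^ n) by (apply pow_le; lra). nra. }
  assert (Sv : forall t, Cmod t < 1 / 2 -> (x0 + t)%C <> 0%C /\ AS (fun n => v n * t ^ n)%C /\ csums (fun n => v n * t ^ n)%C (/ (x0 + t))%C).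
  { intros t Ht.
    assert (Hnt : (x0 + t)%C <> 0%C).
    { apply Cmod_nz. generalize (Cmod_tri_rev x0 (- t)%C). rewrite Cmod_opp. replace (x0 - - t)%C with (x0 + t)%C by ring. lra. }
    split; [exact Hnt|].
    assert (Hqt : Cmod (q * t)%C < 1).
    { rewrite Cmod_mult. generalize (Cmod_ge_0 q) (Cmod_ge_0 t). nra. }
    destruct (csums_geom _ Hqt) as [G1 G2].
    assert (Ep : forall n, ((q * t) ^ n)%C = (q ^ n * t ^ n)%C).
    { induction n as [|n IH]; simpl; [ring|]. rewrite IH. ring. }
    split.
    - refine (AS_le _ _ _ (ex_series_scal (Cmod (/ x0)%C) _ G1)). intros n. unfold v.
      change (Cmod (/ x0 * q ^ n * t ^ n)%C <= Cmod (/ x0)%C * Cmod ((q * t) ^ n)%C). rewrite Ep, <- Cmod_mult. right. f_equal. ring.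
    - apply csums_ext with (fun n => / x0 * (q * t) ^ n)%C; [intros n; rewrite Ep; unfold v; ring|].
      replace (/ (x0 + t))%C with (/ x0 * / (1 - q * t))%C; [apply csums_scal, G2|].
      unfold q. field. split; assumption. }
  set (w := conv v v). set (g := conv w w).
  assert (Hw : forall n, Cmod (w n) <= INR (n + 1)).
  { intros n. unfold w, conv. apply Rle_trans with (sum_f_R0 (fun _ => 1) n).
    - apply csum_bound. intros k _. rewrite Cmod_mult. generalize (Hv k) (Hv (n - k)%nat) (Cmod_ge_0 (v k)) (Cmod_ge_0 (v (n - k)%nat)). nra.
    - rewrite sum_cte. replace (S n) with (n + 1)%nat by lia. lra. }
  assert (Hg : forall n, Cmod (g n) <= INR (n + 1) * INR (n + 2) * INR (n + 3) / 6).
  { intros n. unfold g. eapply Rle_trans; [apply (conv_tetra_bound w w 1 1 1 n); [lra| |]|].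
    - intros k _. rewrite pow1. generalize (Hw k). lra.
    - intros k _. rewrite pow1. generalize (Hw k). lra.
    - rewrite pow1. lra. }
  destruct (local_exist (fun x => - / x)%C (fun x => RtoC kH / (x * x * (x * x)))%C 1%C (/ 2)%C x0 a0 a1
    (fun n => (-1) * v n)%C (fun n => RtoC kH * g n)%C (Rmax M 0)) as [f [f1 [Sf [F0 F1]]]].
  - exact HM.
  - rewrite Cmod_1. lra.
  - rewrite Cmod_inv, Cmod_R, Rabs_pos_eq by (try lra; intros h; apply RtoC_inj in h; lra). lra.
  - lra.
  - lra.
  - intros n. rewrite Cmod_mult. replace (Cmod (-1)%C) with 1; [generalize (Hv n); lra|].
    rewrite Cmod_R, Rabs_left; lra.
  - intros n. rewrite Cmod_mult, Cmod_R, Rabs_pos_eq by (unfold kH; lra). specialize (Hg n).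
    assert (0 <= Cmod (g n)) by apply Cmod_ge_0. unfold kH. nra.
  - intros t Ht. destruct (Sv t Ht) as [_ [_ Sv']]. replace (- / (x0 + t))%C with ((-1) * / (x0 + t))%C by ring.
    refine (csums_ext _ _ _ _ (csums_scal (-1)%C _ _ Sv')). intros n. cbv beta. ring.
  - intros t Ht. destruct (Sv t Ht) as [Hnt [HASv Sv']].
    assert (Sw : csums (fun n => w n * t ^ n)%C (/ (x0 + t) * / (x0 + t))%C).
    { refine (csums_ext _ _ _ _ (csums_mult _ _ _ _ HASv HASv Sv' Sv')). intros n. apply conv_pow. }
    assert (ASw : AS (fun n => w n * t ^ n)%C).
    { apply (AS_ps w 1); [|lra]. apply (ASr_bound w 1); [lra|]. intros n. rewrite Rinv_1, pow1. generalize (Hw n). lra. }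
    assert (Sg : csums (fun n => g n * t ^ n)%C (/ (x0 + t) * / (x0 + t) * (/ (x0 + t) * / (x0 + t)))%C).
    { refine (csums_ext _ _ _ _ (csums_mult _ _ _ _ ASw ASw Sw Sw)). intros n. apply conv_pow. }
    replace (RtoC kH / ((x0 + t) * (x0 + t) * ((x0 + t) * (x0 + t))))%C
      with (RtoC kH * (/ (x0 + t) * / (x0 + t) * (/ (x0 + t) * / (x0 + t))))%C by (field; exact Hnt).
    refine (csums_ext _ _ _ _ (csums_scal (RtoC kH) _ _ Sg)). intros n. cbv beta. ring.
  - exists f, f1. split; [|split; assumption].
    intros z Hz. destruct (Sf z Hz) as [_ h]. split; [|exact h]. unfold disc in Hz.
    assert (/ (2 * (Rmax M 0 + 2)) <= / 4) by (apply Rinv_le_contravar; lra).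
    generalize (Cmod_tri_rev x0 (x0 - z)%C). replace (x0 - (x0 - z))%C with z by ring.
    rewrite (Cmod_minus_comm x0 z). lra.
Qed.

(* The double pole (r - z)^-2 = sum (n+1) r^(-n-2) z^n solves y'' = 6 y^2, so it majorizes every
   solution of y'' = 6 y^2 + z as soon as the coefficients of index 0, 1 and 3 are majorized. *)
Lemma PI_disc (r : R) (a0 a1 : C) : 0 < r ->
  Cmod a0 <= / r ^ 2 -> Cmod a1 <= 2 / r ^ 3 -> Cmod (12 * a0 * a1 + 1)%C / 6 <= 4 / r ^ 5 ->
  exists f f1, SolPI (disc 0 r) f f1 /\ f (RtoC 0) = a0 /\ f1 (RtoC 0) = a1.
Proof.
  intros Hr H0 H1 H3. set (Q := / r). assert (HQ : 0 < Q) by (apply Rinv_0_lt_compat; lra).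
  set (g := fun n => match n with O => RtoC 0 | 1%nat => RtoC 1 | _ => RtoC 0 end).
  set (p := fun _ : nat => RtoC 0).
  destruct (rec_seq (ode_rec p g 0 6) a0 a1 (ode_rec_local p g 0 6)) as [a [E0 [E1 Hrec]]].
  assert (cz : forall n b, conv b p n = 0%C).
  { intros n b. unfold conv. replace (csum (fun k => b k * p (n - k)%nat)%C n) with (0 * csum b n)%C; [ring|].
    rewrite <- csum_scal. apply csum_ext. intros. unfold p. ring. }
  assert (Hb : forall n k, (k <= S n)%nat -> Cmod (a k) <= Q ^ 2 * INR (k + 1) * Q ^ k).
  { induction n as [|n IH]; intros k Hk.
    - destruct k as [|[|k]]; [| |lia].
      + rewrite E0. unfold Q. simpl. replace (/ r ^ 2) with (/ r * / r) in H0 by (field; lra). lra.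
      + rewrite E1. unfold Q. simpl. replace (2 / r ^ 3) with (2 * (/ r * / r * / r)) in H1 by (field; lra). lra.
    - destruct (Nat.eq_dec k (S (S n))) as [->|]; [|apply IH; lia].
      assert (P1 : 0 < INR (n + 2)) by (apply lt_0_INR; lia). assert (P2 : 0 < INR (n + 1)) by (apply lt_0_INR; lia).
      (* Only n = 1 sees the forcing term z, whence the separate condition on the coefficient of
         index 3. For the other n the convolution bound is exactly the recursion satisfied by the
         majorant. *)
      destruct (Nat.eq_dec n 1) as [->|Hn].
      + rewrite Hrec. unfold ode_rec. rewrite cz. unfold g.
        replace ((0 + 0 * a 1%nat + 6 * conv a a 1 + 1) / RtoC (INR (1 + 2) * INR (1 + 1)))%C with (RtoC (/ 6) * (12 * a0 * a1 + 1))%C.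
        * rewrite Cmod_mult, Cmod_R, Rabs_pos_eq by lra.
          replace (Q ^ 2 * INR (3 + 1) * Q ^ 3) with (4 / r ^ 5) by (unfold Q; simpl; field; lra). lra.
        * unfold conv. rewrite csum_S. replace (csum (fun k => a k * a (1 - k)%nat)%C 0) with (a 0%nat * a 1%nat)%C by (apply injective_projections; reflexivity).
          rewrite E0, E1. replace (INR (1 + 2) * INR (1 + 1)) with 6 by (simpl; ring). rewrite RtoC_inv by lra. change (1 - 1)%nat with O. rewrite ?E0, ?E1.
          replace (RtoC 12) with (2 * 6)%C by (rewrite <- RtoC_mult; f_equal; ring). field.
      + rewrite Hrec. unfold ode_rec. rewrite cz.
        replace (g n) with (RtoC 0) by (unfold g; destruct n as [|[|]]; [reflexivity|lia|reflexivity]).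
        rewrite Cmod_div by (intros h; apply RtoC_inj in h; nra).
        rewrite Cmod_R, Rabs_pos_eq by nra. apply Rle_div_l; [nra|].
        replace (0 + 0 * a n + 6 * conv a a n + 0)%C with (6 * conv a a n)%C by ring.
        rewrite Cmod_mult, Cmod_R, Rabs_pos_eq by lra.
        assert (C2 : Cmod (conv a a n) <= Q ^ 2 * Q ^ 2 * (INR (n + 1) * INR (n + 2) * INR (n + 3) / 6) * Q ^ n).
        { apply conv_tetra_bound; [lra| |]; intros k Hk'; apply IH; lia. }
        replace (S (S n) + 1)%nat with (n + 3)%nat by lia.
        replace (Q ^ S (S n)) with (Q ^ 2 * Q ^ n) by (simpl; ring). nra. }
  assert (HAS : ASr a r).
  { apply (ASr_bound a (Q ^ 2)); [exact Hr|]. intros n. apply (Hb n). lia. }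
  assert (HASp : ASr p r).
  { apply (ASr_bound p 0); [exact Hr|]. intros n. unfold p. rewrite Cmod_0. right. ring. }
  exists (fun z => ps a (z - 0)%C), (fun z => ps (PSd a) (z - 0)%C).
  split; [|split].
  - apply (ps_ode _ _ _ _ 0%C a p g r); auto.
    + intros t _. apply csums_ext with (fun _ => RtoC 0); [intros; unfold p; ring|apply csums_zero].
    + intros t _. apply (csums_affine 0 t).
  - replace (0 - 0)%C with (RtoC 0) by ring. rewrite <- E0.
    apply (csums_unique (fun n => a n * 0 ^ n)%C).
    + apply (ps_correct a r 0%C HAS). rewrite Cmod_0. exact Hr.
    + replace (a 0%nat) with (a 0%nat * 0 ^ 0 + 0)%C by (simpl; ring).
      apply (csums_untail (fun n => a n * 0 ^ n)%C). apply csums_ext with (fun _ => RtoC 0); [intros; simpl; ring|apply csums_zero].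
  - replace (0 - 0)%C with (RtoC 0) by ring. rewrite <- E1.
    apply (csums_unique (fun n => PSd a n * 0 ^ n)%C).
    + apply (ps_correct _ r 0%C (ASr_d _ _ HAS)). rewrite Cmod_0. exact Hr.
    + replace (a 1%nat) with (PSd a 0 * 0 ^ 0 + 0)%C by (unfold PSd; simpl; ring).
      apply (csums_untail (fun n => PSd a n * 0 ^ n)%C). apply csums_ext with (fun _ => RtoC 0); [intros; simpl; ring|apply csums_zero].
Qed.

(** * Energy estimates in the x-plane *)

Definition Nsq (g g1 : C -> C) (x : C) : R := Cmod (g x) ^ 2 + Cmod (g1 x) ^ 2.

(** For h'' = h this is half the derivative of |h|^2 + |h'|^2 in the direction e: it vanishes on
    vertical lines. *)
Lemma Cdot_mult_real_part (a b e : C) : Cdot a (b * e)%C + Cdot b (a * e)%C = 2 * Re e * Cdot a b.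
Proof. unfold Cdot, Re, Im; simpl. ring. Qed.

Lemma Cdot_self_mult (b w : C) : Cdot b (w * b)%C = Re w * Cmod b ^ 2.
Proof. rewrite Cmod_sqr. unfold Cdot, Re, Im; simpl. ring. Qed.

Lemma Cdot_plus_r (a b c : C) : Cdot a (b + c)%C = Cdot a b + Cdot a c.
Proof. unfold Cdot, Re, Im; simpl. ring. Qed.

(** The term -2 Re(e/x) |h'|^2 acts on h' only. When negative it cannot be relied upon, since h' may
    vanish; when positive it may count in full. This is why rho has to dominate both |Re e| and |Re
    e| - Re(e/x). The term B^2/4 comes from |h'| |h|^2 / 2 with |h| |h'| <= B^2/2 and |h| <= B. *)
Lemma Nsq_deriv (U : C -> Prop) (g g1 : C -> C) (p e : C) (u : R) :
  SolH U g g1 -> U (p + RtoC u * e)%C -> Cmod e = 1 ->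
  exists l, is_derive (fun s => Nsq g g1 (p + RtoC s * e)%C) u l /\
    forall B rho, 0 < B -> Nsq g g1 (p + RtoC u * e)%C = B ^ 2 ->
      Rabs (Re e) <= rho -> Rabs (Re e) - Re (e / (p + RtoC u * e))%C <= rho ->
      l <= 2 * B * (rho * B + B ^ 2 / 4 + kH / Cmod (p + RtoC u * e)%C ^ 4).
Proof.
  intros S HU He. set (x := (p + RtoC u * e)%C) in *. destruct (S x HU) as [Hx [d0 d1]].
  assert (Hx0 : x <> 0%C) by (apply Cmod_nz; lra).
  assert (L := pder_line p e u).
  assert (P0 := pder_sq _ _ _ (pder_comp g (fun s => p + RtoC s * e)%C u _ _ d0 L)).
  assert (P1 := pder_sq _ _ _ (pder_comp g1 (fun s => p + RtoC s * e)%C u _ _ d1 L)).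
  eexists. split; [exact (is_derive_plus _ _ _ _ _ P0 P1)|].
  intros B rho HB HN Hr1 Hr2. fold x.
  unfold plus; simpl plus. cbv beta.
  set (a := g x) in *. set (b := g1 x) in *.
  set (src := (/ 2 * (a * a) + RtoC kH / (x * x * (x * x)))%C).
  assert (E : 2 * Cdot a (b * e)%C + 2 * Cdot b ((- / x * b + 1 * a + / 2 * (a * a) + RtoC kH / (x * x * (x * x))) * e)%C
    = 4 * Re e * Cdot a b - 2 * Re (e / x)%C * Cmod b ^ 2 + 2 * Cdot b (src * e)%C).
  { replace ((- / x * b + 1 * a + / 2 * (a * a) + RtoC kH / (x * x * (x * x))) * e)%C
      with (a * e + ((- (e / x)) * b + src * e))%C by (unfold src, Cdiv; ring).
    rewrite !Cdot_plus_r, Cdot_self_mult.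
    assert (H := Cdot_mult_real_part a b e). replace (Re (- (e / x))%C) with (- Re (e / x)%C) by reflexivity. lra. }
  change (2 * Cdot a (b * e)%C + 2 * Cdot b ((- / x * b + 1 * a + / 2 * (a * a) + RtoC kH / (x * x * (x * x))) * e)%C <= 2 * B * (rho * B + B ^ 2 / 4 + kH / Cmod x ^ 4)).
  rewrite E. clear E. unfold Nsq in HN. fold a b in HN.
  assert (ha := Cmod_ge_0 a). assert (hb := Cmod_ge_0 b).
  assert (hab := Cdot_le a b).
  assert (hab2 : - (Cmod a * Cmod b) <= Cdot a b).
  { assert (q := Cdot_le (- a)%C b). rewrite Cmod_opp in q. replace (Cdot (- a)%C b) with (- Cdot a b) in q by (unfold Cdot, Re, Im; simpl; ring). lra. }
  assert (hs : Cdot b (src * e)%C <= Cmod b * (Cmod a ^ 2 / 2 + kH / Cmod x ^ 4)).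
  { eapply Rle_trans; [apply Cdot_le|]. apply Rmult_le_compat_l; [exact hb|]. rewrite Cmod_mult, He, Rmult_1_r.
    unfold src. eapply Rle_trans; [apply Cmod_triangle|]. rewrite Cmod_div by (repeat apply Cmult_neq_0; exact Hx0).
    rewrite !Cmod_mult, Cmod_inv by (intros h; apply RtoC_inj in h; lra).
    rewrite !Cmod_R, !Rabs_pos_eq by (unfold kH; lra). right. f_equal; [field|]. f_equal. ring. }
  assert (hp : 0 <= kH / Cmod x ^ 4).
  { apply Rdiv_le_0_compat; [unfold kH; lra|]. apply pow_lt. lra. }
  set (K := kH / Cmod x ^ 4) in *. clearbody K. set (A_ := Cmod a) in *. set (B_ := Cmod b) in *. clearbody A_ B_.
  set (c := Re (e / x)%C) in *. clearbody c. set (f := Re e) in *. clearbody f.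
  set (dt := Cdot a b) in *. clearbody dt. set (ds := Cdot b (src * e)%C) in *. clearbody ds.
  assert (hB : B_ <= B) by nra.
  assert (hAB : A_ * B_ <= B ^ 2 / 2) by (assert (q := pow2_ge_0 (A_ - B_)); nra).
  assert (h1 : f * dt <= Rabs f * (B ^ 2 / 2)).
  { apply Rle_trans with (Rabs f * (A_ * B_)).
    - unfold Rabs. destruct (Rcase_abs f); nra.
    - apply Rmult_le_compat_l; [apply Rabs_pos|exact hAB]. }
  assert (h2 : B_ * (A_ ^ 2 / 2 + K) <= B * (B ^ 2 / 4) + B * K).
  { assert (A_ <= B) by nra. assert (B_ * A_ ^ 2 <= B * (B ^ 2 / 2)) by (replace (B_ * A_ ^ 2) with (A_ * (A_ * B_)) by ring; nra). nra. }
  assert (h3 : Rabs f * B ^ 2 - c * B_ ^ 2 <= rho * B ^ 2).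
  { assert (0 <= B_ ^ 2 <= B ^ 2) by nra. destruct (Rle_dec 0 c); nra. }
  nra.
Qed.

(** Comparison principle: where N = B, [Nsq_deriv] bounds the slope of N^2 by that of B^2, so
    [barrier] applies to B^2 - N^2. *)
Lemma energy_line (U : C -> Prop) (g g1 : C -> C) (p e : C) (l : R) (B B' rho : R -> R) :
  SolH U g g1 -> Cmod e = 1 ->
  (forall u, 0 <= u <= l -> U (p + RtoC u * e)%C) ->
  (forall u, 0 <= u <= l -> is_derive B u (B' u) /\ 0 < B u) ->
  Nsq g g1 p < B 0 ^ 2 ->
  (forall u, 0 <= u <= l -> Rabs (Re e) <= rho u /\ Rabs (Re e) - Re (e / (p + RtoC u * e))%C <= rho u /\
    rho u * B u + B u ^ 2 / 4 + kH / Cmod (p + RtoC u * e)%C ^ 4 < B' u) ->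
  forall u, 0 <= u <= l -> Nsq g g1 (p + RtoC u * e)%C < B u ^ 2.
Proof.
  intros S He HU HB H0 Hc u Hu.
  set (P := fun u l => is_derive (fun s => Nsq g g1 (p + RtoC s * e)%C) u l /\
    forall B rho, 0 < B -> Nsq g g1 (p + RtoC u * e)%C = B ^ 2 ->
      Rabs (Re e) <= rho -> Rabs (Re e) - Re (e / (p + RtoC u * e))%C <= rho ->
      l <= 2 * B * (rho * B + B ^ 2 / 4 + kH / Cmod (p + RtoC u * e)%C ^ 4)).
  (* The derivative is given pointwise by an existential; a choice turns it into the function that
     [barrier] expects. *)
  assert (Hex : forall s, exists l', 0 <= s <= l -> P s l').
  { intros s. destruct (excluded_middle_informative (0 <= s <= l)) as [h|h].
    - destruct (Nsq_deriv U g g1 p e s S (HU s h) He) as [l' Hl']. exists l'. intros _. exact Hl'.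
    - exists 0. intros h'. contradiction. }
  set (N' := fun s => proj1_sig (constructive_indefinite_description _ (Hex s))).
  assert (HN' : forall s, 0 <= s <= l -> P s (N' s)).
  { intros s Hs. unfold N'. destruct (constructive_indefinite_description _ (Hex s)) as [l' Hl']. simpl. apply Hl', Hs. }
  assert (0 < B u ^ 2 - Nsq g g1 (p + RtoC u * e)%C); [|lra].
  apply (barrier (fun s => B s ^ 2 - Nsq g g1 (p + RtoC s * e)%C) (fun s => 2 * B s * B' s - N' s) 0 l); [| | |exact Hu].
  - intros s Hs. destruct (HN' s Hs) as [h1 _]. destruct (HB s Hs) as [h2 _].
    apply (is_derive_minus (fun s => B s ^ 2)); [|exact h1].
    evar_last; [apply (is_derive_pow B 2 s _ h2)|]. simpl. ring.
  - replace (p + RtoC 0 * e)%C with p by ring. lra.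
  - intros s Hs Hz _. destruct (HN' s Hs) as [_ h1]. destruct (HB s Hs) as [_ h2]. destruct (Hc s Hs) as [r1 [r2 r3]].
    specialize (h1 (B s) (rho s) h2 ltac:(lra) r1 r2). nra.
Qed.

Lemma down_point (c t u : R) : (((c, t) : C) + RtoC u * (- Ci))%C = ((c, t - u) : C).
Proof. apply injective_projections; simpl; ring. Qed.

Lemma left_point (c t u : R) : (((c, t) : C) + RtoC u * (- (1)))%C = ((c - u, t) : C).
Proof. apply injective_projections; simpl; ring. Qed.

Lemma right_point (c t u : R) : (((c, t) : C) + RtoC u * 1)%C = ((c + u, t) : C).
Proof. apply injective_projections; simpl; ring. Qed.

Lemma Cmod_pair4 (c t : R) : Cmod ((c, t) : C) ^ 4 = (c ^ 2 + t ^ 2) ^ 2.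
Proof. replace (Cmod ((c, t) : C) ^ 4) with ((Cmod ((c, t) : C) ^ 2) ^ 2) by ring. rewrite Cmod_sqr. reflexivity. Qed.

Lemma Re_down_div (c t : R) : ((c, t) : C) <> 0%C -> Re (- Ci / ((c, t) : C))%C = - t / (c ^ 2 + t ^ 2).
Proof.
  intros H. unfold Re, Cdiv, Cinv, Ci; simpl. field. intros h. apply H.
  assert (c = 0) by nra. assert (t = 0) by nra. subst. reflexivity.
Qed.

Lemma Re_horiz_div (s c t : R) : ((c, t) : C) <> 0%C -> Re (RtoC s / ((c, t) : C))%C = s * c / (c ^ 2 + t ^ 2).
Proof.
  intros H. unfold Re, Cdiv, Cinv, RtoC; simpl. field. intros h. apply H.
  assert (c = 0) by nra. assert (t = 0) by nra. subst. reflexivity.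
Qed.

Lemma pair_nz (c t : R) : 0 < c ^ 2 + t ^ 2 -> ((c, t) : C) <> 0%C.
Proof. intros H E. injection E. intros. subst. lra. Qed.

Lemma Cmod_mCi : Cmod (- Ci)%C = 1.
Proof. rewrite Cmod_opp. unfold Cmod, Ci; simpl. replace (0 * (0 * 1) + 1 * (1 * 1)) with 1 by ring. apply sqrt_1. Qed.

(* Downward lines: rho absorbs the damping rate Im x / |x|^2 when it is positive. *)
Lemma energy_down (U : C -> Prop) (g g1 : C -> C) (c t l : R) (B B' : R -> R) :
  SolH U g g1 ->
  (forall u, 0 <= u <= l -> U ((c, t - u) : C) /\ 0 < c ^ 2 + (t - u) ^ 2) ->
  (forall u, 0 <= u <= l -> is_derive B u (B' u) /\ 0 < B u) ->
  Nsq g g1 ((c, t) : C) < B 0 ^ 2 ->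
  (forall u, 0 <= u <= l ->
    Rmax 0 ((t - u) / (c ^ 2 + (t - u) ^ 2)) * B u + B u ^ 2 / 4 + kH / (c ^ 2 + (t - u) ^ 2) ^ 2 < B' u) ->
  forall u, 0 <= u <= l -> Nsq g g1 ((c, t - u) : C) < B u ^ 2.
Proof.
  intros S HU HB H0 Hc u Hu. rewrite <- down_point.
  apply (energy_line U g g1 (c, t) (- Ci)%C l B B' (fun u => Rmax 0 ((t - u) / (c ^ 2 + (t - u) ^ 2)))); auto.
  - apply Cmod_mCi.
  - intros s Hs. rewrite down_point. apply HU, Hs.
  - intros s Hs. destruct (HU s Hs) as [_ h]. rewrite down_point, Re_down_div by (apply pair_nz; exact h).
    replace (Re (- Ci)%C) with 0 by (unfold Re, Ci; simpl; ring). rewrite Rabs_R0.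
    split; [apply Rmax_l|]. split; [|rewrite Cmod_pair4; apply Hc, Hs].
    eapply Rle_trans; [|apply Rmax_r]. right. field. lra.
Qed.

Definition rad (c t : R) : R := sqrt (c ^ 2 + t ^ 2).

Lemma rad_sq c t : rad c t ^ 2 = c ^ 2 + t ^ 2.
Proof. unfold rad. apply pow2_sqrt. nra. Qed.

Lemma rad_ge0 c t : 0 <= rad c t.
Proof. apply sqrt_pos. Qed.

Lemma rad_down_deriv c t u : 0 < rad c (t - u) ->
  is_derive (fun s => rad c (t - s)) u (- (t - u) / rad c (t - u)).
Proof.
  intros H. assert (E := rad_sq c (t - u)). unfold rad in *.
  evar_last.
  - apply (is_derive_sqrt (fun s => c ^ 2 + (t - s) ^ 2) u (- 2 * (t - u))).
    + auto_derive; [exact I|ring].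
    + rewrite <- E. apply pow_lt, H.
  - field. lra.
Qed.

(* Downwards bup grows at a rate at least 33/50 / |x|^4, which exceeds the forcing kH / |x|^4. *)
Definition bup (c t : R) : R := 33 / 50 / ((rad c t + t) * rad c t ^ 2).

(** [bup] is the solution, vanishing as Im x -> +oo, of the linear equation B' = (Im x / |x|^2) B +
    (33/50) / |x|^4 along the downward line, as follows from the primitive t / (c^2 sqrt(c^2 + t^2))
    of (c^2 + t^2)^(-3/2). The excess of 33/50 over [kH] pays for the quadratic term B^2/4. *)
Lemma V_up (U : C -> Prop) (g g1 : C -> C) (c t l : R) :
  SolH U g g1 ->
  (forall u, 0 <= u <= l -> U ((c, t - u) : C) /\ 0 <= t - u /\ 5 / 2 <= rad c (t - u) + (t - u)) ->
  Nsq g g1 ((c, t) : C) < bup c t ^ 2 ->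
  forall u, 0 <= u <= l -> Nsq g g1 ((c, t - u) : C) < bup c (t - u) ^ 2.
Proof.
  intros S HU H0.
  assert (Hr : forall u, 0 <= u <= l -> 0 < rad c (t - u)).
  { intros u Hu. destruct (HU u Hu) as [_ [h1 h2]]. assert (E := rad_sq c (t - u)).
    destruct (rad_ge0 c (t - u)) as [h|h]; [exact h|]. rewrite <- h in *. nra. }
  apply (energy_down U g g1 c t l (fun u => bup c (t - u))
    (fun u => bup c (t - u) * (/ rad c (t - u) + 2 * (t - u) / rad c (t - u) ^ 2))); auto.
  - intros u Hu. split; [apply HU, Hu|]. rewrite <- rad_sq. apply pow_lt, Hr, Hu.
  - intros u Hu. specialize (Hr u Hu). destruct (HU u Hu) as [_ [h1 h2]].
    assert (HD := rad_down_deriv c t u Hr).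
    split.
    + unfold bup. set (R_ := fun s => rad c (t - s)) in *.
      apply is_derive_ext with (fun s => 33 / 50 / ((R_ s + (t - s)) * (R_ s) ^ 2)); [reflexivity|].
      change (rad c (t - u)) with (R_ u) in *.
      assert (HE : ex_derive R_ u) by (eexists; exact HD).
      evar_last.
      * auto_derive.
        { repeat match goal with |- _ /\ _ => split | |- True => exact I | |- ex_derive _ _ => exact HE | |- _ <> 0 => apply Rgt_not_eq; repeat apply Rmult_lt_0_compat; lra end. }
        reflexivity.
      * change (Derive (fun x : R => R_ x) u) with (Derive R_ u). rewrite (is_derive_unique R_ u _ HD). field. lra.
    + unfold bup. apply Rdiv_lt_0_compat; [lra|]. apply Rmult_lt_0_compat; [lra|apply pow_lt, Hr].
  - rewrite Rminus_0_r. exact H0.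
  - intros u Hu. specialize (Hr u Hu). destruct (HU u Hu) as [_ [h1 h2]].
    rewrite <- rad_sq. unfold bup. set (r := rad c (t - u)) in *. set (tau := t - u) in *.
    rewrite Rmax_right by (apply Rdiv_le_0_compat; [exact h1|apply pow_lt, Hr]).
  
    (* Since r + tau >= 5/2, the quadratic term costs at most (33/50)^2 / 25 < 0.0175, and [kH] =
       0.6272 still fits below 33/50. *)
    assert (Hk : kH < 33 / 50 - (33 / 50) ^ 2 / (4 * (r + tau) ^ 2)).
    { assert ((33 / 50) ^ 2 / (4 * (r + tau) ^ 2) <= (33 / 50) ^ 2 / 25).
      { unfold Rdiv at 1 3. apply Rmult_le_compat_l; [lra|]. apply Rinv_le_contravar; nra. }
      unfold kH. lra. }
    assert (Hr4 : 0 < / (r ^ 2) ^ 2) by (apply Rinv_0_lt_compat, pow_lt, pow_lt, Hr).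
    apply Rminus_gt_0_lt.
    replace (33 / 50 / ((r + tau) * r ^ 2) * (/ r + 2 * tau / r ^ 2) -
      (tau / r ^ 2 * (33 / 50 / ((r + tau) * r ^ 2)) + (33 / 50 / ((r + tau) * r ^ 2)) ^ 2 / 4 + kH / (r ^ 2) ^ 2))
      with (/ (r ^ 2) ^ 2 * (33 / 50 - (33 / 50) ^ 2 / (4 * (r + tau) ^ 2) - kH)) by (field; lra).
    apply Rmult_gt_0_compat; lra.
Qed.

(** Continues [bup] below the real axis, with the same value at s = 0. The term h'/x now damps and
    is bounded by 0; the derivative of [blow] in s is (33/50) / (c |x|^3), which is at least (33/50)
    / |x|^4. *)
Definition blow (c s : R) : R := 33 / 50 / c ^ 3 * (1 + s / rad c s).

Lemma rad_up_deriv c u : 0 < rad c u -> is_derive (fun s => rad c s) u (u / rad c u).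
Proof.
  intros H. assert (E := rad_sq c u). unfold rad in *.
  evar_last.
  - apply (is_derive_sqrt (fun s => c ^ 2 + s ^ 2) u (2 * u)).
    + auto_derive; [exact I|ring].
    + rewrite <- E. apply pow_lt, H.
  - field. lra.
Qed.

Lemma V_low (U : C -> Prop) (g g1 : C -> C) (c l : R) :
  SolH U g g1 -> 5 / 2 <= c -> l <= 29 / 10 ->
  (forall u, 0 <= u <= l -> U ((c, - u) : C)) ->
  Nsq g g1 ((c, 0) : C) < bup c 0 ^ 2 ->
  forall u, 0 <= u <= l -> Nsq g g1 ((c, - u) : C) < blow c u ^ 2.
Proof.
  intros S Hc Hl HU H0 u Hu. replace (- u) with (0 - u) by ring.
  assert (Hr : forall u, c <= rad c u).
  { intros v. assert (E := rad_sq c v). generalize (rad_ge0 c v). nra. }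
  apply (energy_down U g g1 c 0 l (fun u => blow c u)
    (fun u => 33 / 50 / (c * rad c u ^ 3))); auto.
  - intros v Hv. split; [replace (0 - v) with (- v) by ring; apply HU, Hv|]. nra.
  - intros v Hv. specialize (Hr v). split.
    + assert (Hr0 : 0 < rad c v) by lra. assert (HD := rad_up_deriv c v Hr0).
      unfold blow. set (R_ := fun s => rad c s) in *.
      apply is_derive_ext with (fun s => 33 / 50 / c ^ 3 * (1 + s / R_ s)); [reflexivity|].
      change (rad c v) with (R_ v) in *.
      assert (HE : ex_derive R_ v) by (eexists; exact HD).
      assert (E := rad_sq c v). change (rad c v) with (R_ v) in E.
      evar_last.
      * auto_derive.
        { repeat match goal with |- _ /\ _ => split | |- True => exact I | |- ex_derive _ _ => exact HE | |- _ <> 0 => lra end. }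
        reflexivity.
      * change (Derive (fun x : R => R_ x) v) with (Derive R_ v). rewrite (is_derive_unique R_ v _ HD).
        replace (33 / 50 / (c * R_ v ^ 3)) with (33 / 50 / c ^ 3 * ((R_ v ^ 2 - v ^ 2) / R_ v ^ 3)).
        -- field. lra.
        -- rewrite E. field. lra.
    + unfold blow. apply Rmult_lt_0_compat.
      * apply Rdiv_lt_0_compat; [lra|apply pow_lt; lra].
      * assert (0 <= v / rad c v) by (apply Rdiv_le_0_compat; lra). lra.
  - assert (Eb : bup c 0 = blow c 0).
    { unfold bup, blow. replace (rad c 0) with c; [field; lra|].
      assert (E := rad_sq c 0). generalize (rad_ge0 c 0) (Hr 0). nra. }
    rewrite <- Eb. exact H0.
  - intros v Hv. specialize (Hr v). assert (E := rad_sq c v).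
    replace ((0 - v) ^ 2) with (v ^ 2) by ring. rewrite <- E. unfold blow.
    assert (Hr3 : rad c v <= 77 / 50 * c) by nra.
    set (r := rad c v) in *. clearbody r.
    rewrite Rmax_left.
    2:{ apply Rle_div_l; [apply pow_lt; lra|]. lra. }
    set (w := v / r). assert (Ew : w * r = v) by (unfold w; field; lra).
    (* The difference of the two sides is (1 - 2w)^2 / 2. Only w^2 = 1 - 1/q^2 remains, with q = |x|
       / c, so the inequality becomes polynomial in q. *)
    assert (Hw : (1 + w) ^ 2 <= 3 / 2 + 3 * w ^ 2).
    { assert (0 <= (1 - 2 * w) ^ 2) by apply pow2_ge_0. nra. }
    apply Rle_lt_trans with ((33 / 50 / c ^ 3) ^ 2 * (3 / 2 + 3 * w ^ 2) / 4 + kH / (r ^ 2) ^ 2).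
    { rewrite Rmult_0_l, Rplus_0_l. apply Rplus_le_compat_r. unfold Rdiv. apply Rmult_le_compat_r; [lra|].
      rewrite Rpow_mult_distr. apply Rmult_le_compat_l; [apply pow2_ge_0|exact Hw]. }
    set (q := r / c). assert (Eq : q * c = r) by (unfold q; field; lra).
    (* The upper limit comes from depth at most 29/10 and c >= 5/2: the square root of 1 + (29/25)^2
       is below 1.54. *)
    assert (Hq : 1 <= q <= 77 / 50).
    { unfold q. split; [apply Rle_div_r; lra|apply Rle_div_l; lra]. }
    assert (Ew2 : w ^ 2 = (q ^ 2 - 1) / q ^ 2).
    { unfold w. replace ((v / r) ^ 2) with (v ^ 2 / r ^ 2) by (field; lra). 
      replace (v ^ 2) with (r ^ 2 - c ^ 2) by lra. rewrite <- Eq. field. nra. }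
    rewrite Ew2, <- Eq.
    apply Rminus_gt_0_lt.
    replace (33 / 50 / (c * (q * c) ^ 3) - ((33 / 50 / c ^ 3) ^ 2 * (3 / 2 + 3 * ((q ^ 2 - 1) / q ^ 2)) / 4 + kH / ((q * c) ^ 2) ^ 2))
      with (/ (c ^ 4 * q ^ 4) * (33 / 50 * q - kH - 1089 / 10000 * (9 / 2 * q ^ 4 - 3 * q ^ 2) / c ^ 2)).
    2:{ field. lra. }
    apply Rmult_gt_0_compat.
    { apply Rinv_0_lt_compat, Rmult_lt_0_compat; apply pow_lt; lra. }
    assert (Hm : 1089 / 10000 * (9 / 2 * q ^ 4 - 3 * q ^ 2) / c ^ 2 <= 1089 / 10000 * (9 / 2 * q ^ 4 - 3 * q ^ 2) / (25 / 4)).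
    { unfold Rdiv at 1 4. apply Rmult_le_compat_l.
      - assert (1 <= q ^ 2) by nra. replace (q ^ 4) with (q ^ 2 * q ^ 2) by ring. nra.
      - apply Rinv_le_contravar; nra. }
    assert (Hp : 0 < 33 / 50 * q - kH - 1089 / 10000 * (9 / 2 * q ^ 4 - 3 * q ^ 2) / (25 / 4)).
    { unfold kH. assert (h0 : 0 <= (q - 1) * (77 / 50 - q)) by nra.
      assert (h1 : q ^ 4 <= q ^ 2 * (127 / 50 * q - 77 / 50)) by nra.
      assert (h2 : q * q ^ 2 <= q * (127 / 50 * q - 77 / 50)) by nra.
      nra. }
    lra.
Qed.

(** Rational bound for numerical use: e^x is the n-th power of e^(x/n), and e^y <= 1/(1 - y) for 0
    <= y < 1. *)
Lemma exp_upper x n : 0 <= x < INR n -> exp x <= (/ (1 - x / INR n)) ^ n.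
Proof.
  intros Hx. assert (Hn : 0 < INR n) by lra.
  replace x with (INR n * (x / INR n)) at 1 by (field; lra).
  assert (E : forall m y, exp (INR m * y) = exp y ^ m).
  { induction m as [|m IH]; intros y; [simpl; rewrite Rmult_0_l; apply exp_0|].
    rewrite S_INR. simpl. rewrite <- IH, <- exp_plus. f_equal. ring. }
  rewrite E. apply pow_incr. split; [left; apply exp_pos|].
  assert (0 <= x / INR n < 1) by (split; [apply Rdiv_le_0_compat; lra|apply Rlt_div_l; lra]).
  set (y := x / INR n) in *. generalize (exp_ineq1_le (- y)). rewrite exp_Ropp. intros h.
  assert (Hp := exp_pos y). rewrite <- (Rinv_inv (exp y)). apply Rinv_le_contravar; lra.
Qed.

Lemma H_left (U : C -> Prop) (g g1 : C -> C) (c t l : R) :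
  SolH U g g1 -> t <= - (286 / 100) -> 0 <= l <= 257 / 100 ->
  (forall u, 0 <= u <= l -> U ((c - u, t) : C)) ->
  Nsq g g1 ((c, t) : C) < (18 / 100) ^ 2 ->
  forall u, 0 <= u <= l -> Nsq g g1 ((c - u, t) : C) < 100 ^ 2.
Proof.
  intros S Ht Hl HU H0 u Hu.
  (* The linear rate is 1 + 25/143 = 1.1748...; what 123/100 adds to it, times B >= 18/100, exceeds
     the forcing, which is below 94/10000. *)
  set (la := 123 / 100). set (p := / (4 * la)). set (xi := fun u => 18 / 100 * exp (la * u)).
  assert (Hxi : forall v, 0 <= v <= l -> 18 / 100 <= xi v /\ p * xi v <= 19 / 20).
  { intros v Hv. unfold xi, p, la. split.
    - assert (1 <= exp (123 / 100 * v)); [|lra]. generalize (exp_ineq1_le (123 / 100 * v)). lra.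
    - assert (exp (123 / 100 * v) <= exp (123 / 100 * (257 / 100))).
      { destruct (Req_dec v (257 / 100)) as [->|]; [lra|]. left. apply exp_increasing. lra. }
      (* With 64 factors the bound is below 25.9, which keeps p xi under 19/20; the true value is
         near 23.6. *)
      assert (exp (123 / 100 * (257 / 100)) <= (/ (1 - (123 / 100 * (257 / 100)) / INR 64)) ^ 64).
      { apply exp_upper. simpl. lra. }
      assert ((/ (1 - (123 / 100 * (257 / 100)) / INR 64)) ^ 64 <= 259 / 10).
      { replace (/ (1 - (123 / 100 * (257 / 100)) / INR 64)) with (/ (608389 / 640000)) by (simpl; field).
        rewrite pow_inv. rewrite <- (Rinv_inv (259 / 10)). apply Rinv_le_contravar; [lra|]. lra. }
      lra. }
  assert (HB : forall v, 0 <= v <= l -> 0 < 1 - p * xi v) by (intros v Hv; destruct (Hxi v Hv); lra).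
  assert (Hpp : 0 < p) by (unfold p, la; lra).
  assert (HN : Nsq g g1 ((c - u, t) : C) < (xi u / (1 - p * xi u)) ^ 2).
  { rewrite <- left_point.
    apply (energy_line U g g1 (c, t) (- (1))%C l (fun v => xi v / (1 - p * xi v))
      (fun v => la * xi v / (1 - p * xi v) ^ 2) (fun _ => 1 + 25 / 143)); auto.
    - rewrite Cmod_opp. apply Cmod_1.
    - intros v Hv. rewrite left_point. apply HU, Hv.
    - intros v Hv. specialize (HB v Hv). destruct (Hxi v Hv) as [hx _]. split.
      + assert (Hd : is_derive xi v (la * xi v)).
        { unfold xi. auto_derive; [exact I|]. ring. }
        assert (He : ex_derive xi v) by (eexists; exact Hd).
        evar_last.
        * auto_derive; [|reflexivity]. repeat split; auto. lra.
        * change (Derive (fun x : R => xi x) v) with (Derive xi v). rewrite (is_derive_unique xi v _ Hd). field. lra.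
      + apply Rdiv_lt_0_compat; lra.
    - eapply Rlt_le_trans; [exact H0|]. assert (h := HB 0 ltac:(lra)). destruct (Hxi 0 ltac:(lra)) as [hx hy].
      apply pow_incr. split; [lra|]. apply (proj1 (Rle_div_r (18 / 100) (xi 0) (1 - p * xi 0) h)). nra.
    - intros v Hv. rewrite left_point.
      assert (Hc2 : 0 <= (c - v) ^ 2) by apply pow2_ge_0. assert (Ht2 : (286 / 100) ^ 2 <= t ^ 2) by nra.
      assert (Hnz : ((c - v, t) : C) <> 0%C) by (apply pair_nz; lra).
      replace (Re (- (1))%C) with (-1) by (unfold Re; simpl; ring). replace (Rabs (-1)) with 1 by (rewrite Rabs_left; lra).
      replace (- (1))%C with (RtoC (-1)) by (apply injective_projections; simpl; ring).
      rewrite Re_horiz_div by exact Hnz. rewrite Cmod_pair4.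
      set (S2 := (c - v) ^ 2 + t ^ 2). assert (HS : (286 / 100) ^ 2 <= S2) by (unfold S2; lra).
      (* 25/143 = 1 / (2 * 2.86) is the largest value of |Re (1/x)| when |Im x| >= 2.86. *)
      assert (Hc : -1 * (c - v) / S2 >= - (25 / 143)).
      { apply Rle_ge. apply Rle_div_r; [lra|]. unfold S2.
        assert (0 <= ((c - v) + t) ^ 2) by apply pow2_ge_0. assert (0 <= ((c - v) - 286 / 100) ^ 2) by apply pow2_ge_0. nra. }
      split; [lra|]. split; [lra|].
      specialize (HB v Hv). destruct (Hxi v Hv) as [hx hy]. set (x := xi v) in *. set (B := x / (1 - p * x)).
      replace (la * x / (1 - p * x) ^ 2) with (la * B + B ^ 2 / 4).
      2:{ unfold B, p, la. field. unfold p, la in HB. lra. }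
      assert (HBx : 18 / 100 <= B).
      { unfold B. apply (proj1 (Rle_div_r (18 / 100) x (1 - p * x) HB)). nra. }
      assert (HkS : kH / S2 ^ 2 < 94 / 10000).
      { apply Rlt_div_l; [apply pow_lt; lra|]. unfold kH. nra. }
      unfold la. lra. }
  destruct (Hxi u Hu) as [h1 h2]. specialize (HB u Hu).
  assert (Ep : p = 25 / 123) by (unfold p, la; field). rewrite Ep in *.
  eapply Rlt_le_trans; [exact HN|]. apply pow_incr. split; [apply Rdiv_le_0_compat; lra|].
  apply (proj2 (Rle_div_l (xi u) 100 (1 - 25 / 123 * xi u) HB)). lra.
Qed.

(* Horizontal lines far up: the growth e^(3u) is harmless on a bounded range when the data are small. *)
Lemma H_far (U : C -> Prop) (g g1 : C -> C) (s t l eps : R) :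
  SolH U g g1 -> (s = 1 \/ s = -1) -> 2 <= t -> 0 <= l -> 0 < eps -> eps * exp (3 * l) <= 1 ->
  2 * kH / t ^ 4 <= eps ->
  (forall u, 0 <= u <= l -> U ((s * u, t) : C)) ->
  Nsq g g1 ((0, t) : C) < eps ^ 2 ->
  forall u, 0 <= u <= l -> Nsq g g1 ((s * u, t) : C) < (eps * exp (3 * u)) ^ 2.
Proof.
  intros S Hs Ht Hl He Hel Hk HU H0 u Hu.
  assert (Ep : forall v, ((0, t) + RtoC v * RtoC s)%C = ((s * v, t) : C)) by (intros v; apply injective_projections; simpl; ring).
  rewrite <- Ep.
  apply (energy_line U g g1 (0, t) (RtoC s) l (fun v => eps * exp (3 * v)) (fun v => 3 * (eps * exp (3 * v))) (fun _ => 2)); auto.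
  - rewrite Cmod_R. destruct Hs as [-> | ->]; [apply Rabs_R1|rewrite Rabs_left; lra].
  - intros v Hv. rewrite Ep. apply HU, Hv.
  - intros v Hv. split; [auto_derive; [exact I|ring]|]. apply Rmult_lt_0_compat; [exact He|apply exp_pos].
  - rewrite Rmult_0_r, exp_0, Rmult_1_r. exact H0.
  - intros v Hv. rewrite Ep. assert (Hnz : ((s * v, t) : C) <> 0%C) by (apply pair_nz; nra).
    replace (Re (RtoC s)) with s by reflexivity. rewrite Re_horiz_div by exact Hnz. rewrite Cmod_pair4.
    set (S2 := (s * v) ^ 2 + t ^ 2). assert (HS : t ^ 2 <= S2) by (unfold S2; nra).
    assert (Rs : Rabs s = 1) by (destruct Hs as [-> | ->]; [apply Rabs_R1|rewrite Rabs_left; lra]).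
    rewrite Rs. split; [lra|]. split.
    + assert (s * (s * v) / S2 >= -1); [|lra]. apply Rle_ge, Rle_div_r; [nra|].
      replace (s * (s * v)) with v by (destruct Hs as [-> | ->]; ring). nra.
    + assert (h1 : 1 <= exp (3 * v)) by (generalize (exp_ineq1_le (3 * v)); lra).
      assert (h2 : exp (3 * v) <= exp (3 * l)).
      { destruct (Req_dec v l) as [->|]; [lra|]. left. apply exp_increasing. lra. }
      assert (h3 : kH / S2 ^ 2 <= kH / t ^ 4).
      { unfold Rdiv. apply Rmult_le_compat_l; [unfold kH; lra|]. apply Rinv_le_contravar; [apply pow_lt; lra|].
        replace (t ^ 4) with ((t ^ 2) ^ 2) by ring. apply pow_incr. split; [apply pow2_ge_0|exact HS]. }
      set (B := eps * exp (3 * v)). assert (HB1 : B <= 1) by (unfold B; nra). assert (HB2 : eps <= B) by (unfold B; nra).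
      unfold Rdiv in Hk. unfold Rdiv in h3. nra.
Qed.

(** * The decaying manifold in the lower right region *)

(* On the stable manifold of the autonomous part, h' = -h sqrt(1+h/3): slaved vanishes there up to
   fourth order in h, and zeta linearizes the flow up to the same order. *)
Definition slaved (h h1 w : C) : C :=
  (h1 + h + RtoC (1 / 6) * (h * h) + RtoC (-1 / 72) * (h * h * h) + RtoC (1 / 2) * (h * w))%C.

Definition slaved_rate (h w : C) : C :=
  (1 + RtoC (-1 / 2) * w + RtoC (1 / 3) * h + RtoC (-1 / 24) * (h * h))%C.

Definition slaved_rem (h w : C) : C :=
  (RtoC (5 / 432) * (h * h * h * h) + RtoC (-1 / 1728) * (h * h * h * h * h)
   + RtoC (-1 / 12) * (h * h * w) + RtoC (1 / 72) * (h * h * h * w)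
   + RtoC (-1 / 4) * (h * w * w) + RtoC kH * (w * w * w * w))%C.

Definition zeta (h : C) : C := (h + RtoC (-1 / 6) * (h * h) + RtoC (5 / 144) * (h * h * h))%C.

Definition zeta_rem (h a w : C) : C :=
  (RtoC (1 / 12) * (h * h * w) + RtoC (-5 / 144) * (h * h * h * w)
   + a * (1 + RtoC (-1 / 3) * h + RtoC (5 / 48) * (h * h))
   + RtoC (-19 / 864) * (h * h * h * h) + RtoC (5 / 3456) * (h * h * h * h * h))%C.

(** The left side is the derivative of [slaved] with h'' and w' = -w^2 substituted. Give h weight 1
    and w = 1/x weight 2: all terms of weight below 4 go into the factor [slaved_rate], which is
    close to 1, so [slaved] is the growing direction to the right and is driven only by terms of
    weight at least 4. *)
Lemma slaved_identity (h h1 w : C) :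
  ((- w * h1 + h + RtoC (1 / 2) * (h * h) + RtoC kH * (w * w * w * w)) + h1
   + RtoC (1 / 6) * (h1 * h + h * h1) + RtoC (-1 / 72) * ((h1 * h + h * h1) * h + h * h * h1)
   + RtoC (1 / 2) * (h1 * w + h * (- (w * w))))%C
  = (slaved_rate h w * slaved h h1 w + slaved_rem h w)%C.
Proof.
  destruct h as [a b], h1 as [c d], w as [e f]. unfold slaved, slaved_rate, slaved_rem.
  apply injective_projections; simpl; field.
Qed.

(** Up to weight 4 and multiples of [slaved], zeta obeys zeta' = -(1 + 1/(2x)) zeta, the linear
    equation of x^(-1/2) e^(-x). *)
Lemma zeta_identity (h h1 w : C) :
  (h1 + RtoC (-1 / 6) * (h1 * h + h * h1) + RtoC (5 / 144) * ((h1 * h + h * h1) * h + h * h * h1))%C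
  = (- (1 + RtoC (1 / 2) * w) * zeta h + zeta_rem h (slaved h h1 w) w)%C.
Proof.
  destruct h as [a b], h1 as [c d], w as [e f]. unfold slaved, zeta, zeta_rem.
  apply injective_projections; simpl; field.
Qed.

Lemma slaved_deriv (U : C -> Prop) (g g1 : C -> C) (x : C) : SolH U g g1 -> U x ->
  cderiv (fun z => slaved (g z) (g1 z) (/ z)%C) x
    (slaved_rate (g x) (/ x) * slaved (g x) (g1 x) (/ x) + slaved_rem (g x) (/ x))%C.
Proof.
  intros S Hx. destruct (S x Hx) as [Hd [d0 d1]].
  assert (Hnz : x <> 0%C) by (apply Cmod_nz; lra).
  eapply cderiv_val.
  - unfold slaved. apply cderiv_plus; [apply cderiv_plus; [apply cderiv_plus; [apply cderiv_plus|]|]|].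
    + exact d1.
    + exact d0.
    + apply cderiv_scal, cderiv_mult; exact d0.
    + apply cderiv_scal, cderiv_mult; [apply cderiv_mult|]; exact d0.
    + apply cderiv_scal, cderiv_mult; [exact d0|apply cderiv_inv, Hnz].
  - rewrite <- slaved_identity.
    replace (- / (x * x))%C with (- (/ x * / x))%C by (field; exact Hnz).
    replace (RtoC kH / (x * x * (x * x)))%C with (RtoC kH * (/ x * / x * / x * / x))%C by (field; exact Hnz).
    replace (/ 2)%C with (RtoC (1 / 2)) by (rewrite <- RtoC_inv; f_equal; lra). ring.
Qed.

Lemma zeta_deriv (U : C -> Prop) (g g1 : C -> C) (x : C) : SolH U g g1 -> U x ->
  cderiv (fun z => zeta (g z)) x
    (- (1 + RtoC (1 / 2) * / x) * zeta (g x) + zeta_rem (g x) (slaved (g x) (g1 x) (/ x)) (/ x))%C.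
Proof.
  intros S Hx. destruct (S x Hx) as [Hd [d0 d1]].
  eapply cderiv_val.
  - unfold zeta. apply cderiv_plus; [apply cderiv_plus|].
    + exact d0.
    + apply cderiv_scal, cderiv_mult; exact d0.
    + apply cderiv_scal, cderiv_mult; [apply cderiv_mult|]; exact d0.
  - rewrite <- zeta_identity. reflexivity.
Qed.

Ltac ctri := repeat (eapply Rle_trans; [apply Cmod_triangle|]; apply Rplus_le_compat).
Ltac cmods := rewrite ?Cmod_mult, ?Cmod_R.

Lemma Rabs_cst (q r : R) : (0 <= q /\ r = q) \/ (q <= 0 /\ r = - q) -> Rabs q = r.
Proof. intros [[H ->]|[H ->]]; [apply Rabs_pos_eq|apply Rabs_left1]; exact H. Qed.

Ltac mono_mod := cmods; apply Rmult_le_compat; try apply Rabs_pos;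
  try (right; apply Rabs_cst; unfold kH; lra);
  repeat first [apply Rmult_le_compat | apply Rmult_le_pos | apply Cmod_ge_0 | assumption | lra].

Lemma slaved_rem_bound (h w : C) (y : R) : 0 <= y <= 1 -> Cmod h <= y / 4 -> Cmod w <= y ^ 2 ->
  Cmod (slaved_rem h w) <= 5254 / 1000000 * y ^ 4 + 62719 / 1000000 * y ^ 5 + kH * y ^ 8.
Proof.
  intros Hy Hh Hw. assert (h0 := Cmod_ge_0 h). assert (w0 := Cmod_ge_0 w).
  unfold slaved_rem.
  apply Rle_trans with (5 / 432 * (y / 4 * (y / 4) * (y / 4) * (y / 4)) + 1 / 1728 * (y / 4 * (y / 4) * (y / 4) * (y / 4) * (y / 4))
    + 1 / 12 * (y / 4 * (y / 4) * y ^ 2) + 1 / 72 * (y / 4 * (y / 4) * (y / 4) * y ^ 2)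
    + 1 / 4 * (y / 4 * y ^ 2 * y ^ 2) + kH * (y ^ 2 * y ^ 2 * y ^ 2 * y ^ 2)).
  - assert (y2 : 0 <= y ^ 2) by nra.
    ctri; mono_mod.
  - assert (0 <= y ^ 4) by (apply pow_le; lra). assert (y ^ 5 = y * y ^ 4) by ring.
    replace (y ^ 2 * y ^ 2 * y ^ 2 * y ^ 2) with (y ^ 8) by ring.
    replace (y / 4 * (y / 4) * (y / 4) * (y / 4)) with (y ^ 4 / 256) by field.
    replace (y / 4 * (y / 4) * (y / 4) * (y / 4) * (y / 4)) with (y ^ 5 / 1024) by field.
    replace (y / 4 * (y / 4) * y ^ 2) with (y ^ 4 / 16) by field.
    replace (y / 4 * (y / 4) * (y / 4) * y ^ 2) with (y ^ 5 / 64) by field.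
    replace (y / 4 * y ^ 2 * y ^ 2) with (y ^ 5 / 4) by field.
    assert (0 <= y ^ 5) by (apply pow_le; lra). lra.
Qed.

(** Coefficient by coefficient slightly more than the bound of [slaved_rem_bound] divided by 86/100,
    the guaranteed growth rate of [slaved] to the right. *)
Definition alph (y : R) : R := 62 / 10000 * y ^ 4 + 73 / 1000 * y ^ 5 + 73 / 100 * y ^ 8.

Lemma zeta_rem_bound (h a w : C) (y : R) : 0 <= y <= 5132 / 10000 -> Cmod h <= y / 4 -> Cmod w <= y ^ 2 ->
  Cmod a <= alph y ->
  Cmod (zeta_rem h a w) <= 1181 / 100000 * y ^ 4 + 7695 / 100000 * y ^ 5 + 7630 / 10000 * y ^ 8.
Proof.
  intros Hy Hh Hw Ha. assert (h0 := Cmod_ge_0 h). assert (w0 := Cmod_ge_0 w). assert (a0 := Cmod_ge_0 a).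
  unfold zeta_rem.
  assert (Hal : 0 <= alph y).
  { unfold alph. assert (0 <= y ^ 4) by (apply pow_le; lra). assert (0 <= y ^ 5) by (apply pow_le; lra). assert (0 <= y ^ 8) by (apply pow_le; lra). lra. }
  apply Rle_trans with (1 / 12 * (y / 4 * (y / 4) * y ^ 2) + 5 / 144 * (y / 4 * (y / 4) * (y / 4) * y ^ 2)
    + alph y * (1 + 1 / 3 * (y / 4) + 5 / 48 * (y / 4 * (y / 4)))
    + 19 / 864 * (y / 4 * (y / 4) * (y / 4) * (y / 4)) + 5 / 3456 * (y / 4 * (y / 4) * (y / 4) * (y / 4) * (y / 4))).
  - assert (y2 : 0 <= y ^ 2) by nra.
    assert (Hin : Cmod (a * (1 + RtoC (-1 / 3) * h + RtoC (5 / 48) * (h * h)))%C <= alph y * (1 + 1 / 3 * (y / 4) + 5 / 48 * (y / 4 * (y / 4)))).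
    { rewrite Cmod_mult. apply Rmult_le_compat; [exact a0|apply Cmod_ge_0|exact Ha|].
      ctri; [rewrite Cmod_1; lra| |]; mono_mod. }
    set (mid := (a * (1 + RtoC (-1 / 3) * h + RtoC (5 / 48) * (h * h)))%C) in *. clearbody mid.
    ctri; [| |exact Hin| |]; mono_mod.
  - assert (Hm : 1 + 1 / 3 * (y / 4) + 5 / 48 * (y / 4 * (y / 4)) <= 10445 / 10000) by nra.
    assert (H4 : 0 <= y ^ 4) by (apply pow_le; lra). assert (H5 : 0 <= y ^ 5) by (apply pow_le; lra).
    assert (H8 : 0 <= y ^ 8) by (apply pow_le; lra).
    replace (y / 4 * (y / 4) * (y / 4) * (y / 4) * (y / 4)) with (y ^ 5 / 1024) by field.
    replace (y / 4 * (y / 4) * (y / 4) * (y / 4)) with (y ^ 4 / 256) by field.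
    replace (y / 4 * (y / 4) * (y / 4) * y ^ 2) with (y ^ 5 / 64) by field.
    replace (y / 4 * (y / 4) * y ^ 2) with (y ^ 4 / 16) by field.
    assert (alph y * (1 + 1 / 3 * (y / 4) + 5 / 48 * (y / 4 * (y / 4))) <= alph y * (10445 / 10000)) by (apply Rmult_le_compat_l; assumption).
    unfold alph in *. lra.
Qed.

Lemma sqrt_Cmod_lb (x : C) : 5 / 2 <= Re x -> Im x <= - (286 / 100) -> 1949 / 1000 <= sqrt (Cmod x).
Proof.
  intros Hr Hi. assert (E := Cmod_sqr x). assert (C0 := Cmod_ge_0 x).
  assert (H : (1949 / 1000) ^ 2 <= Cmod x) by nra.
  rewrite <- (sqrt_pow2 (1949 / 1000)) by lra. apply sqrt_le_1_alt. exact H.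
Qed.

(* The weight 1/sqrt|x|, in which all remainders are polynomial. *)
Definition wt (x : C) : R := / sqrt (Cmod x).

Lemma wt_bounds (x : C) : 5 / 2 <= Re x -> Im x <= - (286 / 100) ->
  0 < wt x <= 5132 / 10000 /\ Cmod (/ x)%C = wt x ^ 2 /\ Cmod x * wt x ^ 2 = 1 /\ x <> 0%C.
Proof.
  intros Hr Hi. assert (H := sqrt_Cmod_lb x Hr Hi). unfold wt.
  assert (C0 := Cmod_ge_0 x).
  assert (E : sqrt (Cmod x) ^ 2 = Cmod x) by (apply pow2_sqrt, C0).
  assert (Hnz : x <> 0%C) by (apply Cmod_nz; nra).
  split.
  - split; [apply Rinv_0_lt_compat; lra|].
    replace (5132 / 10000) with (/ (10000 / 5132)) by field. apply Rinv_le_contravar; lra.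
  - split; [rewrite Cmod_inv by exact Hnz; rewrite pow_inv, E; reflexivity|].
    split; [|exact Hnz]. rewrite pow_inv, E. apply Rinv_r. nra.
Qed.

(** If |slaved| exceeded [alph] somewhere, the growth rate 86/100 would beat the remainder, and
    |slaved|^2 would increase at least linearly along the half-line to the right, against the bounds
    on h and h' there. Boundedness on the whole half-line thus selects the decaying manifold. *)
Lemma slaved_small (U : C -> Prop) (g g1 : C -> C) (c t : R) : SolH U g g1 -> 5 / 2 <= c -> t <= - (286 / 100) ->
  (forall u, 0 <= u -> U ((c + u, t) : C) /\ Cmod (g ((c + u, t) : C)) <= wt (c + u, t) / 4 /\ Cmod (g1 ((c + u, t) : C)) <= 1) ->
  Cmod (slaved (g (c, t)) (g1 (c, t)) (/ ((c, t) : C))%C) <= alph (wt (c, t)).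
Proof.
  intros S Hc Ht HU. apply Rnot_lt_le. intros Hbig.
  set (y0 := wt (c, t)) in *. destruct (wt_bounds (c, t) Hc Ht) as [Hy0 _]. fold y0 in Hy0.
  set (rb := 5254 / 1000000 * y0 ^ 4 + 62719 / 1000000 * y0 ^ 5 + kH * y0 ^ 8).
  assert (H4 : 0 < y0 ^ 4) by (apply pow_lt; lra). assert (H5 : 0 < y0 ^ 5) by (apply pow_lt; lra). assert (H8 : 0 < y0 ^ 8) by (apply pow_lt; lra).
  assert (Hrb : rb < 86 / 100 * alph y0) by (unfold rb, alph, kH; lra).
  assert (Hrb0 : 0 < rb) by (unfold rb, kH; lra).
  set (al := alph y0) in *. set (ka := al * (86 / 100 * al - rb)).
  assert (Hka : 0 < ka) by (unfold ka; apply Rmult_lt_0_compat; lra).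
  set (a := fun x : C => slaved (g x) (g1 x) (/ x)%C).
  set (ln := fun u : R => ((c, t) + RtoC u * 1)%C : C).
  assert (Eln : forall u, ln u = ((c + u, t) : C)) by (intros u; apply right_point).
  (* At distance L the square has gained 10, more than the 3^2 that the bounds on h, h' and 1/x
     permit. *)
  set (L := 10 / ka). assert (HL : 0 < L) by (apply Rdiv_lt_0_compat; lra).
  assert (Hw : forall u, 0 <= u -> 0 < wt (c + u, t) <= y0).
  { intros u Hu. destruct (wt_bounds (c + u, t)) as [[h _] _]; [simpl; lra|exact Ht|]. split; [exact h|].
    unfold y0, wt. apply Rinv_le_contravar.
    - generalize (sqrt_Cmod_lb (c, t) Hc Ht). lra.
    - apply sqrt_le_1_alt. unfold Cmod. apply sqrt_le_1_alt. simpl. nra. }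
  assert (Hbar : forall u, 0 <= u <= L -> 0 < Cmod (a (ln u)) ^ 2 - (al ^ 2 + ka * u)).
  { apply (barrier _ (fun u => 2 * Cdot (a (ln u)) ((slaved_rate (g (ln u)) (/ ln u) * a (ln u) + slaved_rem (g (ln u)) (/ ln u)) * 1)%C - ka)).
    - intros u Hu. destruct (HU u ltac:(lra)) as [hU _]. rewrite <- Eln in hU.
      apply (is_derive_minus (fun u => Cmod (a (ln u)) ^ 2) (fun u => al ^ 2 + ka * u)).
      + apply (pder_sq (fun u => a (ln u))). apply (pder_comp a ln).
        * exact (slaved_deriv U g g1 (ln u) S hU).
        * apply pder_line.
      + auto_derive; [exact I|ring].
    - rewrite Eln, Rplus_0_r. fold (a (c, t)) in Hbig. change (al < Cmod (a (c, t))) in Hbig. nra.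
    - intros u Hu Hz _. destruct (HU u ltac:(lra)) as [_ [hg _]]. 
      destruct (Hw u ltac:(lra)) as [w0 w1]. destruct (wt_bounds (c + u, t)) as [[_ w2] [Ew [_ Hnz]]]; [simpl; lra|exact Ht|].
      rewrite Eln in *. set (x := ((c + u, t) : C)) in *. set (y := wt x) in *.
      assert (Hrem := slaved_rem_bound (g x) (/ x)%C y ltac:(lra) hg ltac:(lra)).
      assert (Hremb : Cmod (slaved_rem (g x) (/ x)) <= rb).
      { eapply Rle_trans; [exact Hrem|]. unfold rb, kH.
        assert (y ^ 4 <= y0 ^ 4) by (apply pow_incr; lra). assert (y ^ 5 <= y0 ^ 5) by (apply pow_incr; lra).
        assert (y ^ 8 <= y0 ^ 8) by (apply pow_incr; lra). lra. }
      rewrite Cmult_1_r, Cdot_plus_r, Cdot_self_mult.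
      (* The losses are at most (1/2)(25/143) from 1/x, as Im x <= -2.86, and 0.1283/3 plus a
         second-order term from h, as |h| <= 0.5132/4. *)
      assert (Hm : 86 / 100 <= Re (slaved_rate (g x) (/ x))).
      { unfold slaved_rate.
        assert (e1 : Re (1 + RtoC (-1 / 2) * / x + RtoC (1 / 3) * g x + RtoC (-1 / 24) * (g x * g x))%C
          = 1 - / 2 * Re (/ x)%C + / 3 * Re (g x) - / 24 * Re (g x * g x)%C) by (unfold Re; simpl; field_simplify; try reflexivity; try (unfold x; simpl; nra)).
        rewrite e1.
        assert (e2 : Re (/ x)%C <= 25 / 143).
        { assert (t2 : (286 / 100) ^ 2 <= t ^ 2) by nra.
          replace (/ x)%C with (RtoC 1 / x)%C by (unfold Cdiv; ring).
          unfold x. rewrite Re_horiz_div by exact Hnz.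
          assert (0 <= ((c + u) - 286 / 100) ^ 2) by apply pow2_ge_0. assert (0 <= (c + u) ^ 2) by apply pow2_ge_0.
          apply Rle_div_l; [lra|]. nra. }
        assert (e3 := Re_abs_le (g x)). assert (e4 := Re_abs_le (g x * g x)%C). rewrite Cmod_mult in e4.
        apply Rabs_le_between in e3. apply Rabs_le_between in e4. assert (e5 := Cmod_ge_0 (g x)).
        assert (e6 : Cmod (g x) <= 1283 / 10000) by lra. nra. }
      assert (Hd : - (Cmod (a x) * rb) <= Cdot (a x) (slaved_rem (g x) (/ x))).
      { assert (q := Cdot_le (- a x)%C (slaved_rem (g x) (/ x))). rewrite Cmod_opp in q.
        replace (Cdot (- a x)%C (slaved_rem (g x) (/ x))) with (- Cdot (a x) (slaved_rem (g x) (/ x))) in q by (unfold Cdot, Re, Im; simpl; ring).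
        assert (Cmod (a x) * Cmod (slaved_rem (g x) (/ x)) <= Cmod (a x) * rb) by (apply Rmult_le_compat_l; [apply Cmod_ge_0|exact Hremb]). lra. }
      assert (Ha0 := Cmod_ge_0 (a x)). set (m := Cmod (a x)) in *.
      assert (Hal : 0 < al) by lra.
      assert (Hma : al <= m).
      { assert (al ^ 2 <= m ^ 2) by (assert (0 <= ka * u) by (apply Rmult_le_pos; lra); lra). nra. }
      unfold ka. assert (86 / 100 * m ^ 2 <= Re (slaved_rate (g x) (/ x)) * m ^ 2) by (apply Rmult_le_compat_r; [nra|exact Hm]).
      assert (al * (86 / 100 * al - rb) <= m * (86 / 100 * m - rb)) by (apply Rmult_le_compat; lra).
      assert (0 < al * (86 / 100 * al - rb)) by exact Hka. nra. }
  specialize (Hbar L ltac:(lra)). rewrite Eln in Hbar.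
  destruct (HU L ltac:(lra)) as [_ [hg hg1]]. destruct (Hw L ltac:(lra)) as [w0 w1].
  destruct (wt_bounds (c + L, t)) as [[_ w2] [Ew [_ Hnz]]]; [simpl; lra|exact Ht|].
  set (x := ((c + L, t) : C)) in *. set (y := wt x) in *.
  assert (Cmod (a x) <= 3).
  { unfold a, slaved. assert (q0 := Cmod_ge_0 (g x)). assert (q1 : Cmod (g x) <= 1) by lra.
    assert (q2 : Cmod (/ x)%C <= 1) by nra. assert (q3 := Cmod_ge_0 (/ x)%C).
    apply Rle_trans with (1 + 1 + 1 / 6 * (1 * 1) + 1 / 72 * (1 * 1 * 1) + 1 / 2 * (1 * 1)); [|lra].
    ctri; [exact hg1|exact q1| | |]; mono_mod. }
  assert (ka * L = 10) by (unfold L; field; lra). assert (q := Cmod_ge_0 (a x)). nra.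
Qed.

Lemma Cmod_pair (c t : R) : Cmod ((c, t) : C) = rad c t.
Proof. reflexivity. Qed.

(** Barrier for |x|^(1/2) |zeta|, in the variable s = Re x - Im x. Its derivative consists of the
    powers s^(-3/2), s^(-2), s^(-7/2) that come from the three terms of [zeta_rem_bound], with |x|
    >= s / sqrt 2; the factor 118922/100000 is the fourth root of 2. The limit 2095/10000 leaves
    room below 1/4. *)
Definition zbar (s : R) : R :=
  let p := / sqrt s in 2095 / 10000 - 400 / 10000 * p - 1540 / 10000 * p ^ 2 - 10270 / 10000 * p ^ 5.

Lemma zbar_deriv s : 0 < s ->
  is_derive zbar s (/ sqrt s ^ 3 * (200 / 10000 + 1540 / 10000 * / sqrt s + 25675 / 10000 * / sqrt s ^ 4)).
Proof.
  intros Hs. assert (Hq : 0 < sqrt s) by (apply sqrt_lt_R0, Hs).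
  unfold zbar. cbv zeta.
  assert (HD : is_derive sqrt s (/ (2 * sqrt s))).
  { evar_last; [apply (is_derive_sqrt (fun s => s) s 1); [apply (is_derive_id (K := R_AbsRing))|exact Hs]|]. field. lra. }
  assert (HE : ex_derive sqrt s) by (eexists; exact HD).
  set (q := sqrt) in *. clearbody q.
  evar_last.
  - auto_derive; [|reflexivity].
    repeat match goal with |- _ /\ _ => split | |- True => exact I | |- ex_derive _ _ => exact HE | |- _ <> 0 => lra end.
  - change (Derive (fun x : R => q x) s) with (Derive q s). rewrite (is_derive_unique q s _ HD).
    field. lra.
Qed.

Lemma zeta_step (r y p z B : R) : 0 <= y -> 0 <= p -> y <= 118922 / 100000 * p ->
  B <= 1181 / 100000 * y ^ 4 + 7695 / 100000 * y ^ 5 + 7630 / 10000 * y ^ 8 -> 0 < p ->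
  B < y * (p ^ 3 * (200 / 10000 + 1540 / 10000 * p + 25675 / 10000 * p ^ 4)) \/ y = 0.
Proof.
  intros Hy Hp Hyp HB Hp0. destruct (Req_dec y 0) as [->|Hy0]; [right; reflexivity|left].
  assert (E : 1181 / 100000 * y ^ 4 + 7695 / 100000 * y ^ 5 + 7630 / 10000 * y ^ 8 = y * (1181 / 100000 * y ^ 3 + 7695 / 100000 * y ^ 4 + 7630 / 10000 * y ^ 7)) by ring.
  eapply Rle_lt_trans; [exact HB|]. rewrite E. apply Rmult_lt_compat_l; [lra|].
  assert (h3 : y ^ 3 <= (118922 / 100000 * p) ^ 3) by (apply pow_incr; lra).
  assert (h4 : y ^ 4 <= (118922 / 100000 * p) ^ 4) by (apply pow_incr; lra).
  assert (h7 : y ^ 7 <= (118922 / 100000 * p) ^ 7) by (apply pow_incr; lra).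
  rewrite Rpow_mult_distr in h3, h4, h7.
  assert (0 < p ^ 3) by (apply pow_lt; lra). assert (0 < p ^ 4) by (apply pow_lt; lra). assert (0 < p ^ 7) by (apply pow_lt; lra).
  replace (p ^ 3 * (200 / 10000 + 1540 / 10000 * p + 25675 / 10000 * p ^ 4)) with (200 / 10000 * p ^ 3 + 1540 / 10000 * p ^ 4 + 25675 / 10000 * p ^ 7) by ring.
  lra.
Qed.

(** zeta is a near-identity change of unknown; both directions are needed, at the start of the
    descent and at its end. *)
Lemma zeta_le (h : C) (q : R) : Cmod h <= q -> Cmod (zeta h) <= q * (1 + q / 6 + 5 / 144 * q ^ 2) /\
  Cmod h <= Cmod (zeta h) + Cmod h * (q / 6 + 5 / 144 * q ^ 2).
Proof.
  intros Hq. assert (h0 := Cmod_ge_0 h).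
  assert (B : Cmod (RtoC (-1 / 6) * (h * h) + RtoC (5 / 144) * (h * h * h))%C <= Cmod h * (q / 6 + 5 / 144 * q ^ 2)).
  { eapply Rle_trans; [apply Cmod_triangle|]. cmods. rewrite (Rabs_cst (-1 / 6) (1 / 6)), (Rabs_cst (5 / 144) (5 / 144)) by lra.
    assert (Cmod h * Cmod h <= Cmod h * q) by nra. assert (Cmod h * Cmod h * Cmod h <= Cmod h * q * q) by nra. nra. }
  split.
  - unfold zeta. rewrite <- Cplus_assoc. eapply Rle_trans; [apply Cmod_triangle|]. 
    assert (Cmod h * (q / 6 + 5 / 144 * q ^ 2) <= q * (q / 6 + 5 / 144 * q ^ 2)) by (apply Rmult_le_compat_r; nra). lra.
  - assert (E : h = (zeta h - (RtoC (-1 / 6) * (h * h) + RtoC (5 / 144) * (h * h * h)))%C) by (unfold zeta; ring).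
    apply Rle_trans with (Cmod (zeta h) + Cmod (RtoC (-1 / 6) * (h * h) + RtoC (5 / 144) * (h * h * h))%C); [|lra].
    rewrite E at 1. apply Cmod_tri_minus.
Qed.

(** (c - t)^2 <= 2 (c^2 + t^2); the denominator is sqrt 2 rounded up. *)
Lemma rad_half c t : 0 < c - t -> (c - t) / (141422 / 100000) <= rad c t.
Proof.
  intros H. assert (E := rad_sq c t). assert (R0 := rad_ge0 c t). assert (0 <= (c + t) ^ 2) by apply pow2_ge_0.
  apply Rle_div_l; [lra|]. nra.
Qed.

(** The bootstrap step: from |h| <= wt/4 on a quadrant strip, [slaved] is small by the half-lines to
    the right, so zeta obeys its linear equation up to a small remainder. Down a vertical line |x|
    |zeta|^2 then changes only through that remainder, which [zbar] sums up, and the result 215/1000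
    is better than the assumed 1/4. *)
Lemma V3_improve (U : C -> Prop) (g g1 : C -> C) (c l : R) : SolH U g g1 -> 5 / 2 <= c -> 0 <= l ->
  (forall v u, 0 <= v -> 0 <= u <= l -> U ((c + v, - (286 / 100) - u) : C)
    /\ Cmod (g ((c + v, - (286 / 100) - u) : C)) <= wt (c + v, - (286 / 100) - u) / 4
    /\ Cmod (g1 ((c + v, - (286 / 100) - u) : C)) <= 1) ->
  Cmod (g ((c, - (286 / 100)) : C)) <= 1457 / 10000 * wt (c, - (286 / 100)) ->
  Cmod (g ((c, - (286 / 100) - l) : C)) <= 215 / 1000 * wt (c, - (286 / 100) - l)
  /\ Cmod (g1 ((c, - (286 / 100) - l) : C)) <= 262 / 1000 * wt (c, - (286 / 100) - l).
Proof.
  intros S Hc Hl HU Hst. set (t := - (286 / 100)) in *.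
  assert (Hsl : forall u, 0 <= u <= l -> Cmod (slaved (g (c, t - u)) (g1 (c, t - u)) (/ ((c, (t - u)%R) : C))%C) <= alph (wt (c, t - u))).
  { intros u Hu. apply (slaved_small U g g1 c (t - u) S Hc); [unfold t; lra|]. intros v Hv. apply HU; assumption. }
  assert (HU0 : forall u, 0 <= u <= l -> U ((c, t - u) : C) /\ Cmod (g ((c, t - u) : C)) <= wt (c, t - u) / 4 /\ Cmod (g1 ((c, t - u) : C)) <= 1).
  { intros u Hu. generalize (HU 0 u ltac:(lra) Hu). rewrite Rplus_0_r. auto. }
  set (ln := fun u : R => ((c, t) + RtoC u * (- Ci))%C : C).
  assert (Eln : forall u, ln u = ((c, t - u) : C)) by (intros u; apply down_point).
  assert (Hwt : forall u, 0 <= u -> 0 < wt (c, t - u) <= 5132 / 10000 /\ Cmod (/ ((c, (t - u)%R) : C))%C = wt (c, t - u) ^ 2 /\ Cmod ((c, t - u) : C) * wt (c, t - u) ^ 2 = 1 /\ ((c, t - u) : C) <> 0%C).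
  { intros u Hu. apply wt_bounds; [exact Hc|unfold t; simpl; lra]. }
  assert (Hwp : forall u, 0 <= u -> wt (c, t - u) <= 118922 / 100000 * / sqrt (c + 286 / 100 + u)).
  { intros u Hu. assert (Hp : 0 < sqrt (c + 286 / 100 + u)) by (apply sqrt_lt_R0; lra).
    unfold wt. rewrite Cmod_pair. assert (h := rad_half c (t - u) ltac:(unfold t; lra)).
    replace (c - (t - u)) with (c + 286 / 100 + u) in h by (unfold t; ring).
    set (s := c + 286 / 100 + u) in *.
    assert (h2 : sqrt s / (118922 / 100000) <= sqrt (rad c (t - u))).
    { assert (Hs : 0 <= sqrt s / (118922 / 100000)) by (apply Rdiv_le_0_compat; lra).
      rewrite <- (sqrt_pow2 (sqrt s / (118922 / 100000)) Hs). apply sqrt_le_1_alt.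
      replace ((sqrt s / (118922 / 100000)) ^ 2) with (sqrt s ^ 2 / (118922 / 100000) ^ 2) by field.
      rewrite pow2_sqrt by (unfold s; lra). unfold s in *. lra. }
    apply Rle_trans with (/ (sqrt s / (118922 / 100000))).
    - apply Rinv_le_contravar; [apply Rdiv_lt_0_compat; lra|exact h2].
    - right. field. lra. }
  assert (Hz : forall s, c + 286 / 100 <= s -> 1478 / 10000 < zbar s < 2095 / 10000).
  { intros s Hs. assert (h : 23151 / 10000 <= sqrt s).
    { rewrite <- (sqrt_pow2 (23151 / 10000)) by lra. apply sqrt_le_1_alt. lra. }
    unfold zbar. cbv zeta. assert (Hp : 0 < / sqrt s) by (apply Rinv_0_lt_compat; lra).
    assert (Hp2 : / sqrt s <= 43195 / 100000).
    { replace (43195 / 100000) with (/ (100000 / 43195)) by field. apply Rinv_le_contravar; lra. }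
    set (p := / sqrt s) in *. clearbody p.
    assert (p ^ 2 <= (43195 / 100000) ^ 2) by (apply pow_incr; lra). assert (p ^ 5 <= (43195 / 100000) ^ 5) by (apply pow_incr; lra).
    assert (0 < p ^ 2) by (apply pow_lt; lra). assert (0 < p ^ 5) by (apply pow_lt; lra). lra. }
  assert (Hbar : forall u, 0 <= u <= l -> 0 < zbar (c + 286 / 100 + u) ^ 2 - rad c (t - u) * Cmod (zeta (g (ln u))) ^ 2).
  { set (zr := fun u => zeta_rem (g (ln u)) (slaved (g (ln u)) (g1 (ln u)) (/ ln u)) (/ ln u)).
    set (zd := fun u => (- (1 + RtoC (1 / 2) * / ln u) * zeta (g (ln u)) + zr u)%C).
    set (sd := fun s => / sqrt s ^ 3 * (200 / 10000 + 1540 / 10000 * / sqrt s + 25675 / 10000 * / sqrt s ^ 4)).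
    apply (barrier _ (fun u => 2 * zbar (c + 286 / 100 + u) * sd (c + 286 / 100 + u)
      - (- (t - u) / rad c (t - u) * Cmod (zeta (g (ln u))) ^ 2 + rad c (t - u) * (2 * Cdot (zeta (g (ln u))) (zd u * (- Ci))%C)))).
    - intros u Hu. destruct (HU0 u Hu) as [hU _]. rewrite <- Eln in hU.
      assert (Hr : 0 < rad c (t - u)).
      { rewrite <- Cmod_pair. destruct (Hwt u ltac:(lra)) as [_ [_ [_ hnz]]]. apply Cmod_pos, hnz. }
      apply (is_derive_minus (fun u => zbar (c + 286 / 100 + u) ^ 2)).
      + assert (HD : is_derive (fun u => zbar (c + 286 / 100 + u)) u (sd (c + 286 / 100 + u))).
        { evar_last.
          - apply (is_derive_comp zbar (fun u => c + 286 / 100 + u)); [apply zbar_deriv; lra|auto_derive; [exact I|reflexivity]].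
          - change (1 * sd (c + 286 / 100 + u) = sd (c + 286 / 100 + u))%R. ring. }
        evar_last; [apply (is_derive_pow _ 2 u _ HD)|]. simpl. ring.
      + assert (HZ : is_derive (fun u => Cmod (zeta (g (ln u))) ^ 2) u (2 * Cdot (zeta (g (ln u))) (zd u * (- Ci))%C)).
        { apply (pder_sq (fun u => zeta (g (ln u)))). apply (pder_comp (fun x => zeta (g x)) ln).
          - exact (zeta_deriv U g g1 (ln u) S hU).
          - apply pder_line. }
        evar_last; [apply (is_derive_mult (fun u => rad c (t - u)) (fun u => Cmod (zeta (g (ln u))) ^ 2) u _ _ (rad_down_deriv c t u Hr) HZ)|].
        * intros; apply Rmult_comm.
        * unfold plus, mult; simpl. ring.
    - rewrite Eln, Rplus_0_r, Rminus_0_r. destruct (HU0 0 ltac:(lra)) as [_ [hg _]]. destruct (Hwt 0 ltac:(lra)) as [w0 [_ [w2 _]]].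
      rewrite Rminus_0_r in *. rewrite Cmod_pair in w2. set (y := wt (c, t)) in *.
      destruct (Hz (c + 286 / 100) ltac:(lra)) as [z1 _].
      destruct (zeta_le (g (c, t)) _ Hst) as [b1 _]. set (m := Cmod (zeta (g (c, t)))) in *.
      assert (b2 : m <= 1478 / 10000 * y) by (assert (q2 : 1457 / 10000 * y <= 748 / 10000) by lra; set (qq := 1457 / 10000 * y) in *; assert (qq * (1 + qq / 6 + 5 / 144 * qq ^ 2) <= qq * (1 + (748 / 10000) / 6 + 5 / 144 * (748 / 10000) ^ 2)) by (apply Rmult_le_compat_l; [unfold qq; lra|]; assert (0 <= qq) by (unfold qq; lra); nra); unfold qq in *; lra). assert (m0 : 0 <= m) by apply Cmod_ge_0.
      assert (Hr : 0 <= rad c t) by apply rad_ge0.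
      assert (rad c t * m ^ 2 <= (1478 / 10000) ^ 2).
      { apply Rle_trans with (rad c t * (1478 / 10000 * y) ^ 2); [apply Rmult_le_compat_l; [exact Hr|apply pow_incr; lra]|].
        replace (rad c t * (1478 / 10000 * y) ^ 2) with ((1478 / 10000) ^ 2 * (rad c t * y ^ 2)) by ring. rewrite w2. lra. }
      nra.
    - intros u Hu Hzero _. destruct (HU0 u Hu) as [_ [hg _]]. specialize (Hsl u Hu).
      destruct (Hwt u ltac:(lra)) as [w0 [w1 [w2 w3]]]. specialize (Hwp u ltac:(lra)). destruct (Hz (c + 286 / 100 + u) ltac:(lra)) as [z1 z2].
      assert (Ez : zd u = (- (1 + RtoC (1 / 2) * / ln u) * zeta (g (ln u)) + zr u)%C) by reflexivity.
      rewrite Ez. clear Ez.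
      (* The real part Im x / (2 |x|^2) of the downward rate cancels the derivative of the factor
         |x|, so only the remainder [zr] is left. *)
      replace ((- (1 + RtoC (1 / 2) * / ln u) * zeta (g (ln u)) + zr u) * - Ci)%C
        with ((Ci * (1 + RtoC (1 / 2) * / ln u)) * zeta (g (ln u)) + (- Ci) * zr u)%C by ring.
      rewrite Cdot_plus_r, Cdot_self_mult.
      assert (Hzr := zeta_rem_bound (g (c, t - u)) _ (/ ((c, (t - u)%R) : C))%C (wt (c, t - u)) ltac:(lra) hg ltac:(lra) Hsl).
      assert (Hzr' : Cmod (zr u) <= 1181 / 100000 * wt (c, t - u) ^ 4 + 7695 / 100000 * wt (c, t - u) ^ 5 + 7630 / 10000 * wt (c, t - u) ^ 8).
      { unfold zr. rewrite Eln. exact Hzr. }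
      rewrite Cmod_pair in w2.
      assert (Hr : 0 < rad c (t - u)) by (rewrite <- Cmod_pair; apply Cmod_pos, w3).
      assert (Hp : 0 < / sqrt (c + 286 / 100 + u)) by (apply Rinv_0_lt_compat, sqrt_lt_R0; lra).
      destruct (zeta_step 0 (wt (c, t - u)) (/ sqrt (c + 286 / 100 + u)) 0 (Cmod (zr u)) ltac:(lra) ltac:(lra) Hwp Hzr' Hp) as [Hst2|]; [|lra].
      assert (Hsd : Cmod (zr u) < wt (c, t - u) * sd (c + 286 / 100 + u)).
      { unfold sd. rewrite <- !pow_inv. exact Hst2. }
      assert (Hre : Re (Ci * (1 + RtoC (1 / 2) * / ln u))%C = (t - u) / (2 * rad c (t - u) ^ 2)).
      { rewrite Eln, rad_sq. assert (0 < c ^ 2 + (t - u) ^ 2) by (rewrite <- rad_sq; apply pow_lt, Hr).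
        unfold Re, Ci, Cinv; simpl. field. simpl in H. lra. }
      rewrite Hre.
      assert (Hd := Cdot_le (zeta (g (ln u))) (- Ci * zr u)). rewrite (Cmod_mult (- Ci)), Cmod_mCi, Rmult_1_l in Hd.
      set (m := Cmod (zeta (g (ln u)))) in *. assert (m0 : 0 <= m) by apply Cmod_ge_0.
      set (y := wt (c, t - u)) in *. set (r := rad c (t - u)) in *. set (z := zbar (c + 286 / 100 + u)) in *.
      set (sg := sd (c + 286 / 100 + u)) in *.
      assert (Em : m = z * y).
      { assert ((m - z * y) * (m + z * y) = 0).
        { replace ((m - z * y) * (m + z * y)) with (m ^ 2 - z ^ 2 * y ^ 2) by ring.
          replace (z ^ 2) with (r * m ^ 2) by lra. replace (r * m ^ 2 * y ^ 2) with (m ^ 2 * (r * y ^ 2)) by ring. rewrite w2. ring. }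
        assert (0 < z * y) by (apply Rmult_lt_0_compat; lra). nra. }
      replace (- (t - u) / r * m ^ 2 + r * (2 * ((t - u) / (2 * r ^ 2) * m ^ 2 + Cdot (zeta (g (ln u))) (- Ci * zr u)%C)))
        with (2 * r * Cdot (zeta (g (ln u))) (- Ci * zr u)%C) by (field; lra).
      set (dd := Cdot (zeta (g (ln u))) (- Ci * zr u)%C) in *.
      assert (r * dd < z * sg); [|nra].
      assert (zp : 0 < z * y * r) by (repeat apply Rmult_lt_0_compat; lra).
      apply Rle_lt_trans with (z * y * r * Cmod (zr u)).
      + replace (z * y * r * Cmod (zr u)) with (r * (m * Cmod (zr u))) by (rewrite Em; ring). apply Rmult_le_compat_l; lra.
      + apply Rlt_le_trans with (z * y * r * (y * sg)); [apply Rmult_lt_compat_l; assumption|].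
        replace (z * y * r * (y * sg)) with (z * sg * (r * y ^ 2)) by ring. rewrite w2. lra. }
  specialize (Hbar l ltac:(lra)). rewrite Eln in Hbar. destruct (HU0 l ltac:(lra)) as [_ [hg hg1]].
  destruct (Hwt l ltac:(lra)) as [w0 [w1 [w2 w3]]]. rewrite Cmod_pair in w2. specialize (Hsl l ltac:(lra)).
  destruct (Hz (c + 286 / 100 + l) ltac:(lra)) as [z1 z2].
  set (x := ((c, t - l) : C)) in *. set (y := wt x) in *. set (r := rad c (t - l)) in *.
  assert (m0 := Cmod_ge_0 (zeta (g x))). set (m := Cmod (zeta (g x))) in *. set (z := zbar (c + 286 / 100 + l)) in *.
  assert (Hm : m <= 2095 / 10000 * y).
  { apply Rnot_lt_le. intros Hm. assert (r0 : 0 < r) by nra.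
    assert (Hrm : (2095 / 10000) ^ 2 * (r * y ^ 2) <= r * m ^ 2).
    { replace ((2095 / 10000) ^ 2 * (r * y ^ 2)) with (r * (2095 / 10000 * y) ^ 2) by ring. apply Rmult_le_compat_l; [lra|]. apply pow_incr. nra. }
    rewrite w2 in Hrm. nra. }
  destruct (zeta_le (g x) _ hg) as [_ b2]. fold m in b2. assert (h0 := Cmod_ge_0 (g x)).
  assert (B0 : Cmod (g x) <= 215 / 1000 * y) by nra.
  split; [exact B0|].
  (* The definition of [slaved] solved for h' turns the bound on h into one on h'. *)
  assert (E : g1 x = (slaved (g x) (g1 x) (/ x) + (- g x + (RtoC (-1 / 6) * (g x * g x) + (RtoC (1 / 72) * (g x * g x * g x) + RtoC (-1 / 2) * (g x * / x)))))%C).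
  { unfold slaved. replace (RtoC (-1 / 6)) with (- RtoC (1 / 6))%C by (rewrite <- RtoC_opp; f_equal; field).
    replace (RtoC (-1 / 72)) with (- RtoC (1 / 72))%C by (rewrite <- RtoC_opp; f_equal; field).
    replace (RtoC (-1 / 2)) with (- RtoC (1 / 2))%C by (rewrite <- RtoC_opp; f_equal; field). ring. }
  rewrite E. clear E. set (q := 215 / 1000 * y) in *.
  set (sl := slaved (g x) (g1 x) (/ x)) in *. clearbody sl. remember (alph y) as al eqn:Eal.
  apply Rle_trans with (al + (q + (1 / 6 * (q * q) + (1 / 72 * (q * q * q) + 1 / 2 * (q * y ^ 2))))).
  - ctri; [exact Hsl|rewrite Cmod_opp; exact B0| | |]; mono_mod.
  - rewrite Eal. unfold alph, q. assert (hy2 : y ^ 2 <= 5132 / 10000 * y) by nra.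
    assert (k3 : y ^ 3 <= (5132 / 10000) ^ 2 * y) by (replace (y ^ 3) with (y ^ 2 * y) by ring; apply Rmult_le_compat_r; [lra|apply pow_incr; lra]).
    assert (k4 : y ^ 4 <= (5132 / 10000) ^ 3 * y) by (replace (y ^ 4) with (y ^ 3 * y) by ring; apply Rmult_le_compat_r; [lra|apply pow_incr; lra]).
    assert (k5 : y ^ 5 <= (5132 / 10000) ^ 4 * y) by (replace (y ^ 5) with (y ^ 4 * y) by ring; apply Rmult_le_compat_r; [lra|apply pow_incr; lra]).
    assert (k8 : y ^ 8 <= (5132 / 10000) ^ 7 * y) by (replace (y ^ 8) with (y ^ 7 * y) by ring; apply Rmult_le_compat_r; [lra|apply pow_incr; lra]).
    replace (215 / 1000 * y * (215 / 1000 * y)) with ((215 / 1000) ^ 2 * y ^ 2) by ring.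
    replace ((215 / 1000) ^ 2 * y ^ 2 * (215 / 1000 * y)) with ((215 / 1000) ^ 3 * y ^ 3) by ring.
    replace (215 / 1000 * y * y ^ 2) with (215 / 1000 * y ^ 3) by ring. lra.
Qed.

(** * Existence in the x-plane *)

Lemma HA_H : forall x : C, 1 <= Cmod x -> Cmod (- / x)%C <= 1.
Proof.
  intros x Hx. rewrite Cmod_opp, Cmod_inv by (apply Cmod_nz; lra).
  rewrite <- Rinv_1. apply Rinv_le_contravar; lra.
Qed.

Definition H_agree := agree_convex (fun x => - / x)%C (fun x => RtoC kH / (x * x * (x * x)))%C 1%C (/ 2)%C (fun x => 1 <= Cmod x) HA_H.
Definition H_seg := Sol_unique_seg (fun x => - / x)%C (fun x => RtoC kH / (x * x * (x * x)))%C 1%C (/ 2)%C (fun x => 1 <= Cmod x) HA_H.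

(** For convex pieces, one point of agreement in each nonempty intersection is enough. *)
Lemma H_GlueConv (I : Type) (K : I -> C -> Prop) (g g1 : I -> C -> C) :
  (forall i, openC (K i)) -> (forall i, convexC (K i)) -> (forall i, SolH (K i) (g i) (g1 i)) ->
  (forall i j x, K i x -> K j x -> exists z, K i z /\ K j z /\ g i z = g j z /\ g1 i z = g1 j z) ->
  exists f f1, SolH (fun x => exists i, K i x) f f1 /\ forall i x, K i x -> f x = g i x /\ f1 x = g1 i x.
Proof.
  intros HO HC HS HE. apply Glue; [exact HO|exact HS|].
  intros i j x Hi Hj. destruct (HE i j x Hi Hj) as [z [z1 [z2 [z3 z4]]]].
  apply (H_agree (K i) (K j) (g i) (g1 i) (g j) (g1 j) z x); auto; apply HS.
Qed.

Lemma tube_right c t eta l x : tube 1 ((c, t) : C) eta l x <-> - eta < Re x - c < l + eta /\ Rabs (Im x - t) < eta.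
Proof.
  unfold tube. cbv zeta. replace ((x - (c, t)) * Cconj 1)%C with ((Re x - c, Im x - t) : C); [reflexivity|].
  apply injective_projections; unfold Re, Im; simpl; ring.
Qed.

Lemma tube_left c t eta l x : tube (- (1)) ((c, t) : C) eta l x <-> - eta < c - Re x < l + eta /\ Rabs (Im x - t) < eta.
Proof.
  unfold tube. cbv zeta. replace ((x - (c, t)) * Cconj (- (1)))%C with ((c - Re x, t - Im x) : C).
  - rewrite (Rabs_minus_sym (Im x)). reflexivity.
  - apply injective_projections; unfold Re, Im; simpl; ring.
Qed.

Lemma tube_down c t eta l x : tube (- Ci) ((c, t) : C) eta l x <-> - eta < t - Im x < l + eta /\ Rabs (Re x - c) < eta.
Proof.
  unfold tube. cbv zeta. replace ((x - (c, t)) * Cconj (- Ci))%C with ((t - Im x, Re x - c) : C); [reflexivity|].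
  apply injective_projections; unfold Re, Im; simpl; ring.
Qed.

Lemma pair_eta (x : C) : ((Re x, Im x) : C) = x.
Proof. destruct x; reflexivity. Qed.

Lemma ReIm_close (w z : C) d : Cmod (w - z)%C < d -> Rabs (Re w - Re z) < d /\ Rabs (Im w - Im z) < d.
Proof.
  intros H. split; (eapply Rle_lt_trans; [|exact H]).
  - replace (Re w - Re z) with (Re (w - z)%C) by reflexivity. apply Re_abs_le.
  - replace (Im w - Im z) with (Im (w - z)%C) by reflexivity. apply Im_abs_le.
Qed.

Definition openR (J : R -> Prop) : Prop := forall c, J c -> exists d, 0 < d /\ forall s, Rabs (s - c) < d -> J s.
Definition convR (J : R -> Prop) : Prop := forall a b t, J a -> J b -> 0 <= t <= 1 -> J (a + t * (b - a)).

Definition rect (J L : R -> Prop) (x : C) : Prop := J (Re x) /\ L (Im x).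

Lemma rect_open J L : openR J -> openR L -> openC (rect J L).
Proof.
  intros HJ HL z [h1 h2]. destruct (HJ _ h1) as [d1 [Hd1 k1]]. destruct (HL _ h2) as [d2 [Hd2 k2]].
  exists (Rmin d1 d2). split; [apply Rmin_case; lra|]. intros w Hw. apply ReIm_close in Hw. destruct Hw as [w1 w2].
  split; [apply k1|apply k2]; (eapply Rlt_le_trans; [eassumption|]); [apply Rmin_l|apply Rmin_r].
Qed.

Lemma rect_convex J L : convR J -> convR L -> convexC (rect J L).
Proof.
  intros HJ HL x y t [x1 x2] [y1 y2] Ht. split.
  - replace (Re (x + RtoC t * (y - x))%C) with (Re x + t * (Re y - Re x)) by (unfold Re; simpl; ring). apply HJ; assumption.
  - replace (Im (x + RtoC t * (y - x))%C) with (Im x + t * (Im y - Im x)) by (unfold Im; simpl; ring). apply HL; assumption.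
Qed.

Definition above (b s : R) : Prop := b < s.
Definition below (b s : R) : Prop := s < b.
Definition between (a b s : R) : Prop := a < s < b.

Lemma above_open b : openR (above b).
Proof. intros c H. exists (c - b). unfold above in *. split; [lra|]. intros s Hs. apply Rabs_lt_between in Hs. lra. Qed.
Lemma below_open b : openR (below b).
Proof. intros c H. exists (b - c). unfold below in *. split; [lra|]. intros s Hs. apply Rabs_lt_between in Hs. lra. Qed.
Lemma between_open a b : openR (between a b).
Proof.
  intros c H. exists (Rmin (c - a) (b - c)). unfold between in *. split; [apply Rmin_case; lra|].
  intros s Hs. assert (h1 := Rmin_l (c - a) (b - c)). assert (h2 := Rmin_r (c - a) (b - c)). apply Rabs_lt_between in Hs. lra.
Qed.
Lemma above_conv b : convR (above b).
Proof. intros x y t Hx Hy Ht. apply conv_lt; assumption. Qed.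
Lemma below_conv b : convR (below b).
Proof. intros x y t Hx Hy Ht. apply conv_gt; assumption. Qed.
Lemma between_conv a b : convR (between a b).
Proof. intros x y t [h1 h2] [h3 h4] Ht. split; [apply conv_lt|apply conv_gt]; assumption. Qed.

#[local] Hint Resolve above_open below_open between_open above_conv below_conv between_conv rect_open rect_convex : geo.

Lemma H_Tube (e p : C) (l M : R) (a0 a1 : C) : Cmod e = 1 -> 0 <= l ->
  (forall u, 0 <= u <= l -> 2 <= Cmod (p + RtoC u * e)%C) ->
  (forall s eta g g1, 0 <= s <= l -> 0 < eta -> SolH (tube e p eta s) g g1 -> g p = a0 -> g1 p = a1 ->
     Cmod (g (p + RtoC s * e)%C) <= M /\ Cmod (g1 (p + RtoC s * e)%C) <= M) ->
  Cmod a0 <= M -> Cmod a1 <= M ->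
  exists eta g g1, 0 < eta /\ SolH (tube e p eta l) g g1 /\ g p = a0 /\ g1 p = a1.
Proof.
  apply (Tube _ _ _ _ _ HA_H (fun _ x => 2 <= Cmod x)). exact H_local.
Qed.

Lemma tube_shrink e p eta eta' l x : eta' <= eta -> tube e p eta' l x -> tube e p eta l x.
Proof. intros H [[h1 h2] h3]. split; [split|]; cbv zeta in *; lra. Qed.

Lemma Nsq_le (g g1 : C -> C) x M : 0 <= M -> Nsq g g1 x < M ^ 2 -> Cmod (g x) <= M /\ Cmod (g1 x) <= M.
Proof.
  unfold Nsq. intros HM H. assert (0 <= Cmod (g x)) by apply Cmod_ge_0. assert (0 <= Cmod (g1 x)) by apply Cmod_ge_0.
  split; nra.
Qed.

(** One tube for each abscissa c, started from the data of f at height t0. Two tubes containing x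
    both contain the point at height t0 with the same abscissa, where each agrees with f; convexity
    carries the agreement to x. The bound is assumed for every solution on a tube because it serves
    as the a priori estimate of [H_Tube]. *)
Lemma Down (J : R -> Prop) (b b' t0 M : R) (f f1 : C -> C) : openR J -> convR J -> b < b' < t0 ->
  SolH (rect J (above b')) f f1 ->
  (forall c t, J c -> b <= t <= t0 -> 2 <= Cmod ((c, t) : C)) ->
  (forall c s eta g g1, J c -> 0 <= s <= t0 - b -> 0 < eta -> SolH (tube (- Ci) ((c, t0) : C) eta s) g g1 ->
    g ((c, t0) : C) = f ((c, t0) : C) -> g1 ((c, t0) : C) = f1 ((c, t0) : C) ->
    Cmod (g ((c, t0 - s) : C)) <= M /\ Cmod (g1 ((c, t0 - s) : C)) <= M) ->
  exists F F1, SolH (rect J (above b)) F F1 /\ forall x, rect J (above b') x -> F x = f x /\ F1 x = f1 x.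
Proof.
  intros HJ HJc Hb Sf H2 Hap.
  assert (E0 : forall c u, (((c, t0) : C) + RtoC u * (- Ci))%C = ((c, t0 - u) : C)) by (intros; apply down_point).
  assert (Hex : forall c : {c : R | J c}, exists d : R * (C -> C) * (C -> C), let '(eta, g, g1) := d in
    0 < eta <= t0 - b' /\ (forall s, Rabs (s - proj1_sig c) < eta -> J s) /\
    SolH (tube (- Ci) ((proj1_sig c, t0) : C) eta (t0 - b)) g g1 /\
    g ((proj1_sig c, t0) : C) = f ((proj1_sig c, t0) : C) /\ g1 ((proj1_sig c, t0) : C) = f1 ((proj1_sig c, t0) : C)).
  { intros [c Jc]. simpl. destruct (HJ c Jc) as [d [Hd HdJ]].
    (* This width keeps the slice of the tube at height t0, and a neighbourhood of its start, inside
       the rectangle where f is given. *)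
    set (e0 := Rmin d (t0 - b')). assert (He0 : 0 < e0) by (apply Rmin_case; lra).
    assert (e0d : e0 <= d) by apply Rmin_l. assert (e0t : e0 <= t0 - b') by apply Rmin_r.
    destruct (Hap c 0 e0 f f1 Jc ltac:(lra) He0) as [m0 m1]; [|reflexivity|reflexivity|].
    { apply (Sol_sub _ _ _ _ _ (rect J (above b'))); [|exact Sf]. intros x Hx. apply tube_down in Hx. split.
      - apply HdJ. lra.
      - unfold above. lra. }
    rewrite Rminus_0_r in m0, m1.
    destruct (H_Tube (- Ci)%C ((c, t0) : C) (t0 - b) M (f ((c, t0) : C)) (f1 ((c, t0) : C))) as [eta [g [g1 [Heta [Sg [G0 G1]]]]]]; auto.
    - apply Cmod_mCi.
    - lra.
    - intros u Hu. rewrite E0. apply H2; [exact Jc|lra].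
    - intros s eta g g1 Hs Heta Sg G0 G1. rewrite E0. apply (Hap c s eta g g1); auto.
    - exists (Rmin eta e0, g, g1). assert (q1 := Rmin_l eta e0). assert (q2 := Rmin_r eta e0).
      split; [split; [apply Rmin_case; lra|lra]|]. split; [intros s Hs; apply HdJ; lra|].
      split; [|split; assumption]. apply (Sol_sub _ _ _ _ _ (tube (- Ci) ((c, t0) : C) eta (t0 - b))); [|exact Sg].
      intros x. apply tube_shrink, q1. }
  set (dat := fun c => proj1_sig (constructive_indefinite_description _ (Hex c))).
  assert (Hdat : forall c, let '(eta, g, g1) := dat c in
    0 < eta <= t0 - b' /\ (forall s, Rabs (s - proj1_sig c) < eta -> J s) /\
    SolH (tube (- Ci) ((proj1_sig c, t0) : C) eta (t0 - b)) g g1 /\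
    g ((proj1_sig c, t0) : C) = f ((proj1_sig c, t0) : C) /\ g1 ((proj1_sig c, t0) : C) = f1 ((proj1_sig c, t0) : C)).
  { intros c. unfold dat. apply (proj2_sig (constructive_indefinite_description _ (Hex c))). }
  clearbody dat. clear Hex.
  set (et := fun c => fst (fst (dat c))). set (gg := fun c => snd (fst (dat c))). set (gg1 := fun c => snd (dat c)).
  assert (Hd : forall c, 0 < et c <= t0 - b' /\ (forall s, Rabs (s - proj1_sig c) < et c -> J s) /\
    SolH (tube (- Ci) ((proj1_sig c, t0) : C) (et c) (t0 - b)) (gg c) (gg1 c) /\
    gg c ((proj1_sig c, t0) : C) = f ((proj1_sig c, t0) : C) /\ gg1 c ((proj1_sig c, t0) : C) = f1 ((proj1_sig c, t0) : C)).
  { intros c. specialize (Hdat c). unfold et, gg, gg1. destruct (dat c) as [[eta g] g1]. exact Hdat. }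
  clearbody et gg gg1. clear Hdat dat.
  set (I := option {c : R | J c}).
  set (K := fun i : I => match i with None => rect J (above b') | Some c => tube (- Ci) ((proj1_sig c, t0) : C) (et c) (t0 - b) end).
  set (G := fun i : I => match i with None => f | Some c => gg c end).
  set (G1 := fun i : I => match i with None => f1 | Some c => gg1 c end).
  assert (Hjoin : forall (c : {c : R | J c}) s, Rabs (s - proj1_sig c) < et c ->
    K (Some c) ((s, t0) : C) /\ rect J (above b') ((s, t0) : C) /\
    gg c ((s, t0) : C) = f ((s, t0) : C) /\ gg1 c ((s, t0) : C) = f1 ((s, t0) : C)).
  { intros c s Hs. destruct (Hd c) as [h1 [h2 [h3 [h4 h5]]]].
    assert (k1 : forall r, Rabs (r - proj1_sig c) < et c -> K (Some c) ((r, t0) : C)).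
    { intros r Hr. simpl. apply tube_down. simpl. split; [lra|exact Hr]. }
    assert (k2 : forall r, Rabs (r - proj1_sig c) < et c -> rect J (above b') ((r, t0) : C)).
    { intros r Hr. split; [apply h2, Hr|unfold above; simpl; lra]. }
    assert (Hc0 : Rabs (proj1_sig c - proj1_sig c) < et c) by (rewrite Rminus_diag, Rabs_R0; lra).
    split; [apply k1, Hs|]. split; [apply k2, Hs|].
    apply (H_agree (K (Some c)) (rect J (above b')) (gg c) (gg1 c) f f1 ((proj1_sig c, t0) : C)); auto with geo.
    apply tube_convex. }
  destruct (H_GlueConv I K G G1) as [F [F1 [SF HF]]].
  - intros [c|]; simpl; [apply tube_open, Cmod_mCi|auto with geo].
  - intros [c|]; simpl; [apply tube_convex|auto with geo].
  - intros [c|]; simpl; [apply Hd|exact Sf].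
  - assert (Hsw : forall c x, K (Some c) x -> Rabs (Re x - proj1_sig c) < et c).
    { intros c x Hx. simpl in Hx. apply tube_down in Hx. apply Hx. }
    intros [c|] [c'|] x Hi Hj.
    + exists ((Re x, t0) : C). destruct (Hjoin c (Re x) (Hsw c x Hi)) as [a1 [a2 [a3 a4]]].
      destruct (Hjoin c' (Re x) (Hsw c' x Hj)) as [b1 [b2 [b3 b4]]]. simpl. rewrite a3, a4, b3, b4. auto.
    + exists ((Re x, t0) : C). destruct (Hjoin c (Re x) (Hsw c x Hi)) as [a1 [a2 [a3 a4]]]. auto.
    + exists ((Re x, t0) : C). destruct (Hjoin c' (Re x) (Hsw c' x Hj)) as [b1 [b2 [b3 b4]]]. simpl. auto.
    + exists x. auto.
  - exists F, F1. split; [|intros x Hx; apply (HF None x Hx)].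
    apply (Sol_sub _ _ _ _ _ (fun x => exists i, K i x)); [|exact SF].
    intros x [x1 x2]. unfold above in x2. destruct (Rlt_le_dec b' (Im x)) as [h|h].
    + exists None. split; assumption.
    + set (c0 := exist (fun c => J c) (Re x) x1). exists (Some c0). simpl. apply tube_down. simpl.
      destruct (Hd c0) as [h1 _]. set (e := et c0) in *. clearbody e.
      replace (Re x - Re x) with 0 by ring. rewrite Rabs_R0. split; lra.
Qed.

Lemma bup_far c t : Rabs c <= t -> 0 < t -> 1 / 10 / t ^ 3 < bup c t.
Proof.
  intros Hc Ht. unfold bup. assert (E := rad_sq c t). assert (R0 := rad_ge0 c t).
  assert (Hc2 : c ^ 2 <= t ^ 2) by (rewrite <- (pow2_abs c); apply pow_incr; split; [apply Rabs_pos|exact Hc]).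
  assert (Hr : rad c t <= 2 * t) by nra.
  assert (Hr0 : 0 < rad c t) by nra.
  assert (Hd : (rad c t + t) * rad c t ^ 2 <= 6 * t ^ 3).
  { rewrite E. replace (6 * t ^ 3) with ((3 * t) * (2 * t ^ 2)) by ring. assert (0 <= c ^ 2) by apply pow2_ge_0. assert (0 <= t ^ 2) by apply pow2_ge_0. apply Rmult_le_compat; lra. }
  assert (0 < t ^ 3) by (apply pow_lt, Ht). assert (0 < (rad c t + t) * rad c t ^ 2) by (apply Rmult_lt_0_compat; nra).
  apply Rlt_le_trans with (33 / 50 / (6 * t ^ 3)).
  - replace (33 / 50 / (6 * t ^ 3)) with (11 / 100 * / t ^ 3) by (field; lra).
    unfold Rdiv at 1. apply Rmult_lt_compat_r; [apply Rinv_0_lt_compat; assumption|lra].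
  - unfold Rdiv. apply Rmult_le_compat_l; [lra|]. apply Rinv_le_contravar; assumption.
Qed.

(** On a strip of bounded width the horizontal growth turns the decay K/t^4 on the axis into at most
    K e^(3 C0) / t^4, which above T' is smaller than [bup], of order t^-3. As T' depends on the
    width, every width gets its own solution. *)
Lemma Far (V : C -> Prop) (h h1 : C -> C) (K T C0 : R) : SolH V h h1 -> 2 * kH <= K -> 10 <= T -> 1 <= C0 ->
  (forall t, T < t -> V ((0, t) : C) /\ Nsq h h1 ((0, t) : C) < (K / t ^ 4) ^ 2) ->
  exists T' f f1, T <= T' /\ SolH (rect (between (- (1 / 20)) C0) (above T')) f f1 /\
    (forall t, T' < t -> f ((0, t) : C) = h ((0, t) : C) /\ f1 ((0, t) : C) = h1 ((0, t) : C)) /\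
    (forall x, rect (between (- (1 / 20)) C0) (above T') x -> Nsq f f1 x < bup (Re x) (Im x) ^ 2).
Proof.
  intros SV HK HT HC0 HV.
  set (T' := T + C0 + 10 * K * exp (3 * C0)).
  assert (HkH : 0 < kH) by (unfold kH; lra). assert (HeC : 1 <= exp (3 * C0)) by (generalize (exp_ineq1_le (3 * C0)); lra).
  assert (HKe : 0 < K * exp (3 * C0)) by (apply Rmult_lt_0_compat; lra).
  assert (HT' : T <= T' /\ C0 <= T' /\ 10 * (K * exp (3 * C0)) <= T') by (unfold T'; lra).
  assert (Hsmall : forall t, T' < t -> K / t ^ 4 * exp (3 * C0) <= 1 / 10 / t ^ 3).
  { intros t Ht. assert (0 < t ^ 3) by (apply pow_lt; lra).
    replace (K / t ^ 4 * exp (3 * C0)) with (K * exp (3 * C0) / t * / t ^ 3) by (field; lra).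
    unfold Rdiv at 2. apply Rmult_le_compat_r; [left; apply Rinv_0_lt_compat; lra|]. apply Rle_div_l; lra. }
  assert (Hone : forall t, T' < t -> K / t ^ 4 * exp (3 * C0) <= 1).
  { intros t Ht. eapply Rle_trans; [apply Hsmall, Ht|]. assert (1 <= t ^ 3) by (apply pow_R1_Rle; lra).
    apply Rle_div_l; lra. }
  (* [true] stands for the lines going right from the axis, [false] for those going left. *)
  set (e := fun b : bool => if b then RtoC 1 else (- (1))%C).
  set (s := fun b : bool => if b then 1 else -1).
  set (len := fun b : bool => if b then C0 else 1 / 20).
  assert (Hlen : forall b, 0 <= len b <= C0) by (intros []; simpl; lra).
  assert (He : forall b t u, (((0, t) : C) + RtoC u * e b)%C = ((s b * u, t) : C)).
  { intros [] t u; apply injective_projections; simpl; ring. }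
  assert (Hs : forall b, s b = 1 \/ s b = -1) by (intros []; simpl; auto).
  assert (Hbound : forall b t l U g g1, T' < t -> 0 <= l <= len b -> SolH U g g1 -> (forall u, 0 <= u <= l -> U ((s b * u, t) : C)) ->
    g ((0, t) : C) = h ((0, t) : C) -> g1 ((0, t) : C) = h1 ((0, t) : C) ->
    Nsq g g1 ((s b * l, t) : C) < (K / t ^ 4 * exp (3 * l)) ^ 2).
  { intros b t l U g g1 Ht Hl Sg HU G0 G1. destruct (HV t ltac:(lra)) as [_ hN].
    assert (Ht4 : 0 < t ^ 4) by (apply pow_lt; lra). 
    apply (H_far U g g1 (s b) t l (K / t ^ 4)); auto; try lra.
    - apply Rdiv_lt_0_compat; lra.
    - eapply Rle_trans; [|apply (Hone t Ht)]. apply Rmult_le_compat_l; [apply Rdiv_le_0_compat; lra|].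
      specialize (Hlen b). destruct (Req_dec l C0) as [->|]; [lra|]. left. apply exp_increasing. lra.
    - unfold Rdiv. apply Rmult_le_compat_r; [left; apply Rinv_0_lt_compat; lra|lra].
    - unfold Nsq in *. rewrite G0, G1. exact hN. }
  assert (Hex : forall i : {t : R | T' < t} * bool, exists d : R * (C -> C) * (C -> C), let '(eta, g, g1) := d in
    let t := proj1_sig (fst i) in 0 < eta <= t - T' /\ SolH (tube (e (snd i)) ((0, t) : C) eta (len (snd i))) g g1 /\
    g ((0, t) : C) = h ((0, t) : C) /\ g1 ((0, t) : C) = h1 ((0, t) : C)).
  { intros [[t Ht] b]. simpl. destruct (HV t ltac:(lra)) as [_ hN].
    assert (h0 : Nsq h h1 ((0, t) : C) < 1 ^ 2).
    { eapply Rlt_le_trans; [exact hN|]. assert (Ht4 : 0 < t ^ 4) by (apply pow_lt; lra).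
      apply pow_incr. split; [apply Rdiv_le_0_compat; lra|]. eapply Rle_trans; [|apply (Hone t Ht)].
      assert (0 <= K / t ^ 4) by (apply Rdiv_le_0_compat; lra). nra. }
    apply Nsq_le in h0; [|lra].
    destruct (H_Tube (e b) ((0, t) : C) (len b) 1 (h ((0, t) : C)) (h1 ((0, t) : C))) as [eta [g [g1 [Heta [Sg [G0 G1]]]]]].
    - destruct b; simpl; [apply Cmod_1|rewrite Cmod_opp; apply Cmod_1].
    - apply Hlen.
    - intros u Hu. rewrite He, Cmod_pair. assert (E := rad_sq (s b * u) t). generalize (rad_ge0 (s b * u) t). nra.
    - intros l eta g g1 Hl Heta Sg G0 G1. rewrite He. apply Nsq_le; [lra|].
      eapply Rlt_le_trans.
      + apply (Hbound b t l _ g g1 Ht Hl Sg); [|exact G0|exact G1]. intros u Hu. rewrite <- He.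
        apply tube_line; [destruct b; simpl; [apply Cmod_1|rewrite Cmod_opp; apply Cmod_1]|exact Heta|lra].
      + assert (Ht4 : 0 < t ^ 4) by (apply pow_lt; lra). apply pow_incr. split.
        * apply Rmult_le_pos; [apply Rdiv_le_0_compat; lra|left; apply exp_pos].
        * eapply Rle_trans; [|apply (Hone t Ht)]. apply Rmult_le_compat_l; [apply Rdiv_le_0_compat; lra|].
          specialize (Hlen b). destruct (Req_dec l C0) as [->|]; [lra|]. left. apply exp_increasing. lra.
    - apply h0.
    - apply h0.
    - exists (Rmin eta (t - T'), g, g1). assert (q1 := Rmin_l eta (t - T')). assert (q2 := Rmin_r eta (t - T')).
      split; [split; [apply Rmin_case; lra|lra]|]. split; [|split; assumption].
      apply (Sol_sub _ _ _ _ _ (tube (e b) ((0, t) : C) eta (len b))); [|exact Sg].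
      intros x. apply tube_shrink, q1. }
  set (I := ({t : R | T' < t} * bool)%type) in *.
  set (dat := fun i : I => proj1_sig (constructive_indefinite_description _ (Hex i))).
  assert (Hdat : forall i : I, let '(eta, g, g1) := dat i in
    let t := proj1_sig (fst i) in 0 < eta <= t - T' /\ SolH (tube (e (snd i)) ((0, t) : C) eta (len (snd i))) g g1 /\
    g ((0, t) : C) = h ((0, t) : C) /\ g1 ((0, t) : C) = h1 ((0, t) : C)).
  { intros i. unfold dat. apply (proj2_sig (constructive_indefinite_description _ (Hex i))). }
  clearbody dat. clear Hex.
  set (et := fun i => fst (fst (dat i))). set (gg := fun i => snd (fst (dat i))). set (gg1 := fun i => snd (dat i)).
  assert (Hd : forall i : I, 0 < et i <= proj1_sig (fst i) - T' /\ SolH (tube (e (snd i)) ((0, proj1_sig (fst i)) : C) (et i) (len (snd i))) (gg i) (gg1 i) /\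
    gg i ((0, proj1_sig (fst i)) : C) = h ((0, proj1_sig (fst i)) : C) /\ gg1 i ((0, proj1_sig (fst i)) : C) = h1 ((0, proj1_sig (fst i)) : C)).
  { intros i. specialize (Hdat i). unfold et, gg, gg1. destruct (dat i) as [[eta g] g1]. exact Hdat. }
  clearbody et gg gg1. clear Hdat dat.
  set (Kt := fun i : I => tube (e (snd i)) ((0, proj1_sig (fst i)) : C) (et i) (len (snd i))).
  assert (Htube : forall i x, Kt i x <-> - et i < s (snd i) * Re x < len (snd i) + et i /\ Rabs (Im x - proj1_sig (fst i)) < et i).
  { intros [[t Ht] []] x; unfold Kt; simpl; [rewrite tube_right|rewrite tube_left];
      (split; intros [q1 q2]; (split; [lra|exact q2])). }
  assert (Haxis : forall i r, Rabs (r - proj1_sig (fst i)) < et i -> Kt i ((0, r) : C) /\ gg i ((0, r) : C) = h ((0, r) : C) /\ gg1 i ((0, r) : C) = h1 ((0, r) : C)).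
  { intros i r Hr. destruct (Hd i) as [d1 [d2 [d3 d4]]].
    assert (k1 : forall q, Rabs (q - proj1_sig (fst i)) < et i -> Kt i ((0, q) : C)).
    { intros q Hq. apply Htube. unfold Re; simpl fst at 2 3. rewrite Rmult_0_r. specialize (Hlen (snd i)). split; [lra|exact Hq]. }
    split; [apply k1, Hr|].
    apply (H_seg (fun x => Kt i x /\ V x) (gg i) (gg1 i) h h1 ((0, proj1_sig (fst i)) : C)).
    - apply (Sol_sub _ _ _ _ _ (Kt i)); [intros x Hx; apply Hx|exact d2].
    - apply (Sol_sub _ _ _ _ _ V); [intros x Hx; apply Hx|exact SV].
    - intros t Ht. set (t0 := proj1_sig (fst i)) in *.
      replace (((0, t0) : C) + RtoC t * (((0, r) : C) - ((0, t0) : C)))%C with ((0, t0 + t * (r - t0)) : C) by (apply injective_projections; simpl; ring).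
      apply Rabs_lt_between in Hr.
      split; [apply k1, Rabs_lt_between; nra|apply HV; nra].
    - exact d3.
    - exact d4. }
  destruct (H_GlueConv I Kt gg gg1) as [f [f1 [Sf Hf]]].
  - intros i. apply tube_open. destruct i as [t []]; simpl; [apply Cmod_1|rewrite Cmod_opp; apply Cmod_1].
  - intros i. apply tube_convex.
  - intros i. apply Hd.
  - intros i j x Hi Hj. apply Htube in Hi. apply Htube in Hj. exists ((0, Im x) : C).
    destruct (Haxis i (Im x) (proj2 Hi)) as [a1 [a2 a3]]. destruct (Haxis j (Im x) (proj2 Hj)) as [b1 [b2 b3]].
    rewrite a2, a3, b2, b3. auto.
  - assert (Hcov : forall x, rect (between (- (1 / 20)) C0) (above T') x -> exists i, Kt i x /\ proj1_sig (fst i) = Im x /\ 0 <= s (snd i) * Re x <= len (snd i)).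
    { intros x [x1 x2]. unfold above, between in *. set (t := exist (fun t => T' < t) (Im x) x2).
      exists (t, if Rle_dec 0 (Re x) then true else false).
      assert (q : 0 <= s (if Rle_dec 0 (Re x) then true else false) * Re x <= len (if Rle_dec 0 (Re x) then true else false)).
      { destruct (Rle_dec 0 (Re x)); simpl; lra. }
      split; [|split; [reflexivity|exact q]].
      apply Htube. destruct (Hd (t, if Rle_dec 0 (Re x) then true else false)) as [d1 _]. simpl fst in *. simpl snd in *. simpl proj1_sig in *.
      set (ee := et (t, if Rle_dec 0 (Re x) then true else false)) in *. clearbody ee.
      split; [lra|]. replace (Im x - Im x) with 0 by ring. rewrite Rabs_R0. lra. }
    exists T', f, f1. split; [apply HT'|]. split; [|split].
    + apply (Sol_sub _ _ _ _ _ (fun x => exists i, Kt i x)); [|exact Sf].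
      intros x Hx. destruct (Hcov x Hx) as [i [Hi _]]. exists i. exact Hi.
    + intros t Ht. set (i := (exist (fun t => T' < t) t Ht, true) : I). destruct (Hd i) as [d1 _].
      destruct (Haxis i t) as [a1 [a2 a3]].
      { simpl. replace (t - t) with 0 by ring. rewrite Rabs_R0. lra. }
      destruct (Hf i _ a1) as [b1 b2]. rewrite b1, b2. auto.
    + intros x Hx. destruct (Hcov x Hx) as [i [Hi [Et Hl]]]. destruct Hx as [x1 x2]. unfold above, between in *.
      destruct (Hd i) as [d1 [d2 [d3 d4]]]. unfold Nsq. destruct (Hf i x Hi) as [e0 e1]. rewrite e0, e1.
      rewrite Et in *. set (b := snd i) in *. set (l := s b * Re x) in *.
      assert (Ex : x = ((s b * l, Im x) : C)).
      { rewrite <- (pair_eta x) at 1. f_equal. unfold l. destruct b; simpl; ring. }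
      assert (HN : Nsq (gg i) (gg1 i) ((s b * l, Im x) : C) < (K / Im x ^ 4 * exp (3 * l)) ^ 2).
      { apply (Hbound b (Im x) l _ (gg i) (gg1 i) x2 Hl d2); auto. intros u Hu. rewrite <- He.
        apply tube_line; [destruct b; simpl; [apply Cmod_1|rewrite Cmod_opp; apply Cmod_1]|apply d1|lra]. }
      rewrite <- Ex in HN. unfold Nsq in HN. eapply Rlt_le_trans; [exact HN|].
      assert (Ht4 : 0 < Im x ^ 4) by (apply pow_lt; lra).
      apply pow_incr. split; [apply Rmult_le_pos; [apply Rdiv_le_0_compat; lra|left; apply exp_pos]|].
      apply Rle_trans with (K / Im x ^ 4 * exp (3 * C0)).
      * apply Rmult_le_compat_l; [apply Rdiv_le_0_compat; lra|]. specialize (Hlen b).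
        destruct (Req_dec l C0) as [->|]; [lra|]. left. apply exp_increasing. lra.
      * eapply Rle_trans; [apply Hsmall; lra|]. left. apply bup_far; [|lra]. apply Rabs_le. lra.
Qed.

Lemma rad_ge_l c t : Rabs c <= rad c t.
Proof. assert (E := rad_sq c t). assert (R0 := rad_ge0 c t). assert (H := pow2_abs c). assert (0 <= t ^ 2) by apply pow2_ge_0. generalize (Rabs_pos c). nra. Qed.

Lemma rad_ge_r c t : Rabs t <= rad c t.
Proof. assert (E := rad_sq c t). assert (R0 := rad_ge0 c t). assert (H := pow2_abs t). assert (0 <= c ^ 2) by apply pow2_ge_0. generalize (Rabs_pos t). nra. Qed.

Lemma bup_bounds c t : 0 <= t -> 5 / 2 <= rad c t -> 0 < bup c t <= 1.
Proof.
  intros Ht Hr. unfold bup.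
  assert (15 <= (rad c t + t) * rad c t ^ 2).
  { assert (25 / 4 <= rad c t ^ 2) by nra. nra. }
  split; [apply Rdiv_lt_0_compat; lra|]. apply Rle_div_l; lra.
Qed.

Lemma Nsq_ext (f f1 g g1 : C -> C) x : f x = g x -> f1 x = g1 x -> Nsq f f1 x = Nsq g g1 x.
Proof. intros E0 E1. unfold Nsq. rewrite E0, E1. reflexivity. Qed.

Lemma Nsq_bup_le (g g1 : C -> C) c t x : 0 <= t -> 5 / 2 <= rad c t -> Nsq g g1 x < bup c t ^ 2 ->
  Cmod (g x) <= 1 /\ Cmod (g1 x) <= 1.
Proof.
  intros Ht Hr H. destruct (bup_bounds c t Ht Hr). apply Nsq_le; [lra|].
  eapply Rlt_le_trans; [exact H|]. apply pow_incr. lra.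
Qed.

Lemma Upper_n (V : C -> Prop) (h h1 : C -> C) (K T C0 : R) : SolH V h h1 -> 2 * kH <= K -> 10 <= T -> 1 <= C0 ->
  (forall t, T < t -> V ((0, t) : C) /\ Nsq h h1 ((0, t) : C) < (K / t ^ 4) ^ 2) ->
  exists T' f f1, T <= T' /\ SolH (rect (between (- (1 / 20)) C0) (above (287 / 100))) f f1 /\
    (forall t, T' < t -> f ((0, t) : C) = h ((0, t) : C) /\ f1 ((0, t) : C) = h1 ((0, t) : C)) /\
    (forall x, rect (between (- (1 / 20)) C0) (above (287 / 100)) x -> Nsq f f1 x < bup (Re x) (Im x) ^ 2).
Proof.
  intros SV HK HT HC0 HV. destruct (Far V h h1 K T C0 SV HK HT HC0 HV) as [T' [f [f1 [HT' [Sf [Hax HN]]]]]].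
  set (J := between (- (1 / 20)) C0) in *.
  assert (Hstart : forall c, J c -> Nsq f f1 ((c, T' + 1) : C) < bup c (T' + 1) ^ 2).
  { intros c Jc. apply (HN ((c, T' + 1) : C)). split; [exact Jc|]. unfold above. simpl. lra. }
  assert (Hrad : forall c t, 287 / 100 <= t -> 5 / 2 <= rad c t /\ 5 / 2 <= rad c t + t).
  { intros c t Ht. assert (q := rad_ge_r c t). rewrite Rabs_pos_eq in q by lra. lra. }
  assert (Hline : forall U g g1 c l, SolH U g g1 -> J c -> 0 <= l <= T' + 1 - 287 / 100 ->
    (forall u, 0 <= u <= l -> U ((c, T' + 1 - u) : C)) ->
    g ((c, T' + 1) : C) = f ((c, T' + 1) : C) -> g1 ((c, T' + 1) : C) = f1 ((c, T' + 1) : C) ->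
    Nsq g g1 ((c, T' + 1 - l) : C) < bup c (T' + 1 - l) ^ 2).
  { intros U g g1 c l Sg Jc Hl HU G0 G1. apply (V_up U g g1 c (T' + 1) l); auto; [| |lra].
    - intros u Hu. split; [apply HU, Hu|]. destruct (Hrad c (T' + 1 - u) ltac:(lra)). lra.
    - rewrite (Nsq_ext _ _ f f1) by assumption. apply Hstart, Jc. }
  destruct (Down J (287 / 100) T' (T' + 1) 1 f f1) as [F [F1 [SF HF]]].
  - apply between_open.
  - apply between_conv.
  - lra.
  - exact Sf.
  - intros c t Jc Ht. rewrite Cmod_pair. destruct (Hrad c t ltac:(lra)). lra.
  - intros c s eta g g1 Jc Hs Heta Sg G0 G1. 
    apply (Nsq_bup_le g g1 c (T' + 1 - s)); [lra|apply Hrad; lra|].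
    apply (Hline _ g g1 c s Sg Jc ltac:(lra)); auto. intros u Hu. rewrite <- down_point. apply tube_line; [apply Cmod_mCi|exact Heta|lra].
  - exists T', F, F1. split; [exact HT'|]. split; [exact SF|].
    assert (HF' : forall c t, J c -> T' < t -> F ((c, t) : C) = f ((c, t) : C) /\ F1 ((c, t) : C) = f1 ((c, t) : C)).
    { intros c t Jc Ht. apply HF. split; [exact Jc|exact Ht]. }
    split.
    + intros t Ht. destruct (HF' 0 t) as [e0 e1]; [unfold J, between; lra|exact Ht|]. rewrite e0, e1. apply Hax, Ht.
    + intros x [x1 x2]. destruct (Rlt_le_dec T' (Im x)) as [h0|h0].
      * rewrite (Nsq_ext _ _ f f1) by (apply HF; split; assumption). apply HN. split; assumption.
      * unfold above in x2. assert (q := Hline _ F F1 (Re x) (T' + 1 - Im x) SF x1 ltac:(lra)).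
        replace (T' + 1 - (T' + 1 - Im x)) with (Im x) in q by ring. rewrite <- (pair_eta x) at 1.
        apply q; try (apply HF'; [exact x1|lra]).
        intros u Hu. split; [exact x1|unfold above; simpl; lra].
Qed.

(** The heights from which the strips of width n + 1 start are unbounded in n, but after the descent
    all of them reach down to 287/100 and agree with h far up the axis, so they glue to a
    quadrant. *)
Lemma Upper (V : C -> Prop) (h h1 : C -> C) (K T : R) : SolH V h h1 -> 2 * kH <= K -> 10 <= T ->
  (forall t, T < t -> V ((0, t) : C) /\ Nsq h h1 ((0, t) : C) < (K / t ^ 4) ^ 2) ->
  exists T' f f1, SolH (rect (above (- (1 / 20))) (above (287 / 100))) f f1 /\
    (forall t, T' < t -> f ((0, t) : C) = h ((0, t) : C) /\ f1 ((0, t) : C) = h1 ((0, t) : C)) /\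
    (forall x, rect (above (- (1 / 20))) (above (287 / 100)) x -> Nsq f f1 x < bup (Re x) (Im x) ^ 2).
Proof.
  intros SV HK HT HV.
  assert (Hex : forall n : nat, exists d : R * (C -> C) * (C -> C), let '(T', f, f1) := d in
    T <= T' /\ SolH (rect (between (- (1 / 20)) (INR n + 1)) (above (287 / 100))) f f1 /\
    (forall t, T' < t -> f ((0, t) : C) = h ((0, t) : C) /\ f1 ((0, t) : C) = h1 ((0, t) : C)) /\
    (forall x, rect (between (- (1 / 20)) (INR n + 1)) (above (287 / 100)) x -> Nsq f f1 x < bup (Re x) (Im x) ^ 2)).
  { intros n. destruct (Upper_n V h h1 K T (INR n + 1) SV HK HT) as [T' [f [f1 H]]]; [generalize (pos_INR n); lra|exact HV|].
    exists (T', f, f1). exact H. }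
  apply choice in Hex. destruct Hex as [dat Hdat].
  set (tt := fun n => fst (fst (dat n))). set (gg := fun n => snd (fst (dat n))). set (gg1 := fun n => snd (dat n)).
  assert (Hd : forall n, T <= tt n /\ SolH (rect (between (- (1 / 20)) (INR n + 1)) (above (287 / 100))) (gg n) (gg1 n) /\
    (forall t, tt n < t -> gg n ((0, t) : C) = h ((0, t) : C) /\ gg1 n ((0, t) : C) = h1 ((0, t) : C)) /\
    (forall x, rect (between (- (1 / 20)) (INR n + 1)) (above (287 / 100)) x -> Nsq (gg n) (gg1 n) x < bup (Re x) (Im x) ^ 2)).
  { intros n. specialize (Hdat n). unfold tt, gg, gg1. destruct (dat n) as [[a b] c]. exact Hdat. }
  clearbody tt gg gg1. clear Hdat dat.
  set (Kn := fun n => rect (between (- (1 / 20)) (INR n + 1)) (above (287 / 100))).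
  assert (Hax : forall n t, 287 / 100 < t -> Kn n ((0, t) : C)).
  { intros n t Ht. split; [unfold between; simpl; generalize (pos_INR n); lra|exact Ht]. }
  destruct (H_GlueConv nat Kn gg gg1) as [f [f1 [Sf Hf]]].
  - intros n. unfold Kn. auto with geo.
  - intros n. unfold Kn. auto with geo.
  - intros n. apply Hd.
  - intros i j x _ _. set (t := Rmax (tt i) (tt j) + 1). assert (q1 := Rmax_l (tt i) (tt j)). assert (q2 := Rmax_r (tt i) (tt j)).
    destruct (Hd i) as [a1 [_ [a2 _]]]. destruct (Hd j) as [b1 [_ [b2 _]]].
    exists ((0, t) : C). destruct (a2 t) as [c1 c2]; [unfold t; lra|]. destruct (b2 t) as [d1 d2]; [unfold t; lra|].
    split; [apply Hax; unfold t; lra|]. split; [apply Hax; unfold t; lra|]. rewrite c1, c2, d1, d2. auto.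
  - assert (Hcov : forall x, rect (above (- (1 / 20))) (above (287 / 100)) x -> exists n, Kn n x).
    { intros x [x1 x2]. destruct (INR_unbounded (Re x)) as [n Hn]. exists n. split; [|exact x2]. unfold above, between in *. lra. }
    exists (tt O), f, f1. split; [|split].
    + apply (Sol_sub _ _ _ _ _ (fun x => exists n, Kn n x)); assumption.
    + intros t Ht. destruct (Hd O) as [a1 [_ [a2 _]]]. destruct (Hf O ((0, t) : C)) as [e0 e1]; [apply Hax; lra|]. rewrite e0, e1. apply a2, Ht.
    + intros x Hx. destruct (Hcov x Hx) as [n Hn]. destruct (Hf n x Hn). rewrite (Nsq_ext _ _ (gg n) (gg1 n)) by assumption. apply Hd, Hn.
Qed.

Lemma right_line (U : C -> Prop) (g g1 : C -> C) (c l : R) : SolH U g g1 -> 5 / 2 <= c -> 0 <= l <= 59 / 10 ->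
  (forall u, 0 <= u <= l -> U ((c, 3 - u) : C)) -> Nsq g g1 ((c, 3) : C) < bup c 3 ^ 2 ->
  (l <= 3 -> Nsq g g1 ((c, 3 - l) : C) < bup c (3 - l) ^ 2) /\
  (3 <= l -> Nsq g g1 ((c, 3 - l) : C) < blow c (l - 3) ^ 2).
Proof.
  intros Sg Hc Hl HU H0.
  assert (Hup : forall v, 0 <= v <= l -> v <= 3 -> Nsq g g1 ((c, 3 - v) : C) < bup c (3 - v) ^ 2).
  { intros v Hv Hv3. apply (V_up U g g1 c 3 v); auto; [|lra]. intros u Hu. split; [apply HU; lra|].
    assert (q := rad_ge_l c (3 - u)). rewrite Rabs_pos_eq in q by lra. lra. }
  split; intros h; [apply Hup; lra|].
  replace (3 - l) with (- (l - 3)) by ring. apply (V_low U g g1 c (l - 3)); auto; [lra| | |lra].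
  - intros u Hu. replace (- u) with (3 - (u + 3)) by ring. apply HU. lra.
  - replace 0 with (3 - 3) by ring. apply Hup; lra.
Qed.

(** Hands the energy barrier over to the weight of the bootstrap. The extreme case is c = 5/2, u =
    29/10, where [blow] is about 0.1453 times the weight. *)
Lemma blow_wt c u : 5 / 2 <= c -> 0 <= u <= 29 / 10 -> 0 < blow c u <= 1457 / 10000 * wt (c, - u).
Proof.
  intros Hc Hu. assert (E := rad_sq c u). assert (R0 := rad_ge0 c u).
  assert (Er : rad c (- u) = rad c u) by (unfold rad; f_equal; ring).
  unfold wt. rewrite Cmod_pair, Er. unfold blow. set (r := rad c u) in *. clearbody r.
  assert (Hcr : c <= r) by nra. assert (Hr : r <= 15322 / 10000 * c) by nra.
  set (w := u / r). assert (Hw0 : 0 <= w) by (apply Rdiv_le_0_compat; lra).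
  assert (Hwr : w * r = u) by (unfold w; field; lra).
  assert (Hw : w <= 7577 / 10000).
  { apply Rnot_lt_le. intros hw. assert ((7577 / 10000) ^ 2 * r ^ 2 < u ^ 2).
    { rewrite <- Hwr, Rpow_mult_distr. apply Rmult_lt_compat_r; [nra|]. nra. }
    nra. }
  assert (Hc3 : 0 < c ^ 3) by (apply pow_lt; lra).
  assert (Hb : 0 < 33 / 50 / c ^ 3 * (1 + w)) by (apply Rmult_lt_0_compat; [apply Rdiv_lt_0_compat; lra|lra]).
  split; [exact Hb|].
  assert (Hq : 0 < sqrt r) by (apply sqrt_lt_R0; lra).
  assert (Eq : sqrt r ^ 2 = r) by (apply pow2_sqrt; lra).
  set (q := sqrt r) in *. clearbody q.
  apply (Rmult_le_reg_r q); [exact Hq|]. replace (1457 / 10000 * / q * q) with (1457 / 10000) by (field; lra).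
  apply Rsqr_incr_0_var; [|lra].
  unfold Rsqr. replace (33 / 50 / c ^ 3 * (1 + w) * q * (33 / 50 / c ^ 3 * (1 + w) * q)) with ((33 / 50) ^ 2 * (1 + w) ^ 2 * q ^ 2 / c ^ 6) by (field; lra).
  rewrite Eq. 
  apply Rle_trans with ((33 / 50) ^ 2 * (17577 / 10000) ^ 2 * (15322 / 10000) / c ^ 5).
  - replace ((33 / 50) ^ 2 * (17577 / 10000) ^ 2 * (15322 / 10000) / c ^ 5) with ((33 / 50) ^ 2 * (17577 / 10000) ^ 2 * (15322 / 10000 * c) / c ^ 6) by (field; lra).
    unfold Rdiv. apply Rmult_le_compat_r; [left; apply Rinv_0_lt_compat, pow_lt; lra|].
    apply Rmult_le_compat; [nra|lra| |lra]. apply Rmult_le_compat_l; [lra|]. apply pow_incr. lra.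
  - assert ((5 / 2) ^ 5 <= c ^ 5) by (apply pow_incr; lra). apply Rle_div_l; [lra|]. lra.
Qed.

Lemma Right0 (f f1 : C -> C) : SolH (rect (above (- (1 / 20))) (above (287 / 100))) f f1 ->
  (forall x, rect (above (- (1 / 20))) (above (287 / 100)) x -> Nsq f f1 x < bup (Re x) (Im x) ^ 2) ->
  exists F F1, SolH (rect (above (5 / 2)) (above (- (29 / 10)))) F F1 /\
    (forall x, rect (above (5 / 2)) (above (287 / 100)) x -> F x = f x /\ F1 x = f1 x) /\
    (forall c u, 5 / 2 < c -> 286 / 100 <= u < 29 / 10 ->
      Cmod (F ((c, - u) : C)) <= 1457 / 10000 * wt (c, - u) /\ Cmod (F1 ((c, - u) : C)) <= 1457 / 10000 * wt (c, - u)).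
Proof.
  intros Sf HN.
  assert (Hstart : forall c, 5 / 2 < c -> Nsq f f1 ((c, 3) : C) < bup c 3 ^ 2).
  { intros c Hc. apply (HN ((c, 3) : C)). split; unfold above; simpl; lra. }
  destruct (Down (above (5 / 2)) (- (29 / 10)) (287 / 100) 3 1 f f1) as [F [F1 [SF HF]]].
  - apply above_open.
  - apply above_conv.
  - lra.
  - apply (Sol_sub _ _ _ _ _ (rect (above (- (1 / 20))) (above (287 / 100)))); [|exact Sf].
    intros x [x1 x2]. split; [unfold above in *; lra|exact x2].
  - intros c t Jc Ht. unfold above in Jc. rewrite Cmod_pair. assert (q := rad_ge_l c t). rewrite Rabs_pos_eq in q by lra. lra.
  - intros c s eta g g1 Jc Hs Heta Sg G0 G1. unfold above in Jc.
    destruct (right_line _ g g1 c s Sg ltac:(lra) ltac:(lra)) as [h1 h2].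
    + intros u Hu. rewrite <- down_point. apply tube_line; [apply Cmod_mCi|exact Heta|lra].
    + rewrite (Nsq_ext _ _ f f1) by assumption. apply Hstart, Jc.
    + destruct (Rle_dec s 3) as [hs|hs].
      * apply (Nsq_bup_le g g1 c (3 - s)); [lra| |apply h1, hs]. assert (q := rad_ge_l c (3 - s)). rewrite Rabs_pos_eq in q by lra. lra.
      * apply Nsq_le; [lra|]. eapply Rlt_le_trans; [apply h2; lra|].
        assert (Hwt : wt (c, - (s - 3)) <= 1).
        { unfold wt. rewrite <- Rinv_1. apply Rinv_le_contravar; [lra|]. rewrite <- sqrt_1. apply sqrt_le_1_alt.
          rewrite Cmod_pair. assert (q := rad_ge_l c (- (s - 3))). rewrite Rabs_pos_eq in q by lra. lra. }
        destruct (blow_wt c (s - 3)) as [b1 b2]; [lra|lra|]. apply pow_incr. lra.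
  - exists F, F1. split; [exact SF|]. split; [exact HF|].
    intros c u Hc Hu. destruct (right_line _ F F1 c (3 + u) SF ltac:(lra) ltac:(lra)) as [_ h2].
    + intros v Hv. split; unfold above; simpl; lra.
    + rewrite (Nsq_ext _ _ f f1) by (apply HF; split; unfold above; simpl; lra). apply Hstart, Hc.
    + specialize (h2 ltac:(lra)). replace (3 - (3 + u)) with (- u) in h2 by ring. replace (3 + u - 3) with u in h2 by ring.
      destruct (blow_wt c u) as [b1 b2]; [lra|lra|]. apply Nsq_le in h2; lra.
Qed.

(** The two levels of the bootstrap: [weak] feeds [V3_improve], [strong] is what it returns, and
    [V3_short] loses no more than the gap on a short descent. *)
Definition strong (g g1 : C -> C) (x : C) : Prop :=
  Cmod (g x) <= 215 / 1000 * wt x /\ Cmod (g1 x) <= 262 / 1000 * wt x.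

Definition weak (g g1 : C -> C) (x : C) : Prop := Cmod (g x) <= wt x / 4 /\ Cmod (g1 x) <= 1.

Lemma strong_weak g g1 (c t : R) : 5 / 2 <= c -> t <= - (286 / 100) -> strong g g1 (c, t) -> weak g g1 (c, t).
Proof.
  intros Hc Ht [h1 h2]. destruct (wt_bounds (c, t) Hc Ht) as [w _]. split; lra.
Qed.

(** Over a height of at most 3/100 crude bounds suffice: the energy at most adds y times the length,
    and |h| then grows at a rate below 4/10 y. The weight itself changes by a factor of at most
    1.004. *)
Lemma V3_short (U : C -> Prop) (g g1 : C -> C) (c t l : R) : SolH U g g1 -> 5 / 2 <= c -> t <= - (286 / 100) -> 0 <= l <= 3 / 100 ->
  (forall u, 0 <= u <= l -> U ((c, t - u) : C)) -> strong g g1 (c, t) -> weak g g1 (c, t - l).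
Proof.
  intros Sg Hc Ht Hl HU [S0 S1].
  destruct (wt_bounds (c, t) Hc Ht) as [[y0 y1] [_ [y2 _]]]. set (y := wt (c, t)) in *. rewrite Cmod_pair in y2.
  (* 339/1000 is the root of 0.215^2 + 0.262^2, rounded up. *)
  assert (N0 : Nsq g g1 ((c, t) : C) < (339 / 1000 * y) ^ 2).
  { unfold Nsq. assert (Cmod (g (c, t)) ^ 2 <= (215 / 1000 * y) ^ 2) by (apply pow_incr; split; [apply Cmod_ge_0|exact S0]).
    assert (Cmod (g1 (c, t)) ^ 2 <= (262 / 1000 * y) ^ 2) by (apply pow_incr; split; [apply Cmod_ge_0|exact S1]). nra. }
  assert (Hrmono : forall u, 0 <= u -> rad c t <= rad c (t - u)).
  { intros u Hu. unfold rad. apply sqrt_le_1_alt. nra. }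
  assert (Hr379 : 379 / 100 <= rad c t).
  { assert (E := rad_sq c t). assert (R0 := rad_ge0 c t). nra. }
  assert (HN : forall u, 0 <= u <= l -> Nsq g g1 ((c, t - u) : C) < ((339 / 1000 + u) * y) ^ 2).
  { apply (energy_down U g g1 c t l (fun u => (339 / 1000 + u) * y) (fun _ => y)); auto.
    - intros u Hu. split; [apply HU, Hu|]. rewrite <- rad_sq. apply pow_lt. specialize (Hrmono u ltac:(lra)). lra.
    - intros u Hu. split; [auto_derive; [exact I|ring]|]. apply Rmult_lt_0_compat; lra.
    - rewrite Rplus_0_r. exact N0.
    - intros u Hu. rewrite <- rad_sq. rewrite Rmax_left.
      2:{ apply Rle_div_l; [apply pow_lt; specialize (Hrmono u ltac:(lra)); lra|]. lra. }
      rewrite Rmult_0_l, Rplus_0_l.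
      assert (k1 : ((339 / 1000 + u) * y) ^ 2 / 4 <= y / 10) by nra.
      assert (k2 : kH / (rad c (t - u) ^ 2) ^ 2 <= kH / (rad c t ^ 2) ^ 2).
      { unfold Rdiv. apply Rmult_le_compat_l; [unfold kH; lra|]. apply Rinv_le_contravar; [apply pow_lt, pow_lt; lra|].
        apply pow_incr. split; [apply pow2_ge_0|]. apply pow_incr. split; [lra|apply Hrmono; lra]. }
      assert (k3 : kH / (rad c t ^ 2) ^ 2 = kH * y ^ 8).
      { replace (y ^ 8) with ((rad c t * y ^ 2) ^ 4 / (rad c t) ^ 4) by (field; lra). rewrite y2. field. lra. }
      assert (k4 : kH * y ^ 8 <= y / 10).
      { replace (y ^ 8) with (y ^ 7 * y) by ring. assert (y ^ 7 <= (5132 / 10000) ^ 7) by (apply pow_incr; lra). unfold kH. nra. }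
      lra. }
  set (ln := fun u : R => ((c, t) + RtoC u * (- Ci))%C : C).
  assert (Eln : forall u, ln u = ((c, t - u) : C)) by (intros u; apply down_point).
  assert (Hg : forall u, 0 <= u <= l -> 0 < ((2151 / 10000 + 4 / 10 * u) * y) ^ 2 - Cmod (g (ln u)) ^ 2).
  { apply (barrier _ (fun u => 2 * ((2151 / 10000 + 4 / 10 * u) * y) * (4 / 10 * y) - 2 * Cdot (g (ln u)) (g1 (ln u) * (- Ci))%C)).
    - intros u Hu. apply (is_derive_minus (fun u => ((2151 / 10000 + 4 / 10 * u) * y) ^ 2)).
      + auto_derive; [exact I|ring].
      + apply (pder_sq (fun u => g (ln u))). apply (pder_comp g ln); [|apply pder_line].
        rewrite Eln. apply (Sg _ (HU u Hu)).
    - rewrite Eln, Rminus_0_r. assert (q := Cmod_ge_0 (g (c, t))).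
      assert (Cmod (g (c, t)) ^ 2 <= (215 / 1000 * y) ^ 2) by (apply pow_incr; lra). nra.
    - intros u Hu Hz _. specialize (HN u Hu). rewrite Eln in *.
      assert (0 < (339 / 1000 + u) * y) by (apply Rmult_lt_0_compat; lra).
      assert (q1 : Cmod (g1 ((c, t - u) : C)) <= (339 / 1000 + u) * y) by (apply Nsq_le in HN; lra).
      assert (qd := Cdot_le (g ((c, t - u) : C)) (g1 ((c, (t - u)%R) : C) * - Ci)%C). rewrite Cmod_mult, Cmod_mCi, Rmult_1_r in qd.
      set (m := Cmod (g ((c, t - u) : C))) in *. assert (m0 : 0 <= m) by apply Cmod_ge_0.
      set (B := (2151 / 10000 + 4 / 10 * u) * y) in *. assert (HB : 0 < B) by (unfold B; apply Rmult_lt_0_compat; lra).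
      assert (Em : m = B) by (assert ((B - m) * (B + m) = 0) by nra; nra).
      set (m1 := Cmod (g1 ((c, t - u) : C))) in *. rewrite Em in qd.
      assert (a1 : m1 < 4 / 10 * y) by (eapply Rle_lt_trans; [exact q1|]; apply Rmult_lt_compat_r; lra).
      assert (a2 : B * m1 < B * (4 / 10 * y)) by (apply Rmult_lt_compat_l; assumption). lra. }
  specialize (HN l ltac:(lra)). specialize (Hg l ltac:(lra)). rewrite Eln in Hg.
  assert (P1 : 0 < (339 / 1000 + l) * y) by (apply Rmult_lt_0_compat; lra). assert (P2 : 0 < (2151 / 10000 + 4 / 10 * l) * y) by (apply Rmult_lt_0_compat; lra).
  apply Nsq_le in HN; [|lra]. destruct HN as [_ q1].
  assert (q0 : Cmod (g ((c, t - l) : C)) < (2151 / 10000 + 4 / 10 * l) * y).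
  { assert (q := Cmod_ge_0 (g ((c, t - l) : C))). nra. }
  split; [|nra].
  destruct (wt_bounds (c, t - l)) as [[v0 v1] [_ [v2 _]]]; [exact Hc|simpl; lra|]. rewrite Cmod_pair in v2. set (v := wt (c, t - l)) in *.
  assert (Hrr : rad c (t - l) <= 1008 / 1000 * rad c t).
  { assert (E := rad_sq c t). assert (E2 := rad_sq c (t - l)).
    assert (rad c (t - l) <= rad c t + l).
    { assert (q := rad_ge_r c t). rewrite Rabs_left in q by lra. assert (0 <= rad c (t - l)) by apply rad_ge0. nra. }
    lra. }
  assert (y <= 1004 / 1000 * v); [|nra].
  assert (y ^ 2 <= 1008 / 1000 * v ^ 2).
  { replace (y ^ 2) with (y ^ 2 * (rad c (t - l) * v ^ 2)) by (rewrite v2; ring).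
    apply Rle_trans with (y ^ 2 * (1008 / 1000 * rad c t * v ^ 2)).
    - apply Rmult_le_compat_l; [nra|]. apply Rmult_le_compat_r; [nra|exact Hrr].
    - right. replace (y ^ 2 * (1008 / 1000 * rad c t * v ^ 2)) with (1008 / 1000 * v ^ 2 * (rad c t * y ^ 2)) by ring. rewrite y2. ring. }
  nra.
Qed.

(** The strip height d is the same for all n because the data at every stage are bounded by 1, so
    [H_local] gives one radius. Each stage adds discs, obtains [weak] on the new strip by
    [V3_short], and restores [strong] by [V3_improve] started from the fixed height -286/100, so
    that no loss accumulates. *)
Lemma V3_strips (f f1 : C -> C) : SolH (rect (above (5 / 2)) (above (- (29 / 10)))) f f1 ->
  (forall c u, 5 / 2 < c -> 286 / 100 <= u < 29 / 10 ->
    Cmod (f ((c, - u) : C)) <= 1457 / 10000 * wt (c, - u) /\ Cmod (f1 ((c, - u) : C)) <= 1457 / 10000 * wt (c, - u)) ->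
  exists d, 0 < d /\ forall n, exists g g1, SolH (rect (above (5 / 2)) (above (- (29 / 10) - INR n * d))) g g1 /\
    (forall x, rect (above (5 / 2)) (above (- (29 / 10))) x -> g x = f x /\ g1 x = f1 x) /\
    (forall c t, 5 / 2 < c -> - (29 / 10) - INR n * d < t <= - (286 / 100) -> strong g g1 (c, t)).
Proof.
  intros Sf Hf. destruct (H_local 1) as [del [Hdel Hloc]].
  set (d := Rmin (del / 4) (1 / 100)).
  assert (Hd : 0 < d) by (apply Rmin_case; lra). assert (Hd1 : d <= del / 4) by apply Rmin_l. assert (Hd2 : d <= 1 / 100) by apply Rmin_r.
  exists d. split; [exact Hd|].
  induction n as [|n [g [g1 [Sg [Hgf Hst]]]]].
  - exists f, f1. rewrite Rmult_0_l, Rminus_0_r. split; [exact Sf|]. split; [auto|].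
    intros c t Hc Ht. destruct (Hf c (- t) Hc ltac:(lra)) as [h1 h2]. rewrite Ropp_involutive in *.
    destruct (wt_bounds (c, t)) as [[w _] _]; [simpl; lra|simpl; lra|]. split; lra.
  - set (b := - (29 / 10) - INR n * d) in *.
    assert (Hb : b <= - (29 / 10)) by (unfold b; assert (0 <= INR n * d) by (apply Rmult_le_pos; [apply pos_INR|lra]); lra).
    replace (- (29 / 10) - INR (S n) * d) with (b - d) by (unfold b; rewrite S_INR; ring).
    set (Kr := rect (above (5 / 2)) (above b)) in *.
    set (ctr := fun c : R => ((c, b + d) : C)).
    assert (Hctr : forall c, 5 / 2 < c -> Kr (ctr c)) by (intros c Hc; split; unfold above, ctr; simpl; lra).
    assert (Hwk : forall c, 5 / 2 < c -> Cmod (g (ctr c)) <= 1 /\ Cmod (g1 (ctr c)) <= 1).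
    { intros c Hc. destruct (strong_weak g g1 c (b + d)) as [h1 h2]; [lra|lra|apply Hst; lra|].
      destruct (wt_bounds (c, b + d)) as [[_ w] _]; [simpl; lra|simpl; lra|]. unfold ctr. lra. }
    assert (Hex : forall c : {c : R | 5 / 2 < c}, exists q : (C -> C) * (C -> C), SolH (disc (ctr (proj1_sig c)) del) (fst q) (snd q) /\
      fst q (ctr (proj1_sig c)) = g (ctr (proj1_sig c)) /\ snd q (ctr (proj1_sig c)) = g1 (ctr (proj1_sig c))).
    { intros [c Hc]. simpl. destruct (Hwk c Hc) as [w0 w1].
      destruct (Hloc (ctr c) (g (ctr c)) (g1 (ctr c))) as [k [k1 [Sk [K0 K1]]]]; auto.
      - unfold ctr. rewrite Cmod_pair. assert (q := rad_ge_l c (b + d)). rewrite Rabs_pos_eq in q by lra. lra.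
      - exists (k, k1). auto. }
    apply choice in Hex. destruct Hex as [dat Hdat].
    (* Discs around points at height b + d, slightly inside the old domain, reach below b - d
       because d <= del/4. Cutting them at Re x = 5/2 keeps their vertical projections to height b +
       d in the old domain. *)
    set (K := fun i : option {c : R | 5 / 2 < c} => match i with None => Kr | Some c => fun x => disc (ctr (proj1_sig c)) del x /\ above (5 / 2) (Re x) end).
    set (G := fun i : option {c : R | 5 / 2 < c} => match i with None => g | Some c => fst (dat c) end).
    set (G1 := fun i : option {c : R | 5 / 2 < c} => match i with None => g1 | Some c => snd (dat c) end).
    assert (KO : forall i, openC (K i)).
    { intros [c|]; simpl; [|unfold Kr; auto with geo]. intros z [z1 z2].
      destruct (disc_open _ _ z z1) as [d1 [D1 E1]]. destruct (above_open _ _ z2) as [d2 [D2 E2]].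
      exists (Rmin d1 d2). split; [apply Rmin_case; lra|]. intros w Hw. split.
      - apply E1. eapply Rlt_le_trans; [exact Hw|apply Rmin_l].
      - apply E2. apply ReIm_close in Hw. eapply Rlt_le_trans; [apply Hw|apply Rmin_r]. }
    assert (KC : forall i, convexC (K i)).
    { intros [c|]; simpl; [|unfold Kr; auto with geo]. intros x y t [x1 x2] [y1 y2] Ht. split; [apply disc_convex; assumption|].
      replace (Re (x + RtoC t * (y - x))%C) with (Re x + t * (Re y - Re x)) by (unfold Re; simpl; ring). apply above_conv; assumption. }
    assert (KS : forall i, SolH (K i) (G i) (G1 i)).
    { intros [c|]; simpl; [|exact Sg]. apply (Sol_sub _ _ _ _ _ (disc (ctr (proj1_sig c)) del)); [intros x Hx; apply Hx|apply Hdat]. }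
    assert (Hjoin : forall c s, 5 / 2 < s -> K (Some c) (ctr s) -> G (Some c) (ctr s) = g (ctr s) /\ G1 (Some c) (ctr s) = g1 (ctr s)).
    { intros c s Hs Hk. destruct (Hdat c) as [_ [e0 e1]].
      apply (H_agree (K (Some c)) Kr (G (Some c)) (G1 (Some c)) g g1 (ctr (proj1_sig c))); auto.
      - apply (KC None).
      - apply KS.
      - split; [unfold disc; replace (ctr (proj1_sig c) - ctr (proj1_sig c))%C with (RtoC 0) by ring; rewrite Cmod_0; exact Hdel|].
        exact (proj2_sig c).
      - apply Hctr, (proj2_sig c). }
    assert (Hproj : forall c x, K (Some c) x -> 5 / 2 < Re x /\ K (Some c) (ctr (Re x))).
    { intros c x [x1 x2]. split; [exact x2|]. split; [|exact x2]. unfold disc in *.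
      replace (ctr (Re x) - ctr (proj1_sig c))%C with (RtoC (Re x - proj1_sig c)) by (apply injective_projections; simpl; ring).
      rewrite Cmod_R. eapply Rle_lt_trans; [|exact x1].
      replace (Re x - proj1_sig c) with (Re (x - ctr (proj1_sig c))%C) by reflexivity. apply Re_abs_le. }
    destruct (H_GlueConv _ K G G1) as [F [F1 [SF HF]]]; auto.
    { intros [c|] [c'|] x Hi Hj.
      - destruct (Hproj c x Hi) as [p1 p2]. destruct (Hproj c' x Hj) as [p3 p4]. exists (ctr (Re x)).
        destruct (Hjoin c (Re x) p1 p2) as [a1 a2]. destruct (Hjoin c' (Re x) p1 p4) as [b1 b2].
        rewrite a1, a2, b1, b2. auto.
      - destruct (Hproj c x Hi) as [p1 p2]. exists (ctr (Re x)). destruct (Hjoin c (Re x) p1 p2) as [a1 a2].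
        split; [exact p2|]. split; [apply Hctr, p1|]. rewrite a1, a2. auto.
      - destruct (Hproj c' x Hj) as [p1 p2]. exists (ctr (Re x)). destruct (Hjoin c' (Re x) p1 p2) as [a1 a2].
        split; [apply Hctr, p1|]. split; [exact p2|]. rewrite a1, a2. auto.
      - exists x. auto. }
    assert (SF' : SolH (rect (above (5 / 2)) (above (b - d))) F F1).
    { apply (Sol_sub _ _ _ _ _ (fun x => exists i, K i x)); [|exact SF]. intros x [x1 x2].
      destruct (Rlt_le_dec b (Im x)) as [h|h]; [exists None; split; assumption|].
      exists (Some (exist _ (Re x) x1)). split; [|exact x1]. unfold disc. simpl.
      replace (x - ctr (Re x))%C with ((0, Im x - (b + d)) : C) by (apply injective_projections; unfold ctr, Re, Im; simpl; ring).
      unfold above in x2. rewrite Cmod_pair. unfold rad. replace (0 ^ 2 + (Im x - (b + d)) ^ 2) with ((b + d - Im x) ^ 2) by ring.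
      rewrite sqrt_pow2 by lra. lra. }
    assert (HFg : forall x, Kr x -> F x = g x /\ F1 x = g1 x) by (intros x Hx; apply (HF None x Hx)).
    exists F, F1. split; [exact SF'|]. split.
    + intros x [x1 x2]. destruct (HFg x) as [a1 a2]; [split; [exact x1|unfold above in *; lra]|].
      destruct (Hgf x) as [b1 b2]; [split; assumption|]. rewrite a1, a2, b1, b2. auto.
    + assert (Hst' : forall c t, 5 / 2 < c -> b < t <= - (286 / 100) -> strong F F1 (c, t)).
      { intros c t Hc Ht. destruct (HFg (c, t)) as [a1 a2]; [split; unfold above; simpl; lra|].
        unfold strong. rewrite a1, a2. apply Hst; lra. }
      assert (Hweak : forall c t, 5 / 2 < c -> b - d < t <= - (286 / 100) -> weak F F1 (c, t)).
      { intros c t Hc Ht. destruct (Rlt_le_dec b t) as [h|h].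
        - apply strong_weak; [lra|lra|]. apply Hst'; lra.
        - replace t with (b + d - (b + d - t)) by ring. apply (V3_short _ F F1 c (b + d) (b + d - t) SF'); try lra.
          + intros u Hu. split; unfold above; simpl; lra.
          + apply Hst'; lra. }
      intros c t Hc Ht. replace t with (- (286 / 100) - (- (286 / 100) - t)) by ring.
      apply (V3_improve _ F F1 c (- (286 / 100) - t) SF'); [lra|lra| |].
      * intros v u Hv Hu. split; [split; unfold above; simpl; lra|]. apply (Hweak (c + v) (- (286 / 100) - u)); lra.
      * destruct (HFg (c, - (286 / 100))) as [a1 _]; [split; unfold above; simpl; lra|].
        destruct (Hgf (c, - (286 / 100))) as [b1 _]; [split; unfold above; simpl; lra|].
        rewrite a1, b1. apply Hf; lra.
Qed.

Lemma RightHalf (f f1 : C -> C) : SolH (rect (above (5 / 2)) (above (- (29 / 10)))) f f1 ->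
  (forall c u, 5 / 2 < c -> 286 / 100 <= u < 29 / 10 ->
    Cmod (f ((c, - u) : C)) <= 1457 / 10000 * wt (c, - u) /\ Cmod (f1 ((c, - u) : C)) <= 1457 / 10000 * wt (c, - u)) ->
  exists g g1, SolH (fun x => 5 / 2 < Re x) g g1 /\
    (forall x, rect (above (5 / 2)) (above (- (29 / 10))) x -> g x = f x /\ g1 x = f1 x) /\
    (forall c t, 5 / 2 < c -> t <= - (286 / 100) -> strong g g1 (c, t)).
Proof.
  intros Sf Hf. destruct (V3_strips f f1 Sf Hf) as [d [Hd Hex]].
  assert (Hex' : forall n : nat, exists q : (C -> C) * (C -> C), SolH (rect (above (5 / 2)) (above (- (29 / 10) - INR n * d))) (fst q) (snd q) /\
    (forall x, rect (above (5 / 2)) (above (- (29 / 10))) x -> fst q x = f x /\ snd q x = f1 x) /\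
    (forall c t, 5 / 2 < c -> - (29 / 10) - INR n * d < t <= - (286 / 100) -> strong (fst q) (snd q) (c, t))).
  { intros n. destruct (Hex n) as [g [g1 H]]. exists (g, g1). exact H. }
  apply choice in Hex'. destruct Hex' as [dat Hdat].
  assert (Hn : forall n, - (29 / 10) - INR n * d <= - (29 / 10)) by (intros n; assert (0 <= INR n * d) by (apply Rmult_le_pos; [apply pos_INR|lra]); lra).
  destruct (H_GlueConv nat (fun n => rect (above (5 / 2)) (above (- (29 / 10) - INR n * d))) (fun n => fst (dat n)) (fun n => snd (dat n))) as [g [g1 [Sg Hg]]].
  - intros n. auto with geo.
  - intros n. auto with geo.
  - intros n. apply Hdat.
  - intros i j x _ _. exists ((3, 0) : C). destruct (Hdat i) as [_ [a _]]. destruct (Hdat j) as [_ [b _]].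
    assert (h : rect (above (5 / 2)) (above (- (29 / 10))) ((3, 0) : C)) by (split; unfold above; simpl; lra).
    destruct (a _ h) as [a1 a2]. destruct (b _ h) as [b1 b2]. rewrite a1, a2, b1, b2.
    generalize (Hn i) (Hn j). intros. repeat split; unfold above; simpl; lra.
  - assert (Hcov : forall x : C, 5 / 2 < Re x -> exists n, rect (above (5 / 2)) (above (- (29 / 10) - INR n * d)) x).
    { intros x Hx. destruct (INR_unbounded (- Im x / d)) as [n Hnn]. exists n. split; [exact Hx|]. unfold above.
      apply Rlt_div_l in Hnn; [|exact Hd]. lra. }
    exists g, g1. split; [|split].
    + apply (Sol_sub _ _ _ _ _ (fun x => exists n : nat, rect (above (5 / 2)) (above (- (29 / 10) - INR n * d)) x)); assumption.
    + intros x Hx. destruct (Hg O x) as [e0 e1]; [rewrite Rmult_0_l, Rminus_0_r; exact Hx|]. rewrite e0, e1. apply (Hdat O), Hx.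
    + intros c t Hc Ht. destruct (Hcov ((c, t) : C) Hc) as [n Hx]. destruct (Hg n _ Hx) as [e0 e1]. unfold strong. rewrite e0, e1.
      apply (Hdat n); [exact Hc|]. destruct Hx as [_ h]. unfold above in h. simpl in h. lra.
Qed.

(** Lines start at Re x = 251/100, just inside the half-plane, where [strong] gives an energy below
    (18/100)^2; the length 256/100 leads to Re x = -1/20. *)
Lemma LowerLeft (g g1 : C -> C) : SolH (fun x => 5 / 2 < Re x) g g1 ->
  (forall c t, 5 / 2 < c -> t <= - (286 / 100) -> strong g g1 (c, t)) ->
  exists F F1, SolH (rect (above (- (1 / 20))) (below (- (287 / 100)))) F F1 /\
    (forall x, rect (above (5 / 2)) (below (- (287 / 100))) x -> F x = g x /\ F1 x = g1 x).
Proof.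
  intros Sg Hst. set (Kr := rect (above (5 / 2)) (below (- (287 / 100)))).
  set (pt := fun t : R => ((251 / 100, t) : C)).
  assert (Epl : forall t u, (pt t + RtoC u * (- (1)))%C = ((251 / 100 - u, t) : C)) by (intros; apply left_point).
  assert (Hm1 : Cmod (- (1))%C = 1) by (rewrite Cmod_opp; apply Cmod_1).
  assert (HN : forall t, t <= - (287 / 100) -> Nsq g g1 (pt t) < (18 / 100) ^ 2 /\ Cmod (g (pt t)) <= 1 /\ Cmod (g1 (pt t)) <= 1).
  { intros t Ht. destruct (Hst (251 / 100) t ltac:(lra) ltac:(lra)) as [h1 h2].
    destruct (wt_bounds (251 / 100, t)) as [[w0 w1] _]; [simpl; lra|simpl; lra|]. fold (pt t) in *.
    assert (q0 := Cmod_ge_0 (g (pt t))). assert (q1 := Cmod_ge_0 (g1 (pt t))).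
    split; [|lra]. unfold Nsq.
    assert (Cmod (g (pt t)) ^ 2 <= (215 / 1000 * (5132 / 10000)) ^ 2) by (apply pow_incr; lra).
    assert (Cmod (g1 (pt t)) ^ 2 <= (262 / 1000 * (5132 / 10000)) ^ 2) by (apply pow_incr; lra). lra. }
  assert (Hex : forall t : {t : R | t < - (287 / 100)}, exists q : R * (C -> C) * (C -> C), let '(eta, k, k1) := q in
    0 < eta /\ eta <= 1 / 100 /\ eta <= - (287 / 100) - proj1_sig t /\ SolH (tube (- (1)) (pt (proj1_sig t)) eta (256 / 100)) k k1 /\
    k (pt (proj1_sig t)) = g (pt (proj1_sig t)) /\ k1 (pt (proj1_sig t)) = g1 (pt (proj1_sig t))).
  { intros [t Ht]. simpl. destruct (HN t ltac:(lra)) as [n0 [n1 n2]].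
    destruct (H_Tube (- (1))%C (pt t) (256 / 100) 100 (g (pt t)) (g1 (pt t))) as [eta [k [k1 [Heta [Sk [K0 K1]]]]]]; auto; try lra.
    - intros u Hu. rewrite Epl, Cmod_pair. assert (q := rad_ge_r (251 / 100 - u) t). rewrite Rabs_left in q by lra. lra.
    - intros s eta k k1 Hs Heta Sk K0 K1. rewrite Epl. apply Nsq_le; [lra|].
      apply (H_left _ k k1 (251 / 100) t s Sk); try lra.
      + intros u Hu. rewrite <- Epl. apply tube_line; [exact Hm1|exact Heta|lra].
      + rewrite (Nsq_ext _ _ g g1) by assumption. exact n0.
    - set (e0 := Rmin (1 / 100) (- (287 / 100) - t)). assert (a1 : e0 <= 1 / 100) by apply Rmin_l. assert (a2 : e0 <= - (287 / 100) - t) by apply Rmin_r.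
      assert (a3 : 0 < e0) by (apply Rmin_case; lra).
      exists (Rmin eta e0, k, k1). assert (b1 := Rmin_l eta e0). assert (b2 := Rmin_r eta e0).
      split; [apply Rmin_case; lra|]. split; [lra|]. split; [lra|]. split; [|split; assumption].
      apply (Sol_sub _ _ _ _ _ (tube (- (1)) (pt t) eta (256 / 100))); [|exact Sk]. intros x. apply tube_shrink, b1. }
  apply choice in Hex. destruct Hex as [dat Hdat].
  set (et := fun n => fst (fst (dat n))). set (gg := fun n => snd (fst (dat n))). set (gg1 := fun n => snd (dat n)).
  assert (Hd : forall t, 0 < et t /\ et t <= 1 / 100 /\ et t <= - (287 / 100) - proj1_sig t /\ SolH (tube (- (1)) (pt (proj1_sig t)) (et t) (256 / 100)) (gg t) (gg1 t) /\
    gg t (pt (proj1_sig t)) = g (pt (proj1_sig t)) /\ gg1 t (pt (proj1_sig t)) = g1 (pt (proj1_sig t))).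
  { intros t. specialize (Hdat t). unfold et, gg, gg1. destruct (dat t) as [[a b] c]. exact Hdat. }
  clearbody et gg gg1. clear Hdat dat.
  set (I := option {t : R | t < - (287 / 100)}).
  set (K := fun i : I => match i with None => Kr | Some t => tube (- (1)) (pt (proj1_sig t)) (et t) (256 / 100) end).
  set (G := fun i : I => match i with None => g | Some t => gg t end).
  set (G1 := fun i : I => match i with None => g1 | Some t => gg1 t end).
  assert (SKr : SolH Kr g g1) by (apply (Sol_sub _ _ _ _ _ (fun x => 5 / 2 < Re x)); [intros x Hx; apply Hx|exact Sg]).
  assert (Hin : forall t x, K (Some t) x -> Rabs (Im x - proj1_sig t) < et t).
  { intros t x Hx. apply tube_left in Hx. apply Hx. }
  assert (Hjoin : forall t s, Rabs (s - proj1_sig t) < et t -> K (Some t) (pt s) /\ Kr (pt s) /\ gg t (pt s) = g (pt s) /\ gg1 t (pt s) = g1 (pt s)).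
  { intros t s Hs. destruct (Hd t) as [d1 [d2 [d3 [d4 [d5 d6]]]]].
    assert (k1 : forall r, Rabs (r - proj1_sig t) < et t -> K (Some t) (pt r)).
    { intros r Hr. apply tube_left. simpl. split; [lra|exact Hr]. }
    assert (k2 : forall r, Rabs (r - proj1_sig t) < et t -> Kr (pt r)).
    { intros r Hr. apply Rabs_lt_between in Hr. split; unfold above, below; simpl; lra. }
    split; [apply k1, Hs|]. split; [apply k2, Hs|].
    assert (h0 : Rabs (proj1_sig t - proj1_sig t) < et t) by (replace (proj1_sig t - proj1_sig t) with 0 by ring; rewrite Rabs_R0; lra).
    apply (H_agree (K (Some t)) Kr (gg t) (gg1 t) g g1 (pt (proj1_sig t))); auto.
    - apply tube_convex.
    - unfold Kr. auto with geo. }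
  destruct (H_GlueConv I K G G1) as [F [F1 [SF HF]]].
  - intros [t|]; simpl; [apply tube_open, Hm1|unfold Kr; auto with geo].
  - intros [t|]; simpl; [apply tube_convex|unfold Kr; auto with geo].
  - intros [t|]; simpl; [apply Hd|exact SKr].
  - intros [t|] [t'|] x Hi Hj.
    + destruct (Hjoin t (Im x) (Hin t x Hi)) as [a1 [a2 [a3 a4]]]. destruct (Hjoin t' (Im x) (Hin t' x Hj)) as [b1 [b2 [b3 b4]]].
      exists (pt (Im x)). simpl. rewrite a3, a4, b3, b4. auto.
    + destruct (Hjoin t (Im x) (Hin t x Hi)) as [a1 [a2 [a3 a4]]]. exists (pt (Im x)). auto.
    + destruct (Hjoin t' (Im x) (Hin t' x Hj)) as [b1 [b2 [b3 b4]]]. exists (pt (Im x)). simpl. auto.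
    + exists x. auto.
  - exists F, F1. split; [|intros x Hx; apply (HF None x Hx)].
    apply (Sol_sub _ _ _ _ _ (fun x => exists i, K i x)); [|exact SF]. intros x [x1 x2]. unfold above, below in *.
    destruct (Rlt_le_dec (5 / 2) (Re x)) as [h|h]; [exists None; split; assumption|].
    set (t0 := exist (fun t => t < - (287 / 100)) (Im x) x2). exists (Some t0). simpl. apply tube_left. simpl.
    destruct (Hd t0) as [d1 _]. set (ee := et t0) in *. clearbody ee. replace (Im x - Im x) with 0 by ring. rewrite Rabs_R0. split; lra.
Qed.

(** The half-plane Re x > -1/20 without a rectangle adjoining its boundary. The upper and lower arms
    are disjoint and meet only the right half-plane, so the gluing meets no monodromy. *)
Definition Gr (x : C) : Prop :=
  (- (1 / 20) < Re x /\ 287 / 100 < Im x) \/ 5 / 2 < Re x \/ (- (1 / 20) < Re x /\ Im x < - (287 / 100)).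

Theorem right_solution (V : C -> Prop) (h h1 : C -> C) (K T : R) : SolH V h h1 -> 2 * kH <= K -> 10 <= T ->
  (forall t, T < t -> V ((0, t) : C) /\ Nsq h h1 ((0, t) : C) < (K / t ^ 4) ^ 2) ->
  exists T' H H1, SolH Gr H H1 /\
    (forall t, T' < t -> H ((0, t) : C) = h ((0, t) : C)) /\
    (forall t, 287 / 100 < t -> Nsq H H1 ((0, t) : C) < bup 0 t ^ 2).
Proof.
  intros SV HK HT HV. destruct (Upper V h h1 K T SV HK HT HV) as [T' [f [f1 [Sf [Hax HN]]]]].
  destruct (Right0 f f1 Sf HN) as [f2 [f21 [Sf2 [Hf2 Hb2]]]].
  destruct (RightHalf f2 f21 Sf2 Hb2) as [g [g1 [Sg [Hg Hst]]]].
  destruct (LowerLeft g g1 Sg Hst) as [k [k1 [Sk Hk]]].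
  set (Kx := fun i : option bool => match i with
    | None => rect (above (- (1 / 20))) (above (287 / 100))
    | Some true => rect (above (5 / 2)) (fun _ => True)
    | Some false => rect (above (- (1 / 20))) (below (- (287 / 100))) end).
  set (Gx := fun i : option bool => match i with None => f | Some true => g | Some false => k end).
  set (Gx1 := fun i : option bool => match i with None => f1 | Some true => g1 | Some false => k1 end).
  assert (OT : openR (fun _ => True)) by (intros c _; exists 1; split; [lra|auto]).
  assert (CT : convR (fun _ => True)) by (intros a b t _ _ _; exact I).
  assert (E1 : exists z, Kx None z /\ Kx (Some true) z /\ f z = g z /\ f1 z = g1 z).
  { exists ((3, 3) : C). split; [split; unfold above; simpl; lra|]. split; [split; [unfold above; simpl; lra|exact I]|].
    destruct (Hg (3, 3)) as [a1 a2]; [split; unfold above; simpl; lra|].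
    destruct (Hf2 (3, 3)) as [b1 b2]; [split; unfold above; simpl; lra|]. rewrite a1, a2, b1, b2. auto. }
  assert (E2 : exists z, Kx (Some true) z /\ Kx (Some false) z /\ g z = k z /\ g1 z = k1 z).
  { exists ((3, -3) : C). split; [split; [unfold above; simpl; lra|exact I]|]. split; [split; unfold above, below; simpl; lra|].
    destruct (Hk (3, -3)) as [a1 a2]; [split; unfold above, below; simpl; lra|]. rewrite a1, a2. auto. }
  destruct (H_GlueConv _ Kx Gx Gx1) as [H [H1 [SH HH]]].
  - intros [[]|]; simpl; auto with geo.
  - intros [[]|]; simpl; auto with geo.
  - intros [[]|]; simpl; auto. apply (Sol_sub _ _ _ _ _ (fun x => 5 / 2 < Re x)); [intros x Hx; apply Hx|exact Sg].
  - intros [[]|] [[]|] x Hi Hj; try (exists x; auto; fail).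
    + exact E2.
    + destruct E1 as [z [z1 [z2 [z3 z4]]]]. exists z. simpl. auto.
    + destruct E2 as [z [z1 [z2 [z3 z4]]]]. exists z. simpl. auto.
    + exfalso. destruct Hi as [_ i2]. destruct Hj as [_ j2]. unfold above, below in *. lra.
    + exact E1.
    + exfalso. destruct Hi as [_ i2]. destruct Hj as [_ j2]. unfold above, below in *. lra.
  - assert (HF : forall t, 287 / 100 < t -> H ((0, t) : C) = f ((0, t) : C) /\ H1 ((0, t) : C) = f1 ((0, t) : C)).
    { intros t Ht. apply (HH None). split; unfold above; simpl; lra. }
    exists (Rmax T' 3), H, H1. split; [|split].
    + apply (Sol_sub _ _ _ _ _ (fun x => exists i, Kx i x)); [|exact SH].
      intros x [[x1 x2]|[x1|[x1 x2]]]; [exists None|exists (Some true)|exists (Some false)]; split; auto.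
    + intros t Ht. assert (q1 := Rmax_l T' 3). assert (q2 := Rmax_r T' 3).
      rewrite (proj1 (HF t ltac:(lra))). apply Hax. lra.
    + intros t Ht. rewrite (Nsq_ext _ _ f f1) by (apply HF; exact Ht). apply (HN ((0, t) : C)). split; unfold above; simpl; lra.
Qed.

(** * Decay of h' along the imaginary axis *)

Lemma MVT_line (f df : R -> R) (a b : R) : a < b -> (forall t, a <= t <= b -> is_derive f t (df t)) ->
  exists c, a <= c <= b /\ f b - f a = df c * (b - a).
Proof.
  intros Hab Hd. destruct (MVT_gen f a b df) as [c [Hc E]].
  - intros x Hx. rewrite Rmin_left, Rmax_right in Hx by lra. apply Hd. lra.
  - intros x Hx. rewrite Rmin_left, Rmax_right in Hx by lra. apply (is_derive_continuity_pt f x (df x)), Hd. lra.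
  - rewrite Rmin_left, Rmax_right in Hc by lra. exists c. split; assumption.
Qed.

(* phi' takes its mean value on [t, t + 1], and (s phi')' is small. *)
Lemma slope_bound (phi p1 p2 : R -> R) (t E D : R) : 1 <= t ->
  (forall s, t <= s <= t + 1 -> is_derive phi s (p1 s) /\ is_derive p1 s (p2 s)) ->
  (forall s, t <= s <= t + 1 -> Rabs (phi s) <= E /\ Rabs (s * p2 s + p1 s) <= s * D) ->
  Rabs (p1 t) <= 4 * E + 2 * D.
Proof.
  intros Ht Hd Hb.
  destruct (MVT_line phi p1 t (t + 1)) as [xi [Hxi E1]]; [lra|intros s Hs; apply Hd, Hs|].
  assert (E0 : 0 <= E) by (eapply Rle_trans; [apply Rabs_pos|apply (Hb t ltac:(lra))]).
  assert (D0 : 0 <= D) by (assert (q := Rle_trans _ _ _ (Rabs_pos _) (proj2 (Hb t ltac:(lra)))); nra).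
  assert (b1 : Rabs (p1 xi) <= 2 * E).
  { replace (p1 xi) with (phi (t + 1) - phi t) by lra.
    destruct (Hb t ltac:(lra)) as [c1 _]. destruct (Hb (t + 1) ltac:(lra)) as [c2 _].
    eapply Rle_trans; [apply Rabs_triang|]. rewrite Rabs_Ropp. lra. }
  assert (b2 : Rabs (t * p1 t) <= (t + 1) * (2 * E) + (t + 1) * D).
  { destruct (Req_dec t xi) as [<-|n].
    - rewrite Rabs_mult, (Rabs_pos_eq t) by lra. assert (q := Rabs_pos (p1 t)). nra.
    - destruct (MVT_line (fun s => s * p1 s) (fun s => s * p2 s + p1 s) t xi) as [c [Hc E2]]; [lra| |].
      + intros s Hs. destruct (Hd s ltac:(lra)) as [_ h].
        replace (s * p2 s + p1 s) with (1 * p1 s + s * p2 s) by ring.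
        apply (is_derive_mult (fun s => s) p1 s 1 (p2 s)); [apply @is_derive_id|exact h|intros; apply Rmult_comm].
      + destruct (Hb c ltac:(lra)) as [_ h].
        replace (t * p1 t) with (xi * p1 xi - (c * p2 c + p1 c) * (xi - t)) by lra.
        eapply Rle_trans; [apply Rabs_triang|]. rewrite Rabs_Ropp, !Rabs_mult, (Rabs_pos_eq xi), (Rabs_pos_eq (xi - t)) by lra.
        assert (q := Rabs_pos (p1 xi)). assert (q2 := Rabs_pos (c * p2 c + p1 c)).
        apply Rplus_le_compat; [nra|]. apply Rle_trans with ((c * D) * 1); [apply Rmult_le_compat; lra|nra]. }
  rewrite Rabs_mult, (Rabs_pos_eq t) in b2 by lra.
  assert (q := Rabs_pos (p1 t)). nra.
Qed.

(** The asymptotics bound h only; the bound on h' comes from the equation. For F(s) = h(is) it reads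
    (s F')' = -s (F + F^2/2 + kH/s^4), so s F' varies little on an interval of length 1, and
    [slope_bound] applies to the real and imaginary parts. *)
Lemma axis_Nsq (V : C -> Prop) (h h1 : C -> C) (K T : R) : SolH V h h1 -> 0 <= K -> 1 <= T -> K <= T ->
  (forall t, T < t -> V ((0, t) : C) /\ Cmod (h ((0, t) : C)) <= K / t ^ 4) ->
  forall t, T < t -> Nsq h h1 ((0, t) : C) < ((20 * K + 10) / t ^ 4) ^ 2.
Proof.
  intros Sh HK HT HKT Hb t Ht.
  set (F := fun s : R => h (0 + RtoC s * Ci)%C). set (F1 := fun s : R => (h1 (0 + RtoC s * Ci) * Ci)%C).
  assert (Ep : forall s : R, (0 + RtoC s * Ci)%C = ((0, s) : C)) by (intros s; apply injective_projections; simpl; ring).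
  set (h2 := fun x : C => (- / x * h1 x + 1 * h x + / 2 * (h x * h x) + RtoC kH / (x * x * (x * x)))%C).
  set (F2 := fun s : R => (h2 (0 + RtoC s * Ci) * Ci * Ci)%C).
  set (E := K / t ^ 4).
  assert (t4 : 0 < t ^ 4) by (apply pow_lt; lra).
  assert (tp : 1 <= t ^ 3) by (rewrite <- (pow1 3); apply pow_incr; lra).
  assert (E0 : 0 <= E) by (apply Rdiv_le_0_compat; lra).
  assert (E1 : E <= 1) by (unfold E; apply Rle_div_l; [lra|]; replace (t ^ 4) with (t ^ 3 * t) by ring; nra).
  assert (dF : forall s, t <= s <= t + 1 -> pder F s (F1 s) /\ pder F1 s (F2 s)).
  { intros s Hs. destruct (Hb s ltac:(lra)) as [HV _]. destruct (Sh _ HV) as [_ [d1 d2]]. rewrite <- Ep in d1, d2. split.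
    - apply (pder_comp h (fun s => (0 + RtoC s * Ci)%C)); [exact d1|apply pder_line].
    - apply (pder_comp (fun x => (h1 x * Ci)%C) (fun s => (0 + RtoC s * Ci)%C)); [|apply pder_line].
      eapply cderiv_val; [exact (cderiv_mult _ _ _ _ _ d2 (cderiv_const Ci _))|]. unfold h2. ring. }
  assert (bF : forall s, t <= s <= t + 1 -> Cmod (F s) <= E).
  { intros s Hs. destruct (Hb s ltac:(lra)) as [_ h0]. unfold F. rewrite Ep. eapply Rle_trans; [exact h0|].
    unfold E, Rdiv. apply Rmult_le_compat_l; [exact HK|]. apply Rinv_le_contravar; [exact t4|]. apply pow_incr; lra. }
  set (D := 3 / 2 * E + kH / t ^ 4).
  assert (bG : forall s, t <= s <= t + 1 -> Cmod (RtoC s * F2 s + F1 s)%C <= s * D).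
  { intros s Hs. assert (s0 : RtoC s <> 0%C) by (intros e; injection e; lra).
    assert (i0 : Ci <> 0%C) by (intros e; injection e; lra).
    assert (s4 : t ^ 4 <= s ^ 4) by (apply pow_incr; lra).
    replace (RtoC s * F2 s + F1 s)%C with (- (RtoC s * (F s + / 2 * (F s * F s) + RtoC (kH / s ^ 4))))%C.
    - rewrite Cmod_opp, Cmod_mult, Cmod_R, Rabs_pos_eq by lra. apply Rmult_le_compat_l; [lra|].
      specialize (bF s Hs). assert (q := Cmod_ge_0 (F s)).
      eapply Rle_trans; [apply Cmod_triangle|]. unfold D. apply Rplus_le_compat.
      + eapply Rle_trans; [apply Cmod_triangle|]. rewrite !Cmod_mult, Cmod_inv, Cmod_R, Rabs_pos_eq; [nra|lra|intros e; injection e; lra].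
      + rewrite Cmod_R, Rabs_pos_eq; [|unfold kH; apply Rdiv_le_0_compat; lra].
        unfold kH, Rdiv. apply Rmult_le_compat_l; [lra|]. apply Rinv_le_contravar; [exact t4|exact s4].
    - unfold F2, F1, h2. fold (F s). set (g1 := h1 (0 + RtoC s * Ci)%C). rewrite Cplus_0_l in *.
      rewrite RtoC_div, RtoC_pow by lra.
      assert (ii : (Ci * Ci)%C = (- (1))%C) by (apply injective_projections; simpl; ring).
      replace (RtoC s * Ci * (RtoC s * Ci) * (RtoC s * Ci * (RtoC s * Ci)))%C with (RtoC s * RtoC s * (RtoC s * RtoC s) * ((Ci * Ci) * (Ci * Ci)))%C by ring.
      replace (/ (RtoC s * Ci))%C with (- Ci / RtoC s)%C.
      2:{ field_simplify_eq; [|split; assumption]. replace (Ci ^ 2)%C with (Ci * Ci)%C by ring. rewrite ii. ring. }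
      match goal with |- ?l = ?r => replace r with (RtoC s * (- (- Ci / RtoC s) * g1 + 1 * F s + / 2 * (F s * F s) + RtoC kH / (RtoC s * RtoC s * (RtoC s * RtoC s) * (Ci * Ci * (Ci * Ci)))) * (Ci * Ci) + g1 * Ci)%C by ring end.
      rewrite ii. field. exact s0. }
  assert (Hs1 : forall (pr : C -> R), (pr = Re \/ pr = Im) -> Rabs (pr (F1 t)) <= 4 * E + 2 * D).
  { intros pr Hpr. apply (slope_bound (fun s => pr (F s)) (fun s => pr (F1 s)) (fun s => pr (F2 s)) t E D); [lra| |].
    - intros s Hs. destruct (dF s Hs) as [d1 d2]. destruct Hpr as [->| ->]; split; (apply pder_Re + apply pder_Im); assumption.
    - intros s Hs. split.
      + eapply Rle_trans; [|apply (bF s Hs)]. destruct Hpr as [->| ->]; [apply Re_abs_le|apply Im_abs_le].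
      + eapply Rle_trans; [|apply (bG s Hs)].
        replace (s * pr (F2 s) + pr (F1 s)) with (pr (RtoC s * F2 s + F1 s)%C) by (destruct Hpr as [->| ->]; unfold Re, Im; simpl; ring).
        destruct Hpr as [->| ->]; [apply Re_abs_le|apply Im_abs_le]. }
  assert (B1 : Cmod (h1 ((0, t) : C)) <= 14 * E + 4 * (kH / t ^ 4)).
  { replace (Cmod (h1 ((0, t) : C))) with (Cmod (F1 t)).
    - eapply Rle_trans; [apply Cmod_le_ReIm|]. assert (a := Hs1 Re (or_introl eq_refl)). assert (b := Hs1 Im (or_intror eq_refl)). unfold D in *. lra.
    - unfold F1. rewrite Ep, Cmod_mult, <- (Cmod_opp Ci), Cmod_mCi. ring. }
  assert (B0 : Cmod (h ((0, t) : C)) <= E) by (rewrite <- Ep; apply (bF t); lra).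
  assert (P : 0 < / t ^ 4) by (apply Rinv_0_lt_compat, t4).
  assert (EE : (20 * K + 10) / t ^ 4 = 20 * E + 10 * / t ^ 4) by (unfold E; field; lra).
  rewrite EE. unfold Nsq. replace (kH / t ^ 4) with (kH * / t ^ 4) in B1 by reflexivity. unfold kH in B1.
  set (w := / t ^ 4) in *. assert (q0 := Cmod_ge_0 (h ((0, t) : C))). assert (q1 := Cmod_ge_0 (h1 ((0, t) : C))).
  assert (Cmod (h ((0, t) : C)) ^ 2 <= E ^ 2) by (apply pow_incr; lra).
  assert (Cmod (h1 ((0, t) : C)) ^ 2 <= (14 * E + 3 * w) ^ 2) by (apply pow_incr; lra).
  nra.
Qed.

(** * Complex powers *)

Definition cis (t : R) : C := (cos t, sin t).

Lemma Cmod_cis (t : R) : Cmod (cis t) = 1.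
Proof. unfold Cmod, cis; simpl. replace (cos t * (cos t * 1) + sin t * (sin t * 1)) with 1; [apply sqrt_1|]. generalize (sin2_cos2 t). unfold Rsqr. lra. Qed.

Lemma cis_plus (s t : R) : (cis (s + t) = cis s * cis t)%C.
Proof. unfold cis. rewrite cos_plus, sin_plus. apply injective_projections; simpl; ring. Qed.

Lemma cis_0 : cis 0 = 1%C.
Proof. unfold cis. rewrite cos_0, sin_0. reflexivity. Qed.

Lemma cis_conj (t : R) : Cconj (cis t) = cis (- t).
Proof. unfold cis, Cconj; simpl. rewrite cos_neg, sin_neg. reflexivity. Qed.

Lemma cis_pder (t : R) : pder cis t (Ci * cis t)%C.
Proof.
  apply pder_ReIm; unfold cis, Re, Im; simpl; auto_derive; try exact I; ring.
Qed.

Lemma Cexp_cis (z : C) : Cexp z = (RtoC (exp (Re z)) * cis (Im z))%C.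
Proof. reflexivity. Qed.

Lemma Cexp_Ci (t : R) : Cexp (Ci * RtoC t)%C = cis t.
Proof.
  rewrite Cexp_cis. replace (Re (Ci * RtoC t)%C) with 0 by (unfold Re; simpl; ring).
  replace (Im (Ci * RtoC t)%C) with t by (unfold Im; simpl; ring). rewrite exp_0. ring.
Qed.

Lemma Cexp_plus (a b : C) : Cexp (a + b)%C = (Cexp a * Cexp b)%C.
Proof.
  rewrite !Cexp_cis. replace (Re (a + b)%C) with (Re a + Re b) by reflexivity. replace (Im (a + b)%C) with (Im a + Im b) by reflexivity.
  rewrite exp_plus, cis_plus, RtoC_mult. ring.
Qed.

Lemma Cmod_Cexp (z : C) : Cmod (Cexp z) = exp (Re z).
Proof. rewrite Cexp_cis, Cmod_mult, Cmod_cis, Cmod_R, Rabs_pos_eq by (left; apply exp_pos). ring. Qed.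

Lemma Cexp_nz (z : C) : Cexp z <> 0%C.
Proof. apply Cmod_nz. rewrite Cmod_Cexp. apply exp_pos. Qed.

Lemma Cexp_small (eps : R) : 0 < eps -> exists d, 0 < d /\ forall w, Cmod w < d -> Cmod (Cexp w - 1 - w)%C <= eps * Cmod w.
Proof.
  intros He. assert (dexp : is_derive exp 0 1) by (auto_derive; [exact I|rewrite exp_0; ring]).
  destruct (proj1 (rderiv_eps exp 0 1) dexp (eps / 4)) as [d1 [Hd1 h1]]; [lra|].
  destruct (cis_pder 0 (eps / 8)) as [d2 [Hd2 h2]]; [lra|].
  exists (Rmin (Rmin d1 d2) (Rmin 1 (eps / 4))). split; [repeat apply Rmin_case; lra|]. intros w Hw.
  assert (l1 : Cmod w < d1) by (eapply Rlt_le_trans; [exact Hw|]; eapply Rle_trans; apply Rmin_l).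
  assert (l2 : Cmod w < d2) by (eapply Rlt_le_trans; [exact Hw|]; eapply Rle_trans; [apply Rmin_l|apply Rmin_r]).
  assert (l3 : Cmod w < 1) by (eapply Rlt_le_trans; [exact Hw|]; eapply Rle_trans; [apply Rmin_r|apply Rmin_l]).
  assert (l4 : Cmod w < eps / 4) by (eapply Rlt_le_trans; [exact Hw|]; eapply Rle_trans; apply Rmin_r).
  assert (a := Re_abs_le w). assert (b := Im_abs_le w). set (x := Re w) in *. set (y := Im w) in *. set (m := Cmod w) in *.
  specialize (h1 x). specialize (h2 y). rewrite !Rminus_0_r in h1, h2. rewrite exp_0 in h1. rewrite cis_0 in h2.
  specialize (h1 ltac:(lra)). specialize (h2 ltac:(lra)).
  rewrite Cexp_cis. fold x y.
  assert (Ew : w = (RtoC x + Ci * RtoC y)%C) by (apply injective_projections; unfold x, y, Re, Im; simpl; ring).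
  replace (RtoC (exp x) * cis y - 1 - w)%C with
    (RtoC (exp x - 1 - 1 * x) * cis y + (RtoC (1 + x) * (cis y - 1 - Ci * 1 * RtoC y) + RtoC x * (Ci * RtoC y)))%C.
  2:{ rewrite Ew, !RtoC_minus, RtoC_plus, RtoC_mult. ring. }
  eapply Rle_trans; [apply Cmod_triangle|].
  assert (Ci1 : Cmod Ci = 1) by (rewrite <- Cmod_opp; apply Cmod_mCi).
  eapply Rle_trans; [apply Rplus_le_compat_l, Cmod_triangle|]. rewrite !Cmod_mult, !Cmod_R, Cmod_cis, Ci1.
  assert (qx := Rabs_pos x). assert (qy := Rabs_pos y). assert (q1 : Rabs (1 + x) <= 2) by (eapply Rle_trans; [apply Rabs_triang|]; rewrite Rabs_R1; lra).
  assert (q2 := Rabs_pos (1 + x)). set (Z := Cmod (cis y - 1 - Ci * 1 * RtoC y)%C) in *. assert (qz : 0 <= Z) by apply Cmod_ge_0.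
  assert (e1 : Rabs (1 + x) * Z <= 2 * (eps / 8 * Rabs y)) by (apply Rmult_le_compat; assumption).
  assert (e2 : Rabs x * (1 * Rabs y) <= eps / 4 * Rabs y) by (rewrite Rmult_1_l; apply Rmult_le_compat_r; lra).
  assert (m0 : 0 <= m) by apply Cmod_ge_0. nra.
Qed.

Lemma cderiv_Cexp (z : C) : cderiv Cexp z (Cexp z).
Proof.
  apply cderiv_eps. intros eps He. assert (P := Cmod_pos _ (Cexp_nz z)).
  destruct (Cexp_small (eps / Cmod (Cexp z))) as [d [Hd h]]; [apply Rdiv_lt_0_compat; lra|].
  exists d. split; [exact Hd|]. intros w Hw. specialize (h _ Hw).
  replace (Cexp w) with (Cexp (z + (w - z))%C) by (f_equal; ring). rewrite Cexp_plus.
  replace (Cexp z * Cexp (w - z) - Cexp z - Cexp z * (w - z))%C with (Cexp z * (Cexp (w - z) - 1 - (w - z)))%C by ring.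
  rewrite Cmod_mult. apply Rle_trans with (Cmod (Cexp z) * (eps / Cmod (Cexp z) * Cmod (w - z)%C)); [apply Rmult_le_compat_l; lra|].
  right. field. lra.
Qed.

Lemma Carg_polar (r t : R) : 0 < r -> - PI < t <= PI -> Carg (RtoC r * cis t)%C = t.
Proof.
  intros Hr Ht. unfold Carg.
  replace (Im (RtoC r * cis t)%C) with (r * sin t) by (unfold cis, Im; simpl; ring).
  replace (Re (RtoC r * cis t)%C) with (r * cos t) by (unfold cis, Re; simpl; ring).
  rewrite Cmod_mult, Cmod_cis, Cmod_R, Rabs_pos_eq, Rmult_1_r by lra.
  replace (r * cos t / r) with (cos t) by (field; lra).
  destruct (Rle_dec 0 (r * sin t)) as [h|h].
  - apply acos_cos. split; [|lra]. apply Rnot_lt_le. intros ht.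
    assert (sin t < 0) by (apply sin_lt_0_var; lra). nra.
  - rewrite <- (cos_neg t), acos_cos; [ring|]. split; [|lra]. apply Rnot_lt_le. intros ht. apply h.
    apply Rmult_le_pos; [lra|]. apply sin_ge_0; lra.
Qed.

Lemma Carg_range (z : C) : - PI <= Carg z <= PI.
Proof. unfold Carg. assert (q := acos_bound (Re z / Cmod z)). destruct Rle_dec; lra. Qed.

Lemma polar (z : C) : z <> 0%C -> z = (RtoC (Cmod z) * cis (Carg z))%C.
Proof.
  intros Hz. assert (P := Cmod_pos z Hz). assert (E := Cmod_sqr z). assert (B := Re_abs_le z). apply Rabs_le_between in B.
  assert (Hb : -1 <= Re z / Cmod z <= 1).
  { split; [apply Rle_div_r; [exact P|]; lra|apply Rle_div_l; [exact P|]; lra]. }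
  assert (S0 : sin (acos (Re z / Cmod z)) = Rabs (Im z) / Cmod z).
  { rewrite sin_acos by exact Hb. unfold Rsqr. replace (1 - Re z / Cmod z * (Re z / Cmod z)) with ((Rabs (Im z) / Cmod z) ^ 2).
    - apply sqrt_pow2. apply Rdiv_le_0_compat; [apply Rabs_pos|exact P].
    - unfold Rdiv. rewrite Rpow_mult_distr, pow2_abs. apply (Rmult_eq_reg_r (Cmod z ^ 2)); [|apply pow_nonzero; lra].
      replace (Im z ^ 2 * (/ Cmod z) ^ 2 * Cmod z ^ 2) with (Im z ^ 2) by (field; lra).
      replace ((1 - Re z * / Cmod z * (Re z * / Cmod z)) * Cmod z ^ 2) with (Cmod z ^ 2 - Re z ^ 2) by (field; lra). lra. }
  unfold Carg, cis. destruct (Rle_dec 0 (Im z)) as [h|h].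
  - rewrite cos_acos, S0, Rabs_pos_eq by assumption. apply injective_projections; unfold Re, Im in *; simpl; field; lra.
  - rewrite cos_neg, sin_neg, cos_acos, S0, Rabs_left by lra. apply injective_projections; unfold Re, Im in *; simpl; field; lra.
Qed.

Lemma Carg_neq_mPI (z : C) : z <> 0%C -> - PI < Carg z.
Proof.
  intros Hz. destruct (Carg_range z) as [[h|h] _]; [exact h|]. exfalso.
  assert (P := PI_RGT_0). unfold Carg in h. destruct (Rle_dec 0 (Im z)) as [q|q].
  - assert (b := acos_bound (Re z / Cmod z)). lra.
  - assert (E := polar z Hz). unfold Carg in E. destruct (Rle_dec 0 (Im z)) as [q'|_]; [lra|]. rewrite <- h in E.
    apply q. rewrite E. unfold cis. rewrite sin_neg, sin_PI. unfold Im; simpl. lra.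
Qed.

(** Principal logarithm, built on the same [Carg] as [Cpowr]: the powers in the change of variables
    are exponentials of multiples of it, and inherit their derivatives from it. *)
Definition Clog (z : C) : C := (ln (Cmod z), Carg z).

Lemma Cexp_Clog (z : C) : z <> 0%C -> Cexp (Clog z) = z.
Proof.
  intros Hz. rewrite Cexp_cis. unfold Clog at 1. change (Re (ln (Cmod z), Carg z)) with (ln (Cmod z)).
  rewrite exp_ln by (apply Cmod_pos, Hz). symmetry. apply polar, Hz.
Qed.

Lemma Clog_polar (r t : R) : 0 < r -> - PI < t <= PI -> Clog (RtoC r * cis t)%C = (ln r, t).
Proof.
  intros Hr Ht. unfold Clog. rewrite Carg_polar by assumption. f_equal. f_equal.
  rewrite Cmod_mult, Cmod_cis, Cmod_R, Rabs_pos_eq; lra.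
Qed.

Lemma ln_near_1 (x : R) : 1 / 2 <= x -> Rabs (ln x) <= 2 * Rabs (x - 1).
Proof.
  intros Hx. assert (up : forall y, 0 < y -> ln y <= y - 1).
  { intros y Hy. assert (q := exp_ineq1_le (ln y)). rewrite exp_ln in q by exact Hy. lra. }
  assert (u1 := up x ltac:(lra)). assert (u2 := up (/ x) ltac:(apply Rinv_0_lt_compat; lra)). rewrite ln_Rinv in u2 by lra.
  assert (Hi : / x - 1 = (1 - x) / x) by (field; lra).
  destruct (Rle_lt_dec 1 x) as [h|h].
  - assert (0 <= ln x) by (rewrite <- ln_1; apply ln_le; lra). rewrite !Rabs_pos_eq; lra.
  - assert (ln x <= 0) by (rewrite <- ln_1; apply ln_le; lra). rewrite !Rabs_left1; try lra.
    assert ((1 - x) / x <= 2 * (1 - x)); [|lra]. apply Rle_div_l; nra.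
Qed.

Lemma atan_abs_le (x : R) : Rabs (atan x) <= Rabs x.
Proof.
  assert (P : forall y, 0 <= y -> 0 <= atan y <= y).
  { intros y Hy. destruct (Req_dec y 0) as [->|n]; [rewrite atan_0; lra|].
    split; [rewrite <- atan_0; left; apply atan_increasing; lra|].
    destruct (MVT_line atan (fun s => / (1 + s ^ 2)) 0 y) as [c [_ E]]; [lra| |].
    - intros t _. assert (q := derivable_pt_lim_atan t). apply is_derive_Reals in q.
      exact q.
    - rewrite atan_0 in E. assert (/ (1 + c ^ 2) <= 1) by (rewrite <- Rinv_1; apply Rinv_le_contravar; nra). nra. }
  destruct (Rle_lt_dec 0 x) as [h|h].
  - rewrite !Rabs_pos_eq; [apply P|..]; try assumption. apply P, h.
  - assert (q := P (- x) ltac:(lra)). rewrite atan_opp in q. rewrite !Rabs_left1; lra.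
Qed.

(** With p = w/z near 1, Clog w = Clog z + k where e^k = p: off the cut the argument of w stays in
    the principal range. The derivative at 1 then follows by inverting the first-order expansion of
    the exponential at 0. *)
Lemma cderiv_Clog (z : C) : z <> 0%C -> Carg z <> PI -> cderiv Clog z (/ z)%C.
Proof.
  intros Hz Hcut. assert (P := Cmod_pos z Hz). assert (c1 := Carg_neq_mPI z Hz). assert (c2 := Carg_range z).
  apply cderiv_eps. intros eps He.
  set (e := Rmin (1 / 2) (eps * Cmod z / 2)). assert (e0 : 0 < e) by (apply Rmin_case; [lra|apply Rdiv_lt_0_compat; nra]).
  assert (e1 : e <= 1 / 2) by apply Rmin_l. assert (e2 : e <= eps * Cmod z / 2) by apply Rmin_r.
  destruct (Cexp_small e e0) as [d [Hd Hex]].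
  set (rho := Rmin (Rmin (1 / 2) (d / 8)) (Rmin ((PI - Carg z) / 4) ((PI + Carg z) / 4))).
  assert (r0 : 0 < rho) by (repeat apply Rmin_case; lra).
  assert (r1 : rho <= 1 / 2) by (eapply Rle_trans; apply Rmin_l).
  assert (r2 : rho <= d / 8) by (eapply Rle_trans; [apply Rmin_l|apply Rmin_r]).
  assert (r3 : rho <= (PI - Carg z) / 4) by (eapply Rle_trans; [apply Rmin_r|apply Rmin_l]).
  assert (r4 : rho <= (PI + Carg z) / 4) by (eapply Rle_trans; apply Rmin_r).
  exists (rho * Cmod z). split; [apply Rmult_lt_0_compat; assumption|]. intros w Hw.
  set (q := ((w - z) / z)%C). assert (Eq : Cmod q = Cmod (w - z)%C / Cmod z) by (apply Cmod_div, Hz).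
  assert (Hq : Cmod q < rho) by (rewrite Eq; apply Rlt_div_l; assumption).
  set (m := Cmod q) in *. assert (m0 : 0 <= m) by apply Cmod_ge_0.
  assert (a := Re_abs_le q). assert (b := Im_abs_le q). fold m in a, b.
  set (p := (1 + q)%C).
  assert (Rp : Re p = 1 + Re q) by reflexivity. assert (Ip : Im p = Im q) by (unfold p, Im; simpl; ring).
  assert (Rq := a). apply Rabs_le_between in Rq.
  (* The argument of p is an arctangent because Re p > 0, which gives an explicit bound on k. *)
  set (k := ((ln (Cmod p), atan (Im p / Re p)) : C)).
  assert (Mp : Rabs (Cmod p - 1) <= m).
  { assert (t1 := Cmod_triangle 1 q). assert (t2 := Cmod_tri_rev 1 (- q)%C). replace (1 - - q)%C with p in t2 by (unfold p; ring).
    fold p m in t1. rewrite Cmod_opp in t2. fold m in t2. rewrite Cmod_1 in t1, t2. apply Rabs_le. lra. }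
  assert (Mp' := Mp). apply Rabs_le_between in Mp'.
  assert (k1 : Rabs (ln (Cmod p)) <= 2 * m) by (eapply Rle_trans; [apply ln_near_1; lra|]; lra).
  assert (k2 : Rabs (atan (Im p / Re p)) <= 2 * m).
  { eapply Rle_trans; [apply atan_abs_le|]. unfold Rdiv. rewrite Rabs_mult, Ip, Rp, (Rabs_pos_eq (/ (1 + Re q))) by (left; apply Rinv_0_lt_compat; lra).
    assert (/ (1 + Re q) <= 2) by (replace 2 with (/ (1 / 2)) by field; apply Rinv_le_contravar; lra).
    assert (0 < / (1 + Re q)) by (apply Rinv_0_lt_compat; lra). assert (q0 := Rabs_pos (Im q)). nra. }
  assert (Ek : Cexp k = p).
  { rewrite Cexp_cis. change (Re k) with (ln (Cmod p)). change (Im k) with (atan (Im p / Re p)). rewrite exp_ln by lra.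
    assert (P2 : 0 < Re p) by (rewrite Rp; lra). assert (PM : 0 < Cmod p) by lra.
    assert (Esq : sqrt (1 + Rsqr (Im p / Re p)) = Cmod p / Re p).
    { replace (1 + Rsqr (Im p / Re p)) with ((Cmod p / Re p) ^ 2); [apply sqrt_pow2, Rdiv_le_0_compat; lra|].
      unfold Rdiv, Rsqr. rewrite Rpow_mult_distr, Cmod_sqr. field. lra. }
    unfold cis. rewrite cos_atan, sin_atan, Esq. transitivity ((Re p, Im p) : C); [|apply pair_eta].
    generalize (Cmod p) (Re p) (Im p) P2 PM. intros.
    apply injective_projections; simpl; field; lra. }
  assert (EL : Clog w = (Clog z + k)%C).
  { apply Rabs_le_between in k2.
    assert (Ew : w = (RtoC (Cmod z * Cmod p) * cis (Carg z + atan (Im p / Re p)))%C).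
    { transitivity (Cexp (Clog z + k)%C).
      - rewrite Cexp_plus, Cexp_Clog, Ek by exact Hz. unfold p, q. field. exact Hz.
      - rewrite Cexp_cis. replace (Re (Clog z + k)%C) with (ln (Cmod z) + ln (Cmod p)) by reflexivity.
        rewrite exp_plus, !exp_ln by lra. reflexivity. }
    rewrite Ew, Clog_polar; [|apply Rmult_lt_0_compat; lra|lra]. rewrite ln_mult by lra. reflexivity. }
  rewrite EL. replace (Clog z + k - Clog z - / z * (w - z))%C with (- (Cexp k - 1 - k))%C by (rewrite Ek; unfold p, q; field; exact Hz).
  rewrite Cmod_opp. assert (Hk : Cmod k <= 4 * m) by (eapply Rle_trans; [apply Cmod_le_ReIm|]; change (Rabs (ln (Cmod p)) + Rabs (atan (Im p / Re p)) <= 4 * m); lra).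
  assert (H1 := Hex k ltac:(lra)).
  (* Since q = k + (e^k - 1 - k) and the last term is at most |k|/2, the crude bound 4m improves to
     2m, the one needed for eps. *)
  assert (H2 : Cmod k <= 2 * m).
  { replace k with (q - (Cexp k - 1 - k))%C in |- * at 1 by (rewrite Ek; unfold p; ring).
    assert (t := Cmod_tri_minus q (Cexp k - 1 - k)%C). fold m in t.
    replace (Cmod k) with (Cmod (q - (Cexp k - 1 - k))%C) in H1 by (f_equal; rewrite Ek; unfold p; ring).
    set (X := Cmod (Cexp k - 1 - k)%C) in *. set (Y := Cmod (q - (Cexp k - 1 - k))%C) in *. assert (0 <= Y) by apply Cmod_ge_0. nra. }
  eapply Rle_trans; [exact H1|]. apply Rle_trans with (eps * Cmod z / 2 * (2 * m)); [apply Rmult_le_compat; try lra; apply Cmod_ge_0|].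
  right. rewrite Eq. field. lra.
Qed.

Lemma Cpowr_polar (r t a : R) : 0 < r -> - PI < t <= PI -> Cpowr (RtoC r * cis t)%C a = (RtoC (Rpower r a) * cis (a * t))%C.
Proof.
  intros Hr Ht. unfold Cpowr. rewrite Carg_polar, Cexp_Ci by assumption. do 3 f_equal.
  rewrite Cmod_mult, Cmod_cis, Cmod_R, Rabs_pos_eq; lra.
Qed.

(** * The change of variables between z and x *)

Definition xrad (r : R) : R := Rpower (24 * r) (5 / 4) / 30.

Definition qvar (z : C) : C := (Ci * Cpowr (z / 6) (1 / 2))%C.

Lemma xvar_polar (r t : R) : 0 < r -> - PI < t <= PI -> xvar (RtoC r * cis t)%C = (RtoC (xrad r) * cis (PI / 4 + 5 / 4 * t))%C.
Proof.
  intros Hr Ht. unfold xvar, xrad. replace (24 * (RtoC r * cis t))%C with (RtoC (24 * r) * cis t)%C by (rewrite RtoC_mult; ring).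
  rewrite Cpowr_polar, Cexp_Ci, cis_plus, RtoC_div by lra. field.
Qed.

Lemma Ci_cis : Ci = cis (PI / 2).
Proof. unfold cis. rewrite cos_PI2, sin_PI2. reflexivity. Qed.

Lemma qvar_polar (r t : R) : 0 < r -> - PI < t <= PI -> qvar (RtoC r * cis t)%C = (RtoC (Rpower (r / 6) (1 / 2)) * cis (PI / 2 + / 2 * t))%C.
Proof.
  intros Hr Ht. unfold qvar. replace (RtoC r * cis t / 6)%C with (RtoC (r / 6) * cis t)%C.
  - rewrite Cpowr_polar by lra. rewrite cis_plus, <- Ci_cis. replace (1 / 2 * t) with (/ 2 * t) by field. ring.
  - rewrite RtoC_div by lra. field.
Qed.

(** [cX] and [cQ] are logarithms of the constant factors: x = exp(cX + (5/4) log z), and the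
    prefactor of y is exp(cQ + (1/2) log z). *)
Definition cX : C := (5 / 4 * ln 24 - ln 30, PI / 4).
Definition cQ : C := (- (/ 2 * ln 6), PI / 2).

Lemma Carg_le_PI (z : C) : z <> 0%C -> - PI < Carg z <= PI.
Proof. intros H. split; [apply Carg_neq_mPI, H|apply Carg_range]. Qed.

Lemma xvar_Cexp (z : C) : z <> 0%C -> xvar z = Cexp (cX + RtoC (5 / 4) * Clog z)%C.
Proof.
  intros Hz. assert (P := Cmod_pos z Hz). rewrite (polar z Hz) at 1.
  rewrite xvar_polar by (auto using Carg_le_PI). rewrite Cexp_cis. f_equal.
  - f_equal. unfold xrad, Rpower. rewrite ln_mult by lra.
    replace (Re (cX + RtoC (5 / 4) * Clog z)%C) with (5 / 4 * (ln 24 + ln (Cmod z)) + - ln 30) by (unfold cX, Clog, Re; simpl; ring).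
    rewrite exp_plus, exp_Ropp, exp_ln by lra. reflexivity.
  - f_equal. unfold cX, Clog, Im; simpl; ring.
Qed.

Lemma qvar_Cexp (z : C) : z <> 0%C -> qvar z = Cexp (cQ + RtoC (/ 2) * Clog z)%C.
Proof.
  intros Hz. assert (P := Cmod_pos z Hz). rewrite (polar z Hz) at 1.
  rewrite qvar_polar by (auto using Carg_le_PI). rewrite Cexp_cis. f_equal.
  - f_equal. unfold Rpower. f_equal. rewrite ln_div by lra. unfold cQ, Clog, Re; simpl; field.
  - f_equal. unfold cQ, Clog, Im; simpl; ring.
Qed.

Lemma xvar_nz (z : C) : z <> 0%C -> xvar z <> 0%C.
Proof. intros Hz. rewrite xvar_Cexp by exact Hz. apply Cexp_nz. Qed.

Lemma cderiv_Cexp_Clog (f : C -> C) (c a z : C) : (forall w : C, w <> 0%C -> f w = Cexp (c + a * Clog w)%C) ->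
  z <> 0%C -> Carg z <> PI -> cderiv f z (a * f z / z)%C.
Proof.
  intros Hf Hz Hc. apply (cderiv_ext_loc (fun w => Cexp (c + a * Clog w)%C) f z _ (Cmod z) (Cmod_pos z Hz)).
  - intros w Hw. symmetry. apply Hf. intros ->. replace (0 - z)%C with (- z)%C in Hw by ring. rewrite Cmod_opp in Hw. lra.
  - rewrite (Hf z Hz). eapply cderiv_val.
    + eapply (cderiv_comp Cexp (fun w => c + a * Clog w)%C z _ _ (cderiv_Cexp (c + a * Clog z)%C)).
      exact (cderiv_plus _ _ z _ _ (cderiv_const c z) (cderiv_scal a _ _ _ (cderiv_Clog z Hz Hc))).
    + cbv beta. field. exact Hz.
Qed.

Lemma qvar_sq (z : C) : z <> 0%C -> (qvar z * qvar z = - z / 6)%C.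
Proof.
  intros Hz. rewrite qvar_Cexp, <- Cexp_plus by exact Hz.
  replace (cQ + RtoC (/ 2) * Clog z + (cQ + RtoC (/ 2) * Clog z))%C with (((- ln 6)%R, PI) + Clog z)%C.
  - rewrite Cexp_plus, Cexp_Clog by exact Hz. rewrite Cexp_cis. unfold cis, Re, Im; simpl. rewrite cos_PI, sin_PI, exp_Ropp, exp_ln by lra.
    apply injective_projections; simpl; field.
  - apply injective_projections; unfold cQ, Clog; simpl; field.
Qed.

(** Together with [qvar_sq] this removes the fractional powers, so that the verification of P_I
    becomes an identity of rational functions. *)
Lemma qvar_xvar (z : C) : z <> 0%C -> (qvar z * (xvar z * xvar z) = - (32 * (z * z * z)) / 25)%C.
Proof.
  intros Hz. rewrite qvar_Cexp, xvar_Cexp, <- !Cexp_plus by exact Hz.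
  replace (cQ + RtoC (/ 2) * Clog z + (cX + RtoC (5 / 4) * Clog z + (cX + RtoC (5 / 4) * Clog z)))%C
    with (((- (/ 2 * ln 6) + (5 / 2 * ln 24 + - (2 * ln 30)))%R, PI) + (Clog z + (Clog z + Clog z)))%C.
  - rewrite (Cexp_plus _ (Clog z + (Clog z + Clog z))%C), (Cexp_plus (Clog z) (Clog z + Clog z)%C), (Cexp_plus (Clog z) (Clog z)), Cexp_Clog by exact Hz. rewrite Cexp_cis. unfold cis, Re, Im; simpl. rewrite cos_PI, sin_PI.
    replace (- (/ 2 * ln 6) + (5 / 2 * ln 24 + - (2 * ln 30))) with (ln (32 / 25)).
    + rewrite exp_ln by lra. apply injective_projections; simpl; field.
    + replace 24 with (6 * (2 * 2)) by ring. replace (32 / 25) with (6 * (2 * 2) * (6 * (2 * 2)) * 2 / (30 * 30)) by field.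
      rewrite ln_div, !ln_mult by lra. field.
  - apply injective_projections; unfold cQ, cX, Clog; simpl; field.
Qed.

Definition vprof (h : C -> C) (z : C) : C := (1 - 4 / (25 * (xvar z * xvar z)) + h (xvar z))%C.
Definition vprof1 (h1 : C -> C) (z : C) : C := (8 / (25 * (xvar z * (xvar z * xvar z))) + h1 (xvar z))%C.

Lemma y_of_h_vprof (h : C -> C) (z : C) : y_of_h h z = (qvar z * vprof h z)%C.
Proof. unfold y_of_h, vprof, qvar. replace (xvar z ^ 2)%C with (xvar z * xvar z)%C by (simpl; ring). reflexivity. Qed.

Definition dy_of_h (h h1 : C -> C) (z : C) : C := (qvar z / z * (vprof h z / 2 + 5 / 4 * (xvar z * vprof1 h1 z)))%C.

(** Chain rule with x' = (5/4) x/z and q' = q/(2z). The condition on the argument keeps z off the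
    cut, where these derivatives hold. *)
Lemma y_of_h_transfer (U V : C -> Prop) (h h1 : C -> C) : SolH V h h1 ->
  (forall z, U z -> z <> 0%C /\ Carg z <> PI /\ V (xvar z)) ->
  SolPI U (y_of_h h) (dy_of_h h h1).
Proof.
  intros Sh HU.
  set (v := vprof h). set (v1 := vprof1 h1). set (w := fun z => (qvar z * v z)%C). set (w1 := dy_of_h h h1).
  assert (Hw : SolPI U w w1).
  { intros z Hz. split; [exact I|]. destruct (HU z Hz) as [Hz0 [Hz1 HV]]. destruct (Sh _ HV) as [_ [d1 d2]].
    assert (X0 := xvar_nz z Hz0). assert (n25 : RtoC 25 <> 0%C) by (intros e; injection e; lra).
    assert (n2 : RtoC 2 <> 0%C) by (intros e; injection e; lra). assert (n4 : RtoC 4 <> 0%C) by (intros e; injection e; lra).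
    assert (n6 : RtoC 6 <> 0%C) by (intros e; injection e; lra). assert (n625 : RtoC 625 <> 0%C) by (intros e; injection e; lra).
    assert (dX := cderiv_Cexp_Clog xvar cX (RtoC (5 / 4)) z xvar_Cexp Hz0 Hz1).
    assert (dQ := cderiv_Cexp_Clog qvar cQ (RtoC (/ 2)) z qvar_Cexp Hz0 Hz1).
    assert (EQ := qvar_sq z Hz0). assert (EQX := qvar_xvar z Hz0).
    assert (dh := cderiv_comp h xvar z _ _ d1 dX). assert (dh1 := cderiv_comp h1 xvar z _ _ d2 dX).
    assert (dXX := cderiv_mult _ _ z _ _ dX dX). assert (dXXX := cderiv_mult _ _ z _ _ dX dXX).
    set (X := xvar z) in *. set (Q := qvar z) in *.
    assert (nXX : (25 * (X * X))%C <> 0%C) by (apply Cmult_neq_0; [exact n25|apply Cmult_neq_0; exact X0]).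
    assert (nXXX : (25 * (X * (X * X)))%C <> 0%C) by (apply Cmult_neq_0; [exact n25|apply Cmult_neq_0; [exact X0|apply Cmult_neq_0; exact X0]]).
    assert (dv : cderiv v z (RtoC (5 / 4) * X / z * v1 z)%C).
    { eapply cderiv_val.
      - apply cderiv_plus; [|exact dh]. apply cderiv_minus; [apply cderiv_const|].
        apply cderiv_div; [exact nXX|apply cderiv_const|apply cderiv_scal; exact dXX].
      - cbv beta. unfold v1, vprof1. fold X. rewrite RtoC_div by lra. field. repeat split; assumption. }
    set (h2 := (- / X * h1 X + 1 * h X + / 2 * (h X * h X) + RtoC kH / (X * X * (X * X)))%C) in *.
    assert (dv1 : cderiv v1 z (RtoC (5 / 4) * X / z * (h2 - 24 / (25 * (X * X * (X * X)))))%C).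
    { eapply cderiv_val.
      - apply cderiv_plus; [|exact dh1].
        apply cderiv_div; [exact nXXX|apply cderiv_const|apply cderiv_scal; exact dXXX].
      - cbv beta. fold X. rewrite RtoC_div by lra. field. repeat split; assumption. }
    rewrite RtoC_div in dX, dv, dv1 by lra. rewrite RtoC_inv in dQ by lra.
    split.
    - eapply cderiv_val; [exact (cderiv_mult _ _ z _ _ dQ dv)|]. cbv beta. unfold w1, dy_of_h. fold X Q v v1. field. repeat split; assumption.
    - eapply cderiv_val.
      + apply cderiv_mult.
        * apply cderiv_div; [exact Hz0|exact dQ|apply cderiv_id].
        * apply cderiv_plus; [apply cderiv_div; [exact n2|exact dv|apply cderiv_const]|].
          apply cderiv_scal. exact (cderiv_mult _ _ z _ _ dX dv1).
      (* Q^2 is replaced through [EQ] and the remaining factor Q through [EQX]; no power of z other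
         than integral ones survives. *)
      + cbv beta. fold X Q. unfold w. replace (qvar z * v z * (qvar z * v z))%C with (Q * Q * (v z * v z))%C by (unfold Q; ring).
        rewrite EQ. replace Q with (- (32 * (z * z * z)) / 25 / (X * X))%C by (rewrite <- EQX; field; exact X0).
        unfold h2, v1, v, vprof, vprof1. fold X. unfold kH. rewrite RtoC_div by lra. field. repeat split; assumption. }
  intros z Hz. destruct (Hw z Hz) as [_ [a b]]. split; [exact I|]. rewrite y_of_h_vprof. fold v. fold (w z).
  split; [|exact b]. apply (cderiv_ext w); [intros s; symmetry; apply y_of_h_vprof|exact a].
Qed.

(** * The solution on the ray arg z = pi/5 *)

Section IntegerPolynomials.

Import ZArith List ListNotations.

(** Polynomials with integer coefficients, lowest degree first, so that estimates reduce to integer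
    computation. A range is covered by intervals [c - 1, c + 1]; after the shift to c the sum of the
    absolute coefficients bounds the polynomial. *)
Fixpoint zev (l : list Z) (x : R) : R := match l with nil => 0 | c :: l => IZR c + x * zev l x end.
Fixpoint zadd (p q : list Z) : list Z :=
  match p, q with nil, _ => q | _, nil => p | a :: p, b :: q => (a + b)%Z :: zadd p q end.
Definition zscal (c : Z) (p : list Z) : list Z := map (Z.mul c) p.
Fixpoint zmul (p q : list Z) : list Z := match p with nil => nil | a :: p => zadd (zscal a q) (0%Z :: zmul p q) end.
Fixpoint zderiv (p : list Z) : list Z := match p with nil => nil | _ :: p => zadd p (0%Z :: zderiv p) end.
Fixpoint zshift (c : Z) (p : list Z) : list Z := match p with nil => nil | a :: p => zadd [a] (zmul [c; 1%Z] (zshift c p)) end.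
Fixpoint zabs (p : list Z) : Z := match p with nil => 0%Z | a :: p => (Z.abs a + zabs p)%Z end.

Lemma zev_add p q x : zev (zadd p q) x = zev p x + zev q x.
Proof. revert q. induction p as [|a p IH]; intros [|b q]; simpl; try ring. rewrite IH, plus_IZR. ring. Qed.

Lemma zev_scal c p x : zev (zscal c p) x = IZR c * zev p x.
Proof. induction p as [|a p IH]; simpl; [ring|]. rewrite IH, mult_IZR. ring. Qed.

Lemma zev_mul p q x : zev (zmul p q) x = zev p x * zev q x.
Proof. induction p as [|a p IH]; simpl; [ring|]. rewrite zev_add, zev_scal. simpl. rewrite IH. ring. Qed.

Lemma zev_deriv p x : is_derive (zev p) x (zev (zderiv p) x).
Proof.
  induction p as [|a p IH]; simpl; [apply @is_derive_const|].
  rewrite zev_add. simpl. replace (zev p x + (0 + x * zev (zderiv p) x)) with (0 + (1 * zev p x + x * zev (zderiv p) x)) by ring.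
  apply (is_derive_plus (fun _ => IZR a)); [apply @is_derive_const|].
  apply (is_derive_mult (fun y : R => y) (zev p) x 1 (zev (zderiv p) x)); [apply @is_derive_id|exact IH|intros; apply Rmult_comm].
Qed.

Lemma zev_shift c p x : zev (zshift c p) x = zev p (IZR c + x).
Proof. induction p as [|a p IH]; [reflexivity|]. cbn [zshift]. rewrite zev_add, zev_mul, IH. simpl. ring. Qed.

Lemma zev_abs p x : Rabs x <= 1 -> Rabs (zev p x) <= IZR (zabs p).
Proof.
  intros Hx. induction p as [|a p IH]; simpl; [rewrite Rabs_R0; lra|]. rewrite plus_IZR, abs_IZR.
  eapply Rle_trans; [apply Rabs_triang|]. apply Rplus_le_compat_l. rewrite Rabs_mult.
  assert (q := Rabs_pos (zev p x)). assert (q2 := Rabs_pos x). nra.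
Qed.

(* The profile P(s) = zev wp (10 s / 3) / 10^13 approximates e^(2 i pi / 5) y_t(s e^(i pi / 5)), a solution of w'' = 6 w^2 - s,
   on [0, 12/5]; its coefficients come from a least-squares fit. *)
Definition wp : list Z := [-187540 * 10 ^ 7; -304920 * 3 * 10 ^ 6; 105395 * 3 ^ 2 * 10 ^ 5; -50769 * 3 ^ 3 * 10 ^ 4;
  22285 * 3 ^ 4 * 10 ^ 3; -7275 * 3 ^ 5 * 10 ^ 2; 1447 * 3 ^ 6 * 10; -127 * 3 ^ 7]%Z.

(** 9 * 10^26 times the residual P'' - 6 P^2 + s, in the variable t = 10 s / 3, which makes all
    coefficients integers. *)
Definition wres : list Z :=
  zadd (zscal 1000000000000000 (zderiv (zderiv wp))) (zadd (zscal (-54) (zmul wp wp)) [0; 270000000000000000000000000])%Z.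

Lemma wres_ev t : zev wres t =
  1000000000000000 * zev (zderiv (zderiv wp)) t - 54 * zev wp t ^ 2 + 270000000000000000000000000 * t.
Proof.
  unfold wres. rewrite !zev_add, !zev_scal, zev_mul. cbn [zev]. ring.
Qed.

Lemma cover (t : R) : 0 <= t <= 8 -> exists c w, (c = 1 \/ c = 3 \/ c = 5 \/ c = 7)%Z /\ Rabs w <= 1 /\ t = IZR c + w.
Proof.
  intros Ht. destruct (Rle_lt_dec t 2); [exists 1%Z, (t - 1)|destruct (Rle_lt_dec t 4); [exists 3%Z, (t - 3)|
    destruct (Rle_lt_dec t 6); [exists 5%Z, (t - 5)|exists 7%Z, (t - 7)]]];
  (split; [auto|split; [apply Rabs_le; lra|lra]]).
Qed.

Lemma wres_bound (t : R) : 0 <= t <= 8 -> Rabs (zev wres t) <= 1485000000000000000000000.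
Proof.
  intros Ht. destruct (cover t Ht) as [c [w [Hc [Hw ->]]]]. rewrite <- zev_shift. eapply Rle_trans; [apply zev_abs, Hw|].
  apply Rle_trans with 1485000000000000000000000; [apply IZR_le; destruct Hc as [->|[->|[->| ->]]]; vm_compute; discriminate|lra].
Qed.

(** On each of the four intervals the constant coefficient of the shifted derivative is negative and
    outweighs all the others together. *)
Lemma wp_decr (t : R) : 0 <= t <= 8 -> zev (zderiv wp) t <= 0.
Proof.
  intros Ht. destruct (cover t Ht) as [c [w [Hc [Hw ->]]]]. rewrite <- zev_shift.
  assert (H : forall a l, (a + zabs l <= 0)%Z -> zev (a :: l) w <= 0).
  { intros a l Hl. apply IZR_le in Hl. rewrite plus_IZR in Hl. assert (q := zev_abs l w Hw). simpl.
    assert (q2 : Rabs (w * zev l w) <= 1 * IZR (zabs l)) by (rewrite Rabs_mult; apply Rmult_le_compat; try assumption; apply Rabs_pos).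
    apply Rabs_le_between in q2. lra. }
  destruct Hc as [->|[->|[->| ->]]]; match goal with |- zev ?l w <= 0 => let l' := eval vm_compute in l in replace l with l' by (vm_compute; reflexivity) end;
  apply H; vm_compute; discriminate.
Qed.

Lemma wp_deriv_bound (t : R) : 0 <= t <= 8 -> Rabs (zev (zderiv wp) t) <= 3000000000000.
Proof.
  intros Ht. destruct (cover t Ht) as [c [w [Hc [Hw ->]]]]. rewrite <- zev_shift. eapply Rle_trans; [apply zev_abs, Hw|].
  apply IZR_le. destruct Hc as [->|[->|[->| ->]]]; vm_compute; discriminate.
Qed.

End IntegerPolynomials.

Definition wP (s : R) : R := zev wp (10 / 3 * s) / 10000000000000.
Definition wP1 (s : R) : R := zev (zderiv wp) (10 / 3 * s) * (10 / 3) / 10000000000000.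
Definition wP2 (s : R) : R := zev (zderiv (zderiv wp)) (10 / 3 * s) * (10 / 3) ^ 2 / 10000000000000.

Lemma wP_derive (s : R) : is_derive wP s (wP1 s) /\ is_derive wP1 s (wP2 s).
Proof.
  assert (H : forall l, is_derive (fun s => zev l (10 / 3 * s)) s (10 / 3 * zev (zderiv l) (10 / 3 * s))).
  { intros l. apply (is_derive_comp (zev l) (fun s => 10 / 3 * s)); [apply zev_deriv|]. auto_derive; [exact I|ring]. }
  split.
  - apply is_derive_ext with (fun s => / 10000000000000 * zev wp (10 / 3 * s)); [intros t; unfold wP; match goal with |- ?a = ?b => change (@eq R a b) end; field|].
    replace (wP1 s) with (/ 10000000000000 * (10 / 3 * zev (zderiv wp) (10 / 3 * s))) by (unfold wP1; field). apply is_derive_scal, H.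
  - apply is_derive_ext with (fun s => (10 / 3) / 10000000000000 * zev (zderiv wp) (10 / 3 * s)); [intros t; unfold wP1; match goal with |- ?a = ?b => change (@eq R a b) end; field|].
    replace (wP2 s) with ((10 / 3) / 10000000000000 * (10 / 3 * zev (zderiv (zderiv wp)) (10 / 3 * s))) by (unfold wP2; field). apply is_derive_scal, H.
Qed.

Lemma wP_residual (s : R) : 0 <= s <= 12 / 5 -> Rabs (wP2 s - 6 * wP s ^ 2 + s) <= 165 / 100000.
Proof.
  intros Hs. assert (H := wres_bound (10 / 3 * s) ltac:(lra)). rewrite wres_ev in H.
  replace (wP2 s - 6 * wP s ^ 2 + s) with (/ 900000000000000000000000000 * (1000000000000000 * zev (zderiv (zderiv wp)) (10 / 3 * s) - 54 * zev wp (10 / 3 * s) ^ 2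
    + 270000000000000000000000000 * (10 / 3 * s))) by (unfold wP2, wP; field).
  rewrite Rabs_mult, Rabs_pos_eq by (left; apply Rinv_0_lt_compat; lra).
  apply Rle_trans with (/ 900000000000000000000000000 * 1485000000000000000000000); [apply Rmult_le_compat_l; [left; apply Rinv_0_lt_compat; lra|exact H]|].
  right. field.
Qed.

Lemma wP1_neg (s : R) : 0 <= s <= 12 / 5 -> wP1 s <= 0.
Proof. intros Hs. assert (H := wp_decr (10 / 3 * s) ltac:(lra)). unfold wP1. lra. Qed.

Lemma wP1_bound (s : R) : 0 <= s <= 12 / 5 -> Rabs (wP1 s) <= 1.
Proof. intros Hs. assert (H := wp_deriv_bound (10 / 3 * s) ltac:(lra)). apply Rabs_le_between in H. unfold wP1. apply Rabs_le. lra. Qed.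

Lemma wP_0 : wP 0 = - (18754 / 100000) /\ wP1 0 = - (30492 / 100000).
Proof. split; unfold wP, wP1; rewrite Rmult_0_r; simpl; field. Qed.

Lemma wP_neg (s : R) : 0 <= s <= 12 / 5 -> wP s <= - (18 / 100).
Proof.
  intros Hs. destruct wP_0 as [E _].
  assert (H := derive_nonpos_decr wP wP1 0 s (proj1 Hs) (fun t _ => proj1 (wP_derive t)) (fun t Ht => wP1_neg t ltac:(lra))). lra.
Qed.

(** The numbers compared with P(s0) and P'(s0) are the value and the derivative at s0 of the
    explicit part of w, that is, with h = 0: -sqrt(s/6) (1 + 4/(25 t^2)), where t = |x|. *)
Lemma wP_start : let s := 14641 / 6144 in let t := 161051 / 30720 in
  - (64 / 100) <= wP s <= - (63 / 100) /\
  Rabs (- (121 / 192) * (1 + 4 / (25 * t ^ 2)) - wP s) <= 4 / 10000 /\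
  Rabs (- (16 / 121) * (1 - 16 / (25 * t ^ 2)) - wP1 s) <= 75 / 100000.
Proof. simpl. unfold wP, wP1. simpl. split; [lra|]. split; apply Rabs_le; lra. Qed.

Definition om : C := cis (PI / 5).
(* s0 = n^4 / 24 with n = 11 / 4, which makes |xvar| = n^5 / 30 and the factor sqrt (s0 / 6) = n^2 / 12 rational. *)
Definition s0 : R := 14641 / 6144.

Lemma om_mod : Cmod om = 1.
Proof. apply Cmod_cis. Qed.

Lemma om5 : (om * om * (om * om) * om = - (1))%C.
Proof.
  unfold om. rewrite <- !cis_plus. replace (PI / 5 + PI / 5 + (PI / 5 + PI / 5) + PI / 5) with PI by field.
  unfold cis. rewrite cos_PI, sin_PI. apply injective_projections; simpl; ring.
Qed.

(* If y'' = 6 y^2 + z, then w(s) = om^2 y(s om) satisfies w'' = 6 w^2 - s. *)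
Definition dev0 (g : C -> C) (s : R) : C := (om * om * g (RtoC s * om) - RtoC (wP s))%C.
Definition dev1 (g1 : C -> C) (s : R) : C := (om * om * om * g1 (RtoC s * om) - RtoC (wP1 s))%C.
(** Energy of the linearized equation d'' = 12 P d, positive definite because P < 0. P decreases in
    s, so moving towards s = 0 the varying coefficient only lowers it. *)
Definition devE (g g1 : C -> C) (s : R) : R := Cmod (dev1 g1 s) ^ 2 - 12 * wP s * Cmod (dev0 g s) ^ 2.

Lemma pder_RtoC (f : R -> R) (t l : R) : is_derive f t l -> pder (fun s => RtoC (f s)) t (RtoC l).
Proof. intros H. apply pder_ReIm; [exact H|exact (@is_derive_const R_AbsRing R_NormedModule 0 t)]. Qed.

(** The linear terms cancel in the derivative of [devE]; what drives it is the residual 165/100000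
    of P and the term 6 d^2. Together they stay below 205/100000, less than the slope 21/10000 of
    the barrier. *)
Lemma ray_energy (U : C -> Prop) (g g1 : C -> C) (l : R) : SolPI U g g1 -> 0 <= l <= s0 ->
  (forall u, 0 <= u <= l -> U (RtoC (s0 - u) * om)%C) -> devE g g1 s0 < (57 / 10000) ^ 2 ->
  devE g g1 (s0 - l) < (57 / 10000 + 21 / 10000 * l) ^ 2.
Proof.
  intros Sg Hl HU H0. unfold s0 in Hl.
  set (a := fun u => dev0 g (s0 - u)). set (b := fun u => dev1 g1 (s0 - u)).
  assert (Hp : forall u, pder (fun u => RtoC (s0 - u) * om)%C u (- om)%C).
  { intros u. intros eps He. destruct (pder_line (RtoC s0 * om)%C (- om)%C u eps He) as [d [Hd h]]. exists d. split; [exact Hd|].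
    intros s Hs. specialize (h s Hs). replace (RtoC (s0 - s) * om - RtoC (s0 - u) * om - - om * RtoC (s - u))%C
      with (RtoC s0 * om + RtoC s * - om - (RtoC s0 * om + RtoC u * - om) - - om * RtoC (s - u))%C by (rewrite !RtoC_minus; ring). exact h. }
  assert (Hsub : forall (f : R -> R) u m, is_derive f (s0 - u) m -> is_derive (fun u => f (s0 - u)) u (- m)).
  { intros f u m Hf. replace (- m) with (-1 * m) by ring. apply (is_derive_comp f (fun u => s0 - u)); [exact Hf|auto_derive; [exact I|ring]]. }
  assert (Ha : forall u, 0 <= u <= l -> pder a u (- b u)%C).
  { intros u Hu. destruct (Sg _ (HU u Hu)) as [_ [d1 _]].
    eapply pder_val.
    - apply pder_minus; [|apply (pder_RtoC (fun u => wP (s0 - u))), Hsub, wP_derive].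
      apply (pder_comp (fun x => om * om * g x)%C (fun u => RtoC (s0 - u) * om)%C); [apply cderiv_scal; exact d1|apply Hp].
    - unfold b, dev1. rewrite RtoC_opp. ring. }
  set (res := fun u => wP2 (s0 - u) - 6 * wP (s0 - u) ^ 2 + (s0 - u)).
  assert (Hb : forall u, 0 <= u <= l -> pder b u (- (RtoC (12 * wP (s0 - u)) * a u + (6 * (a u * a u) - RtoC (res u))))%C).
  { intros u Hu. destruct (Sg _ (HU u Hu)) as [_ [_ d2]].
    eapply pder_val.
    - apply pder_minus; [|apply (pder_RtoC (fun u => wP1 (s0 - u))), Hsub, wP_derive].
      apply (pder_comp (fun x => om * om * om * g1 x)%C (fun u => RtoC (s0 - u) * om)%C); [apply cderiv_scal; exact d2|apply Hp].
    - set (zz := (RtoC (s0 - u) * om)%C). unfold a, dev0, res. fold zz. set (gz := g zz).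
      transitivity (- (6 * (om * om * gz * (om * om * gz)) + om * om * (om * om) * om * RtoC (s0 - u) - RtoC (wP2 (s0 - u))))%C.
      + unfold zz. rewrite RtoC_opp. ring.
      + rewrite om5. replace (RtoC (wP2 (s0 - u) - 6 * wP (s0 - u) ^ 2 + (s0 - u)))
          with (RtoC (wP2 (s0 - u)) - 6 * (RtoC (wP (s0 - u)) * RtoC (wP (s0 - u))) + RtoC (s0 - u))%C
          by (rewrite <- !RtoC_mult, <- RtoC_minus, <- RtoC_plus; f_equal; ring).
        rewrite RtoC_mult. ring. }
  assert (Hwp : forall u, 0 <= u <= l -> wP (s0 - u) <= - (18 / 100) /\ wP1 (s0 - u) <= 0 /\ Rabs (res u) <= 165 / 100000).
  { intros u Hu. assert (0 <= s0 - u <= 12 / 5) by (unfold s0; lra). split; [apply wP_neg|split; [apply wP1_neg|apply wP_residual]]; assumption. }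
  assert (HD : 0 < (57 / 10000 + 21 / 10000 * l) ^ 2 - (Cmod (b l) ^ 2 - 12 * wP (s0 - l) * Cmod (a l) ^ 2)).
  { apply (barrier (fun u => (57 / 10000 + 21 / 10000 * u) ^ 2 - (Cmod (b u) ^ 2 - 12 * wP (s0 - u) * Cmod (a u) ^ 2))
      (fun u => 2 * (57 / 10000 + 21 / 10000 * u) * (21 / 10000) - (2 * Cdot (b u) (- (RtoC (12 * wP (s0 - u)) * a u + (6 * (a u * a u) - RtoC (res u))))%C
         - (12 * - wP1 (s0 - u) * Cmod (a u) ^ 2 + 12 * wP (s0 - u) * (2 * Cdot (a u) (- b u)%C)))) 0 l); [| | |lra].
    - intros u Hu. apply (is_derive_minus (fun u => (57 / 10000 + 21 / 10000 * u) ^ 2)); [auto_derive; [exact I|ring]|].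
      apply (is_derive_minus (fun u => Cmod (b u) ^ 2)); [apply pder_sq, Hb, Hu|].
      apply (is_derive_mult (fun u => 12 * wP (s0 - u)) (fun u => Cmod (a u) ^ 2) u (12 * - wP1 (s0 - u)) (2 * Cdot (a u) (- b u)%C)).
      + apply is_derive_scal, Hsub, wP_derive.
      + apply pder_sq, Ha, Hu.
      + intros; apply Rmult_comm.
    - unfold devE in H0. unfold a, b. rewrite Rminus_0_r. lra.
    - intros u Hu Hz _. destruct (Hwp u Hu) as [w1 [w2 w3]].
      set (B := 57 / 10000 + 21 / 10000 * u) in *. assert (B0 : 0 < B <= 107 / 10000 + 1 / 20000) by (unfold B; lra).
      set (W := wP (s0 - u)) in *. set (av := Cmod (a u)) in *. set (bv := Cmod (b u)) in *.
      assert (a0 : 0 <= av) by apply Cmod_ge_0. assert (b0 : 0 <= bv) by apply Cmod_ge_0.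
      (* 216/100 is 12 * 18/100, from P <= -18/100. *)
      assert (E1 : bv <= B) by nra. assert (E2 : 216 / 100 * av ^ 2 <= B ^ 2) by nra.
      assert (Ex : Cdot (b u) (- (RtoC (12 * W) * a u + (6 * (a u * a u) - RtoC (res u))))%C
        = - (12 * W) * Cdot (a u) (b u) + Cdot (b u) (- (6 * (a u * a u) - RtoC (res u)))%C) by (unfold Cdot, Re, Im; simpl; ring).
      assert (Ey : Cdot (a u) (- b u)%C = - Cdot (a u) (b u)) by (unfold Cdot, Re, Im; simpl; ring).
      rewrite Ex, Ey.
      assert (Hc := Cdot_le (b u) (- (6 * (a u * a u) - RtoC (res u)))%C). fold bv in Hc. rewrite Cmod_opp in Hc.
      assert (Hm : Cmod (6 * (a u * a u) - RtoC (res u))%C <= 6 * av ^ 2 + 165 / 100000).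
      { eapply Rle_trans; [apply Cmod_tri_minus|]. rewrite !Cmod_mult, !Cmod_R, (Rabs_pos_eq 6) by lra. fold av. nra. }
      set (X := Cdot (b u) (- (6 * (a u * a u) - RtoC (res u)))%C) in *.
      assert (Hs : 6 * av ^ 2 + 165 / 100000 <= 205 / 100000) by nra.
      assert (HX : X <= B * (205 / 100000)).
      { eapply Rle_trans; [exact Hc|]. apply Rmult_le_compat; [exact b0|apply Cmod_ge_0|exact E1|lra]. }
      assert (Hn : 0 <= - wP1 (s0 - u) * av ^ 2) by (apply Rmult_le_pos; [lra|apply pow2_ge_0]).
      nra. }
  unfold devE. fold (a l) (b l). lra.
Qed.

Lemma PI_Tube (e p : C) (l M : R) (a0 a1 : C) : Cmod e = 1 -> 0 <= l ->
  (forall u, 0 <= u <= l -> Cmod (p + RtoC u * e)%C <= M) ->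
  (forall s eta g g1, 0 <= s <= l -> 0 < eta -> SolPI (tube e p eta s) g g1 -> g p = a0 -> g1 p = a1 ->
     Cmod (g (p + RtoC s * e)%C) <= M /\ Cmod (g1 (p + RtoC s * e)%C) <= M) ->
  Cmod a0 <= M -> Cmod a1 <= M ->
  exists eta g g1, 0 < eta /\ SolPI (tube e p eta l) g g1 /\ g p = a0 /\ g1 p = a1.
Proof.
  apply (Tube _ _ _ _ _ (fun x _ => eq_ind_r (fun r => r <= 1) Rle_0_1 Cmod_0) (fun M x => Cmod x <= M)).
  intros N. apply PI_local.
Qed.

(** The solution is carried down the ray to 0, and its data there start the Taylor series in the
    disc. At s = 0 the derivative deviates from P'(0) by at most 1071/100000, which brings |y'(0)|
    just below 2 / (37/20)^3. *)
Lemma ray_disc (a0 a1 : C) : Cmod (om * om * om * a1 - RtoC (wP1 s0))%C ^ 2 - 12 * wP s0 * Cmod (om * om * a0 - RtoC (wP s0))%C ^ 2 < (57 / 10000) ^ 2 ->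
  exists eta g g1 f f1, 0 < eta /\ SolPI (tube (- om) (RtoC s0 * om) eta s0) g g1 /\ g (RtoC s0 * om)%C = a0 /\ g1 (RtoC s0 * om)%C = a1 /\
    SolPI (disc 0 (37 / 20)) f f1 /\ f 0%C = g 0%C /\ f1 0%C = g1 0%C.
Proof.
  intros H0.
  assert (Epl : forall u, (RtoC s0 * om + RtoC u * - om)%C = (RtoC (s0 - u) * om)%C) by (intros u; rewrite RtoC_minus; ring).
  assert (Hm : Cmod (- om)%C = 1) by (rewrite Cmod_opp; apply om_mod).
  assert (Hs0 : 0 <= s0 <= 12 / 5) by (unfold s0; lra).
  assert (Hdev : forall g g1 s B, 0 <= s <= 12 / 5 -> 0 <= B -> devE g g1 s < B ^ 2 ->
    Cmod (dev1 g1 s) <= B /\ 216 / 100 * Cmod (dev0 g s) ^ 2 <= B ^ 2).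
  { intros g g1 s B Hs HB. unfold devE. assert (q := wP_neg s Hs). assert (p0 := Cmod_ge_0 (dev0 g s)). assert (p1 := Cmod_ge_0 (dev1 g1 s)).
    assert (0 <= (- wP s - 18 / 100) * Cmod (dev0 g s) ^ 2) by (apply Rmult_le_pos; [lra|apply pow2_ge_0]). split; nra. }
  assert (Hpb : forall s, 0 <= s <= s0 -> Rabs (wP s) <= 1 /\ Rabs (wP1 s) <= 1).
  { intros s Hs. destruct wP_start as [[w1 _] _]. fold s0 in w1.
    assert (wP s0 <= wP s) by (apply (derive_nonpos_decr wP wP1 s s0 (proj2 Hs)); intros t Ht; [apply wP_derive|apply wP1_neg; lra]).
    assert (wP s <= - (18 / 100)) by (apply wP_neg; lra).
    split; [apply Rabs_le; lra|apply wP1_bound; lra]. }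
  assert (o2 : Cmod (om * om)%C = 1) by (rewrite Cmod_mult, om_mod; ring).
  assert (o3 : Cmod (om * om * om)%C = 1) by (rewrite Cmod_mult, o2, om_mod; ring).
  assert (Hmod : forall g g1 s B, 0 <= s <= s0 -> 0 <= B <= 2 / 100 -> devE g g1 s < B ^ 2 ->
    Cmod (g (RtoC s * om)%C) <= 10 /\ Cmod (g1 (RtoC s * om)%C) <= 10).
  { intros g g1 s B Hs HB HE. destruct (Hdev g g1 s B) as [h1 h0]; try lra. destruct (Hpb s Hs) as [p0 p1].
    assert (q0 := Cmod_ge_0 (dev0 g s)). split.
    - rewrite <- (Rmult_1_l (Cmod _)), <- o2, <- Cmod_mult. replace (om * om * g (RtoC s * om))%C with (dev0 g s + RtoC (wP s))%C by (unfold dev0; ring).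
      eapply Rle_trans; [apply Cmod_triangle|]. rewrite Cmod_R. nra.
    - rewrite <- (Rmult_1_l (Cmod _)), <- o3, <- Cmod_mult. replace (om * om * om * g1 (RtoC s * om))%C with (dev1 g1 s + RtoC (wP1 s))%C by (unfold dev1; ring).
      eapply Rle_trans; [apply Cmod_triangle|]. rewrite Cmod_R. lra. }
  assert (HE : forall s eta g g1, 0 <= s <= s0 -> 0 < eta -> SolPI (tube (- om) (RtoC s0 * om) eta s) g g1 ->
    g (RtoC s0 * om)%C = a0 -> g1 (RtoC s0 * om)%C = a1 -> devE g g1 (s0 - s) < (57 / 10000 + 21 / 10000 * s) ^ 2).
  { intros s eta g g1 Hs Heta Sg G0 G1. apply (ray_energy _ g g1 s Sg Hs).
    - intros u Hu. rewrite <- Epl. apply tube_line; [exact Hm|exact Heta|lra].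
    - unfold devE, dev0, dev1. rewrite G0, G1. exact H0. }
  destruct (Hmod (fun _ => a0) (fun _ => a1) s0 (57 / 10000)) as [m0 m1]; [lra|lra|exact H0|].
  destruct (PI_Tube (- om)%C (RtoC s0 * om)%C s0 10 a0 a1) as [eta [g [g1 [Heta [Sg [G0 G1]]]]]]; auto; try lra.
  - intros u Hu. rewrite Epl, Cmod_mult, om_mod, Cmod_R, Rabs_pos_eq by lra. lra.
  - intros s eta g g1 Hs Heta Sg G0 G1. rewrite Epl. apply (Hmod g g1 (s0 - s) (57 / 10000 + 21 / 10000 * s)); [lra|lra|]. apply (HE s eta); assumption.
  - assert (E0 := HE s0 eta g g1 ltac:(lra) Heta Sg G0 G1). replace (s0 - s0) with 0 in E0 by ring.
    destruct (Hdev g g1 0 (57 / 10000 + 21 / 10000 * s0)) as [h1 h0]; [lra|lra|exact E0|].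
    destruct wP_0 as [w0 w1]. unfold dev0, dev1 in h0, h1. replace (RtoC 0 * om)%C with (RtoC 0) in h0, h1 by ring. rewrite w0 in h0. rewrite w1 in h1.
    set (d0 := (om * om * g 0 - RtoC (- (18754 / 100000)))%C) in *. set (d1 := (om * om * om * g1 0 - RtoC (- (30492 / 100000)))%C) in *.
    set (b := 57 / 10000 + 21 / 10000 * s0) in *. assert (Hb : 0 <= b <= 1071 / 100000) by (unfold b, s0; lra).
    assert (q0 := Cmod_ge_0 d0). assert (q1 := Cmod_ge_0 d1). assert (h0' : Cmod d0 <= 74 / 10000) by nra.
    assert (k0 : Cmod (g 0%C) <= 18754 / 100000 + Cmod d0).
    { rewrite <- (Rmult_1_l (Cmod (g _))), <- o2, <- Cmod_mult. replace (om * om * g 0)%C with (RtoC (- (18754 / 100000)) + d0)%C by (unfold d0; ring).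
      eapply Rle_trans; [apply Cmod_triangle|]. rewrite Cmod_R, Rabs_left by lra. lra. }
    assert (k1 : Cmod (g1 0%C) <= 30492 / 100000 + Cmod d1).
    { rewrite <- (Rmult_1_l (Cmod (g1 _))), <- o3, <- Cmod_mult. replace (om * om * om * g1 0)%C with (RtoC (- (30492 / 100000)) + d1)%C by (unfold d1; ring).
      eapply Rle_trans; [apply Cmod_triangle|]. rewrite Cmod_R, Rabs_left by lra. lra. }
    (* This is 6 times the third Taylor coefficient. As om^5 = -1, y(0) y'(0) is the opposite of
       w(0) w'(0), which is positive up to small errors: the two summands partly cancel. *)
    assert (k2 : Cmod (12 * g 0 * g1 0 + 1)%C <= 1).
    { set (c := (18754 * 30492 / 10000000000)). replace (12 * g 0 * g1 0 + 1)%C with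
        (RtoC (1 - 12 * c) - (12 * (RtoC (- (18754 / 100000)) * d1 + d0 * RtoC (- (30492 / 100000)) + d0 * d1)))%C.
      - eapply Rle_trans; [apply Cmod_tri_minus|]. rewrite Cmod_R, Cmod_mult, Cmod_R, !Rabs_pos_eq by (unfold c; lra).
        assert (t : Cmod (RtoC (- (18754 / 100000)) * d1 + d0 * RtoC (- (30492 / 100000)) + d0 * d1)%C <= 18754 / 100000 * Cmod d1 + Cmod d0 * (30492 / 100000) + Cmod d0 * Cmod d1).
        { eapply Rle_trans; [apply Cmod_triangle|]. rewrite Cmod_mult. apply Rplus_le_compat_r.
          eapply Rle_trans; [apply Cmod_triangle|]. rewrite !Cmod_mult, !Cmod_R, !Rabs_left by lra. lra. }
        assert (Cmod d0 * Cmod d1 <= 74 / 10000 * (1071 / 100000)) by (apply Rmult_le_compat; lra).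
        unfold c. lra.
      - set (C0 := RtoC (- (18754 / 100000))) in *. set (C1 := RtoC (- (30492 / 100000))) in *.
        assert (P : ((C0 + d0) * (C1 + d1) = - (g 0 * g1 0))%C).
        { transitivity (om * om * (om * om) * om * (g 0 * g1 0))%C; [unfold d0, d1; ring|rewrite om5; ring]. }
        replace (RtoC (1 - 12 * c)) with (1 - 12 * (C0 * C1))%C by (unfold C0, C1, c; rewrite <- !RtoC_mult, <- RtoC_minus; f_equal; field).
        transitivity (1 - 12 * ((C0 + d0) * (C1 + d1)))%C; [ring|rewrite P; ring]. }
    destruct (PI_disc (37 / 20) (g 0%C) (g1 0%C)) as [f [f1 [Sf [F0 F1]]]]; [lra| | | |].
    + apply Rle_trans with (18754 / 100000 + 74 / 10000); [lra|]. lra.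
    + lra.
    + lra.
    + exists eta, g, g1, f, f1. exact (conj Heta (conj Sg (conj G0 (conj G1 (conj Sf (conj F0 F1)))))). 
Qed.

(** * Reflections and the z-plane *)

Lemma Cconj_R (r : R) : Cconj (RtoC r) = RtoC r.
Proof. apply injective_projections; simpl; ring. Qed.

(** Conjugating both the argument and the value preserves holomorphy; e is the rotation that makes
    the reflection fix a prescribed line. *)
Lemma cderiv_conj (f : C -> C) (e z l : C) : cderiv f (e * Cconj z)%C l ->
  cderiv (fun w => Cconj (f (e * Cconj w)%C)) z (Cconj (e * l)%C).
Proof.
  intros Hf.
  assert (Hg : cderiv (fun w => f (e * w)%C) (Cconj z) (e * l)%C).
  { eapply cderiv_val.
    - apply (cderiv_comp f (fun w => e * w)%C); [exact Hf|apply cderiv_scal, cderiv_id].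
    - cbv beta. ring. }
  apply cderiv_eps. intros eps He. destruct (proj1 (cderiv_eps _ _ _) Hg eps He) as [d [Hd h]]. exists d. split; [exact Hd|].
  intros w Hw. specialize (h (Cconj w)). cbv beta in h. rewrite <- (Cmod_conj (Cconj w - Cconj z)%C), Cminus_conj, !Cconj_conj in h.
  match goal with |- Cmod ?u <= _ => replace u with (Cconj (f (e * Cconj w) - f (e * Cconj z) - e * l * (Cconj w - Cconj z)))%C end.
  - rewrite Cmod_conj. exact (h Hw).
  - rewrite !Cminus_conj, (Cmult_conj (e * l)%C), Cminus_conj, !Cconj_conj. reflexivity.
Qed.

(** The equation has real coefficients and is invariant under x -> -x, hence under reflection in the
    imaginary axis. *)
Lemma SolH_reflect (V : C -> Prop) (h h1 : C -> C) : SolH V h h1 ->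
  SolH (fun x => V (- (1) * Cconj x)%C) (fun x => Cconj (h (- (1) * Cconj x)%C)) (fun x => (- Cconj (h1 (- (1) * Cconj x)))%C).
Proof.
  intros Sh x Hx. destruct (Sh _ Hx) as [D [d1 d2]]. rewrite Cmod_mult, Cmod_opp, Cmod_1, Cmod_conj, Rmult_1_l in D.
  assert (c1 : Cconj 1 = 1%C) by apply Cconj_R.
  split; [exact D|]. split.
  - eapply cderiv_val; [exact (cderiv_conj h _ x _ d1)|]. rewrite Cmult_conj, Copp_conj, c1. ring.
  - set (h2 := (- / (- (1) * Cconj x) * h1 (- (1) * Cconj x) + 1 * h (- (1) * Cconj x) + / 2 * (h (- (1) * Cconj x) * h (- (1) * Cconj x)) +
        RtoC kH / (- (1) * Cconj x * (- (1) * Cconj x) * (- (1) * Cconj x * (- (1) * Cconj x))))%C) in *.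
    assert (E := cderiv_scal (- (1))%C _ x _ (cderiv_conj h1 _ x _ d2)).
    apply (cderiv_ext _ (fun x => - Cconj (h1 (- (1) * Cconj x)))%C) in E; [|intros w; cbv beta; ring].
    eapply cderiv_val; [exact E|]. cbv beta.
    assert (n0 : x <> 0%C) by (apply Cmod_nz; lra).
    assert (n1 : (- (1) * Cconj x)%C <> 0%C) by (apply Cmod_nz; rewrite Cmod_mult, Cmod_opp, Cmod_1, Cmod_conj; lra).
    assert (n2 : (- (1) * Cconj x * (- (1) * Cconj x))%C <> 0%C) by (apply Cmult_neq_0; exact n1).
    assert (n3 : (- (1) * Cconj x * (- (1) * Cconj x) * (- (1) * Cconj x * (- (1) * Cconj x)))%C <> 0%C) by (apply Cmult_neq_0; exact n2).
    assert (two : RtoC 2 <> 0%C) by (intros e; injection e; lra).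
    rewrite Cmult_conj, Copp_conj, c1. unfold h2.
    rewrite !Cplus_conj, Cdiv_conj by exact n3. rewrite !Cmult_conj, !Copp_conj, !Cinv_conj by assumption.
    rewrite !Cmult_conj, !Copp_conj, !Cconj_R, Cconj_conj. field. exact n0.
Qed.

(** z -> eR conj z is the reflection in the ray arg z = pi/5. The values are multiplied by cR =
    conj(eR)^2 to preserve 6 y^2, and the term z then requires cR^2 conj(eR) = 1, the fivefold
    symmetry of P_I. *)
Definition eR : C := cis (2 * PI / 5).
Definition cR : C := (Cconj eR * Cconj eR)%C.

Lemma cR_eR : (cR * cR * Cconj eR)%C = 1%C.
Proof.
  unfold cR, eR. rewrite !cis_conj, <- !cis_plus.
  replace (- (2 * PI / 5) + - (2 * PI / 5) + (- (2 * PI / 5) + - (2 * PI / 5)) + - (2 * PI / 5)) with (- (2 * PI)) by field.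
  rewrite <- cis_conj. unfold cis. rewrite cos_2PI, sin_2PI. apply injective_projections; simpl; ring.
Qed.

Lemma SolPI_reflect (U : C -> Prop) (f f1 : C -> C) : SolPI U f f1 ->
  SolPI (fun z => U (eR * Cconj z)%C) (fun z => cR * Cconj (f (eR * Cconj z)))%C (fun z => cR * (Cconj eR * Cconj (f1 (eR * Cconj z))))%C.
Proof.
  intros Sf z Hz. destruct (Sf _ Hz) as [_ [d1 d2]]. split; [exact I|]. split.
  - eapply cderiv_val; [exact (cderiv_scal cR _ z _ (cderiv_conj f _ z _ d1))|]. rewrite Cmult_conj. ring.
  - eapply cderiv_val; [exact (cderiv_scal cR _ z _ (cderiv_scal (Cconj eR) _ z _ (cderiv_conj f1 _ z _ d2)))|].
    rewrite Cmult_conj, !Cplus_conj, !Cmult_conj, !Cconj_R, Cconj_conj. set (F := Cconj (f (eR * Cconj z)%C)).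
    transitivity (6 * (cR * F * (cR * F)) + cR * cR * Cconj eR * z)%C; [unfold cR; ring|]. rewrite cR_eR. ring.
Qed.

Lemma eR_om (s : R) : (eR * Cconj (RtoC s * om))%C = (RtoC s * om)%C.
Proof.
  rewrite Cmult_conj, Cconj_R. unfold eR, om. rewrite cis_conj.
  transitivity (RtoC s * (cis (2 * PI / 5) * cis (- (PI / 5))))%C; [ring|]. rewrite <- cis_plus. do 2 f_equal. field.
Qed.

Lemma PI5 : - PI < PI / 5 <= PI.
Proof. assert (q := PI_RGT_0). lra. Qed.

Lemma xrad_pos (s : R) : 0 < xrad s.
Proof. unfold xrad, Rpower. assert (q := exp_pos (5 / 4 * ln (24 * s))). lra. Qed.

Lemma xvar_ray (s : R) : 0 < s -> xvar (RtoC s * om)%C = ((0, xrad s) : C).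
Proof.
  intros Hs. unfold om. rewrite xvar_polar by (auto using PI5). replace (PI / 4 + 5 / 4 * (PI / 5)) with (PI / 2) by field.
  rewrite <- Ci_cis. apply injective_projections; simpl; ring.
Qed.

Lemma qvar_ray (s : R) : 0 < s -> qvar (RtoC s * om)%C = (RtoC (Rpower (s / 6) (1 / 2)) * cis (3 * PI / 5))%C.
Proof. intros Hs. unfold om. rewrite qvar_polar by (auto using PI5). do 2 f_equal. field. Qed.

Lemma vprof_ray (h : C -> C) (s : R) : 0 < s -> vprof h (RtoC s * om)%C = (RtoC (1 + 4 / (25 * xrad s ^ 2)) + h ((0, xrad s) : C))%C.
Proof.
  intros Hs. unfold vprof. rewrite xvar_ray by exact Hs. f_equal. assert (q := xrad_pos s).
  replace ((0, xrad s) * (0, xrad s))%C with (RtoC (- xrad s ^ 2)) by (apply injective_projections; simpl; ring).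
  rewrite <- RtoC_mult, <- RtoC_div by nra. rewrite <- RtoC_minus. f_equal. field. lra.
Qed.

(* On the ray the leading factor satisfies cR * conj q = q, so the reflected solution has the same asymptotics. *)
Lemma y_ray_reflect (h k : C -> C) (s : R) : 0 < s -> k ((0, xrad s) : C) = Cconj (h ((0, xrad s) : C)) ->
  (cR * Cconj (y_of_h k (RtoC s * om)))%C = y_of_h h (RtoC s * om)%C.
Proof.
  intros Hs Hk. rewrite !y_of_h_vprof, !vprof_ray, qvar_ray, Hk by exact Hs.
  rewrite !Cmult_conj, Cplus_conj, !Cconj_R, Cconj_conj, cis_conj. unfold cR, eR. rewrite !cis_conj, <- cis_plus.
  match goal with |- (cis ?a * (?q * cis ?b * ?v) = _)%C => transitivity (q * (cis a * cis b) * v)%C; [ring|]; rewrite <- cis_plus end.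
  do 2 f_equal. replace (- (2 * PI / 5) + - (2 * PI / 5) + - (3 * PI / 5)) with (3 * PI / 5 - 2 * PI) by field.
  unfold cis. rewrite cos_minus, sin_minus, cos_2PI, sin_2PI. apply injective_projections; simpl; ring.
Qed.

Lemma s0_radii : xrad s0 = 161051 / 30720 /\ Rpower (s0 / 6) (1 / 2) = 121 / 192.
Proof.
  split.
  - unfold xrad, Rpower. replace (24 * s0) with ((11 / 4) ^ 4) by (unfold s0; field). rewrite ln_pow by lra.
    replace (5 / 4 * (INR 4 * ln (11 / 4))) with (INR 5 * ln (11 / 4)) by (simpl; field). rewrite <- ln_pow, exp_ln; lra.
  - unfold Rpower. replace (s0 / 6) with ((121 / 192) ^ 2) by (unfold s0; field). rewrite ln_pow by lra.
    replace (1 / 2 * (INR 2 * ln (121 / 192))) with (ln (121 / 192)) by (simpl; field). apply exp_ln. lra.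
Qed.

(** Here the x-plane estimate meets the polynomial P: each deviation is a fit error from [wP_start]
    plus multiples of h and h', which [bup] bounds by 0.0023 on the axis at height n^5/30, n =
    11/4. *)
Lemma ray_start (h h1 : C -> C) : Nsq h h1 ((0, 161051 / 30720) : C) < bup 0 (161051 / 30720) ^ 2 ->
  devE (y_of_h h) (dy_of_h h h1) s0 < (57 / 10000) ^ 2.
Proof.
  intros HN. set (t := 161051 / 30720) in *. destruct s0_radii as [r1 r2]. fold t in r1.
  assert (S0 : 0 < s0) by (unfold s0; lra). set (x := ((0, t) : C)) in *.
  assert (o1 : (om * om * cis (3 * PI / 5) = - (1))%C).
  { unfold om. rewrite <- !cis_plus. replace (PI / 5 + PI / 5 + 3 * PI / 5) with PI by field. unfold cis. rewrite cos_PI, sin_PI.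
    apply injective_projections; simpl; ring. }
  assert (n0 : om <> 0%C) by (apply Cmod_nz; rewrite om_mod; lra).
  assert (E0 : dev0 (y_of_h h) s0 = (RtoC (- (121 / 192) * (1 + 4 / (25 * t ^ 2)) - wP s0) - RtoC (121 / 192) * h x)%C).
  { unfold dev0. rewrite y_of_h_vprof, vprof_ray, qvar_ray, r1, r2 by exact S0.
    fold x. transitivity (om * om * cis (3 * PI / 5) * RtoC (121 / 192) * (RtoC (1 + 4 / (25 * t ^ 2)) + h x) - RtoC (wP s0))%C; [ring|].
    rewrite o1, RtoC_minus, RtoC_mult, RtoC_opp. ring. }
  assert (E1 : dev1 (dy_of_h h h1) s0 = (RtoC (- (16 / 121) * (1 - 16 / (25 * t ^ 2)) - wP1 s0) - RtoC (16 / 121) * h x - Ci * (RtoC (1331 / 768) * h1 x))%C).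
  { unfold dev1, dy_of_h. rewrite vprof_ray, qvar_ray by exact S0. unfold vprof1. rewrite xvar_ray, r1, r2 by exact S0. fold x.
    assert (xx : (x * x)%C = RtoC (- t ^ 2)) by (apply injective_projections; unfold x; simpl; ring).
    assert (x0 : x <> 0%C) by (apply pair_nz; unfold t; lra).
    assert (n2 : RtoC 2 <> 0%C) by (intros e; injection e; lra). assert (n25 : RtoC 25 <> 0%C) by (intros e; injection e; lra).
    assert (ns : RtoC s0 <> 0%C) by (intros e; injection e; lra).
    assert (H1 : (x * (8 / (25 * (x * (x * x))) + h1 x))%C = (RtoC (- (8 / (25 * t ^ 2))) + Ci * (RtoC t * h1 x))%C).
    { transitivity (8 / (25 * (x * x)) + x * h1 x)%C; [field; repeat split; assumption|]. rewrite xx.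
      replace x with (Ci * RtoC t)%C by (unfold x; apply injective_projections; simpl; ring).
      rewrite <- RtoC_mult, <- RtoC_div by (unfold t; lra). rewrite Cmult_assoc. do 2 f_equal. unfold t. field. }
    rewrite H1. set (v := (RtoC (1 + 4 / (25 * t ^ 2)) + h x)%C). set (w := (RtoC (- (8 / (25 * t ^ 2))) + Ci * (RtoC t * h1 x))%C).
    transitivity (om * om * cis (3 * PI / 5) * (RtoC (121 / 192) / RtoC s0) * (v / 2 + 5 / 4 * w) - RtoC (wP1 s0))%C; [field; split; assumption|].
    rewrite o1, <- RtoC_div by lra. replace (121 / 192 / s0) with (32 / 121) by (unfold s0; field).
    unfold v, w. replace (1331 / 768) with (32 / 121 * (5 / 4 * t)) by (unfold t; field).
    replace (- (16 / 121) * (1 - 16 / (25 * t ^ 2)) - wP1 s0) with (- (32 / 121) * ((1 + 4 / (25 * t ^ 2)) * / 2 + 5 / 4 * - (8 / (25 * t ^ 2))) - wP1 s0) by (unfold t; field).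
    replace (16 / 121) with (32 / 121 * / 2) by field.
    set (a := 4 / (25 * t ^ 2)). set (b := 8 / (25 * t ^ 2)).
    rewrite (RtoC_minus _ (wP1 s0)), !RtoC_mult, (RtoC_plus (_ * _)), !RtoC_mult, !RtoC_opp, (RtoC_plus 1), RtoC_inv, (RtoC_div 5 4) by lra.
    field. }
  destruct wP_start as [[w1 w2] [b0 b1]]. fold t s0 in w1, w2, b0, b1.
  unfold devE. rewrite E0, E1. unfold Nsq in HN. assert (qa := Cmod_ge_0 (h x)). assert (qb := Cmod_ge_0 (h1 x)).
  set (a := Cmod (h x)) in *. set (b := Cmod (h1 x)) in *.
  assert (A0 : Cmod (RtoC (- (121 / 192) * (1 + 4 / (25 * t ^ 2)) - wP s0) - RtoC (121 / 192) * h x)%C <= 4 / 10000 + 121 / 192 * a).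
  { eapply Rle_trans; [apply Cmod_tri_minus|]. rewrite Cmod_mult, !Cmod_R, (Rabs_pos_eq (121 / 192)) by lra. fold a. lra. }
  assert (A1 : Cmod (RtoC (- (16 / 121) * (1 - 16 / (25 * t ^ 2)) - wP1 s0) - RtoC (16 / 121) * h x - Ci * (RtoC (1331 / 768) * h1 x))%C <= 75 / 100000 + 16 / 121 * a + 1331 / 768 * b).
  { eapply Rle_trans; [apply Cmod_tri_minus|]. rewrite !Cmod_mult, !Cmod_R, <- (Cmod_opp Ci), Cmod_mCi, (Rabs_pos_eq (1331 / 768)) by lra. fold b.
    apply Rplus_le_compat; [|lra]. eapply Rle_trans; [apply Cmod_tri_minus|]. rewrite Cmod_mult, !Cmod_R, (Rabs_pos_eq (16 / 121)) by lra. fold a. lra. }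
  assert (HB : bup 0 t <= 22905 / 10000000).
  { unfold bup. replace (rad 0 t) with t; [unfold t; lra|]. unfold rad. replace (0 ^ 2 + t ^ 2) with (t ^ 2) by ring. symmetry. apply sqrt_pow2. unfold t; lra. }
  assert (HB0 : 0 <= bup 0 t).
  { unfold bup. replace (rad 0 t) with t; [unfold t; lra|]. unfold rad. replace (0 ^ 2 + t ^ 2) with (t ^ 2) by ring. symmetry. apply sqrt_pow2. unfold t; lra. }
  assert (HN2 : a ^ 2 + b ^ 2 <= (22905 / 10000000) ^ 2) by (assert (bup 0 t ^ 2 <= (22905 / 10000000) ^ 2) by (apply pow_incr; lra); lra).
  clearbody a b. clear HN HB HB0 E0 E1 o1 n0 b0 b1.
  match type of A0 with Cmod ?u <= _ => set (P := Cmod u) in *; assert (0 <= P) by apply Cmod_ge_0 end.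
  match type of A1 with Cmod ?u <= _ => set (Q := Cmod u) in *; assert (0 <= Q) by apply Cmod_ge_0 end.
  assert (K0 : P ^ 2 <= (4 / 10000 + 121 / 192 * a) ^ 2) by (apply pow_incr; lra).
  assert (K1 : Q ^ 2 <= (75 / 100000 + 16 / 121 * a + 1331 / 768 * b) ^ 2) by (apply pow_incr; lra).
  assert (K2 : - 12 * wP s0 * P ^ 2 <= 768 / 100 * P ^ 2) by (apply Rmult_le_compat_r; [apply pow2_ge_0|lra]).
  assert (q := pow2_ge_0 (a - b)).
  (* a^2 + b^2 is bounded, hence a + b by sqrt 2 times the root; this uses the bound on the energy
     better than separate bounds on a and b. *)
  assert (sq : (a + b) ^ 2 <= (324 / 100000) ^ 2) by nra.
  assert (ab : a + b <= 324 / 100000) by (apply Rnot_lt_le; intros c; nra).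
  nra.
Qed.

(* |z| > 1847/1000 gives |xvar z| > 381/100, which with Re (xvar z) > -1/20 puts xvar z in Gr. *)
Definition Ur (z : C) : Prop := 1847 / 1000 < Cmod z /\ - (7 * PI / 10) < Carg z < 3 * PI / 10 /\ - (1 / 20) < Re (xvar z).
Definition Ul (z : C) : Prop := Ur (eR * Cconj z)%C.

Lemma eR_mod : Cmod eR = 1.
Proof. apply Cmod_cis. Qed.

Lemma Ur_open : openC Ur.
Proof.
  intros z [h1 [[h2 h3] h4]]. assert (Hz : z <> 0%C) by (apply Cmod_nz; lra). assert (P := PI_RGT_0).
  assert (Hc : Carg z <> PI) by lra.
  destruct (cderiv_cont Clog z _ (cderiv_Clog z Hz Hc) (Rmin (Carg z + 7 * PI / 10) (3 * PI / 10 - Carg z))) as [d1 [Hd1 k1]]; [apply Rmin_case; lra|].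
  destruct (cderiv_cont xvar z _ (cderiv_Cexp_Clog xvar cX (RtoC (5 / 4)) z xvar_Cexp Hz Hc) (Re (xvar z) + 1 / 20)) as [d2 [Hd2 k2]]; [lra|].
  exists (Rmin (Cmod z - 1847 / 1000) (Rmin d1 d2)). split; [repeat apply Rmin_case; lra|]. intros w Hw.
  assert (w1 : Cmod (w - z)%C < Cmod z - 1847 / 1000) by (eapply Rlt_le_trans; [exact Hw|apply Rmin_l]).
  assert (w2 : Cmod (w - z)%C < d1) by (eapply Rlt_le_trans; [exact Hw|]; eapply Rle_trans; [apply Rmin_r|apply Rmin_l]).
  assert (w3 : Cmod (w - z)%C < d2) by (eapply Rlt_le_trans; [exact Hw|]; eapply Rle_trans; apply Rmin_r).
  split; [|split].
  - assert (t := Cmod_tri_rev z (z - w)%C). replace (z - (z - w))%C with w in t by ring. rewrite (Cmod_minus_comm z w) in t. lra.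
  - destruct (ReIm_close _ _ _ (k1 w w2)) as [_ c]. change (Im (Clog w)) with (Carg w) in c. change (Im (Clog z)) with (Carg z) in c.
    assert (m1 := Rmin_l (Carg z + 7 * PI / 10) (3 * PI / 10 - Carg z)). assert (m2 := Rmin_r (Carg z + 7 * PI / 10) (3 * PI / 10 - Carg z)).
    apply Rabs_lt_between in c. lra.
  - destruct (ReIm_close _ _ _ (k2 w w3)) as [c _]. apply Rabs_lt_between in c. lra.
Qed.

Lemma Ul_open : openC Ul.
Proof.
  intros z Hz. destruct (Ur_open _ Hz) as [d [Hd h]]. exists d. split; [exact Hd|]. intros w Hw. apply h.
  replace (eR * Cconj w - eR * Cconj z)%C with (eR * Cconj (w - z))%C by (rewrite Cminus_conj; ring).
  rewrite Cmod_mult, Cmod_conj, eR_mod. lra.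
Qed.

Lemma xrad_mono (r s : R) : 0 < r -> r <= s -> xrad r <= xrad s.
Proof.
  intros Hr Hs. unfold xrad, Rdiv. apply Rmult_le_compat_r; [lra|]. apply Rle_Rpower_l; lra.
Qed.

Lemma xrad_large (r : R) : 1847 / 1000 <= r -> 381 / 100 <= xrad r.
Proof.
  intros Hr. apply Rle_trans with (xrad (1847 / 1000)); [|apply xrad_mono; lra]. unfold xrad, Rpower.
  apply (proj1 (Rle_div_r (381 / 100) _ 30 ltac:(lra))). rewrite <- (exp_ln (381 / 100 * 30)) by lra.
  (* Raising both sides to the fourth power turns the exponent 5/4 into a comparison of rational
     numbers. *)
  assert (E : ln ((381 / 100 * 30) ^ 4) <= ln ((24 * (1847 / 1000)) ^ 5)) by (apply ln_le; lra).
  rewrite !ln_pow in E by lra. simpl INR in E.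
  destruct (Rle_lt_or_eq_dec (ln (381 / 100 * 30)) (5 / 4 * ln (24 * (1847 / 1000)))) as [h|h]; [lra| |].
  - left. apply exp_increasing, h.
  - rewrite h. lra.
Qed.

Lemma Ur_Gr (z : C) : Ur z -> z <> 0%C /\ Carg z <> PI /\ Gr (xvar z).
Proof.
  intros [h1 [h2 h3]]. assert (P := PI_RGT_0). assert (Hz : z <> 0%C) by (apply Cmod_nz; lra).
  split; [exact Hz|]. split; [lra|].
  assert (M : Cmod (xvar z) = xrad (Cmod z)).
  { rewrite (polar z Hz) at 1. rewrite xvar_polar by (try apply Carg_le_PI; try assumption; lra).
    rewrite Cmod_mult, Cmod_cis, Cmod_R, Rabs_pos_eq by (left; apply xrad_pos). ring. }
  assert (L := xrad_large (Cmod z) ltac:(lra)). rewrite <- M in L. assert (E := Cmod_sqr (xvar z)).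
  unfold Gr. destruct (Rlt_le_dec (5 / 2) (Re (xvar z))) as [h|h]; [auto|].
  (* For Re x <= 5/2 the bound |x| >= 3.81 gives (Im x)^2 >= 3.81^2 - 2.5^2 > 2.87^2. *)
  destruct (Rle_lt_dec 0 (Im (xvar z))) as [i|i]; [left|right; right]; (split; [exact h3|]); nra.
Qed.

Lemma Ur_polar (r t : R) : 0 < r -> - PI < t <= PI ->
  (Ur (RtoC r * cis t)%C <-> 1847 / 1000 < r /\ - (7 * PI / 10) < t < 3 * PI / 10 /\ - (1 / 20) < xrad r * cos (PI / 4 + 5 / 4 * t)).
Proof.
  intros Hr Ht. unfold Ur. rewrite Cmod_mult, Cmod_cis, Cmod_R, Rabs_pos_eq, Rmult_1_r, Carg_polar, xvar_polar by lra.
  replace (Re (RtoC (xrad r) * cis (PI / 4 + 5 / 4 * t))%C) with (xrad r * cos (PI / 4 + 5 / 4 * t)) by (unfold Re; simpl; ring). reflexivity.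
Qed.

(** [Ur] is star-shaped in the angle with respect to the ray arg z = pi/5: circular arcs from the
    ray serve as paths where segments would leave the region. *)
Lemma Ur_arc (r t s : R) : 0 < r -> - PI < t <= PI -> Ur (RtoC r * cis t)%C -> 0 <= s <= 1 -> Ur (RtoC r * cis (PI / 5 + s * (t - PI / 5)))%C.
Proof.
  intros Hr Ht Hu Hs. assert (P := PI_RGT_0). apply Ur_polar in Hu; [|assumption|assumption]. destruct Hu as [h1 [h2 h3]].
  set (u := PI / 5 + s * (t - PI / 5)).
  assert (Hb : (t <= u <= PI / 5) \/ (PI / 5 <= u <= t)).
  { unfold u. destruct (Rle_lt_dec t (PI / 5)); [left|right]; split; nra. }
  apply Ur_polar; [exact Hr|lra|]. split; [exact h1|]. split; [lra|]. assert (X := xrad_pos r).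
  (* arg x is pi/4 + 5u/4. Either it lies in [-pi/2, pi/2], or it is closer to 0 than at the end of
     the arc; in both cases the condition on Re x persists. *)
  assert (C : 0 <= cos (PI / 4 + 5 / 4 * u) \/ cos (PI / 4 + 5 / 4 * t) <= cos (PI / 4 + 5 / 4 * u)).
  { destruct Hb as [Hb|Hb].
    - destruct (Rle_lt_dec (- (3 * PI / 5)) u) as [q|q]; [left; apply cos_ge_0; lra|right].
      rewrite <- (cos_neg (_ + 5 / 4 * t)), <- (cos_neg (_ + 5 / 4 * u)). apply cos_decr_1; lra.
    - right. apply cos_decr_1; lra. }
  destruct C as [C|C]; [assert (0 <= xrad r * cos (PI / 4 + 5 / 4 * u)) by (apply Rmult_le_pos; lra); lra|].
  eapply Rlt_le_trans; [exact h3|]. apply Rmult_le_compat_l; lra.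
Qed.

Lemma eR_polar (r t : R) : (eR * Cconj (RtoC r * cis t) = RtoC r * cis (2 * PI / 5 - t))%C.
Proof.
  rewrite Cmult_conj, Cconj_R, cis_conj. transitivity (RtoC r * (eR * cis (- t)))%C; [ring|]. unfold eR. rewrite <- cis_plus. reflexivity.
Qed.

Lemma eR_invol (z : C) : (eR * Cconj (eR * Cconj z) = z)%C.
Proof. rewrite Cmult_conj, Cconj_conj. transitivity (eR * Cconj eR * z)%C; [ring|]. rewrite <- Cmod2_conj, eR_mod. rewrite RtoC_pow. ring. Qed.

Lemma Ul_arc (r t s : R) : 0 < r -> - PI < 2 * PI / 5 - t <= PI -> Ul (RtoC r * cis t)%C -> 0 <= s <= 1 -> Ul (RtoC r * cis (PI / 5 + s * (t - PI / 5)))%C.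
Proof.
  unfold Ul. intros Hr Ht Hu Hs. rewrite eR_polar in *.
  replace (2 * PI / 5 - (PI / 5 + s * (t - PI / 5))) with (PI / 5 + s * ((2 * PI / 5 - t) - PI / 5)) by field. apply Ur_arc; assumption.
Qed.

Lemma Ur_ray (s : R) : 1847 / 1000 < s -> Ur (RtoC s * om)%C /\ Ul (RtoC s * om)%C.
Proof.
  intros Hs. assert (P := PI_RGT_0). assert (H : Ur (RtoC s * om)%C).
  { apply Ur_polar; [lra|lra|]. split; [exact Hs|]. split; [lra|]. replace (PI / 4 + 5 / 4 * (PI / 5)) with (PI / 2) by field. rewrite cos_PI2. lra. }
  split; [exact H|]. unfold Ul. rewrite eR_om. exact H.
Qed.

(** The sector -3 pi/5 <= arg z <= pi/5 corresponds to Re x >= 0, and the reflection maps it onto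
    pi/5 <= arg z <= pi, closing at the negative axis. *)
Lemma region_cover (z : C) : region_D z -> Ur z \/ Ul z \/ disc 0 (37 / 20) z.
Proof.
  assert (P := PI_RGT_0). intros Hz. destruct (Rlt_le_dec (Cmod z) (37 / 20)) as [h|h].
  { right. right. unfold disc. replace (z - 0)%C with z by ring. exact h. }
  destruct Hz as [[Hz Ha]|Hz]; [|lra].
  assert (H : forall r t, 37 / 20 <= r -> - (3 * PI / 5) <= t <= PI / 5 -> Ur (RtoC r * cis t)%C).
  { intros r t Hr Ht. apply Ur_polar; [lra|lra|]. split; [lra|]. split; [lra|].
    assert (0 <= xrad r * cos (PI / 4 + 5 / 4 * t)) by (apply Rmult_le_pos; [left; apply xrad_pos|apply cos_ge_0; lra]). lra. }
  rewrite (polar z Hz). destruct (Rle_lt_dec (Carg z) (PI / 5)) as [q|q].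
  - left. apply H; lra.
  - right. left. unfold Ul. rewrite eR_polar. apply H; lra.
Qed.

(** * Gluing in the z-plane *)

Lemma HA_PI (x : C) : True -> Cmod 0%C <= 1.
Proof. intros _. rewrite Cmod_0. lra. Qed.

Definition PI_path := Sol_unique_path (fun _ => 0%C) (fun z => z) 0%C 6%C (fun _ => True) HA_PI.
Definition PI_seg := Sol_unique_seg (fun _ => 0%C) (fun z => z) 0%C 6%C (fun _ => True) HA_PI.

Lemma PI_arc (K : C -> Prop) (f f1 g g1 : C -> C) (r t : R) : SolPI K f f1 -> SolPI K g g1 -> 0 < r ->
  (forall s, 0 <= s <= 1 -> K (RtoC r * cis (PI / 5 + s * (t - PI / 5)))%C) ->
  f (RtoC r * om)%C = g (RtoC r * om)%C -> f1 (RtoC r * om)%C = g1 (RtoC r * om)%C ->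
  f (RtoC r * cis t)%C = g (RtoC r * cis t)%C /\ f1 (RtoC r * cis t)%C = g1 (RtoC r * cis t)%C.
Proof.
  intros Sf Sg Hr HK E0 E1.
  set (p := fun s : R => Cexp ((ln r, (PI / 5)%R) + RtoC s * (0%R, (t - PI / 5)%R))%C).
  assert (Ep : forall s, p s = (RtoC r * cis (PI / 5 + s * (t - PI / 5)))%C).
  { intros s. unfold p. rewrite Cexp_cis. replace (Re ((ln r, (PI / 5)%R) + RtoC s * (0%R, (t - PI / 5)%R))%C) with (ln r) by (unfold Re; simpl; ring).
    rewrite exp_ln by exact Hr. do 2 f_equal. unfold Im; simpl; ring. }
  assert (H := PI_path K f f1 g g1 p (fun s => p s * (0%R, (t - PI / 5)%R))%C (r * Cmod (0%R, (t - PI / 5)%R)) 0 1 Rle_0_1 Sf Sg).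
  rewrite !Ep in H. replace (PI / 5 + 0 * (t - PI / 5)) with (PI / 5) in H by ring. replace (PI / 5 + 1 * (t - PI / 5)) with t in H by ring.
  apply H; [|exact E0|exact E1].
  intros s Hs. split; [rewrite Ep; apply HK, Hs|]. split.
  - apply (pder_comp Cexp (fun s => (ln r, (PI / 5)%R) + RtoC s * (0%R, (t - PI / 5)%R))%C); [apply cderiv_Cexp|apply pder_line].
  - rewrite Cmod_mult, Ep, Cmod_mult, Cmod_cis, Cmod_R, Rabs_pos_eq by lra. lra.
Qed.

Lemma pder_unique (f g : R -> C) (t d : R) (l m : C) : 0 < d -> (forall s, Rabs (s - t) < d -> f s = g s) -> pder f t l -> pder g t m -> l = m.
Proof.
  intros Hd He Hf Hg. destruct (Req_dec (Cmod (l - m)%C) 0) as [E|E].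
  { apply Cmod_eq_0 in E. replace l with (l - m + m)%C by ring. rewrite E. ring. }
  exfalso. assert (P : 0 < Cmod (l - m)%C) by (assert (q := Cmod_ge_0 (l - m)%C); lra). set (a := Cmod (l - m)%C) in *.
  destruct (Hf (a / 4)) as [d1 [H1 k1]]; [lra|]. destruct (Hg (a / 4)) as [d2 [H2 k2]]; [lra|].
  set (h := Rmin d (Rmin d1 d2) / 2). assert (m1 := Rmin_l d (Rmin d1 d2)). assert (m2 := Rmin_r d (Rmin d1 d2)).
  assert (m3 := Rmin_l d1 d2). assert (m4 := Rmin_r d1 d2). assert (h0 : 0 < h) by (unfold h; assert (0 < Rmin d (Rmin d1 d2)) by (repeat apply Rmin_case; lra); lra).
  assert (Eh : Rabs (t + h - t) = h) by (replace (t + h - t) with h by ring; apply Rabs_pos_eq; lra).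
  specialize (k1 (t + h)). specialize (k2 (t + h)). rewrite Eh in k1, k2. specialize (k1 ltac:(unfold h in *; lra)). specialize (k2 ltac:(unfold h in *; lra)).
  rewrite (He (t + h)) in k1 by (rewrite Eh; unfold h in *; lra). rewrite (He t) in k1 by (rewrite Rminus_diag, Rabs_R0; exact Hd).
  set (X := g (t + h)) in *. set (Y := RtoC (t + h - t)) in *.
  assert (T := Cmod_tri_minus (X - g t - m * Y)%C (X - g t - l * Y)%C).
  replace (X - g t - m * Y - (X - g t - l * Y))%C with ((l - m) * Y)%C in T by ring. unfold Y in *.
  rewrite Cmod_mult, Cmod_R, Eh in T. fold a in T. nra.
Qed.

(** Equality on an interval of the ray determines the derivative along it, hence the complex
    derivative: this supplies the second Cauchy datum. *)
Lemma ray_deriv (K : C -> Prop) (f f1 g g1 : C -> C) (s d : R) : SolPI K f f1 -> SolPI K g g1 -> K (RtoC s * om)%C -> 0 < d ->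
  (forall u, Rabs (u - s) < d -> f (RtoC u * om)%C = g (RtoC u * om)%C) -> f1 (RtoC s * om)%C = g1 (RtoC s * om)%C.
Proof.
  intros Sf Sg HK Hd He. destruct (Sf _ HK) as [_ [df _]]. destruct (Sg _ HK) as [_ [dg _]].
  assert (p : pder (fun u : R => RtoC u * om)%C s om).
  { intros eps Heps. destruct (pder_line 0%C om s eps Heps) as [e [He0 h]]. exists e. split; [exact He0|]. intros u Hu. specialize (h u Hu).
    rewrite !Cplus_0_l in h. exact h. }
  assert (E : (f1 (RtoC s * om) * om)%C = (g1 (RtoC s * om) * om)%C).
  { apply (pder_unique (fun u => f (RtoC u * om)%C) (fun u => g (RtoC u * om)%C) s d); [exact Hd|exact He| |].
    - exact (pder_comp f (fun u : R => RtoC u * om)%C s _ _ df p).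
    - exact (pder_comp g (fun u : R => RtoC u * om)%C s _ _ dg p). }
  assert (n : om <> 0%C) by (apply Cmod_nz; rewrite om_mod; lra).
  replace (f1 (RtoC s * om)%C) with (f1 (RtoC s * om) * om / om)%C by (field; exact n). rewrite E. field. exact n.
Qed.

Lemma ray_seg (K : C -> Prop) (f f1 g g1 : C -> C) (a b : R) : SolPI K f f1 -> SolPI K g g1 ->
  (forall u, Rmin a b <= u <= Rmax a b -> K (RtoC u * om)%C) ->
  f (RtoC a * om)%C = g (RtoC a * om)%C -> f1 (RtoC a * om)%C = g1 (RtoC a * om)%C ->
  f (RtoC b * om)%C = g (RtoC b * om)%C /\ f1 (RtoC b * om)%C = g1 (RtoC b * om)%C.
Proof.
  intros Sf Sg HK. apply (PI_seg K); [exact Sf|exact Sg|]. intros t Ht.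
  replace (RtoC a * om + RtoC t * (RtoC b * om - RtoC a * om))%C with (RtoC (a + t * (b - a)) * om)%C by (rewrite RtoC_plus, RtoC_mult, RtoC_minus; ring).
  apply HK. unfold Rmin, Rmax. destruct Rle_dec; split; nra.
Qed.

Lemma ray_agree (K : C -> Prop) (f f1 g g1 : C -> C) (a S : R) : SolPI K f f1 -> SolPI K g g1 ->
  (forall u, a < u -> K (RtoC u * om)%C) -> (forall u, S < u -> f (RtoC u * om)%C = g (RtoC u * om)%C) ->
  forall s, a < s -> f (RtoC s * om)%C = g (RtoC s * om)%C /\ f1 (RtoC s * om)%C = g1 (RtoC s * om)%C.
Proof.
  intros Sf Sg HK He s Hs. set (b := Rmax s S + 1). assert (m1 := Rmax_l s S). assert (m2 := Rmax_r s S).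
  apply (ray_seg K f f1 g g1 b s Sf Sg).
  - intros u Hu. apply HK. rewrite Rmin_right in Hu by (unfold b; lra). lra.
  - apply He. unfold b. lra.
  - apply (ray_deriv K f f1 g g1 b 1 Sf Sg); [apply HK; unfold b; lra|lra|].
    intros u Hu. apply Rabs_lt_between in Hu. apply He. unfold b in Hu. lra.
Qed.

Lemma disc_arc (r t : R) : 0 < r -> disc 0 (37 / 20) (RtoC r * cis t)%C -> forall u, disc 0 (37 / 20) (RtoC r * cis u)%C.
Proof.
  unfold disc. intros Hr H u. replace (RtoC r * cis u - 0)%C with (RtoC r * cis u)%C by ring. replace (RtoC r * cis t - 0)%C with (RtoC r * cis t)%C in H by ring.
  rewrite Cmod_mult, Cmod_cis in *. exact H.
Qed.

Lemma disc_ray (s : R) : 0 <= s < 37 / 20 -> disc 0 (37 / 20) (RtoC s * om)%C.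
Proof.
  intros Hs. unfold disc. replace (RtoC s * om - 0)%C with (RtoC s * om)%C by ring. rewrite Cmod_mult, om_mod, Cmod_R, Rabs_pos_eq; lra.
Qed.

Lemma Ur_pos (z : C) : Ur z -> exists r t, 1847 / 1000 < r /\ - (7 * PI / 10) < t < 3 * PI / 10 /\ z = (RtoC r * cis t)%C.
Proof.
  intros H. destruct (Ur_Gr z H) as [Hz _]. destruct H as [h1 [h2 _]]. exists (Cmod z), (Carg z). split; [exact h1|]. split; [exact h2|]. apply polar, Hz.
Qed.

Lemma Ul_pos (z : C) : Ul z -> exists r t, 1847 / 1000 < r /\ PI / 10 < t < 11 * PI / 10 /\ z = (RtoC r * cis t)%C.
Proof.
  intros H. destruct (Ur_pos _ H) as [r [t [h1 [h2 h3]]]]. exists r, (2 * PI / 5 - t). split; [exact h1|]. split; [lra|].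
  rewrite <- eR_polar, <- h3. symmetry. apply eR_invol.
Qed.

Lemma cis_period (t : R) : cis (t - 2 * PI) = cis t.
Proof. unfold cis. rewrite cos_minus, sin_minus, cos_2PI, sin_2PI. apply injective_projections; simpl; ring. Qed.

(** The regions span the arguments (-7 pi/10, 3 pi/10) and (pi/10, 11 pi/10). The second ends at 11
    pi/10 - 2 pi = -9 pi/10, before the first begins, so they meet only around the ray and the arc
    to the ray stays in both. *)
Lemma Ur_Ul (z : C) : Ur z -> Ul z -> exists r t, 1847 / 1000 < r /\ z = (RtoC r * cis t)%C /\
  forall s, 0 <= s <= 1 -> Ur (RtoC r * cis (PI / 5 + s * (t - PI / 5)))%C /\ Ul (RtoC r * cis (PI / 5 + s * (t - PI / 5)))%C.
Proof.
  intros H1 H2. assert (P := PI_RGT_0). destruct (Ur_pos z H1) as [r [t [r1 [t1 e1]]]]. exists r, t.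
  assert (Ht : PI / 10 < t).
  { destruct H2 as [_ [h _]]. rewrite e1, eR_polar in h. destruct (Rle_lt_dec (2 * PI / 5 - t) PI) as [c|c].
    - rewrite Carg_polar in h by lra. lra.
    - rewrite <- cis_period, Carg_polar in h by lra. lra. }
  split; [exact r1|]. split; [exact e1|]. rewrite e1 in H1, H2. intros s Hs.
  split; [apply Ur_arc|apply Ul_arc]; try assumption; lra.
Qed.

(** The regions are not all convex, but every point of an intersection is joined to the ray by an
    arc |z| = r inside it, so agreement on the ray is enough. The disc meets the other two only for
    1847/1000 < |z| < 37/20. *)
Lemma Glue_regions (Yr Yr1 Yl Yl1 f f1 : C -> C) : SolPI Ur Yr Yr1 -> SolPI Ul Yl Yl1 -> SolPI (disc 0 (37 / 20)) f f1 ->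
  (forall s, 1847 / 1000 < s -> Yr (RtoC s * om)%C = Yl (RtoC s * om)%C /\ Yr1 (RtoC s * om)%C = Yl1 (RtoC s * om)%C) ->
  (forall s, 1847 / 1000 < s < 37 / 20 -> f (RtoC s * om)%C = Yr (RtoC s * om)%C /\ f1 (RtoC s * om)%C = Yr1 (RtoC s * om)%C) ->
  exists U Y Y1, openC U /\ (forall z, region_D z -> U z) /\ (forall z, Ur z -> U z) /\ SolPI U Y Y1 /\ (forall z, Ur z -> Y z = Yr z).
Proof.
  intros Sr Sl Sf Erl Efr. assert (P := PI_RGT_0).
  set (K := fun i : option bool => match i with None => disc 0 (37 / 20) | Some true => Ur | Some false => Ul end).
  set (G := fun i : option bool => match i with None => f | Some true => Yr | Some false => Yl end).
  set (G1 := fun i : option bool => match i with None => f1 | Some true => Yr1 | Some false => Yl1 end).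
  assert (Hrl : forall z, Ur z -> Ul z -> Yr z = Yl z /\ Yr1 z = Yl1 z).
  { intros z z1 z2. destruct (Ur_Ul z z1 z2) as [r [t [hr [-> ha]]]].
    destruct (Erl r hr) as [a b]. apply (PI_arc (fun z => Ur z /\ Ul z)); auto; try lra.
    - intros x [x1 _]. apply Sr, x1.
    - intros x [_ x2]. apply Sl, x2. }
  assert (Hdr : forall z, Ur z -> disc 0 (37 / 20) z -> f z = Yr z /\ f1 z = Yr1 z).
  { intros z z1 z2. destruct (Ur_pos z z1) as [r [t [hr [ht ->]]]].
    assert (hr2 : r < 37 / 20).
    { assert (q := disc_arc r t ltac:(lra) z2 0). unfold disc in q. replace (RtoC r * cis 0 - 0)%C with (RtoC r * cis 0)%C in q by ring.
      rewrite Cmod_mult, Cmod_cis, Cmod_R, Rabs_pos_eq in q; lra. }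
    destruct (Efr r ltac:(lra)) as [a b]. apply (PI_arc (fun z => Ur z /\ disc 0 (37 / 20) z)); auto; try lra.
    - intros x [_ x2]. apply Sf, x2.
    - intros x [x1 _]. apply Sr, x1.
    - intros s Hs. split; [apply Ur_arc; auto; lra|apply (disc_arc r t); [lra|exact z2]]. }
  assert (Hdl : forall z, Ul z -> disc 0 (37 / 20) z -> f z = Yl z /\ f1 z = Yl1 z).
  { intros z z1 z2. destruct (Ul_pos z z1) as [r [t [hr [ht ->]]]].
    assert (hr2 : r < 37 / 20).
    { assert (q := disc_arc r t ltac:(lra) z2 0). unfold disc in q. replace (RtoC r * cis 0 - 0)%C with (RtoC r * cis 0)%C in q by ring.
      rewrite Cmod_mult, Cmod_cis, Cmod_R, Rabs_pos_eq in q; lra. }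
    destruct (Efr r ltac:(lra)) as [a b]. destruct (Erl r hr) as [a' b']. rewrite a' in a. rewrite b' in b.
    apply (PI_arc (fun z => Ul z /\ disc 0 (37 / 20) z)); auto; try lra.
    - intros x [_ x2]. apply Sf, x2.
    - intros x [x1 _]. apply Sl, x1.
    - intros s Hs. split; [apply Ul_arc; auto; lra|apply (disc_arc r t); [lra|exact z2]]. }
  assert (HO : forall i, openC (K i)) by (intros [[]|]; [apply Ur_open|apply Ul_open|apply disc_open]).
  assert (HS : forall i, SolPI (K i) (G i) (G1 i)) by (intros [[]|]; assumption).
  destruct (Glue _ _ _ _ _ _ K G G1 HO HS) as [Y [Y1 [SY HY]]].
  - intros [[]|] [[]|] x Hi Hj; simpl in *; auto; [destruct (Hdr x Hi Hj)|destruct (Hrl x Hj Hi)|destruct (Hdl x Hi Hj)]; auto.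
  - exists (fun z => exists i, K i z), Y, Y1. split; [|split; [|split; [|split]]].
    + intros z [i Hi]. destruct (HO i z Hi) as [d [Hd h]]. exists d. split; [exact Hd|]. intros w Hw. exists i. apply h, Hw.
    + intros z Hz. destruct (region_cover z Hz) as [h|[h|h]]; [exists (Some true)|exists (Some false)|exists None]; exact h.
    + intros z Hz. exists (Some true). exact Hz.
    + exact SY.
    + intros z Hz. apply (HY (Some true) z Hz).
Qed.

(** * From the germ of the tritronquée to its continuation *)

Lemma SolPI_of_PI (U : C -> Prop) (y : C -> C) : PI_solution U y -> exists y1, SolPI U y y1.
Proof.
  intros [y1 H]. exists y1. intros z Hz. destruct (H z Hz) as [a b]. split; [exact I|]. split; [exact a|].
  eapply cderiv_val; [exact b|]. simpl. ring.
Qed.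

Lemma PI_of_SolPI (U : C -> Prop) (y y1 : C -> C) : SolPI U y y1 -> PI_solution U y.
Proof.
  intros H. exists y1. intros z Hz. destruct (H z Hz) as [_ [a b]]. split; [exact a|].
  eapply cderiv_val; [exact b|]. simpl. ring.
Qed.

Lemma SolH_of_h (V : C -> Prop) (h : C -> C) : h_solution V h -> exists h1, SolH (fun x => V x /\ 1 <= Cmod x) h h1.
Proof.
  intros [h1 H]. exists h1. intros x [Hx Hm]. destruct (H x Hx) as [a b]. split; [exact Hm|]. split; [exact a|].
  assert (n : x <> 0%C) by (apply Cmod_nz; lra).
  eapply cderiv_val; [exact b|]. unfold kH. rewrite RtoC_div by lra. simpl. field. exact n.
Qed.

Lemma xrad_surj (t : R) : 0 < t -> exists s, 0 < s /\ xrad s = t.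
Proof.
  intros Ht. exists (Rpower (30 * t) (4 / 5) / 24). assert (q := exp_pos (4 / 5 * ln (30 * t))). fold (Rpower (30 * t) (4 / 5)) in q.
  split; [lra|]. unfold xrad. replace (24 * (Rpower (30 * t) (4 / 5) / 24)) with (Rpower (30 * t) (4 / 5)) by field.
  rewrite Rpower_mult. replace (4 / 5 * (5 / 4)) with 1 by field. rewrite Rpower_1 by lra. field.
Qed.

Lemma axis_data (W V : C -> Prop) (h h1 : C -> C) (K t0 : R) : near_ray_end W -> (forall z, W z -> V (xvar z)) ->
  SolH (fun x => V x /\ 1 <= Cmod x) h h1 -> (forall t, t0 < t -> Cmod (h (Ci * RtoC t)%C) <= K / t ^ 4) ->
  exists K' T, 2 * kH <= K' /\ 10 <= T /\ forall t, T < t -> (V ((0, t) : C) /\ 1 <= Cmod ((0, t) : C)) /\ Nsq h h1 ((0, t) : C) < (K' / t ^ 4) ^ 2.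
Proof.
  intros [r0 [Hr0 HW]] HV Sh Hb. set (K1 := Rmax K 0). assert (a1 : K <= K1) by apply Rmax_l. assert (a2 : 0 <= K1) by apply Rmax_r.
  (* Beyond T the point lies in V through the ray in W, the decay of h holds, and K1 <= T bounds h
     by 1 as [axis_Nsq] requires. *)
  set (T := Rmax (Rmax 10 K1) (Rmax t0 (xrad (r0 + 1)))).
  assert (b1 : 10 <= T) by (eapply Rle_trans; [apply (Rmax_l 10 K1)|apply Rmax_l]).
  assert (b2 : K1 <= T) by (eapply Rle_trans; [apply (Rmax_r 10 K1)|apply Rmax_l]).
  assert (b3 : t0 <= T) by (eapply Rle_trans; [apply (Rmax_l t0 (xrad (r0 + 1)))|apply Rmax_r]).
  assert (b4 : xrad (r0 + 1) <= T) by (eapply Rle_trans; [apply (Rmax_r t0 (xrad (r0 + 1)))|apply Rmax_r]).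
  assert (Hax : forall t, T < t -> V ((0, t) : C) /\ 1 <= Cmod ((0, t) : C)).
  { intros t Ht. split.
    - destruct (xrad_surj t) as [s [Hs Es]]; [lra|]. rewrite <- Es, <- xvar_ray by exact Hs. apply HV.
      assert (r0 < s).
      { apply Rnot_le_lt. intros c. assert (q := xrad_mono s (r0 + 1) Hs ltac:(lra)). lra. }
      specialize (HW s H). rewrite Cexp_Ci in HW. replace (cis (PI / 5)) with om in HW by reflexivity. exact (locally_singleton _ _ HW).
    - eapply Rle_trans; [|apply Im_abs_le]. simpl. rewrite Rabs_pos_eq; lra. }
  exists (20 * K1 + 10), T. split; [unfold kH; lra|]. split; [exact b1|]. intros t Ht. split; [apply Hax, Ht|].
  apply (axis_Nsq _ h h1 K1 T Sh a2); try lra. intros u Hu. split; [apply Hax, Hu|].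
  replace ((0, u) : C) with (Ci * RtoC u)%C by (apply injective_projections; simpl; ring).
  eapply Rle_trans; [apply Hb; lra|]. unfold Rdiv. apply Rmult_le_compat_r; [|exact a1]. left. apply Rinv_0_lt_compat, pow_lt. lra.
Qed.

Lemma conj_axis (t : R) : (- (1) * Cconj ((0, t) : C))%C = ((0, t) : C).
Proof. apply injective_projections; simpl; ring. Qed.

(** h and its reflection [hc] satisfy the same bounds on the axis, so both continue to the right.
    The second continuation, reflected in the ray, agrees with y_of_h h on the ray, hence continues
    the same germ to the left. Far up the ray H equals h, which ties the result to y. *)
Theorem continuation (W V : C -> Prop) (h h1 : C -> C) (K t0 : R) : near_ray_end W -> (forall z, W z -> V (xvar z)) ->
  SolH (fun x => V x /\ 1 <= Cmod x) h h1 -> (forall t, t0 < t -> Cmod (h (Ci * RtoC t)%C) <= K / t ^ 4) ->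
  exists U Y Y1 S, openC U /\ (forall z, region_D z -> U z) /\ (forall z, Ur z -> U z) /\ SolPI U Y Y1 /\
    (forall s, S < s -> Y (RtoC s * om)%C = y_of_h h (RtoC s * om)%C).
Proof.
  intros HW HV Sh Hb. destruct (axis_data W V h h1 K t0 HW HV Sh Hb) as [K' [T [HK [HT Hax]]]].
  destruct (right_solution _ h h1 K' T Sh HK HT Hax) as [T1 [H [H1 [SH [EH NH]]]]].
  set (hc := fun x => Cconj (h (- (1) * Cconj x)%C)). set (hc1 := fun x => (- Cconj (h1 (- (1) * Cconj x)))%C).
  assert (Sc := SolH_reflect _ h h1 Sh).
  destruct (right_solution _ hc hc1 K' T Sc HK HT) as [T2 [L [L1 [SL [EL NL]]]]].
  { intros t Ht. rewrite conj_axis. destruct (Hax t Ht) as [a b]. split; [exact a|].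
    unfold Nsq, hc, hc1. rewrite conj_axis, Cmod_opp, !Cmod_conj. exact b. }
  assert (SYr := y_of_h_transfer Ur Gr H H1 SH Ur_Gr).
  assert (SYl := SolPI_reflect _ _ _ (y_of_h_transfer Ur Gr L L1 SL Ur_Gr)). fold Ul in SYl. change (fun z => Ur (eR * Cconj z)%C) with Ul in SYl.
  set (Yr := y_of_h H) in *. set (Yr1 := dy_of_h H H1) in *.
  set (Yl := fun z => (cR * Cconj (y_of_h L (eR * Cconj z)))%C) in *.
  set (Yl1 := fun z => (cR * (Cconj eR * Cconj (dy_of_h L L1 (eR * Cconj z))))%C) in *.
  destruct (xrad_surj (Rmax (Rmax T1 T2) 0 + 1)) as [S [HS ES]].
  { assert (q := Rmax_r (Rmax T1 T2) 0). lra. }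
  assert (Hlarge : forall s, S < s -> 0 < s /\ T1 < xrad s /\ T2 < xrad s).
  { intros s Hs. assert (q := xrad_mono S s HS ltac:(lra)). assert (q1 := Rmax_l (Rmax T1 T2) 0). assert (q2 := Rmax_l T1 T2). assert (q3 := Rmax_r T1 T2). lra. }
  assert (Hyr : forall s, S < s -> Yr (RtoC s * om)%C = y_of_h h (RtoC s * om)%C).
  { intros s Hs. destruct (Hlarge s Hs) as [p0 [p1 p2]]. unfold Yr. rewrite !y_of_h_vprof, !vprof_ray, (EH _ p1) by exact p0. reflexivity. }
  assert (Hyl : forall s, S < s -> Yr (RtoC s * om)%C = Yl (RtoC s * om)%C).
  { intros s Hs. rewrite (Hyr s Hs). destruct (Hlarge s Hs) as [p0 [p1 p2]]. unfold Yl. rewrite eR_om. symmetry.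
    apply y_ray_reflect; [exact p0|]. rewrite (EL _ p2). unfold hc. rewrite conj_axis. reflexivity. }
  assert (Erl : forall s, 1847 / 1000 < s -> Yr (RtoC s * om)%C = Yl (RtoC s * om)%C /\ Yr1 (RtoC s * om)%C = Yl1 (RtoC s * om)%C).
  { apply (ray_agree (fun z => Ur z /\ Ul z) Yr Yr1 Yl Yl1 _ S); [| |apply Ur_ray|exact Hyl].
    - intros x [x1 _]. apply SYr, x1.
    - intros x [_ x2]. apply SYl, x2. }
  assert (HE : devE Yr Yr1 s0 < (57 / 10000) ^ 2) by (apply ray_start, NH; lra).
  destruct (ray_disc (Yr (RtoC s0 * om)%C) (Yr1 (RtoC s0 * om)%C) HE) as [eta [g [g1 [f [f1 [Heta [Sg [G0 [G1 [Sf [F0 F1]]]]]]]]]]].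
  assert (Hs0 : s0 = 14641 / 6144) by reflexivity.
  assert (Htube : forall u, 0 <= u <= s0 -> tube (- om) (RtoC s0 * om) eta s0 (RtoC u * om)%C).
  { intros u Hu. replace (RtoC u * om)%C with (RtoC s0 * om + RtoC (s0 - u) * - om)%C by (rewrite RtoC_minus; ring).
    apply tube_line; [rewrite Cmod_opp; apply om_mod|exact Heta|lra]. }
  assert (Efr : forall s, 1847 / 1000 < s < 37 / 20 -> f (RtoC s * om)%C = Yr (RtoC s * om)%C /\ f1 (RtoC s * om)%C = Yr1 (RtoC s * om)%C).
  { intros s Hs.
    (* On the overlap of the radii the disc solution is compared with the tube solution from 0
       upwards, and the latter with [Yr] from s0 downwards. *)
    destruct (ray_seg (fun z => Ur z /\ tube (- om) (RtoC s0 * om) eta s0 z) g g1 Yr Yr1 s0 s) as [e0 e1]; [| | |exact G0|exact G1|].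
    - intros x [_ x2]. apply Sg, x2.
    - intros x [x1 _]. apply SYr, x1.
    - intros u Hu. rewrite Rmin_right, Rmax_left in Hu by lra. split; [apply Ur_ray; lra|apply Htube; lra].
    - rewrite <- e0, <- e1. apply (ray_seg (fun z => disc 0 (37 / 20) z /\ tube (- om) (RtoC s0 * om) eta s0 z) f f1 g g1 0 s).
      + intros x [x1 _]. apply Sf, x1.
      + intros x [_ x2]. apply Sg, x2.
      + intros u Hu. rewrite Rmin_left, Rmax_right in Hu by lra. split; [apply disc_ray; lra|apply Htube; lra].
      + rewrite Cmult_0_l. exact F0.
      + rewrite Cmult_0_l. exact F1. }
  destruct (Glue_regions Yr Yr1 Yl Yl1 f f1 SYr SYl Sf Erl Efr) as [U [Y [Y1 [UO [UD [UR [SY EY]]]]]]].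
  exists U, Y, Y1, (Rmax S 2). split; [exact UO|]. split; [exact UD|]. split; [exact UR|]. split; [exact SY|].
  intros s Hs. assert (q := Rmax_l S 2). assert (q2 := Rmax_r S 2). rewrite EY by (apply Ur_ray; lra). apply Hyr. lra.
Qed.


Local Close Scope R_scope.
Open Scope C_scope.

Theorem theorem1 :
  forall y : C -> C, is_tritronquee y -> tritronquee_analytic_on region_D y.
Proof.
  intros y [W [V [h [HWo [_ [HW [HW0 [_ [Hy [Hh [HV [K [t0 [_ Hb]]]]]]]]]]]]]].
  destruct (SolPI_of_PI W y Hy) as [y1 Sy]. destruct (SolH_of_h V h Hh) as [h1 Sh].
  destruct (continuation W V h h1 K t0 HW (fun z Hz => proj1 (HV z Hz)) Sh Hb) as [U [Y [Y1 [S [UO [UD [UR [SY HS]]]]]]]].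
  exists U, Y. split; [|split; [exact UD|split; [|split]]].
  - intros z Hz. apply loc_eps, UO, Hz.
  - intros z Hz. exists (Y1 z). apply SY, Hz.
  - exact (PI_of_SolPI U Y Y1 SY).
  - destruct HW as [r0 [Hr0 HW]]. set (R1 := Rmax (Rmax r0 S) 2).
    assert (q1 : (r0 <= R1)%R) by (eapply Rle_trans; [apply (Rmax_l r0 S)|apply Rmax_l]).
    assert (q2 : (S <= R1)%R) by (eapply Rle_trans; [apply (Rmax_r r0 S)|apply Rmax_l]).
    assert (q3 : (2 <= R1)%R) by apply Rmax_r.
    assert (HWr : forall r, (R1 < r)%R -> W (RtoC r * om)).
    { intros r Hr. specialize (HW r ltac:(lra)). rewrite Cexp_Ci in HW. exact (locally_singleton _ _ HW). }
    assert (Hag : forall r, (R1 < r)%R -> Y (RtoC r * om) = y (RtoC r * om)).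
    { intros r Hr. rewrite HS by lra. symmetry. apply HV, HWr, Hr. }
    exists (R1 + 1)%R. split; [lra|]. intros r Hr.
    rewrite Cexp_Ci. change (cis (PI / 5)) with om. set (p := RtoC r * om).
    assert (Wp : W p) by (apply HWr; lra). assert (Up : U p) by (apply UR, Ur_ray; lra).
    (* Equality along the ray also gives equality of derivatives at p; uniqueness along segments
       then extends it to a disc around p inside U and W, as [near_ray_end] demands. *)
    assert (Ed : Y1 p = y1 p).
    { apply (ray_deriv (fun z => U z /\ W z) Y Y1 y y1 r 1).
      - intros x [x1 _]. apply SY, x1.
      - intros x [_ x2]. apply Sy, x2.
      - split; assumption.
      - lra.
      - intros u Hu. apply Rabs_lt_between in Hu. apply Hag. lra. }
    destruct (UO p Up) as [d1 [Hd1 k1]]. destruct (proj1 (loc_eps p W) (HWo p Wp)) as [d2 [Hd2 k2]].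
    apply loc_eps. exists (Rmin d1 d2). split; [apply Rmin_case; assumption|]. intros w Hw.
    apply (PI_seg (fun z => U z /\ W z) Y Y1 y y1 p w).
    + intros x [x1 _]. apply SY, x1.
    + intros x [_ x2]. apply Sy, x2.
    + intros t Ht. set (v := p + RtoC t * (w - p)).
      assert (Hv : disc p (Rmin d1 d2) v) by (apply disc_convex; [unfold disc; replace (p - p) with (RtoC 0) by ring; rewrite Cmod_0; apply Rmin_case; assumption|exact Hw|exact Ht]).
      unfold disc in Hv. split; [apply k1|apply k2]; (eapply Rlt_le_trans; [exact Hv|]); [apply Rmin_l|apply Rmin_r].
    + apply Hag. lra.
    + exact Ed.
Qed.
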